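(* Let $n\ge2$, let $\Omega\subset\mathbb R^n$ be a domain and $s\in(0,1)$. Suppose that $\Phi$ satisfies the structure assumption for some $\Lambda\ge1$ and that $u\in W^{s,2}_{\rm loc}(\Omega)\cap L^1_{2s}(\mathbb R^n)$ is a weak solution of $\mathcal L u=0$ in $\Omega$. Then there exists a constant $\alpha=\alpha(n,s,\Lambda)\in(0,1)$ such that $u\in C^{1,\alpha}_{\rm loc}(\Omega)$. Moreover, for any $x_0\in\Omega$ and any $R>0$ with $B_R(x_0)\Subset\Omega$, $$\|\nabla u\|_{L^\infty(B_{R/2}(x_0))}+R^\alpha[\nabla u]_{C^\alpha(B_{R/2}(x_0))}\le c\,E(u/R;B_R(x_0))$$ for some constant $c=c(n,s,\Lambda)$. In addition, for any fixed $s_0\in(0,1)$, the constants $c$ and $\alpha$ depend only on $n,s_0$ and $\Lambda$ whenever $s\in[s_0,1)$.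
   Context: Structure assumption on $\Phi$: $\Phi:\mathbb R\to\mathbb R$ is odd and, for all $t,t'\in\mathbb R$, $|\Phi(t)-\Phi(t')|\le\Lambda|t-t'|$ and $(\Phi(t)-\Phi(t'))(t-t')\ge\Lambda^{-1}|t-t'|^2$. The operator is formally $\mathcal L u(x)=(1-s)\,\mathrm{P.V.}\int_{\mathbb R^n}\Phi\big(\frac{u(x)-u(y)}{|x-y|^s}\big)\frac{dy}{|x-y|^{n+s}}$. $L^1_{2s}(\mathbb R^n)=\{u\in L^1_{\rm loc}(\mathbb R^n):\int_{\mathbb R^n}|u(y)|(1+|y|)^{-n-2s}\,dy<\infty\}$. Weak solution of $\mathcal L u=0$ in $\Omega$: $u\in W^{s,2}_{\rm loc}(\Omega)\cap L^1_{2s}(\mathbb R^n)$ with $$(1-s)\int_{\mathbb R^n}\int_{\mathbb R^n}\Phi\Big(\frac{u(x)-u(y)}{|x-y|^s}\Big)\frac{\psi(x)-\psi(y)}{|x-y|^s}\frac{dx\,dy}{|x-y|^n}=0\quad\text{for all }\psi\in C_c^\infty(\Omega).$$ Tail: $\mathrm{Tail}(u;B_R(x_0))=(1-s)R^{2s}\int_{\mathbb R^n\setminus B_R(x_0)}\frac{|u(y)|}{|x_0-y|^{n+2s}}\,dy$. With $(u)_B$ the average of $u$ over $B$, set $E_{\rm loc}(u;B)=\frac1{|B|}\int_B|u-(u)_B|\,dx$ and $E(u;B)=E_{\rm loc}(u;B)+\mathrm{Tail}(u-(u)_B;B)$ for a ball $B=B_R(x_0)$. *)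

(* Defs.v *)
From HB Require Import structures.
From mathcomp Require Import all_boot all_order all_algebra.
From mathcomp Require Import all_classical all_reals all_analysis.

Set Implicit Arguments.
Unset Strict Implicit.
Unset Printing Implicit Defensive.

Import Order.TTheory GRing.Theory Num.Theory.
Import numFieldNormedType.Exports.

Local Open Scope classical_set_scope.
Local Open Scope ring_scope.

(* The space R^n is 'rV[R]_n, with the product topology of the library and the
   product (= Borel) sigma-algebra.  The library norm `|x| on 'rV[R]_n is the
   maximum norm, so the Euclidean norm is introduced separately below. *)

Definition rV_display : measure_display -> measure_display.
Proof. exact. Qed.

Section measurable_rV.
Context (R : realType) (n : nat).

Let coord : 'I_n -> 'rV[R]_n -> R := fun i x => x ord0 i.

Let rV_set0 : g_sigma_preimage coord set0.
Proof. exact: sigma_algebra0. Qed.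

Let rV_setC A : g_sigma_preimage coord A -> g_sigma_preimage coord (~` A).
Proof. exact: sigma_algebraC. Qed.

Let rV_bigcup (F : (set 'rV[R]_n)^nat) :
  (forall i, g_sigma_preimage coord (F i)) ->
  g_sigma_preimage coord (\bigcup_i F i).
Proof. exact: sigma_algebra_bigcup. Qed.

HB.instance Definition _ := @isMeasurable.Build (rV_display default_measure_display)
  'rV[R]_n (g_sigma_preimage coord) rV_set0 rV_setC rV_bigcup.

Lemma measurable_coord (i : 'I_n) :
  measurable_fun [set: 'rV[R]_n] (fun x : 'rV[R]_n => x ord0 i).
Proof.
move=> _ Y mY; rewrite setTI; apply: sub_sigma_algebra => /=.
rewrite -bigcup_seq/=; exists i => /=; first by rewrite mem_index_enum.
by exists Y => //; rewrite setTI.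
Qed.

Lemma measurable_fun_coordP d (T : measurableType d) (f : T -> 'rV[R]_n) :
  (forall i, measurable_fun [set: T] (fun x => f x ord0 i)) ->
  measurable_fun [set: T] f.
Proof.
move=> mf _ A mA; rewrite setTI.
have : preimage_set_system [set: T] f (g_sigma_preimage coord) `<=` measurable.
  rewrite -g_sigma_preimage_comp.
  apply: smallest_sub; first exact: sigma_algebra_measurable.
  rewrite -bigcup_seq; apply: bigcup_sub => i _ _ [B mB <-].
  exact: mf.
by apply; exists A => //; rewrite setTI.
Qed.

End measurable_rV.

Section lebesgue_measure_rV.
Context (R : realType).

(* n-dimensional Lebesgue measure, by integrating the measures of the slices. *)
Fixpoint lebesgue_rV (n : nat) : set 'rV[R]_n -> \bar R :=
  match n return set 'rV[R]_n -> \bar R with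
  | 0%N => fun A => \d_(0 : 'rV[R]_0) A
  | m.+1 => fun A => (\int[@lebesgue_measure R]_x
      @lebesgue_rV m [set v | A (row_mx (x%:M : 'M[R]_1) v)])%E
  end.

Let cons_rV m (z : R * 'rV[R]_m) : 'rV[R]_m.+1 := row_mx (z.1%:M : 'M[R]_1) z.2.
Let uncons_rV m (v : 'rV[R]_m.+1) : R * 'rV[R]_m :=
  (v ord0 ord0, \row_i v ord0 (lift ord0 i)).

Let cons0 m (z : R * 'rV[R]_m) : cons_rV z ord0 ord0 = z.1.
Proof.
rewrite /cons_rV.
have -> : ord0 = lshift m (ord0 : 'I_1) :> 'I_(1 + m) by apply: val_inj.
by apply: etrans (row_mxEl _ _ _ _) _; rewrite mxE eqxx.
Qed.

Let consS m (z : R * 'rV[R]_m) i : cons_rV z ord0 (lift ord0 i) = z.2 ord0 i.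
Proof.
rewrite /cons_rV.
have -> : lift ord0 i = rshift 1 i :> 'I_(1 + m) by apply: val_inj.
exact: row_mxEr.
Qed.

Let consK m : cancel (@cons_rV m) (@uncons_rV m).
Proof.
move=> z; rewrite /uncons_rV cons0 [RHS]surjective_pairing; congr pair.
by apply/rowP => i; rewrite mxE consS.
Qed.

Let measurable_cons_rV m : measurable_fun setT (@cons_rV m).
Proof.
apply: measurable_fun_coordP => i.
case: (unliftP ord0 i) => [j|] ->.
  under eq_fun do rewrite consS.
  apply: (measurableT_comp (measurable_coord j)); exact: measurable_snd.
under eq_fun do rewrite cons0.
exact: measurable_fst.
Qed.

Let measurable_uncons_rV m : measurable_fun setT (@uncons_rV m).
Proof.
apply: measurable_fun_pair; first exact: measurable_coord.
apply: measurable_fun_coordP => i.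
under eq_fun do rewrite mxE.
exact: measurable_coord.
Qed.

Let prod_sigma_finite d1 d2 (T1 : measurableType d1) (T2 : measurableType d2)
    (m1 : {sigma_finite_measure set T1 -> \bar R})
    (m2 : {sigma_finite_measure set T2 -> \bar R}) :
  sigma_finite setT (m1 \x m2)%E.
Proof.
have /sigma_finiteP[F [TF ndF Foo]] := sigma_finiteT m1.
have /sigma_finiteP[G [TG ndG Goo]] := sigma_finiteT m2.
exists (fun k => F k `*` G k).
  rewrite -setXTT TF TG predeqE => -[x y]; split.
    move=> [/= [k _ Fkx] [l _ Gly]]; exists (maxn k l) => //; split.
    - by move: x Fkx; exact/subsetPset/ndF/leq_maxl.
    - by move: y Gly; exact/subsetPset/ndG/leq_maxr.
  by move=> [k _ []/= ? ?]; split; exists k.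
move=> k; have [? ?] := Foo k; have [? ?] := Goo k.
split; first exact: measurableX.
by rewrite product_measure1E// lte_mul_pinfty// ge0_fin_numE.
Qed.

Let lebesgue_rV_ex n : exists mu : {sigma_finite_measure set 'rV[R]_n -> \bar R},
  forall A, @lebesgue_rV n A = mu A.
Proof.
elim: n => [|m [mu muE]].
  by exists (\d_(0 : 'rV[R]_0)).
pose P := [the {measure set _ -> \bar R} of (@lebesgue_measure R \x mu)%E].
have E A : @lebesgue_rV m.+1 A = P (@cons_rV m @^-1` A).
  rewrite /= /P /product_measure1; apply: eq_integral => x _ /=.
  rewrite muE; congr (mu _).
  by apply/seteqP; split => v /=; rewrite /xsection/= in_setE.
have h0 : @lebesgue_rV m.+1 set0 = 0%E by rewrite E preimage_set0 measure0.
have hge A : (0 <= @lebesgue_rV m.+1 A)%E by rewrite E measure_ge0.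
have hsa : semi_sigma_additive (@lebesgue_rV m.+1).
  move=> F mF tF mUF; rewrite E.
  under eq_fun do under eq_bigr do rewrite E.
  rewrite preimage_bigcup.
  apply: measure_semi_sigma_additive.
  - by move=> i; rewrite -[X in measurable X]setTI; exact: measurable_cons_rV.
  - by move=> i j _ _ [z [Fi Fj]]; apply: tF => //; exists (cons_rV z).
  - rewrite -preimage_bigcup -[X in measurable X]setTI.
    exact: measurable_cons_rV.
have hsf : sigma_finite setT (@lebesgue_rV m.+1).
  have [F FT Ffin] := @prod_sigma_finite _ _ _ _
    [the {sigma_finite_measure set _ -> \bar R} of @lebesgue_measure R] mu.
  exists (fun i => @uncons_rV m @^-1` F i).
    by rewrite -preimage_bigcup -FT preimage_setT.
  move=> i; have [mFi Pi] := Ffin i; split.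
    by rewrite -[X in measurable X]setTI; exact: measurable_uncons_rV.
  rewrite E -comp_preimage.
  by rewrite (_ : _ \o _ = id) ?preimage_id//; apply/funext => z /=; rewrite consK.
pose M := isMeasure.Build _ _ _ (@lebesgue_rV m.+1) h0 hge hsa.
pose mu1 : {measure set 'rV[R]_m.+1 -> \bar R} :=
  HB.pack (@lebesgue_rV m.+1) M.
pose S := Measure_isSigmaFinite.Build _ _ _ mu1 hsf.
pose mu2 : {sigma_finite_measure set 'rV[R]_m.+1 -> \bar R} :=
  HB.pack (@lebesgue_rV m.+1) mu1 S.
by exists mu2.
Qed.

Context (n : nat).

Let lebesgue_rV0 : @lebesgue_rV n set0 = 0%E.
Proof. by have [mu ->] := lebesgue_rV_ex n. Qed.

Let lebesgue_rV_ge0 A : (0 <= @lebesgue_rV n A)%E.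
Proof. by have [mu ->] := lebesgue_rV_ex n. Qed.

Let lebesgue_rV_sigma_additive : semi_sigma_additive (@lebesgue_rV n).
Proof.
have [mu /funext ->] := lebesgue_rV_ex n.
exact: measure_semi_sigma_additive.
Qed.

HB.instance Definition _ := isMeasure.Build _ _ _ (@lebesgue_rV n)
  lebesgue_rV0 lebesgue_rV_ge0 lebesgue_rV_sigma_additive.

Let lebesgue_rV_sigma_finite : sigma_finite setT (@lebesgue_rV n).
Proof. by have [mu /funext ->] := lebesgue_rV_ex n; exact: sigma_finiteT. Qed.

HB.instance Definition _ := Measure_isSigmaFinite.Build _ _ _ (@lebesgue_rV n)
  lebesgue_rV_sigma_finite.

End lebesgue_measure_rV.

Section nonlocal_equation.
Context {R : realType} {n : nat}.
Implicit Types (A B Om : set 'rV[R]_n) (u v psi : 'rV[R]_n -> R) (Phi : R -> R).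
Implicit Types (x y : 'rV[R]_n) (s r alpha Lambda c : R).

Local Notation leb := (@lebesgue_rV R n).

Definition enorm {m} (x : 'rV[R]_m) : R := Num.sqrt (\sum_i x ord0 i ^+ 2).

Definition eball x0 r : set 'rV[R]_n := [set x | enorm (x - x0) < r].

Definition domain Om := [/\ open Om, connected Om & Om !=set0].

Definition compactly_contained A Om := compact (closure A) /\ closure A `<=` Om.

Definition structure_assumption Lambda Phi :=
  [/\ forall t, Phi (- t) = - Phi t,
      forall t t', `|Phi t - Phi t'| <= Lambda * `|t - t'| &
      forall t t', Lambda^-1 * `|t - t'| ^+ 2 <= (Phi t - Phi t') * (t - t')].

Definition partial (i : 'I_n) v : 'rV[R]_n -> R :=
  fun x => 'D_(delta_mx ord0 i : 'rV[R]_n) v x.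

Definition grad v : 'rV[R]_n -> 'rV[R]_n := fun x => \row_i partial i v x.

Fixpoint Ck (k : nat) v : Prop :=
  if k is k'.+1 then
    (forall x, differentiable v x) /\ (forall i, Ck k' (partial i v))
  else continuous v.

Definition test_function Om psi :=
  (forall k, Ck k psi) /\ compactly_contained [set x | psi x != 0] Om.

Definition L1_tail s u :=
  [/\ measurable_fun setT u,
      forall K, compact K -> (\int[leb]_(y in K) `|u y|%:E < +oo)%E &
      (\int[leb]_y (`|u y| * (1 + enorm y) `^ (- (n%:R + 2 * s)))%:E < +oo)%E].

Definition Ws2 s A u :=
  [/\ measurable_fun A u,
      (\int[leb]_(x in A) (u x ^+ 2)%:E < +oo)%E &
      (\int[leb \x leb]_(z in A `*` A)
         ((u z.1 - u z.2) ^+ 2 / enorm (z.1 - z.2) `^ (n%:R + 2 * s))%:E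
         < +oo)%E].

Definition Ws2_loc s Om u :=
  forall A, open A -> compactly_contained A Om -> Ws2 s A u.

(* The value of the integrand on the diagonal z.1 = z.2, a null set, is
   immaterial; there both difference quotients are 0. *)
Definition weak_form s Phi u psi : \bar R :=
  ((1 - s)%:E * \int[leb \x leb]_z
     (Phi ((u z.1 - u z.2) / enorm (z.1 - z.2) `^ s)
      * ((psi z.1 - psi z.2) / enorm (z.1 - z.2) `^ s)
      / enorm (z.1 - z.2) ^+ n)%:E)%E.

Definition weak_solution s Phi Om u :=
  [/\ Ws2_loc s Om u, L1_tail s u &
      forall psi, test_function Om psi -> weak_form s Phi u psi = 0%E].

Definition mean B u : R :=
  (fine (leb B))^-1 * \int[leb]_(x in B) u x.

Definition tail s u x0 r : \bar R :=
  (((1 - s) * r `^ (2 * s))%:E *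
   \int[leb]_(y in ~` eball x0 r)
     (`|u y| / enorm (x0 - y) `^ (n%:R + 2 * s))%:E)%E.

Definition excess_loc u x0 r : \bar R :=
  ((fine (leb (eball x0 r)))^-1%:E *
   \int[leb]_(x in eball x0 r) `|u x - mean (eball x0 r) u|%:E)%E.

Definition excess s u x0 r : \bar R :=
  (excess_loc u x0 r +
   tail s (fun x => (u x - mean (eball x0 r) u)%R) x0 r)%E.

Definition Linfty_norm {m} A (w : 'rV[R]_n -> 'rV[R]_m) : \bar R :=
  ('N[leb]_+oo [ (fun x => (enorm (w x))%:E) \_ A ])%E.

Definition holder_seminorm {m} alpha A (w : 'rV[R]_n -> 'rV[R]_m) : \bar R :=
  ereal_sup [set q | exists x y, [/\ A x, A y, x != y &
    q = (enorm (w x - w y) / enorm (x - y) `^ alpha)%:E]].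

Definition C1alpha_loc alpha Om v :=
  (forall x, Om x -> differentiable v x /\ {for x, continuous (grad v)}) /\
  (forall A, open A -> compactly_contained A Om ->
     (holder_seminorm alpha A (grad v) < +oo)%E).

(* Elements of the function spaces are functions up to equality almost
   everywhere: the C^{1,alpha} regularity of u, and its gradient, are those of
   a representative v of u in Om. *)
Definition gradient_regularity s Lambda alpha c :=
  forall Om Phi u,
    domain Om -> structure_assumption Lambda Phi -> weak_solution s Phi Om u ->
  exists v, [/\ {ae leb, forall x, Om x -> u x = v x},
    C1alpha_loc alpha Om v &
    forall x0 r, Om x0 -> 0 < r -> compactly_contained (eball x0 r) Om ->
      (Linfty_norm (eball x0 (r / 2)) (grad v)
       + (r `^ alpha)%:E * holder_seminorm alpha (eball x0 (r / 2)) (grad v)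
       <= c%:E * excess s (fun x => (u x / r)%R) x0 r)%E].

End nonlocal_equation.

(* Main.v *)
(** All estimates hold for s in [s0, 1) with constants depending only on n, s0 and Lambda; s0 = s
    gives the first assertion. Caccioppoli and Nash inequalities, De Giorgi's lemma, a logarithmic
    estimate and a growth lemma give a Hoelder estimate with an exponent gam for functions v of
    finite energy and fluxes F with F dv >= dv^2 / Lambda and |F| <= Lambda |dv|, where
    dv = v x - v y. Cutting off, w = eta u satisfies B_w(psi) = int f psi near the centre of a
    ball, where f is bounded by the tail of u and inherits its modulus of continuity. By the
    structure assumption the difference of the fluxes of w (. + h) and w is again such a flux, so
    if w has a Hoelder estimate with exponent bet, the Hoelder estimate applies to
    (w (. + h) - w) / |h|^bet and yields |d_k d_h w| <= C |h|^bet |k|^gam. Through second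
    differences this improves bet to min (bet + gam, 1). Once bet = 1, the function
    h |-> w (x + h) - w x is additive up to an error C |h| |k|^gam, hence linear up to
    C |h|^(1 + gam), so that w is C^{1,gam}. The weak formulation is only tested against
    translates of one radial bump, from which all test functions are recovered by mollification. *)
Require Import Defs.
From HB Require Import structures.
From mathcomp Require Import all_boot all_order all_algebra.
From mathcomp Require Import all_classical all_reals all_analysis.
From mathcomp Require Import measurable_realfun ring lra.

Set Implicit Arguments.
Unset Strict Implicit.
Unset Printing Implicit Defensive.

Import Order.TTheory GRing.Theory Num.Theory.
Import numFieldNormedType.Exports.
Local Open Scope classical_set_scope.
Local Open Scope ring_scope.

(** A difference of two solutions does not solve the nonlinear equation, but its flux still
    satisfies the bounds of [flux]. Every estimate up to the Hoelder one is therefore stated for the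
    class [sol], which forgets [Phi]; rescaling also changes [Phi], and only Lambda survives.
    Uniformity as s tends to 1 is decided by two dyadic sums, which weigh the factor 1 - s of [Jr]
    against a geometric series of ratio q = 4^(s-1). Since 1 - q is comparable with 1 - s, [ker_int]
    bounds (1 - s) / (1 - q) from above and [poincare] bounds it from below; the later constants
    inherit this. Powers r^(2 s) with r <= 1 are replaced by r^(2 s0). Nonlocality enters through
    tails. The growth lemma tolerates only small tails, which is why the first Hoelder exponent is
    tiny: the admissible growth at infinity has a tail proportional to the exponent. Exponent 1 is
    critical for second differences, where a logarithm would appear. The gain per step is lowered to
    2 / (2 N + 1), no integer multiple of which equals 1. *)

Section euclidean_norm.
Context {R : realType} {n : nat}.
Implicit Types (x y z : 'rV[R]_n) (r a : R).

Lemma sum_sqr_ge0 x : 0 <= \sum_i x ord0 i ^+ 2.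
Proof. by apply: sumr_ge0 => i _; exact: sqr_ge0. Qed.

Lemma enorm_ge0 x : 0 <= enorm x.
Proof. exact: sqrtr_ge0. Qed.

Lemma sqr_enorm x : enorm x ^+ 2 = \sum_i x ord0 i ^+ 2.
Proof. by rewrite /enorm sqr_sqrtr// sum_sqr_ge0. Qed.

Lemma enorm0 : enorm (0 : 'rV[R]_n) = 0.
Proof.
by rewrite /enorm big1 ?sqrtr0// => i _; rewrite mxE expr0n.
Qed.

Lemma le_coord_enorm x i : `|x ord0 i| <= enorm x.
Proof.
rewrite -(@ler_pXn2r _ 2)// ?nnegrE ?enorm_ge0// sqr_enorm real_normK ?num_real//.
by rewrite (bigD1 i)//= lerDl; apply: sumr_ge0 => j _; exact: sqr_ge0.
Qed.

Lemma enorm_eq0 x : enorm x = 0 -> x = 0.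
Proof.
move=> x0; apply/rowP => i; rewrite mxE; apply/eqP.
by rewrite -normr_le0 -x0; exact: le_coord_enorm.
Qed.

Lemma enorm_gt0 x : (0 < enorm x) = (x != 0).
Proof.
rewrite lt0r enorm_ge0 andbT; apply/idP/idP; apply: contra.
  by move=> /eqP ->; rewrite enorm0.
by move=> /eqP/enorm_eq0 ->.
Qed.

Lemma enormZ a x : enorm (a *: x) = `|a| * enorm x.
Proof.
rewrite /enorm -sqrtr_sqr -sqrtrM ?sqr_ge0// mulr_sumr.
by congr Num.sqrt; apply: eq_bigr => i _; rewrite mxE exprMn.
Qed.

Lemma enormN x : enorm (- x) = enorm x.
Proof. by rewrite -scaleN1r enormZ normrN1 mul1r. Qed.

Lemma enormB x y : enorm (x - y) = enorm (y - x).
Proof. by rewrite -opprB enormN. Qed.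

Lemma enormD x y : enorm (x + y) <= enorm x + enorm y.
Proof.
have [/eqP/enorm_eq0 ->|x0] := boolP (enorm x == 0); first by rewrite enorm0 !add0r.
have [/eqP/enorm_eq0 ->|y0] := boolP (enorm y == 0); first by rewrite enorm0 !addr0.
rewrite -(@ler_pXn2r _ 2)// ?nnegrE ?addr_ge0 ?enorm_ge0//.
have p : 0 < enorm x * enorm y by rewrite mulr_gt0// lt0r ?x0 ?y0 enorm_ge0.
suff h : \sum_i x ord0 i * y ord0 i <= enorm x * enorm y.
  have -> : enorm (x + y) ^+ 2 = enorm x ^+ 2 + 2 * \sum_i x ord0 i * y ord0 i + enorm y ^+ 2.
    rewrite !sqr_enorm mulr_sumr -!big_split/=; apply: eq_bigr => i _.
    by rewrite mxE; ring.
  by move: h; lra.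
(* Cauchy-Schwarz multiplied by |x| |y|: the i-th term of the difference is half of (x_i |y| - y_i
   |x|)^2. *)
rewrite -(ler_pM2l p).
have -> : enorm x * enorm y * (enorm x * enorm y) = \sum_i
    ((x ord0 i ^+ 2) * enorm y ^+ 2 + y ord0 i ^+ 2 * enorm x ^+ 2) / 2.
  by rewrite -mulr_suml big_split/= -!mulr_suml -!sqr_enorm; field.
rewrite mulr_sumr; apply: ler_sum => i _.
rewrite ler_pdivlMr//.
have := sqr_ge0 (x ord0 i * enorm y - y ord0 i * enorm x); nra.
Qed.

Lemma enorm_triangle y x z : enorm (x - z) <= enorm (x - y) + enorm (y - z).
Proof. by rewrite (le_trans _ (enormD _ _))// addrA subrK. Qed.

Lemma enormBle x y : enorm x - enorm y <= enorm (x - y).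
Proof. by rewrite lerBlDr -{1}(subrK y x); exact: enormD. Qed.

Lemma enorm_lip x y : `|enorm x - enorm y| <= enorm (x - y).
Proof. by rewrite ler_norml lerNl opprB {1}enormB !enormBle. Qed.

Lemma coord_le_norm x i : `|x ord0 i| <= `|x|.
Proof.
rewrite [leRHS]/Num.norm/= mx_normrE.
by apply: (@le_bigmax _ _ _ _ (fun ij : 'I_1 * 'I_n => `|x ij.1 ij.2|) (ord0, i)).
Qed.

Lemma norm_le_coord x a : 0 <= a -> (forall i, `|x ord0 i| <= a) -> `|x| <= a.
Proof.
move=> a0 h; rewrite [leLHS]/Num.norm/= mx_normrE.
by apply/bigmax_leP; split => //= -[i j] _ /=; rewrite ord1.
Qed.

Lemma norm_le_enorm x : `|x| <= enorm x.
Proof. by apply: norm_le_coord => [|i]; rewrite ?enorm_ge0 ?le_coord_enorm. Qed.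

Lemma enorm_le_norm x : enorm x <= n%:R * `|x|.
Proof.
rewrite -(@ler_pXn2r _ 2)// ?nnegrE ?enorm_ge0 ?mulr_ge0// sqr_enorm.
apply: (@le_trans _ _ (\sum_(i < n) `|x| ^+ 2)).
  apply: ler_sum => i _; rewrite -(@real_normK _ (x ord0 i)) ?num_real//.
  by rewrite ler_pXn2r// ?nnegrE// coord_le_norm.
rewrite sumr_const card_ord -[leLHS]mulr_natl exprMn ler_wpM2r ?sqr_ge0//.
by rewrite -natrX ler_nat; case: (n) => // k; rewrite leq_pmulr.
Qed.

(** The topology comes from the maximum norm; the two norms are comparable up to the factor n, so
    that all later arguments can use Euclidean balls. *)
Lemma enorm_nbhs x0 (A : set 'rV[R]_n) :
  nbhs x0 A <-> exists2 r, 0 < r & forall x, enorm (x - x0) < r -> A x.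
Proof.
split => [/nbhs_ballP[e /= e0 h]|[r r0 h]].
  exists e => // x xr; apply: h; rewrite -ball_normE /ball_/=.
  by apply: le_lt_trans xr; rewrite distrC norm_le_enorm.
apply/nbhs_ballP; exists (r / n.+1%:R) => /=; first by rewrite divr_gt0.
move=> x; rewrite -ball_normE/= distrC => xr; apply: h.
apply: le_lt_trans (enorm_le_norm _) _.
apply: (@le_lt_trans _ _ (n.+1%:R * `|x - x0|)).
  by rewrite ler_wpM2r// ler_nat.
by rewrite mulrC -ltr_pdivlMr.
Qed.

Lemma open_eball x r : open (eball x r).
Proof.
rewrite openE => y /= yr; rewrite /interior; apply/enorm_nbhs.
exists (r - enorm (y - x)); first by rewrite subr_gt0.
move=> z zy; rewrite /eball/=.
by apply: le_lt_trans (enorm_triangle y _ _) _; rewrite -ltrBrDr.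
Qed.

(** Rational points supply the countable families of balls by which measurability and almost
    everywhere statements are reduced to countably many sets. *)
Lemma ratV_dense x r : 0 < r -> exists q : 'rV[rat]_n, enorm (x - map_mx ratr q) < r.
Proof.
move=> r0; have e0 : 0 < r / n.+1%:R by rewrite divr_gt0.
have h i : exists q : rat, `|x ord0 i - ratr q| < r / n.+1%:R.
  have /rat_in_itvoo[q] : x ord0 i < x ord0 i + r / n.+1%:R by rewrite ltrDl.
  rewrite in_itv/= => /andP[q1 q2]; exists q.
  by rewrite distrC ger0_norm ?subr_ge0 ?ltW// ltrBlDl.
pose q i := proj1_sig (cid (h i)).
exists (\row_i q i).
apply: le_lt_trans (enorm_le_norm _) _.
apply: (@le_lt_trans _ _ (n%:R * (r / n.+1%:R))).
  rewrite ler_wpM2l//.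
  apply: norm_le_coord (ltW e0) _ => i; rewrite !mxE.
  by rewrite ltW//; exact: (proj2_sig (cid (h i))).
by rewrite mulrCA gtr_pMr// ltr_pdivrMr// mul1r ltr_nat.
Qed.

Lemma compactly_contained_eball x r A :
  (forall y, A y -> enorm (y - x) <= r) -> compact (closure A).
Proof.
move=> h; apply: bounded_closed_compact; last exact: closed_closure.
exists (r + enorm x); split; first exact: num_real.
move=> M rM y Ay; apply: le_trans (norm_le_enorm _) _.
apply: le_trans (ltW rM); rewrite -lerBlDr.
apply: le_trans (enormBle _ _) _.
apply/ler_addgt0Pr => e e0.
have [z [Az yz]] := Ay _ (proj2 (enorm_nbhs y _) (ex_intro2 _ _ e e0 (fun z => id))).
apply: le_trans (enorm_triangle z _ _) _.
by rewrite addrC lerD ?h// enormB ltW.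
Qed.

Lemma closure_eball x r y : closure (eball x r) y -> enorm (y - x) <= r.
Proof.
move=> cy; apply/ler_addgt0Pr => e e0.
have [z [Az yz]] := cy _ (proj2 (enorm_nbhs y _) (ex_intro2 _ _ e e0 (fun z => id))).
apply: le_trans (enorm_triangle z _ _) _.
by rewrite addrC lerD// ?(ltW Az)// enormB ltW.
Qed.

Lemma continuous_enormP (f : 'rV[R]_n -> R) x : {for x, continuous f} <->
  forall e, 0 < e -> exists2 r, 0 < r & forall y, enorm (y - x) < r -> `|f y - f x| < e.
Proof.
split=> [h e e0|h A /nbhs_ballP[e /= e0 eA]].
  have : nbhs (f x) (ball (f x) e) by exact: nbhsx_ballx.
  move=> /h/enorm_nbhs[r r0 hr]; exists r => // y /hr.
  by rewrite /= -ball_normE/= distrC.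
have [r r0 hr] := h _ e0.
apply/enorm_nbhs; exists r => // y /hr yr; apply: eA.
by rewrite -ball_normE/= distrC.
Qed.

End euclidean_norm.

(** * Measurability and affine changes of variables in R^n *)

Section measurable_euclidean.
Context {R : realType}.

Lemma measurable_addV {d} {S : measurableType d} {n} (f g : S -> 'rV[R]_n) :
  measurable_fun setT f -> measurable_fun setT g -> measurable_fun setT (fun x => f x + g x).
Proof.
move=> mf mg; apply: measurable_fun_coordP => i.
under eq_fun do rewrite mxE.
by apply: measurable_funD; apply: (measurableT_comp (measurable_coord i)).
Qed.

Lemma measurable_oppV {d} {S : measurableType d} {n} (f : S -> 'rV[R]_n) :
  measurable_fun setT f -> measurable_fun setT (fun x => - f x).
Proof.
move=> mf; apply: measurable_fun_coordP => i.
under eq_fun do rewrite mxE.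
by apply: measurable_funN; apply: (measurableT_comp (measurable_coord i)).
Qed.

Lemma measurable_scaleV {d} {S : measurableType d} {n} a (f : S -> 'rV[R]_n) :
  measurable_fun setT f -> measurable_fun setT (fun x => a *: f x).
Proof.
move=> mf; apply: measurable_fun_coordP => i.
under eq_fun do rewrite mxE.
by apply: measurable_funM => //; apply: (measurableT_comp (measurable_coord i)).
Qed.

Lemma measurable_sqrtr : measurable_fun setT (@Num.sqrt R).
Proof. by apply: continuous_measurable_fun; exact: sqrt_continuous. Qed.

Lemma measurable_enorm {n} : measurable_fun setT (@enorm R n).
Proof.
apply: (measurableT_comp measurable_sqrtr).
apply: measurable_sum => i; apply: measurable_funX; exact: measurable_coord.
Qed.

Lemma measurable_eball {n} (x : 'rV[R]_n) r : measurable (eball x r).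
Proof.
have m : measurable_fun setT (fun y : 'rV[R]_n => enorm (y - x)).
  by apply: (measurableT_comp measurable_enorm); apply: measurable_addV => //; exact: measurable_cst.
rewrite (_ : eball x r = setT `&` (fun y => enorm (y - x)) @^-1` `]-oo, r[%classic); first exact: m.
by apply/seteqP; split => y /=; rewrite ?in_itv/=; [split|case].
Qed.

(** The sigma-algebra is generated by the coordinates; an open set is the countable union of those
    balls with rational centre and radius 1/(k+1) that it contains. *)
Lemma open_measurable_rV {n} (U : set 'rV[R]_n) : open U -> measurable U.
Proof.
rewrite openE => oU.
pose F (p : 'rV[rat]_n * nat) : set 'rV[R]_n :=
  [set y | eball (map_mx ratr p.1) p.2.+1%:R^-1 y /\ eball (map_mx ratr p.1) p.2.+1%:R^-1 `<=` U].
have -> : U = \bigcup_p F p.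
  apply/seteqP; split => [x Ux|x [p _ [xp]]]; last exact.
  have /enorm_nbhs[r r0 h] := oU _ Ux.
  have [k kr] : exists k, (k.+1%:R^-1 : R) < r / 2.
    exists (Num.truncn ((r / 2)^-1)); rewrite invf_plt ?posrE ?divr_gt0//.
    by rewrite truncnS_gt.
  have [|q xq] := @ratV_dense R n x k.+1%:R^-1; first by [].
  exists (q, k) => //; split => // y yq; apply: h.
  apply: le_lt_trans (enorm_triangle (map_mx ratr q) _ _) _.
  apply: lt_trans (_ : k.+1%:R^-1 + k.+1%:R^-1 < r); last by rewrite [ltRHS]splitr ltrD.
  by apply: ltrD => //; rewrite enormB.
apply: countable_bigcupT_measurable => [|p]; first exact: countableP.
have [h|h] := pselect (eball (map_mx ratr p.1) p.2.+1%:R^-1 `<=` U).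
  rewrite (_ : F p = eball (map_mx ratr p.1) p.2.+1%:R^-1); first exact: measurable_eball.
  by apply/seteqP; split => y; [case|split].
by rewrite (_ : F p = set0)//; apply/seteqP; split => y // -[].
Qed.

Lemma continuous_measurable_rV {n} (f : 'rV[R]_n -> R) : continuous f -> measurable_fun setT f.
Proof.
move=> cf mT; apply: (measurability _ (RGenOInfty.measurableE R)) => //.
move=> _ [_ [a ->] <-]; rewrite setTI; apply: open_measurable_rV.
by apply: open_comp => // x _; exact: cf.
Qed.

End measurable_euclidean.

Section affine_change_of_variables.
Context {R : realType}.

(** Uniqueness of Lebesgue measure: r times the image measure agrees with it on half-open
    intervals. *)
Lemma lebesgue_measure_affine (a r : R) (A : set R) : 0 < r -> measurable A ->
  lebesgue_measure [set x | A (a + r * x)] = (r^-1%:E * lebesgue_measure A)%E.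
Proof.
move=> r0 mA.
pose phi (x : R) : measurableTypeR R := a + r * x.
have mphi : measurable_fun setT phi.
  by apply: measurable_funD => //; apply: measurable_funM.
have r0' : 0 <= r by exact: ltW.
suff /(_ mphi) -> : lebesgue_measure A = mscale (NngNum r0') (pushforward lebesgue_measure phi) A.
  rewrite /mscale/= muleA -EFinM mulVf ?gt_eqF// mul1e.
  by congr (lebesgue_measure _).
move=> m; apply/lebesgue_measure_unique => //= _ [[b c] _ <-].
rewrite /mscale/= /pushforward.
have -> : phi @^-1` [set` `](b, c).1, (b, c).2]] = `](b - a) / r, (c - a) / r]%classic.
  apply/seteqP; split => x /=; rewrite !in_itv/= ltr_pdivrMr// ler_pdivlMr//.
    by rewrite /phi; case/andP => h1 h2; apply/andP; split; lra.
  by rewrite /phi; case/andP => h1 h2; apply/andP; split; lra.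
rewrite !lebesgue_measure_itv/= !lte_fin ltr_pM2r ?invr_gt0// ltrD2r.
case: ifPn => // _; last by rewrite mule0.
by rewrite -!EFinB -EFinM; congr EFin; field; rewrite gt_eqF.
Qed.

Lemma lebesgue_integral_affine (a r : R) (f : R -> \bar R) : 0 < r ->
  measurable_fun setT f -> (forall x, 0 <= f x)%E ->
  (\int[lebesgue_measure]_x f (a + r * x)%R = r^-1%:E * \int[lebesgue_measure]_x f x)%E.
Proof.
move=> r0 mf f0.
pose phi (x : measurableTypeR R) : measurableTypeR R := a + r * x.
have mphi : measurable_fun setT phi.
  by apply: measurable_funD => //; apply: measurable_funM.

have r0' : 0 <= r^-1 by rewrite invr_ge0 ltW.
have := @ge0_integral_pushforward _ _ _ _ R phi mphi lebesgue_measure setT f measurableT mf.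
rewrite preimage_setT => <-; last by move=> *; exact: f0.
rewrite -[X in (X * _)%E]/((NngNum r0')%:num%:E) -ge0_integral_mscale//.
apply: eq_measure_integral => A mA _.
by rewrite [LHS]lebesgue_measure_affine.
Qed.

Let row1 m (x : R) (v : 'rV[R]_m) : 'rV[R]_m.+1 := row_mx (x%:M : 'M[R]_1) v.

Let row10 m x (v : 'rV[R]_m) : row1 x v ord0 ord0 = x.
Proof.
rewrite /row1.
have -> : ord0 = lshift m (ord0 : 'I_1) :> 'I_(1 + m) by apply: val_inj.
by apply: etrans (row_mxEl _ _ _ _) _; rewrite mxE eqxx.
Qed.

Let row1S m x (v : 'rV[R]_m) i : row1 x v ord0 (lift ord0 i) = v ord0 i.
Proof.
rewrite /row1.
have -> : lift ord0 i = rshift 1 i :> 'I_(1 + m) by apply: val_inj.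
exact: row_mxEr.
Qed.

Let measurable_row1 m : measurable_fun setT (fun z : R * 'rV[R]_m => row1 z.1 z.2).
Proof.
apply: measurable_fun_coordP => i.
case: (unliftP ord0 i) => [j|] ->.
  under eq_fun do rewrite row1S.
  apply: (measurableT_comp (measurable_coord j)); exact: measurable_snd.
under eq_fun do rewrite row10.
exact: measurable_fst.
Qed.

Let measurable_slice m (A : set 'rV[R]_m.+1) x : measurable A ->
  measurable [set v | A (row1 x v)].
Proof.
move=> mA.
have : measurable_fun setT (fun v : 'rV[R]_m => row1 x v).
  exact: (measurableT_comp (@measurable_row1 m) (measurable_pair1 x)).
by move=> /(_ measurableT _ mA); rewrite setTI.
Qed.

Let measurable_leb_slice m (A : set 'rV[R]_m.+1) : measurable A ->
  measurable_fun setT (fun x => @lebesgue_rV R m [set v | A (row1 x v)]).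
Proof.
move=> mA.
pose B := (fun z : R * 'rV[R]_m => row1 z.1 z.2) @^-1` A.
have mB : measurable B by rewrite -[B]setTI; exact: measurable_row1.
have := @measurable_fun_xsection _ _ _ _ _ (@lebesgue_rV R m) B mB.
apply: eq_measurable_fun => x _ /=; congr (@lebesgue_rV R m _).
by apply/seteqP; split => v /=; rewrite /xsection/= in_setE.
Qed.

(** Induction over the slices that define [lebesgue_rV]; each coordinate contributes one factor 1/r.
    Translations and dilations suffice for all rescalings below. *)
Lemma lebesgue_rV_affine n (a : 'rV[R]_n) (r : R) (A : set 'rV[R]_n) :
  0 < r -> measurable A ->
  @lebesgue_rV R n [set x | A (a + r *: x)] = ((r ^- n)%:E * @lebesgue_rV R n A)%E.
Proof.
move=> r0; elim: n a A => [|m ih] a A mA.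
  rewrite expr0 invr1 mul1e /= !diracE; congr (_%:R%:E).
  congr (nat_of_bool _); apply/idP/idP; rewrite !in_setE/=.
    by have -> : a + r *: 0 = 0 by apply/rowP => -[].
  have -> : a + r *: 0 = 0 by apply/rowP => -[].
  by [].
pose a1 := a ord0 ord0; pose a2 : 'rV[R]_m := \row_i a ord0 (lift ord0 i).
have aE x v : a + r *: row1 x v = row1 (a1 + r * x) (a2 + r *: v).
  have rowE (u w : 'rV[R]_m.+1) : (forall i, u ord0 i = w ord0 i) -> u = w.
    by move=> h; apply/rowP => i; exact: h.
  apply: rowE => i; rewrite mxE [X in _ + X]mxE.
  by case: (unliftP ord0 i) => [j|] ->; rewrite ?row10 ?row1S// !mxE.
transitivity (\int[lebesgue_measure]_x
   ((r ^- m)%:E * @lebesgue_rV R m [set v | A (row1 (a1 + r * x)%R v)]))%E.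
  apply: eq_integral => x _; rewrite -(ih a2); last exact: measurable_slice.
  congr (@lebesgue_rV R m _); apply/seteqP; split => v /=;
    by rewrite -/(row1 _ _) -aE.
rewrite ge0_integralZl//; last 2 first.
- apply: (measurableT_comp (f := fun x => @lebesgue_rV R m [set v | A (row1 x v)])).
    exact: measurable_leb_slice.
  by apply: measurable_funD => //; apply: measurable_funM.
- by rewrite lee_fin invr_ge0 exprn_ge0// ltW.
rewrite (@lebesgue_integral_affine a1 r (fun x => @lebesgue_rV R m [set v | A (row1 x v)]))//.
- by rewrite muleA -EFinM exprS invfM mulrC.
- exact: measurable_leb_slice.
Qed.

End affine_change_of_variables.

(** * Real bounds for integrals and double integrals *)

Section integral_bounds.
Context {R : realType} {d} {X : measurableType d}.
Variable mu : {measure set X -> \bar R}.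
Implicit Types (f g h : X -> R) (a b c : R).

(* Bounds of integrals are real numbers throughout, which keeps extended reals out of the estimates. *)
Definition ile f a : Prop := (\int[mu]_x (f x)%:E <= a%:E)%E.

Lemma ge0_mono_integral (f g : X -> \bar R) :
  (forall x, 0 <= f x)%E -> (forall x, f x <= g x)%E ->
  (\int[mu]_x f x <= \int[mu]_x g x)%E.
Proof.
move=> f0 fg; rewrite !ge0_integralTE//; last by move=> x; exact: le_trans (fg x).
apply: le_ereal_sup => _ /= [h hf <-]; exists h => // x.
exact: le_trans (hf x) (fg x).
Qed.

Lemma ile_mono f g a : (forall x, 0 <= f x) -> (forall x, f x <= g x) -> ile g a -> ile f a.
Proof. by move=> f0 fg; apply: le_trans; apply: ge0_mono_integral => x; rewrite lee_fin. Qed.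

Lemma ile_le f a b : a <= b -> ile f a -> ile f b.
Proof. by move=> ab /le_trans; apply; rewrite lee_fin. Qed.

Lemma ile_add f g a b : measurable_fun setT f -> measurable_fun setT g ->
  (forall x, 0 <= f x) -> (forall x, 0 <= g x) ->
  ile f a -> ile g b -> ile (fun x => f x + g x) (a + b).
Proof.
move=> mf mg f0 g0 fa gb; rewrite /ile.
under eq_integral do rewrite EFinD.
rewrite ge0_integralD//; try exact/measurable_EFinP; last 2 first.
- by move=> x _; rewrite lee_fin.
- by move=> x _; rewrite lee_fin.
by rewrite EFinD leeD.
Qed.

Lemma ile_scale f a c : 0 <= c -> measurable_fun setT f -> (forall x, 0 <= f x) ->
  ile f a -> ile (fun x => c * f x) (c * a).
Proof.
move=> c0 mf f0 fa; rewrite /ile.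
under eq_integral do rewrite EFinM.
rewrite ge0_integralZl_EFin//; last 2 first.
- by move=> x _; rewrite lee_fin.
- exact/measurable_EFinP.
by rewrite EFinM lee_wpmul2l.
Qed.

Lemma ile_mono_scale f g a c : 0 <= c -> measurable_fun setT g ->
  (forall x, 0 <= g x) -> (forall x, 0 <= f x) -> (forall x, f x <= c * g x) ->
  ile g a -> ile f (c * a).
Proof. by move=> *; apply: (@ile_mono _ (fun x => c * g x)) => //; exact: ile_scale. Qed.

Lemma ile_mono_lin2 f g h a b c e : 0 <= c -> 0 <= e -> measurable_fun setT g ->
  measurable_fun setT h -> (forall x, 0 <= g x) -> (forall x, 0 <= h x) ->
  (forall x, 0 <= f x) -> (forall x, f x <= c * g x + e * h x) ->
  ile g a -> ile h b -> ile f (c * a + e * b).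
Proof.
move=> c0 e0 mg mh g0 h0 f0 fgh ga hb.
apply: (@ile_mono _ (fun x => c * g x + e * h x)) => //.
apply: ile_add; rewrite ?mulr_ge0//; try exact: ile_scale; try exact: measurable_funM;
  by move=> x; rewrite mulr_ge0.
Qed.

Lemma ile0 : ile (fun=> 0) 0.
Proof. by rewrite /ile integral0. Qed.

Lemma ile_ge0 f a : (forall x, 0 <= f x) -> ile f a -> 0 <= a.
Proof. by move=> f0 /(le_trans _); rewrite -lee_fin; apply; apply: integral_ge0 => x _; rewrite lee_fin. Qed.

Lemma ile_value f a : (forall x, 0 <= f x) -> ile f a ->
  exists b, [/\ 0 <= b, b <= a & (\int[mu]_x (f x)%:E = b%:E)%E].
Proof.
move=> f0 fa.
have i0 : (0 <= \int[mu]_x (f x)%:E)%E by apply: integral_ge0 => x _; rewrite lee_fin.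
have fi : (\int[mu]_x (f x)%:E)%E \is a fin_num.
  by rewrite ge0_fin_numE//; apply: le_lt_trans fa _; rewrite ltry.
exists (fine (\int[mu]_x (f x)%:E)); split.
- exact: fine_ge0.
- by rewrite -lee_fin fineK.
- by rewrite fineK.
Qed.

Lemma ile_addgt0 f a : (forall e, 0 < e -> ile f (a + e)) -> ile f a.
Proof. by move=> h; apply/lee_addgt0Pr => e e0; rewrite -EFinD; exact: h. Qed.

Lemma ile_fatou (fk : nat -> X -> R) f a : (forall k, measurable_fun setT (fk k)) ->
  (forall k x, 0 <= fk k x) -> (forall x, fk k x @[k --> \oo] --> f x) ->
  (forall k, ile (fk k) a) -> ile f a.
Proof.
move=> mf f0 fkf fka; rewrite /ile.
have -> : (\int[mu]_x (f x)%:E = \int[mu]_x limn_einf (fun k => (fk k x)%:E))%E.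
  apply: eq_integral => x _; have h : (fk k x)%:E @[k --> \oo] --> (f x)%:E.
    by apply/cvg_EFin; [near=> k|exact: fkf].
  by rewrite is_cvg_limn_einfE; [apply/esym/cvg_lim|apply/cvg_ex; exists (f x)%:E].
apply: le_trans (fatou mu measurableT _ _) _.
- by move=> k; exact/measurable_EFinP.
- by move=> k x _; rewrite lee_fin.
rewrite limn_einf_lim; apply: lime_le; first exact: is_cvg_einfs.
near=> k; apply: le_trans (fka k).
by apply: ereal_inf_lbound; exists k => /=.
Unshelve. all: by end_near. Qed.

Lemma ile_ae f g a : measurable_fun setT f -> measurable_fun setT g ->
  (forall x, 0 <= f x) -> (forall x, 0 <= g x) -> {ae mu, forall x, f x <= g x} ->
  ile g a -> ile f a.
Proof.
move=> mf mg f0 g0 fg ga; apply: le_trans ga.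
apply: ae_ge0_le_integral => //.
- by move=> x _; rewrite lee_fin.
- exact/measurable_EFinP.
- by move=> x _; rewrite lee_fin.
- exact/measurable_EFinP.
- by apply: filterS fg => x fgx _; rewrite lee_fin.
Qed.

(** Made for dyadic shells: each point is charged to one shell, and the masses of the shells
    decrease geometrically. *)
Lemma ile_series (fk : nat -> X -> R) f C q : 0 <= C -> 0 <= q < 1 ->
  (forall k, measurable_fun setT (fk k)) -> (forall k x, 0 <= fk k x) ->
  (forall x, 0 <= f x) -> (forall x, f x != 0 -> exists k, f x <= fk k x) ->
  (forall k, ile (fk k) (C * q ^+ k)) -> ile f (C / (1 - q)).
Proof.
move=> C0 /andP[q0 q1] mf fk0 f0 ffk fka; rewrite /ile.
apply: (@le_trans _ _ (\int[mu]_x (\sum_(k <oo) (fk k x)%:E))%E).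
  apply: ge0_mono_integral => x; first by rewrite lee_fin.
  have [->|/ffk[k fk_]] := eqVneq (f x) 0.
    by apply: nneseries_ge0 => k _ _; rewrite lee_fin.
  apply: (@le_trans _ _ (fk k x)%:E); first by rewrite lee_fin.
  rewrite (@nneseriesD1 _ _ k)//; last by move=> i _; rewrite lee_fin.
  by rewrite leeDl// nneseries_ge0// => i _ _; rewrite lee_fin.
rewrite integral_nneseries//; last 2 first.
- by move=> k; exact/measurable_EFinP.
- by move=> k x _; rewrite lee_fin.
apply: (@le_trans _ _ (\sum_(k <oo) (C * q ^+ k)%:E)%E).
  apply: lee_nneseries => k _; last exact: fka.
  by move=> _; apply: integral_ge0 => x _; rewrite lee_fin.
apply: lime_le.
  by apply: is_cvg_nneseries => k _ _; rewrite lee_fin mulr_ge0// exprn_ge0.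
near=> N; rewrite sumEFin lee_fin -mulr_sumr ler_wpM2l//.
have := @subrXX _ 1 q N; rewrite expr1n => e.
rewrite -[leRHS]mul1r ler_pdivlMr ?subr_gt0//.
have -> : (\sum_(0 <= k < N) q ^+ k) * (1 - q) = 1 - q ^+ N.
  rewrite e mulrC; congr (_ * _); rewrite big_mkord.
  by apply: eq_bigr => i _; rewrite expr1n mul1r.
by rewrite lerBlDr lerDl exprn_ge0.
Unshelve. all: by end_near. Qed.

(** Cauchy-Schwarz from |f g| <= (t / (2 s)) f^2 + (s / (2 t)) g^2, where s and t are slightly
    larger than the two square roots, since those may vanish. *)
Lemma ile_amgm f g a b : measurable_fun setT f -> measurable_fun setT g ->
  ile (fun x => f x ^+ 2) a -> ile (fun x => g x ^+ 2) b ->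
  ile (fun x => `|f x * g x|) (Num.sqrt a * Num.sqrt b).
Proof.
move=> mf mg fa gb.
have a0 : 0 <= a by apply: ile_ge0 fa => x; exact: sqr_ge0.
have b0 : 0 <= b by apply: ile_ge0 gb => x; exact: sqr_ge0.
have key s t : 0 < s -> 0 < t -> Num.sqrt a <= s -> Num.sqrt b <= t ->
    ile (fun x => `|f x * g x|) (s * t).
  move=> s0 t0 as_ bt.
  have aE : a <= s ^+ 2 by rewrite -[a]sqr_sqrtr// ler_pXn2r// nnegrE ?sqrtr_ge0// ltW.
  have bE : b <= t ^+ 2 by rewrite -[b]sqr_sqrtr// ler_pXn2r// nnegrE ?sqrtr_ge0// ltW.
  have -> : s * t = t / (2 * s) * s ^+ 2 + s / (2 * t) * t ^+ 2.
    by field; rewrite !gt_eqF.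
  apply: (@ile_mono_lin2 _ (fun x => f x ^+ 2) (fun x => g x ^+ 2)).
  - by rewrite divr_ge0 ?mulr_ge0// ltW.
  - by rewrite divr_ge0 ?mulr_ge0// ltW.
  - exact: measurable_funX.
  - exact: measurable_funX.
  - by move=> x; exact: sqr_ge0.
  - by move=> x; exact: sqr_ge0.
  - by move=> x; exact: normr_ge0.
  - move=> x; rewrite normrM -(real_normK (num_real (f x))) -(real_normK (num_real (g x))).
    set u := `|f x|; set v := `|g x|.
    rewrite -subr_ge0.
    have -> : t / (2 * s) * u ^+ 2 + s / (2 * t) * v ^+ 2 - u * v =
        (t * u - s * v) ^+ 2 / (2 * s * t) by field; rewrite !gt_eqF.
    by rewrite divr_ge0 ?sqr_ge0// !mulr_ge0// ltW.
  - exact: ile_le fa.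
  - exact: ile_le gb.
apply: ile_addgt0 => e e0.
set s := Num.sqrt a; set t := Num.sqrt b.
have s0 : 0 <= s by exact: sqrtr_ge0.
have t0 : 0 <= t by exact: sqrtr_ge0.
pose D := s + t + 1.
have D0 : 0 < D by rewrite /D; lra.
pose m := Num.min 1 (e / D).
have m0 : 0 < m by rewrite lt_min ltr01 divr_gt0.
have m1 : m <= 1 by rewrite ge_min lexx.
have me : m * D <= e by rewrite -ler_pdivlMr// ge_min lexx orbT.
apply: (@ile_le _ ((s + m) * (t + m))); first by rewrite /D in me; nra.
by apply: key; rewrite ?lerDl; rewrite ?ltW// ltr_wpDl.
Qed.

End integral_bounds.

Notation "'\1[' b ]" := (nat_of_bool b%R)%:R (at level 0, b at level 99, format "'\1[' b ]") : ring_scope.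

(** Names on which the hints for measurability can be keyed; [mf2] keeps kernels curried although
    measurability refers to the product space. *)
Definition mf1 {R : realType} {d} {X : measurableType d} (f : X -> R) := measurable_fun setT f.
Definition mf2 {R : realType} {n : nat} (g : 'rV[R]_n -> 'rV[R]_n -> R) :=
  measurable_fun setT (fun z : 'rV[R]_n * 'rV[R]_n => g z.1 z.2).

Section measurability_rules.
Context {R : realType} {d} {X : measurableType d} {n : nat}.

Lemma mf2_comp (g : 'rV[R]_n -> 'rV[R]_n -> R) (a b : X -> 'rV[R]_n) : mf2 g ->
  measurable_fun setT a -> measurable_fun setT b -> measurable_fun setT (fun x => g (a x) (b x)).
Proof.
move=> mg ma mb.
exact: (measurableT_comp mg (measurable_fun_pair ma mb)).
Qed.

Lemma mf2_sec (g : 'rV[R]_n -> 'rV[R]_n -> R) x : mf2 g -> measurable_fun setT (g x).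
Proof. by move=> mg; exact: (measurableT_comp mg (measurable_pair1 x)). Qed.

Lemma eq_mf2 (g h : 'rV[R]_n -> 'rV[R]_n -> R) : (forall x y, g x y = h x y) -> mf2 h -> mf2 g.
Proof. by move=> gh; have -> : g = h by apply/funext => x; apply/funext => y. Qed.

Lemma mf1_comp {d'} {Y : measurableType d'} (g : Y -> R) (a : X -> Y) : mf1 g ->
  measurable_fun setT a -> measurable_fun setT (fun x => g (a x)).
Proof. by move=> mg ma; exact: (measurableT_comp mg ma). Qed.

Lemma measurable_natb (b : X -> bool) : measurable_fun setT b ->
  measurable_fun setT (fun x => (b x)%:R : R).
Proof.
move=> mb; have -> : (fun x => (b x)%:R : R) = (fun x => if b x then 1 else 0).
  by apply/funext => x; case: (b x).
exact: measurable_fun_ifT.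
Qed.

(** The inverse is sign times a real power of the modulus; at 0 both sides vanish because 0^-1 =
    0. *)
Lemma measurable_invr (f : X -> R) : measurable_fun setT f -> measurable_fun setT (fun x => (f x)^-1).
Proof.
move=> mf; have -> : (fun x => (f x)^-1) = (fun x => Num.sg (f x) * `|f x| `^ (-1)).
  apply/funext => x; rewrite powR_inv1//.
  have [->|x0] := eqVneq (f x) 0; first by rewrite sgr0 mul0r invr0.
  by rewrite {1}[f x]numEsg invfM; congr (_ * _); rewrite invr_sg.
have -> : (fun x => Num.sg (f x) * `|f x| `^ (-1)) =
    (fun x => (if f x == 0 then 0 else if f x < 0 then -1 else 1) * `|f x| `^ (-1)).
  by apply/funext => x; rewrite /Num.sg; case: (f x == 0) => //; case: (f x < 0).
apply: measurable_funM; first last.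
  apply: (measurableT_comp (measurable_powR _)); exact: measurableT_comp.
apply: measurable_fun_ifT => //; first exact: measurable_fun_eqr.
by apply: measurable_fun_ifT => //; exact: measurable_fun_ltr.
Qed.

Lemma measurable_subV (f g : X -> 'rV[R]_n) : measurable_fun setT f ->
  measurable_fun setT g -> measurable_fun setT (fun x => f x - g x).
Proof. by move=> mf mg; apply: measurable_addV => //; exact: measurable_oppV. Qed.

Lemma mf1_enorm : mf1 (@enorm R n). Proof. exact: measurable_enorm. Qed.
Lemma mf1_norm : mf1 (@Num.norm R R). Proof. exact: normr_measurable. Qed.
Lemma mf1_ln : mf1 (@ln R). Proof. exact: measurable_ln. Qed.
Lemma mf1_sqrt : mf1 (@Num.sqrt R). Proof. exact: measurable_sqrtr. Qed.
Lemma mf1_addc (c : R) : mf1 (GRing.add c).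
Proof. by apply: (@measurable_funD _ _ _ _ (fun=> c) (fun x => x)). Qed.
Lemma mfV_addc (c : 'rV[R]_n) : measurable_fun setT (GRing.add c).
Proof. by apply: (@measurable_addV _ _ _ _ (fun=> c) (fun x => x)). Qed.
Lemma mf1_powR p : mf1 (fun x : R => x `^ p). Proof. exact: measurable_powR. Qed.

End measurability_rules.

Create HintDb mdb.
#[export] Hint Resolve mf1_enorm mf1_norm mf1_ln mf1_sqrt : mdb.

(* [mauto] proves measurability goals. *)
Ltac mstep := match goal with
  | |- mf1 _ => rewrite /mf1
  | |- mf2 _ => rewrite /mf2
  | |- measurable_fun _ (fun x => x) => exact: measurable_id
  | |- measurable_fun _ (fun x => x.1) => exact: measurable_fst
  | |- measurable_fun _ (fun x => x.2) => exact: measurable_snd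
  | |- measurable_fun _ fst => exact: measurable_fst
  | |- measurable_fun _ snd => exact: measurable_snd
  | |- measurable_fun _ (GRing.scale ?r) => apply: (@measurable_scaleV _ _ _ _ r (fun x => x))
  | |- measurable_fun _ (GRing.mul ?r) => exact: mulrl_measurable
  | |- measurable_fun _ (GRing.add ?r) => first [exact: mf1_addc | exact: mfV_addc]
  | |- measurable_fun _ GRing.opp => first [exact: oppr_measurable | apply: (@measurable_oppV _ _ _ _ (fun x => x))]
  | |- measurable_fun _ (fun=> ?c) => exact: measurable_cst
  | |- measurable_fun _ (fun x => @?f x + - @?g x) =>
      first [apply: (@measurable_funB _ _ _ _ f g) | apply: measurable_subV]
  | |- measurable_fun _ (fun x => @?f x + @?g x) =>
      first [apply: (@measurable_funD _ _ _ _ f g) | apply: measurable_addV]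
  | |- measurable_fun _ (fun x => - @?f x) =>
      first [apply: (@measurable_funN _ _ _ _ f) | apply: measurable_oppV]
  | |- measurable_fun _ (fun x => @?f x * @?g x) => apply: (@measurable_funM _ _ _ _ f g)
  | |- measurable_fun _ (fun x => ?a *: @?f x) => apply: measurable_scaleV
  | |- measurable_fun _ (fun x => (@?f x)^-1) => apply: measurable_invr
  | |- measurable_fun _ (fun x => @?f x ^+ ?k) => apply: measurable_funX
  | |- measurable_fun _ (fun x => @?f x `^ ?k) => apply: (mf1_comp (mf1_powR k))
  | |- measurable_fun _ (fun x => Num.max (@?f x) (@?g x)) => apply: (@measurable_maxr _ _ _ _ f g)
  | |- measurable_fun _ (fun x => Num.min (@?f x) (@?g x)) => apply: (@measurable_minr _ _ _ _ f g)
  | |- measurable_fun _ (fun x => (nat_of_bool (@?b x))%:R) => apply: measurable_natb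

  | |- measurable_fun _ (fun x => @?f x && @?g x) => apply: measurable_and
  | |- measurable_fun _ (fun x => @?f x || @?g x) => apply: measurable_or
  | |- measurable_fun _ (fun x => ~~ @?f x) => apply: measurable_neg
  | |- measurable_fun _ (fun x => @?f x < @?g x) => apply: measurable_fun_ltr
  | |- measurable_fun _ (fun x => @?f x <= @?g x) => apply: measurable_fun_ler
  | |- measurable_fun _ (fun x => @?f x == @?g x) => apply: measurable_fun_eqr
  | |- measurable_fun _ (fun x => (@?f x, @?g x)) => apply: measurable_fun_pair
  | |- measurable_fun _ (fun x => ?v (@?e x)) =>
      first [apply: (mf1_comp (g:=v) (a:=e)); [solve [assumption | eauto 3 with mdb] | ]
            | apply: (measurableT_comp (f:=v) (g:=e)); [assumption | ]]
  | |- measurable_fun _ (fun x => ?F (@?e x) (@?f x)) =>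
      apply: (mf2_comp (g:=F) (a:=e) (b:=f)); [solve [assumption | eauto 3 with mdb] | | ]
  | |- measurable_fun _ (fun x => fst (@?e x)) => apply: (measurableT_comp measurable_fst)
  | |- measurable_fun _ (fun x => snd (@?e x)) => apply: (measurableT_comp measurable_snd)
  | |- measurable_fun _ (?F ?c) => apply: (mf2_sec (g:=F)); solve [assumption | eauto 3 with mdb]
  | |- measurable_fun _ ?f => first [assumption | solve [eauto 3 with mdb] | apply: measurable_fun_ifT
      | lazymatch f with (fun _ => _) => fail | _ => change (mf1 f); solve [assumption | eauto 3 with mdb] end]
  end.
Ltac mauto := solve [repeat mstep].

Create HintDb ndb.
(* [nneg] proves nonnegativity goals, with [nhook] as its extension point. *)
Ltac nhook := fail.
Ltac nstep := first
  [ assumption | nhook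
  | lazymatch goal with
    | |- is_true (0 <= _ ^+ 2) => exact: sqr_ge0
    | |- is_true (0 <= `|_|) => exact: normr_ge0
    | |- is_true (0 <= enorm _) => exact: enorm_ge0
    | |- is_true (0 <= _ `^ _) => exact: powR_ge0
    | |- is_true (0 <= Num.sqrt _) => exact: sqrtr_ge0
    | |- is_true (0 <= _%:R) => exact: ler0n
    | |- is_true (0 <= 1) => exact: ler01
    | |- is_true (0 <= _ * _) => apply: mulr_ge0
    | |- is_true (0 <= _ + _) => apply: addr_ge0
    | |- is_true (0 <= _ ^+ _) => apply: exprn_ge0
    | |- is_true (0 <= _^-1) => rewrite invr_ge0
    | |- is_true (0 <= Num.max _ _) => rewrite le_max; apply/orP; solve [left; nstep | right; nstep]
    end
  | solve [auto 3 with ndb nocore] | (apply: ltW; assumption) ].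
Ltac nneg := solve [intros; cbv beta; repeat nstep].

Section integrals_rV.
Context {R : realType} {n : nat}.
Local Notation T := 'rV[R]_n.
Local Notation leb := (@lebesgue_rV R n).
Implicit Types (f g h : T -> R) (k : T -> T -> R) (a b c r : R).

Definition I1 f a := ile leb f a.
Definition I2 k a := ile (leb \x leb)%E (fun z : T * T => k z.1 z.2) a.

Lemma I1_eq f g a : (forall x, f x = g x) -> I1 g a -> I1 f a.
Proof. by move=> /funext ->. Qed.

Lemma I2_eq k k' a : (forall x y, k x y = k' x y) -> I2 k' a -> I2 k a.
Proof. by move=> kk; have -> : k = k' by apply/funext => x; apply/funext => y. Qed.

Lemma I2E k a : mf2 k -> (forall x y, 0 <= k x y) ->
  I2 k a = (\int[leb]_x \int[leb]_y (k x y)%:E <= a%:E)%E.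
Proof.
move=> mk k0; rewrite /I2 /ile fubini_tonelli1//.
- exact/measurable_EFinP.
- by move=> z; rewrite lee_fin.
Qed.

Lemma I2_fubini k h a : mf2 k -> (forall x y, 0 <= k x y) ->
  (forall x, I1 (k x) (h x)) -> I1 h a -> I2 k a.
Proof.
move=> mk k0 kh ha; rewrite /I2 /ile fubini_tonelli1//; last 2 first.
- exact/measurable_EFinP.
- by move=> z; rewrite lee_fin.
apply: le_trans ha; apply: ge0_mono_integral => x /=; last exact: kh.
by apply: integral_ge0 => y _; rewrite lee_fin.
Qed.

Lemma I2_fubini2 k h a : mf2 k -> (forall x y, 0 <= k x y) ->
  (forall y, I1 (fun x => k x y) (h y)) -> I1 h a -> I2 k a.
Proof.
move=> mk k0 kh ha; rewrite /I2 /ile fubini_tonelli2//; last 2 first.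
- exact/measurable_EFinP.
- by move=> z; rewrite lee_fin.
apply: le_trans ha; apply: ge0_mono_integral => x /=; last exact: kh.
by apply: integral_ge0 => y _; rewrite lee_fin.
Qed.

Lemma I1_of_I2 k f a : mf2 k -> (forall x y, 0 <= k x y) -> (forall x, 0 <= f x) ->
  (forall x, (f x)%:E <= \int[leb]_y (k x y)%:E)%E -> I2 k a -> I1 f a.
Proof.
move=> mk k0 f0 fk; rewrite /I2 /ile fubini_tonelli1//; last 2 first.
- exact/measurable_EFinP.
- by move=> z; rewrite lee_fin.
by apply: le_trans; apply: ge0_mono_integral => x //; rewrite lee_fin.
Qed.

Lemma I2_swap k a : mf2 k -> (forall x y, 0 <= k x y) -> I2 k a -> I2 (fun x y => k y x) a.
Proof.
move=> mk k0; rewrite /I2 /ile fubini_tonelli1//; last 2 first.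
- exact/measurable_EFinP.
- by move=> z; rewrite lee_fin.
rewrite fubini_tonelli2//; last by move=> z; rewrite lee_fin.
apply/measurable_EFinP; mauto.
Qed.

Lemma I2_prod f g a b : mf1 f -> mf1 g -> (forall x, 0 <= f x) -> (forall x, 0 <= g x) ->
  I1 f a -> I1 g b -> I2 (fun x y => f x * g y) (a * b).
Proof.
move=> mf mg f0 g0 fa gb.
have b0 : 0 <= b by exact: ile_ge0 gb.
apply: (@I2_fubini _ (fun x => b * f x)).
- mauto.
- by move=> x y; exact: mulr_ge0.
- by move=> x; rewrite mulrC; apply: ile_scale.
- by rewrite mulrC; apply: ile_scale.
Qed.

Lemma integral_affine (a : T) r (f : T -> \bar R) : 0 < r -> measurable_fun setT f ->
  (forall x, 0 <= f x)%E ->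
  (\int[leb]_x f (a + r *: x)%R = (r ^- n)%:E * \int[leb]_x f x)%E.
Proof.
move=> r0 mf f0.
pose phi (x : T) : T := a + r *: x.
have mphi : measurable_fun setT phi by rewrite /phi; mauto.
have r0' : 0 <= r ^- n by rewrite invr_ge0 exprn_ge0// ltW.
have := @ge0_integral_pushforward _ _ _ _ R phi mphi leb setT f measurableT mf.
rewrite preimage_setT => <-; last by move=> *; exact: f0.
rewrite -[X in (X * _)%E]/((NngNum r0')%:num%:E) -ge0_integral_mscale//.
apply: eq_measure_integral => A mA _.
exact: lebesgue_rV_affine.
Qed.

Lemma I1_affine (x0 : T) r f a : 0 < r -> mf1 f -> (forall x, 0 <= f x) ->
  I1 f a -> I1 (fun x => f (x0 + r *: x)) (r ^- n * a).
Proof.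
move=> r0 mf f0 fa; rewrite /I1 /ile (@integral_affine _ _ (fun x => (f x)%:E))//.
- by rewrite EFinM lee_wpmul2l// lee_fin invr_ge0 exprn_ge0// ltW.
- exact/measurable_EFinP.
Qed.

Lemma I1_shift (x0 : T) f a : mf1 f -> (forall x, 0 <= f x) ->
  I1 f a -> I1 (fun x => f (x0 + x)) a.
Proof.
move=> mf f0 /(@I1_affine x0 1 _ _ ltr01 mf f0).
rewrite expr1n invr1 mul1r; congr (I1 _ _).
by apply/funext => x; rewrite scale1r.
Qed.

Lemma I2_affine (x0 : T) r k a : 0 < r -> mf2 k -> (forall x y, 0 <= k x y) ->
  I2 k a -> I2 (fun x y => k (x0 + r *: x) (x0 + r *: y)) (r ^- n * (r ^- n * a)).
Proof.
move=> r0 mk k0; rewrite (I2E _ mk k0) (@I2E (fun x y => k (x0 + r *: x) (x0 + r *: y))); [|by mauto|by []].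
have rn : (0 <= (r ^- n)%:E)%E by rewrite lee_fin invr_ge0 exprn_ge0// ltW.
have mF : measurable_fun setT (fun x => \int[leb]_y (k x y)%:E)%E.
  apply: (@measurable_fun_fubini_tonelli_F _ _ _ _ _ leb (fun z : T * T => (k z.1 z.2)%:E)).
    exact/measurable_EFinP.
  by move=> z; rewrite lee_fin.
have F0 x : (0 <= \int[leb]_y (k x y)%:E)%E by apply: integral_ge0 => y _; rewrite lee_fin.
move=> h; have eqF x : (\int[leb]_y (k (x0 + r *: x) (x0 + r *: y))%:E =
    (r ^- n)%:E * \int[leb]_y (k (x0 + r *: x) y)%:E)%E.
  apply: (@integral_affine _ _ (fun y => (k (x0 + r *: x) y)%:E)) => //.
    by apply/measurable_EFinP; mauto.
  by move=> y; rewrite lee_fin.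
under eq_integral do rewrite eqF.
rewrite ge0_integralZl//; last first.
  by apply: (measurableT_comp (f := fun x => \int[leb]_y (k x y)%:E)%E) => //; mauto.
rewrite (@integral_affine _ _ (fun x => \int[leb]_y (k x y)%:E)%E)//.
by rewrite !EFinM !lee_wpmul2l.
Qed.

(** Substitution y = x + z. In these variables an energy is an integral over z of norms of
    increments by z, which is the form on which averaging over translates acts. *)
Lemma I2_shear k a : mf2 k -> (forall x y, 0 <= k x y) ->
  I2 k a -> I2 (fun x z => k x (x + z)) a.
Proof.
move=> mk k0; rewrite (I2E _ mk k0) (@I2E (fun x z => k x (x + z))); [|by mauto|by []].
apply: le_trans; apply: ge0_mono_integral => x.
  by apply: integral_ge0 => y _; rewrite lee_fin.
have := (@integral_affine x 1 (fun y => (k x y)%:E) ltr01).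
rewrite expr1n invr1 mul1e => <-//; last 2 first.
- by apply/measurable_EFinP; mauto.
- by move=> y; rewrite lee_fin.
by under [leRHS]eq_integral do rewrite scale1r.
Qed.

End integrals_rV.

Ltac drop_hyps := repeat match goal with H : ?P |- _ => lazymatch P with
  | is_true (_ <= _) => fail | is_true (_ < _) => fail
  | is_true _ => clear H | forall _, _ => clear H | _ /\ _ => clear H | _ = _ => clear H
  | mf1 _ => clear H | mf2 _ => clear H | I1 _ _ => clear H | I2 _ _ => clear H end end.
Ltac keep_order a b := first [is_var a; fail 1 | is_var b; fail 1 | idtac].
Ltac drop_order := repeat match goal with H : is_true (?a <= ?b) |- _ => keep_order a b; clear H
  | H : is_true (?a < ?b) |- _ => keep_order a b; clear H end.
Ltac qlra := first [solve [drop_hyps; drop_order; lra] | solve [drop_hyps; lra] | lra].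

(** * Volume of balls and integrability of the kernel *)

Section ball_volume.
Context {R : realType}.

Let cube n : set 'rV[R]_n := [set x | forall i, `|x ord0 i| <= 1].

Let leb_cube n : @lebesgue_rV R n (@cube n) = (2 ^+ n)%:E.
Proof.
elim: n => [|n ih].
  by rewrite expr0 /= diracE (_ : _ \in _)// in_setE => -[].
rewrite [LHS](_ : _ = (\int[lebesgue_measure]_x (2 ^+ n * \1_(`[-1, 1]%classic) x)%:E)%E).
  rewrite [RHS](_ : _ = (\int[lebesgue_measure]_x ((2 ^+ n)%:E * (\1_(`[-1, 1]%classic) x)%:E))%E)//.
  rewrite ge0_integralZl//=; last first.
    by apply/measurable_EFinP; apply: measurable_indic.
  have E2 : lebesgue_measure (`[-1, 1]%classic : set R) = 2%:E.
    by rewrite lebesgue_measure_itv/= lte_fin ifT -?EFinB; [congr EFin|]; qlra.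
  by rewrite integral_indic// setIT exprSr EFinM -E2.
apply: eq_integral => x _; rewrite indicE.
have E v : cube (row_mx (x%:M : 'M[R]_1) v : 'rV[R]_n.+1) <-> `|x| <= 1 /\ cube v.
  split => [h|[x1 h] i].
    split.
      have := h (lshift n (ord0 : 'I_1)).
      by rewrite (row_mxEl (x%:M : 'M[R]_1) v) mxE eqxx.
    by move=> i; have := h (rshift 1 i); rewrite (row_mxEr (x%:M : 'M[R]_1) v).
  case: (unliftP ord0 i) => [j|] ->.
    rewrite (_ : lift ord0 j = rshift 1 j); last exact: val_inj.
    by rewrite (row_mxEr (x%:M : 'M[R]_1) v).
  rewrite (_ : ord0 = lshift n (ord0 : 'I_1)); last exact: val_inj.
  by rewrite (row_mxEl (x%:M : 'M[R]_1) v) mxE eqxx.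
case: (boolP (x \in _)) => xI; last first.
  rewrite mulr0 (_ : [set v | _] = set0) -?[LHS]/(lebesgue_rV set0) ?measure0//.
  apply/seteqP; split => [v /= /E[x1 _]|//].
  by apply: (negP xI); rewrite inE/= in_itv/= -ler_norml.
rewrite mulr1 -ih; congr (@lebesgue_rV R n _).
apply/seteqP; split => v /=; first by move=> /E[].
by move=> vc; apply/E; split => //; move: xI; rewrite inE/= in_itv/= -ler_norml.
Qed.

Context {n : nat}.
Local Notation T := 'rV[R]_n.
Local Notation leb := (@lebesgue_rV R n).

Let mcube : measurable (@cube n).
Proof.
have -> : @cube n = \bigcap_(i : 'I_n) [set x | `|x ord0 i| <= 1].
  by apply/seteqP; split => [x h i _|x h i]; exact: h.
apply: fin_bigcap_measurable => // i _.
have : measurable_fun setT (fun x : T => `|x ord0 i|).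
  by apply: (measurableT_comp (@normr_measurable R setT)) => //; exact: measurable_coord.
move=> /(_ measurableT `]-oo, 1]%classic); rewrite setTI.
have -> : (fun x : T => `|x ord0 i|) @^-1` `]-oo, 1] = [set x | `|x ord0 i| <= 1].
  by apply/seteqP; split => x /=; rewrite in_itv.
by apply.
Qed.

(** Only finiteness and positivity of this number matter. Both follow by comparison with a cube,
    whose volume the slices give directly. *)
Definition unit_volume : R := fine (leb (eball 0 1)).

Let leb_unit_fin : (leb (eball 0 1) < +oo)%E.
Proof.
apply: (@le_lt_trans _ _ (leb (@cube n))); last by rewrite leb_cube ltry.
apply: le_measure; rewrite ?inE//; first exact: measurable_eball.
move=> x; rewrite /eball/= subr0 => /ltW x1 i.
exact: le_trans (le_coord_enorm _ _) x1.
Qed.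

Lemma leb_eball (x : T) r : 0 < r -> leb (eball x r) = (r ^+ n * unit_volume)%:E.
Proof.
move=> r0.
rewrite EFinM /unit_volume fineK; last by rewrite ge0_fin_numE.
have := lebesgue_rV_affine (- r^-1 *: x) (r := r^-1) (A := eball 0 1).
rewrite invr_gt0 => /(_ r0 (measurable_eball _ _)).
rewrite exprVn invrK => <-; congr (leb _); apply/seteqP; split => y; rewrite /eball/= subr0.
  have -> : - r^-1 *: x + r^-1 *: y = r^-1 *: (y - x) by rewrite scalerBr scaleNr addrC.
  by rewrite enormZ ger0_norm ?invr_ge0 1?ltW// mulrC ltr_pdivrMr// mul1r.
have -> : - r^-1 *: x + r^-1 *: y = r^-1 *: (y - x) by rewrite scalerBr scaleNr addrC.
by rewrite enormZ ger0_norm ?invr_ge0 1?ltW// mulrC ltr_pdivrMr// mul1r.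
Qed.

Lemma unit_volume_gt0 : 0 < unit_volume.
Proof.
have : (0 < leb (eball 0 (n%:R + 1)))%E.
  apply: (@lt_le_trans _ _ (leb (@cube n))); first by rewrite leb_cube lte_fin exprn_gt0.
  apply: le_measure; rewrite ?inE//; first exact: measurable_eball.
  move=> x xc; rewrite /eball/= subr0; apply: le_lt_trans (enorm_le_norm _) _.
  by rewrite (@le_lt_trans _ _ n%:R)// ?ltrDl// ler_piMr// norm_le_coord.
by rewrite leb_eball ?ltr_wpDl// lte_fin pmulr_rgt0// exprn_gt0// ltr_wpDl.
Qed.

Lemma integral_ball (x : T) r : 0 < r ->
  (\int[leb]_y (\1[enorm (y - x) < r] : R)%:E = (r ^+ n * unit_volume)%:E)%E.
Proof.
move=> r0; rewrite -(leb_eball x r0) -[X in leb X]setIT.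
rewrite -integral_indic//; last exact: measurable_eball.
apply: eq_integral => y _; rewrite indicE; congr (_%:R%:E).
by congr nat_of_bool; apply/idP/idP; rewrite inE.
Qed.

Lemma I1_ball (x : T) r : 0 < r -> I1 (fun y => \1[enorm (y - x) < r]) (r ^+ n * unit_volume).
Proof. by move=> r0; rewrite /I1 /ile integral_ball. Qed.

End ball_volume.

Section kernel_bounds.
Context {R : realType} {n : nat}.
Local Notation T := 'rV[R]_n.
Local Notation leb := (@lebesgue_rV R n).
Implicit Types (x y z : T) (s r : R).

(* [J] is the kernel of the energy and [wt] the weight of the tail, regularized at the origin. *)
Definition Jr s r : R := (1 - s) * (r `^ (n%:R + 2 * s))^-1.
Definition J s x y := Jr s (enorm (x - y)).
Definition wt s y := Jr s (1 + enorm y).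
(* [mJ s0 |x - y| * J s x y] is integrable in y uniformly in s0 <= s < 1. *)
Definition mJ s0 r : R := if r < 1 then r ^+ 2 else r `^ s0.

Lemma Jr_ge0 s r : s < 1 -> 0 <= Jr s r.
Proof. by move=> s1; rewrite mulr_ge0// ?invr_ge0 ?powR_ge0// subr_ge0 ltW. Qed.

Lemma J_ge0 s x y : s < 1 -> 0 <= J s x y.
Proof. exact: Jr_ge0. Qed.

Lemma wt_ge0 s y : s < 1 -> 0 <= wt s y.
Proof. exact: Jr_ge0. Qed.

Lemma mJ_ge0 s0 r : 0 <= mJ s0 r.
Proof. by rewrite /mJ; case: ifP => _; rewrite ?sqr_ge0 ?powR_ge0. Qed.

Lemma J_sym s x y : J s x y = J s y x.
Proof. by rewrite /J enormB. Qed.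

Lemma mf1_Jr s : mf1 (Jr s).
Proof. rewrite /Jr; mauto. Qed.

Lemma mf2_J s : mf2 (J s).
Proof. rewrite /J; apply: (mf1_comp (mf1_Jr s)); mauto. Qed.

Lemma mf1_wt s : mf1 (wt s).
Proof. rewrite /wt; apply: (mf1_comp (mf1_Jr s)); mauto. Qed.

Lemma mf1_mJ s0 : mf1 (mJ s0).
Proof. rewrite /mJ; mauto. Qed.

#[local] Hint Resolve mf2_J mf1_wt mf1_Jr mf1_mJ : mdb.
#[local] Hint Resolve J_ge0 wt_ge0 Jr_ge0 mJ_ge0 : ndb.

Lemma powR_exprn (a : R) (p : R) k : 0 <= a -> (a ^+ k) `^ p = (a `^ p) ^+ k.
Proof.
move=> a0; rewrite -powR_mulrn// -powRrM -[in RHS]powR_mulrn ?powR_ge0//.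
by rewrite -powRrM mulrC.
Qed.

Lemma powRDp (a p q : R) : 0 < a -> a `^ (p + q) = a `^ p * a `^ q.
Proof. by move=> a0; rewrite powRD//; apply/implyP => _; rewrite gt_eqF. Qed.

Lemma ler_powR2 (a b p : R) : 0 <= p -> 0 <= a -> a <= b -> a `^ p <= b `^ p.
Proof. by move=> p0 a0 ab; rewrite ge0_ler_powR// nnegrE// (le_trans a0). Qed.

Lemma dyadic_lt1 r : 0 < r -> r < 1 -> exists k : nat, 2^-1 ^+ k.+1 <= r < 2^-1 ^+ k.
Proof.
move=> r0 r1.
have e : exists k : nat, 2^-1 ^+ k <= r.
  have /cvgrPdist_lt/(_ _ r0) : (2^-1 : R) ^+ k @[k --> \oo] --> (0 : R).
    by apply: cvg_expr; rewrite ger0_norm ?invr_ge0// invf_lt1//; qlra.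
  case=> k _ /(_ k (leqnn k)); rewrite /= sub0r normrN ger0_norm ?exprn_ge0 ?invr_ge0// => h.
  by exists k; exact: ltW.
case: (ex_minnP e) => -[|k] kr km; first by move: kr; rewrite expr0 leNgt r1.
exists k; rewrite kr/= ltNge; apply/negP => /km.
by rewrite ltnn.
Qed.

Lemma dyadic_ge1 r : 1 <= r -> exists k : nat, 2 ^+ k <= r < 2 ^+ k.+1.
Proof.
move=> r1; have r0 : 0 < r by apply: lt_le_trans r1.
have [k /andP[k1 k2]] : exists k : nat, 2^-1 ^+ k.+1 < r^-1 <= 2^-1 ^+ k.
  have e : exists k : nat, 2^-1 ^+ k < r^-1.
    have /cvgrPdist_lt/(_ r^-1) : (2^-1 : R) ^+ k @[k --> \oo] --> (0 : R).
      by apply: cvg_expr; rewrite ger0_norm ?invr_ge0// invf_lt1//; qlra.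
    rewrite invr_gt0 => /(_ r0)[k _ /(_ k (leqnn k))].
    rewrite /= sub0r normrN ger0_norm ?exprn_ge0 ?invr_ge0// => h.
    by exists k.
  case: (ex_minnP e) => -[|k] kr km.
    by move: kr; rewrite expr0 ltNge invf_le1// r1.
  by exists k; rewrite kr/= leNgt; apply/negP => /km; rewrite ltnn.
exists k; move: k1 k2; rewrite !exprVn lef_pV2 ?posrE ?exprn_gt0// => k1 ->/=.
by move: k1; rewrite ltf_pV2 ?posrE ?exprn_gt0.
Qed.

(** Shells of radius about 2^-k carry at most a multiple of (1 - s) q^k with q = 4^(s-1), so their
    sum is of order (1 - s) / (1 - q), which stays bounded as s tends to 1. At infinity r^s0
    r^(-n-2s) decays at least like r^(-n-s0), and the shells of radius 2^k are summable with ratio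
    2^(-s0). *)
Lemma ker_int s0 : 0 < s0 < 1 -> exists C : R, 0 <= C /\ forall s x, s0 <= s < 1 ->
  I1 (fun y => mJ s0 (enorm (x - y)) * J s x y) C.
Proof.
move=> /andP[s00 s01].
pose V : R := @unit_volume R n.
have V0 : 0 < V by exact: unit_volume_gt0.
pose L : R := ln 4.
have L0 : 0 < L by rewrite ln_gt0//; qlra.
pose C1 : R := 2 ^+ (n + 2) * V * ((1 + L) / L).
pose q1 : R := 2 `^ (- s0).
have q1_lt1 : q1 < 1.
  by rewrite /q1 powRN invf_lt1 ?powR_gt0// /powR ifF ?gt_eqF// expR_gt1 mulr_gt0// ln_gt0//; qlra.
pose C2 : R := 2 ^+ n * V / (1 - q1).
have C10 : 0 <= C1 by rewrite !mulr_ge0// ?invr_ge0 ?ltW//; qlra.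
have C20 : 0 <= C2 by rewrite !mulr_ge0// ?invr_ge0 ?ltW// subr_gt0.
exists (1 * C1 + 1 * C2); split; first by rewrite !mul1r addr_ge0.
move=> s x /andP[s0s s1].
pose nearf y : R := \1[enorm (y - x) < 1] * (enorm (y - x) ^+ 2 * J s x y).
pose farf y : R := \1[~~ (enorm (y - x) < 1)] * (enorm (y - x) `^ s0 * J s x y).
have mJs := mf2_J s.
have Js y : 0 <= J s x y by exact: J_ge0.
have n0 y : 0 <= nearf y by rewrite /nearf; nneg.
have f0 y : 0 <= farf y by rewrite /farf; nneg.
apply: (@ile_mono_lin2 _ _ _ _ _ nearf farf) => //.
- by rewrite /nearf; mauto.
- by rewrite /farf; mauto.
- by move=> y; rewrite mulr_ge0// mJ_ge0.
- move=> y; rewrite /nearf /farf /mJ enormB !mul1r.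
  by case: ifP => _ /=; rewrite ?mul1r ?mul0r ?addr0 ?add0r.
(* With t = 1 - s one has q = exp(- t ln 4) <= 1 / (1 + t ln 4), hence t / (1 - q) <= (1 + ln 4) /
   ln 4. This is where the factor 1 - s of the kernel is spent. *)
- pose q : R := 2^-1 `^ (2 - 2 * s).
  have q0 : 0 <= q by exact: powR_ge0.
  pose t : R := 1 - s.
  have t0 : 0 < t by rewrite subr_gt0.
  have qt : q <= (1 + t * L)^-1.
    have -> : q = (expR (t * L))^-1.
      rewrite /q -expRN /L /powR ifF; last by apply/negbTE; rewrite invr_eq0.
      congr expR; rewrite lnV ?posrE// (_ : 4 = 2 ^+ 2); last by rewrite expr2; qlra.
      by rewrite lnXn// /t -mulr_natl; ring.
    rewrite lef_pV2 ?posrE ?expR_gt0 ?expR_ge1Dx//.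
    by rewrite addr_gt0// mulr_gt0.
  have tL : 0 < t * L by rewrite mulr_gt0.
  have q_1 : q < 1 by apply: le_lt_trans qt _; rewrite invf_lt1 ?ltrDl// addr_gt0.
  have bnd : t * 2 ^+ (n + 2) * V / (1 - q) <= C1.
    rewrite ler_pdivrMr ?subr_gt0//.
    have h : t * L <= (1 - q) * (1 + L).
      have : 1 - (1 + t * L)^-1 <= 1 - q by rewrite lerD2l lerN2.
      have tl1 : t * L <= L by rewrite ger_pMl// /t gerBl; apply: le_trans s0s; exact: ltW.
      move=> h1; apply: le_trans (_ : (1 - (1 + t * L)^-1) * (1 + L) <= _).
        have -> : 1 - (1 + t * L)^-1 = t * L / (1 + t * L) by field; rewrite gt_eqF// addr_gt0.
        rewrite -[leRHS]mulrA -[leLHS]mulr1 ler_pM2l// ler_pdivlMl ?addr_gt0//.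
        by rewrite mulr1 lerD2l.
      by rewrite ler_pM2r// addr_gt0.
    rewrite /C1 -!mulrA [t * _]mulrCA ler_pM2l ?exprn_gt0//.
    rewrite [t * V]mulrC ler_pM2l// mulrCA ler_pdivlMl//.
    by rewrite mulrC [leRHS]mulrC.
  apply: ile_le bnd _.
  apply: (@ile_series _ _ _ _ (fun (k : nat) (y : T) => t * 2 ^+ (n + 2) * (2^-1 ^+ k) ^- n * q ^+ k *
     \1[enorm (y - x) < 2^-1 ^+ k])).
  + by rewrite !mulr_ge0// ltW.
  + by rewrite q0.
  + by move=> k; mauto.
  + by move=> k y; rewrite !mulr_ge0// ?invr_ge0 ?exprn_ge0// ltW.
  + by [].
  + move=> y; rewrite /nearf; have [y1|y1] := boolP (enorm (y - x) < 1); rewrite /= ?mul0r ?eqxx// !mul1r => ny0.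
    have yx0 : 0 < enorm (y - x).
      rewrite lt0r enorm_ge0 andbT; apply: contra_neq ny0 => ->.
      by rewrite expr0n mul0r.
    have [k /andP[k1 k2]] := dyadic_lt1 yx0 y1.
    exists k; rewrite k2 mulr1 /J (enormB x y) /Jr -/t.
    set r := enorm (y - x) in yx0 k1 k2 *.
    set h := 2^-1 ^+ k in k2 *.
    have h0 : 0 < h by rewrite exprn_gt0.
    rewrite mulrCA -!mulrA ler_pM2l//.
    have -> : 2 ^+ (n + 2) * (h ^- n * q ^+ k) = 2 ^+ (n + 2) * (h ^+ 2 / h `^ (n%:R + 2 * s)).
      congr (_ * _).
      rewrite /q -powR_exprn ?invr_ge0// -/h powRDp// powRN (powRDp n%:R)//.
      by rewrite !powR_mulrn ?ltW// invfM mulrCA mulrA [_ ^+ 2 * _]mulrC mulrA.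
    have hE : h `^ (n%:R + 2 * s) = (h / 2) `^ (n%:R + 2 * s) * 2 `^ (n%:R + 2 * s).
      by rewrite -powRM ?divfK// divr_ge0// ltW.
    have p0 : 0 <= n%:R + 2 * s by rewrite addr_ge0// mulr_ge0// (le_trans _ s0s)// ltW.
    have hr : (h / 2) `^ (n%:R + 2 * s) <= r `^ (n%:R + 2 * s).
      apply: ler_powR2 => //; first by rewrite divr_ge0 ?ltW.
      by move: k1; rewrite exprSr.
    have p2 : (2 : R) `^ (n%:R + 2 * s) <= 2 ^+ (n + 2).
      rewrite -powR_mulrn// ler_powR//; first by qlra.
      by rewrite natrD lerD2l; qlra.
    have hp : 0 < (h / 2) `^ (n%:R + 2 * s) by rewrite powR_gt0 ?divr_gt0.
    rewrite hE; have B0 : 0 < (2 : R) `^ (n%:R + 2 * s) by rewrite powR_gt0.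
    move: hr p2 hp B0; set A := (h / 2) `^ _; set B := 2 `^ _; set D := r `^ _.
    set E := 2 ^+ (n + 2) => AD BE A0 B0.
    have D0 : 0 < D by exact: lt_le_trans AD.
    rewrite mulrA ler_pdivrMr//.
    have -> : E * (h ^+ 2 / (A * B)) * D = h ^+ 2 * ((E / B) * (D / A)).
      by field; rewrite !gt_eqF.
    rewrite -expr2; apply: (@le_trans _ _ (h ^+ 2)); first by rewrite ler_pXn2r// ?nnegrE ltW.
    by rewrite -[leLHS]mulr1 ler_wpM2l ?sqr_ge0// mulr_ege1// ler_pdivlMr ?mul1r.
  + move=> k; have h0 : 0 < (2^-1 : R) ^+ k by rewrite exprn_gt0.
    have -> : t * 2 ^+ (n + 2) * V * q ^+ k =
      t * 2 ^+ (n + 2) * (2^-1 ^+ k) ^- n * q ^+ k * ((2^-1 ^+ k) ^+ n * V).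
      by field; rewrite gt_eqF ?exprn_gt0.
    apply: ile_scale; last exact: I1_ball.
    * by rewrite !mulr_ge0// ?invr_ge0 ?exprn_ge0// ltW.
    * mauto.
    * by [].
- apply: (@ile_series _ _ _ _ (fun (k : nat) (y : T) => (2 ^+ k) ^- n * q1 ^+ k *
     \1[enorm (y - x) < 2 ^+ k.+1])).
  + by rewrite !mulr_ge0// ltW.
  + by rewrite powR_ge0.
  + by move=> k; mauto.
  + by move=> k y; rewrite !mulr_ge0// ?invr_ge0 ?exprn_ge0// powR_ge0.
  + by [].
  + move=> y; rewrite /farf -leNgt => y0; have {y0} y1 : 1 <= enorm (y - x).
      by move: y0; case: ltrP => //=; rewrite ?mul0r ?eqxx.
    have [k /andP[k1 k2]] := dyadic_ge1 y1.
    exists k; rewrite y1 k2 mulr1 mul1r /J (enormB x y) /Jr.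
    set r := enorm (y - x) in y1 k1 k2 *.
    have r0 : 0 < r by apply: lt_le_trans y1.
    set h := 2 ^+ k in k1 *.
    have h1 : 1 <= h by rewrite exprn_ege1//; qlra.
    have h0 : 0 < h by apply: lt_le_trans h1.
    rewrite mulrCA -powRN -powRDp//.
    have -> : q1 ^+ k = h `^ (- s0) by rewrite /q1 -powR_exprn.
    rewrite -powR_invn ?(ltW h0)// -powRDp//.
    apply: (@le_trans _ _ (r `^ (s0 - (n%:R + 2 * s)))).
      by rewrite ler_piMl ?powR_ge0//; qlra.
    apply: (@le_trans _ _ (h `^ (s0 - (n%:R + 2 * s)))).
      rewrite -[s0 - _]opprB !powRN lef_pV2 ?posrE ?powR_gt0// ler_powR2//; last exact: ltW.
      have : 0 <= n%:R :> R by []. 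
      by qlra.
    by apply: ler_powR => //; qlra.
  + move=> k; have h0 : 0 < (2 : R) ^+ k by rewrite exprn_gt0.
    have -> : 2 ^+ n * V * q1 ^+ k =
      (2 ^+ k) ^- n * q1 ^+ k * ((2 ^+ k.+1) ^+ n * V).
      by rewrite exprS exprMn; field; rewrite gt_eqF ?exprn_gt0.
    apply: ile_scale; last by apply: I1_ball; rewrite exprn_gt0.
    * by rewrite !mulr_ge0// ?invr_ge0 ?exprn_ge0// powR_ge0.
    * mauto.
    * by [].
Qed.

End kernel_bounds.

#[export] Hint Resolve mf2_J mf1_wt mf1_Jr mf1_mJ : mdb.
Ltac nhook ::= lazymatch goal with
  | |- is_true (0 <= J _ _ _) => by apply: J_ge0
  | |- is_true (0 <= wt _ _) => by apply: wt_ge0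
  | |- is_true (0 <= mJ _ _) => exact: mJ_ge0
  end.

(** * Poincare, Nash and Faber-Krahn inequalities for the nonlocal energy *)

Section poincare.
Context {R : realType} {n : nat}.
Local Notation T := 'rV[R]_n.
Local Notation leb := (@lebesgue_rV R n).
Implicit Types (g : T -> R) (c : T -> bool) (s r t a : R).

Definition energy s g a := I2 (fun x y => (g x - g y) ^+ 2 * J s x y) a.
Definition energy_on c s g a :=
  I2 (fun x y => \1[c x && c y] * ((g x - g y) ^+ 2 * J s x y)) a.

(** The sum is dominated by its last nonzero term, at most a^-p, up to the factor 2. The subtracted
    indicator strengthens the induction, whose step passes from a to 2 a. *)
Lemma dyadic_sum_bound (p a : R) N : 1 <= p -> 0 < a ->
  \sum_(k < N) (2 `^ p) ^+ k * \1[a < 2^-1 ^+ k] <= 2 * (a `^ p)^-1 - \1[a < 1].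
Proof.
move=> p1; elim: N a => [|N ih] a a0.
  rewrite big_ord0 subr_ge0.
  have [a1|a1] := ltP a 1; last by rewrite mulr_ge0// invr_ge0 powR_ge0.
  have : a `^ p <= 1 by rewrite -[leRHS](congr1 (fun f => f p) (powR1 R)) ler_powR2 ?ltW//; qlra.
  move=> h; have : 1 <= (a `^ p)^-1 by rewrite invf_ge1// powR_gt0.
  by rewrite /=; qlra.
rewrite big_ord_recl/= expr0 mul1r expr0.
have -> : \sum_(i < N) 2 `^ p ^+ bump 0 i * \1[a < 2^-1 ^+ bump 0 i] =
    2 `^ p * \sum_(k < N) (2 `^ p) ^+ k * \1[2 * a < 2^-1 ^+ k].
  rewrite mulr_sumr; apply: eq_bigr => i _; rewrite /bump/= add1n !exprS mulrA.
  by rewrite -ltr_pdivlMl.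
have w2 : 2 <= (2 : R) `^ p by rewrite -[leLHS]powRr1// ler_powR//; qlra.
have a20 : 0 < 2 * a by rewrite mulr_gt0.
have [a1|a1] := ltP (2 * a) 1.
  have := ih _ a20; rewrite a1 (powRM p (ler0n R 2) (ltW a0)) invfM.
  have -> : (a < 1) = true by apply/idP; qlra.
  move=> /(ler_wpM2l (powR_ge0 2 p)).
  have -> : 2 `^ p * (2 * ((2 `^ p)^-1 / a `^ p) - \1[true]) = 2 / a `^ p - 2 `^ p.
    by rewrite /=; field; rewrite !gt_eqF// powR_gt0.
  by rewrite /=; qlra.
rewrite big1 ?mulr0 ?addr0; last first.
  move=> i _; rewrite ltNge (le_trans _ a1) ?mulr0//.
  by rewrite exprn_ile1 ?invr_ge0// invf_le1//; qlra.
have [b1|b1] := ltP a 1; last by rewrite subr0 mulr_ge0// invr_ge0 powR_ge0.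
have : a `^ p <= 1 by rewrite -[leRHS](congr1 (fun f => f p) (powR1 R)) ler_powR2 ?ltW//; qlra.
move=> h; have : 1 <= (a `^ p)^-1 by rewrite invf_ge1// powR_gt0.
by rewrite /=; qlra.
Qed.

(** Let D_k be the integral of (g x - g y)^2 over pairs in [c] at distance less than t 2^-k. Passing
    through the midpoint, which stays in [c], gives D_k <= 4 2^n D_(k+1). The sum of the D_k with
    weights (1 - s) 2^(p k), p = n + 2 s, is at most 2 t^p times the energy, while its k-th term is
    at least (1 - s) q^k D_0 with q = 4^(s-1). As (1 - s) / (1 - q) >= 1 / ln 4, the resulting bound
    on D_0 does not degenerate when s tends to 1. *)
Lemma poincare : exists C : R, 0 <= C /\ forall s c g t a, (1 <= n)%N ->
  0 < s < 1 -> measurable_fun setT c -> mf1 g -> 0 < t ->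
  (forall x y, c x -> c y -> c (2^-1 *: (x + y))) ->
  energy_on c s g a ->
  I2 (fun x y => \1[[&& c x, c y & enorm (x - y) < t]] * (g x - g y) ^+ 2)
     (C * t `^ (n%:R + 2 * s) * a).
Proof.
pose L : R := ln 4.
have L0 : 0 < L by rewrite ln_gt0//; qlra.
exists (4 * L); split; first by rewrite mulr_ge0// ltW.
move=> s c g t a n1 /andP[s0 s1] mc mg t0 cmid ea.
set p := n%:R + 2 * s.
have p1 : 1 <= p.
  by rewrite /p (le_trans (_ : 1 <= n%:R)) ?ler1n// lerDl mulr_ge0// ltW.
have mJs := @mf2_J R n s.
pose D (k : nat) (x y : T) : R := \1[[&& c x, c y & enorm (x - y) < t * 2^-1 ^+ k]] * (g x - g y) ^+ 2.
have D0 k x y : 0 <= D k x y by rewrite /D; nneg.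
have mD k : mf2 (D k) by rewrite /D; mauto.
have Dsym k x y : D k x y = D k y x.
  by rewrite /D enormB -[(g x - g y) ^+ 2]sqrrN opprB andbCA.
(* Two copies of the pairs at half the distance, each with the Jacobian 2^n of the passage from y to
   the midpoint and the factor 2 of (a + b)^2 <= 2 a^2 + 2 b^2. *)
have half k b : I2 (D k.+1) b -> I2 (D k) (4 * 2 ^+ n * b).
  move=> hb; pose m (x y : T) : T := 2^-1 *: (x + y).
  pose K (x y : T) : R := D k.+1 x (m x y).
  have mK : mf2 K by rewrite /K /m; mauto.
  have K0 x y : 0 <= K x y by exact: D0.
  have hK : I2 K (2 ^+ n * b).
    rewrite I2E//; rewrite I2E// in hb.
    have E x : (\int[leb]_y (K x y)%:E = (2 ^+ n)%:E * \int[leb]_y (D k.+1 x y)%:E)%E.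
      have i0 : 0 < (2^-1 : R) by [].
      have := @integral_affine R n (2^-1 *: x) 2^-1 (fun y => (D k.+1 x y)%:E) i0.
      rewrite exprVn invrK => <-.
      - by apply: eq_integral => y _; rewrite /K /m scalerDr.
      - by apply/measurable_EFinP; mauto.
      - by move=> y; rewrite lee_fin.
    under eq_integral do rewrite E.
    rewrite ge0_integralZl//.
    + by rewrite EFinM lee_wpmul2l// lee_fin exprn_ge0.
    + apply: (@measurable_fun_fubini_tonelli_F _ _ _ _ _ leb (fun z : T * T => (D k.+1 z.1 z.2)%:E)).
        by apply/measurable_EFinP; have := mD k.+1.
      by move=> z; rewrite lee_fin.
    + by move=> x _; apply: integral_ge0 => y _; rewrite lee_fin.
  have hK' := I2_swap mK K0 hK.
  have -> : 4 * 2 ^+ n * b = 2 * (2 ^+ n * b) + 2 * (2 ^+ n * b) by ring.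
  apply: (@ile_mono_lin2 _ _ _ _ _ (fun z : T * T => K z.1 z.2) (fun z => K z.2 z.1)) => //.
  - mauto.
  move=> -[x y]/=; rewrite /K /D.
  have [/and3P[cx cy xy]|] := boolP [&& c x, c y & enorm (x - y) < _]; last first.
    by rewrite mul0r => _; rewrite addr_ge0// mulr_ge0// mulr_ge0// sqr_ge0.
  have yx : m y x = m x y by rewrite /m addrC.
  have e1 : x - m x y = 2^-1 *: (x - y).
    by apply/rowP => i; rewrite /m !mxE; field.
  have e2 : y - m x y = 2^-1 *: (y - x).
    by apply/rowP => i; rewrite /m !mxE; field.
  rewrite yx cx cy cmid// e1 e2 !enormZ ger0_norm ?invr_ge0// (enormB y x).
  have -> : (2^-1 * enorm (x - y) < t * 2^-1 ^+ k.+1) = true.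
    by rewrite exprS mulrCA ltr_pM2l ?invr_gt0.
  rewrite /= !mul1r.
  have := sqr_ge0 (g x - g (m x y) + (g y - g (m x y))); nra.
have Dk k b : I2 (D k) b -> I2 (D 0) ((4 * 2 ^+ n) ^+ k * b).
  elim: k b => [|k ih] b; first by rewrite expr0 mul1r.
  by move=> /half/ih; rewrite exprSr mulrA.
pose t' := 1 - s.
have t'0 : 0 < t' by rewrite subr_gt0.
pose S N (x y : T) : R := \sum_(k < N) t' * (2 `^ p) ^+ k * D k x y.
have SE N x y : S N x y <= 2 * t `^ p * (\1[c x && c y] * ((g x - g y) ^+ 2 * J s x y)).
  rewrite /S /D; have [/andP[cx cy]|ncxy] := boolP (c x && c y); last first.
    rewrite mul0r mulr0 big1// => k _; rewrite andbA (negbTE ncxy)/=.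
    by rewrite mul0r mulr0.
  rewrite cx cy/= mul1r.
  have [->|gxy] := eqVneq (g x) (g y).
    rewrite subrr expr0n/= mul0r mulr0 big1// => k _.
    by rewrite mulr0 mulr0.
  have xy0 : 0 < enorm (x - y).
    by rewrite enorm_gt0 subr_eq0; apply: contra_neq gxy => ->.
  have := @dyadic_sum_bound p (enorm (x - y) / t) N p1; rewrite divr_gt0// => /(_ isT) h.
  have {}h : \sum_(k < N) (2 `^ p) ^+ k * \1[enorm (x - y) < t * 2^-1 ^+ k] <=
     2 * (t `^ p / enorm (x - y) `^ p).
    apply: le_trans (_ : _ <= 2 * ((enorm (x - y) / t) `^ p)^-1 - \1[enorm (x - y) / t < 1]) _.
      apply: le_trans h; apply: ler_sum => k _.
      by rewrite ltr_pdivrMr// [_ * t]mulrC.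
    apply: (@le_trans _ _ (2 * ((enorm (x - y) / t) `^ p)^-1)); first by rewrite lerBlDr lerDl.
    rewrite powRM ?invr_ge0 ?enorm_ge0 ?(ltW t0)// invfM -powRN -(powR_inv1 (ltW t0)) -powRrM.
    by rewrite -[(t `^ _)^-1]powRN mulN1r opprK [X in 2 * X <= _]mulrC.
  have -> : \sum_(k < N) t' * 2 `^ p ^+ k * (\1[enorm (x - y) < t * 2^-1 ^+ k] * (g x - g y) ^+ 2)
     = t' * (g x - g y) ^+ 2 * \sum_(k < N) (2 `^ p) ^+ k * \1[enorm (x - y) < t * 2^-1 ^+ k].
    by rewrite mulr_sumr; apply: eq_bigr => k _; ring.
  apply: le_trans (ler_wpM2l _ h) _; first by rewrite mulr_ge0 ?sqr_ge0// ltW.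
  by rewrite le_eqVlt; apply/orP; left; apply/eqP; rewrite /J /Jr -/p -/t'; ring.
have S0 N x y : 0 <= S N x y.
  apply: sumr_ge0 => k _; apply: mulr_ge0 => //.
  by rewrite mulr_ge0 ?exprn_ge0 ?powR_ge0 ?(ltW t'0).
have mS N : mf2 (S N) by apply: measurable_sum => k; have mDk := mD k; mauto.
have IS N : I2 (S N) (2 * t `^ p * a).
  apply: (ile_mono_scale (g := fun z : T * T =>
    \1[c z.1 && c z.2] * ((g z.1 - g z.2) ^+ 2 * J s z.1 z.2))) => //.
  - by rewrite mulr_ge0// powR_ge0.
  - mauto.
  - by move=> z; nneg.
(* The first term of the sum alone shows that D_0 is finite, so that the D_k below have real
   values. *)
have I0 : I2 (D 0) (t'^-1 * (2 * t `^ p * a)).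
  apply: ile_mono_scale (IS 1%N) => //; first by rewrite invr_ge0 ltW.
  - exact: mS.
  - by move=> z; rewrite /S big_ord_recl big_ord0 addr0 expr0 mulr1 mulrA mulVf ?mul1r// gt_eqF.
have [b0 [b00 _ b0E]] := ile_value (fun z => D0 0%N z.1 z.2) I0.
have Ib0 : I2 (D 0) b0 by rewrite /I2 /ile b0E.
have bk k : exists b, b0 <= (4 * 2 ^+ n) ^+ k * b /\ (\int[leb \x leb]_z (D k z.1 z.2)%:E = b%:E)%E.
  have Ik : I2 (D k) b0.
    apply: ile_mono Ib0 => [z//|z]; rewrite /D expr0 mulr1 ler_wpM2r ?sqr_ge0//.
    case: (c z.1) => //; case: (c z.2) => //=; case: ltP => //= zt.
    rewrite (lt_le_trans zt)// ler_piMr ?(ltW t0)//.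
    by rewrite exprn_ile1 ?invr_ge0// invf_le1//; qlra.
  have [b [_ _ bE]] := ile_value (fun z => D0 k z.1 z.2) Ik.
  exists b; split => //.
  by rewrite -lee_fin -b0E; apply: Dk; rewrite /I2 /ile bE.
pose q : R := 2 `^ (2 * s - 2).
have qE : q = expR (- (t' * L)).
  rewrite /q /powR ifF ?gt_eqF//; congr expR.
  rewrite /L (_ : 4 = 2 ^+ 2); last by rewrite expr2; qlra.
  by rewrite lnXn// /t' -mulr_natl; ring.
have q0 : 0 < q by rewrite powR_gt0.
have q1 : 1 - q <= t' * L by rewrite qE; have := expR_ge1Dx (- (t' * L)); qlra.
have qlt1 : q < 1 by rewrite qE -expR0 ltr_expR oppr_lt0 mulr_gt0.
have wq : 2 `^ p = 4 * 2 ^+ n * q.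
  rewrite /q /p -powR_mulrn// (_ : 4 = 2 `^ 2); last first.
    by rewrite (powR_mulrn 2)// expr2; qlra.
  by rewrite -!powRDp//; congr (_ `^ _); ring.
have key N : b0 * (1 - q ^+ N) <= 2 * L * t `^ p * a.
  have hN : \sum_(k < N) t' * q ^+ k * b0 <= 2 * t `^ p * a.
    rewrite -lee_fin; apply: le_trans (IS N); rewrite /S.
    under eq_integral do rewrite -sumEFin.
    rewrite ge0_integral_sum//; last 2 first.
    - by move=> k; apply/measurable_EFinP; have mDk := mD k; mauto.
    - move=> k z _; rewrite lee_fin; apply: mulr_ge0 => //.
      by rewrite mulr_ge0 ?exprn_ge0 ?powR_ge0 ?(ltW t'0).
    rewrite -sumEFin; apply: lee_sum => k _.
    have [b [bb bE]] := bk k.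
    under eq_integral do rewrite EFinM.
    rewrite ge0_integralZl_EFin//; last 3 first.
    - by move=> z _; rewrite lee_fin.
    - by apply/measurable_EFinP; have := mD k.
    - by rewrite !mulr_ge0// ?exprn_ge0 ?powR_ge0// ltW.
    rewrite bE -EFinM lee_fin wq exprMn -!mulrA ler_pM2l// mulrCA.
    by rewrite ler_pM2l ?exprn_gt0// mulrC.
  have e : t' * b0 * (1 - q ^+ N) = (1 - q) * \sum_(k < N) t' * q ^+ k * b0.
    have -> : \sum_(k < N) t' * q ^+ k * b0 = t' * b0 * \sum_(k < N) q ^+ k.
      by rewrite mulr_sumr; apply: eq_bigr => i _; ring.
    rewrite [RHS]mulrCA; congr (_ * _); rewrite -[X in X - _](expr1n R N) subrXX.
    by congr (_ * _); apply: eq_bigr => i _; rewrite expr1n mul1r.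
  rewrite -(ler_pM2l t'0) mulrA e.
  have -> : t' * (2 * L * t `^ p * a) = t' * L * (2 * t `^ p * a) by ring.
  have a0 : 0 <= 2 * t `^ p * a by apply: le_trans hN; apply: sumr_ge0 => k _; rewrite !mulr_ge0 ?exprn_ge0 ?(ltW t'0) ?(ltW q0).
  apply: le_trans (_ : (1 - q) * (2 * t `^ p * a) <= _); last by rewrite ler_wpM2r.
  by rewrite ler_wpM2l// subr_ge0 ltW.
(* q^N <= 1/2 turns 1 - q^N into a factor 1/2, whence the constant 4 ln 4. *)
have [N qN] : exists N, q ^+ N <= 2^-1.
  have /cvgrPdist_lt/(_ 2^-1) : (q : R) ^+ k @[k --> \oo] --> (0 : R).
    by apply: cvg_expr; rewrite ger0_norm// ltW.
  rewrite invr_gt0 => /(_ (ltr0n _ 2))[k _ /(_ k (leqnn k))].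
  by rewrite /= sub0r normrN ger0_norm ?exprn_ge0 ?ltW// => h; exists k; exact: ltW.
have Ib : I2 (D 0) (4 * L * t `^ p * a).
  by apply: ile_le Ib0; have := key N; nra.
by move: Ib; rewrite /D expr0 mulr1.
Qed.

Hypothesis n_gt0 : (1 <= n)%N.

(* Integrating [g x ^+ 2 <= (g x - g y) ^+ 2 + 2 * |g x| * |g y|] over
   [|x - y| < r] replaces the Sobolev embedding. *)
Lemma nash : exists C : R, 0 <= C /\ forall s g r a A, 0 < s < 1 -> mf1 g -> 0 < r ->
  energy s g a -> I1 (fun x => `|g x|) A ->
  I1 (fun x => g x ^+ 2) (C * (r `^ (2 * s) * a + r ^- n * A ^+ 2)).
Proof.
have [C [C0 hC]] := poincare.
pose V : R := @unit_volume R n; have V0 : 0 < V by exact: unit_volume_gt0.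
exists ((C + 2) / V); split; first by rewrite divr_ge0 ?(ltW V0)// addr_ge0.
move=> s g r a A s01 mg r0 ga gA.
have a0 : 0 <= a.
  by apply: ile_ge0 ga => z; have /andP[_ s1] := s01; nneg.
pose k (x y : T) : R := 1 * (\1[[&& true, true & enorm (x - y) < r]] * (g x - g y) ^+ 2) +
   2 * (`|g x| * `|g y|).
have k0 x y : 0 <= k x y by rewrite /k; nneg.
have mk : mf2 k by rewrite /k; mauto.
have kI : I2 k (1 * (C * r `^ (n%:R + 2 * s) * a) + 2 * (A * A)).
  apply: (ile_mono_lin2 (g := fun z : T * T => \1[[&& true, true & enorm (z.1 - z.2) < r]] * (g z.1 - g z.2) ^+ 2)
    (h := fun z : T * T => `|g z.1| * `|g z.2|)) => //; try mauto; try nneg.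
  - apply: (hC s (fun=> true)) => //.
    by move: ga; rewrite /energy_on; under [X in _ -> I2 X _]eq_fun do under eq_fun do rewrite mul1r.
  - apply: (I2_prod (f := fun x => `|g x|) (g := fun y => `|g y|)) => //; mauto.
have V1 : 0 < r ^+ n * V by rewrite mulr_gt0// exprn_gt0.
have h : I1 (fun x => (r ^+ n * V) * g x ^+ 2) (1 * (C * r `^ (n%:R + 2 * s) * a) + 2 * (A * A)).
  apply: I1_of_I2 kI => //; first by move=> x; rewrite mulr_ge0 ?sqr_ge0 ?ltW.
  move=> x; rewrite EFinM -(integral_ball x r0).
  rewrite muleC -ge0_integralZl_EFin ?sqr_ge0//; last by apply/measurable_EFinP; mauto.
  apply: ge0_mono_integral => y; first by rewrite -EFinM lee_fin mulr_ge0 ?sqr_ge0.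
  rewrite -EFinM lee_fin /k (enormB x y) mul1r.
  case: ltP => _ /=; rewrite ?mulr1 ?mulr0 ?mul1r ?mul0r ?add0r; last by nneg.
  rewrite -normrM; have := ler_norm (g x * g y); have := sqr_ge0 (g y).
  set u := g x; set v := g y; nra.
have -> : (C + 2) / V * (r `^ (2 * s) * a + r ^- n * A ^+ 2) =
  (r ^+ n * V)^-1 * ((C + 2) * r ^+ n * r `^ (2 * s) * a + (C + 2) * (A * A)).
  by field; rewrite !gt_eqF ?exprn_gt0.
apply: (@ile_le _ _ _ _ _ ((r ^+ n * V)^-1 * (1 * (C * r `^ (n%:R + 2 * s) * a) + 2 * (A * A)))).
  rewrite ler_pM2l ?invr_gt0// mul1r powRDp// powR_mulrn ?(ltW r0)//.
  have : 0 <= r ^+ n * r `^ (2 * s) * a by rewrite !mulr_ge0 ?exprn_ge0 ?powR_ge0 ?(ltW r0).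
  by move: C0; clear; nra.
apply: ile_mono_scale h => //; try mauto; try nneg.
by move=> x; rewrite mulrA mulVf ?mul1r// gt_eqF.
Qed.

(** At points y with g y = 0 the integrand of [poincare] is (g x)^2; integrating over this zero set,
    of measure at least m, divides the bound by m. *)
Lemma faber_krahn : exists C : R, 0 <= C /\ forall s c g t a m, 0 < s < 1 ->
  measurable_fun setT c -> mf1 g -> 0 < t -> 0 < m ->
  (forall x y, c x -> c y -> c (2^-1 *: (x + y))) ->
  (forall x y, c x -> c y -> enorm (x - y) < t) ->
  (m%:E <= \int[leb]_y (\1[c y && (g y == 0)] : R)%:E)%E ->
  energy_on c s g a ->
  I1 (fun x => \1[c x] * g x ^+ 2) (C * (m^-1 * t `^ (n%:R + 2 * s) * a)).
Proof.
have [C [C0 hC]] := poincare.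
exists C; split => // s c g t a m s01 mc mg t0 m0 cmid ct mz ga.
have kI := hC s c g t a n_gt0 s01 mc mg t0 cmid ga.
have h : I1 (fun x => m * (\1[c x] * g x ^+ 2)) (C * t `^ (n%:R + 2 * s) * a).
  apply: I1_of_I2 kI => //; try mauto; try nneg.
  move=> x; rewrite EFinM.
  apply: le_trans (_ : (\int[leb]_y (\1[c y && (g y == 0)] : R)%:E) * (\1[c x] * g x ^+ 2)%:E <= _)%E.
    by rewrite lee_wpmul2r// lee_fin; nneg.
  rewrite muleC -ge0_integralZl_EFin//; last 2 first.
  - by apply/measurable_EFinP; mauto.
  - by nneg.
  apply: ge0_mono_integral => y; first by rewrite -EFinM lee_fin; nneg.
  rewrite -EFinM lee_fin.
  case cx : (c x); last by rewrite !mul0r.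
  case cy : (c y); last by rewrite mulr0 mul0r.
  rewrite ct//=; have [->|_] := eqVneq (g y) 0; rewrite ?mulr1 ?mul1r ?subr0//=.
  by rewrite mulr0 sqr_ge0.
have -> : C * (m^-1 * t `^ (n%:R + 2 * s) * a) = m^-1 * (C * t `^ (n%:R + 2 * s) * a) by ring.
apply: ile_mono_scale h => //; try mauto; try nneg.
by move=> x; rewrite mulKf// gt_eqF.
Qed.

End poincare.

(** * Signed integrals and the generalized weak formulation *)

Section signed_integrals.
Context {R : realType} {d} {X : measurableType d}.
Variable mu : {measure set X -> \bar R}.
Implicit Types (f g p q : X -> R) (a b c : R).

(** Integrability is part of the notion because the extended integral of a function that is not
    integrable still has a value. *)
Definition hasint f a :=
  mu.-integrable setT (fun x => (f x)%:E) /\ (\int[mu]_x (f x)%:E = a%:E)%E.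

Lemma integrable_of_ile f g a : measurable_fun setT f ->
  (forall x, `|f x| <= g x) -> ile mu g a -> mu.-integrable setT (fun x => (f x)%:E).
Proof.
move=> mf fg ga; apply/integrableP; split; first exact/measurable_EFinP.
apply: (@le_lt_trans _ _ a%:E); last by rewrite ltry.
by apply: le_trans ga; apply: ge0_mono_integral => x; rewrite ?lee_fin.
Qed.

Lemma hasint_ex f : mu.-integrable setT (fun x => (f x)%:E) -> exists a, hasint f a.
Proof.
move=> fi; exists (fine (\int[mu]_x (f x)%:E)); split => //.
by rewrite fineK//; exact: integrable_fin_num.
Qed.

Lemma hasint_uniq f a b : hasint f a -> hasint f b -> a = b.
Proof. by move=> [_ h] [_]; rewrite h => -[]. Qed.

Lemma hasintD f g a b : hasint f a -> hasint g b -> hasint (fun x => f x + g x) (a + b).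
Proof.
move=> [fi fa] [gi gb]; split.
  by under eq_fun do rewrite EFinD; exact: integrableD.
by under eq_integral do rewrite EFinD; rewrite integralD// fa gb.
Qed.

Lemma hasintZ f a c : hasint f a -> hasint (fun x => c * f x) (c * a).
Proof.
move=> [fi fa]; split.
  by under eq_fun do rewrite EFinM; exact: integrableZl.
by under eq_integral do rewrite EFinM; rewrite integralZl// fa.
Qed.

Lemma hasintB f g a b : hasint f a -> hasint g b -> hasint (fun x => f x - g x) (a - b).
Proof.
move=> fa /(@hasintZ _ _ (-1)) gb; have := hasintD fa gb.
by rewrite mulN1r; under eq_fun do rewrite mulN1r.
Qed.

(** The bridge from an identity with a signed integrand to an estimate: testing the equation yields
    [a], and a pointwise inequality puts the error into [q]. *)
Lemma ile_hasint f a p q c : hasint f a -> measurable_fun setT q -> (forall x, 0 <= p x) ->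
  (forall x, 0 <= q x) -> (forall x, p x <= f x + q x) -> ile mu q c -> ile mu p (a + c).
Proof.
move=> [fi fa] mq p0 q0 pfq qc; rewrite /ile.
have qi : mu.-integrable setT (fun x => (q x)%:E).
  by apply: integrable_of_ile qc => // x; rewrite ger0_norm.
apply: (@le_trans _ _ (\int[mu]_x ((f x)%:E + (q x)%:E))%E).
  by apply: ge0_mono_integral => x; rewrite -?EFinD lee_fin.
by rewrite integralD// fa EFinD leeD2l.
Qed.

Lemma hasint_abs_le f a g b : hasint f a -> measurable_fun setT g ->
  (forall x, `|f x| <= g x) -> ile mu g b -> `|a| <= b.
Proof.
move=> fa mg fg gb.
have g0 x : 0 <= g x by exact: le_trans (fg x).
have hp : ile mu (fun=> 0) (a + b).
  apply: (ile_hasint fa mg) gb => // x.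
  by have := fg x; rewrite ler_norml => /andP[h _]; rewrite -lerBlDr sub0r.
have hn : ile mu (fun=> 0) (-1 * a + b).
  apply: (ile_hasint (hasintZ (-1) fa) mg) gb => // x.
  by have := fg x; rewrite ler_norml => /andP[_ h]; rewrite mulN1r addrC subr_ge0.
have := ile_ge0 (fun=> lexx 0) hp; have := ile_ge0 (fun=> lexx 0) hn.
by rewrite ler_norml mulN1r => h1 h2; apply/andP; split; qlra.
Qed.

End signed_integrals.

Section weak_inequalities.
Context {R : realType} {n : nat}.
Local Notation T := 'rV[R]_n.
Local Notation leb := (@lebesgue_rV R n).
Implicit Types (v w g psi eta zeta : T -> R) (F : T -> T -> R) (s r t a b k : R).

Definition hasint1 v a := hasint leb v a.
Definition hasint2 F a := hasint (leb \x leb)%E (fun z : T * T => F z.1 z.2) a.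

(** Truncations and reciprocals of solutions are not smooth; what they have after a cut-off is
    finite energy over the whole space, and this is what the equation is tested with. *)
Definition adm s (x0 : T) r psi :=
  [/\ mf1 psi, (forall x, r <= enorm (x - x0) -> psi x = 0),
      (exists a, I1 (fun x => psi x ^+ 2) a) & (exists a, energy s psi a)].

(** In other words F x y = A (v x - v y) with A between 1/Lambda and Lambda depending on the pair: a
    linear equation with merely bounded coefficients, a class that contains the differences of
    solutions of the nonlinear equation. *)
Definition flux Lambda v F :=
  [/\ mf2 F, (forall x y, Lambda^-1 * (v x - v y) ^+ 2 <= F x y * (v x - v y)) &
      (forall x y, `|F x y| <= Lambda * `|v x - v y|)].

(* [v] is a weak solution in the ball with right-hand side bounded by [g]. *)
Definition sol Lambda s (x0 : T) r v F g :=
  [/\ mf1 v, (exists a, energy s v a), flux Lambda v F &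
    forall psi, adm s x0 r psi -> forall b, I1 (fun x => g x * `|psi x|) b ->
    exists2 a, hasint2 (fun x y => F x y * (psi x - psi y) * J s x y) a & `|a| <= b].

Definition cut (x0 : T) a b x : R := Num.max 0 (Num.min 1 ((b - enorm (x - x0)) / (b - a))).

Lemma mf1_cut x0 a b : mf1 (cut x0 a b).
Proof. rewrite /cut; mauto. Qed.

Lemma cut_ge0 x0 a b x : 0 <= cut x0 a b x.
Proof. by rewrite /cut le_max lexx. Qed.

Lemma cut_le1 x0 a b x : cut x0 a b x <= 1.
Proof. by rewrite /cut ge_max ler01 ge_min lexx. Qed.

Lemma cut1 x0 a b x : a < b -> enorm (x - x0) <= a -> cut x0 a b x = 1.
Proof.
move=> ab xa; rewrite /cut min_l; first by rewrite max_r.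
by rewrite ler_pdivlMr ?subr_gt0// mul1r lerD2l lerN2.
Qed.

Lemma cut0 x0 a b x : a < b -> b <= enorm (x - x0) -> cut x0 a b x = 0.
Proof.
move=> ab xb; rewrite /cut max_l// ge_min; apply/orP; right.
by rewrite pmulr_lle0 ?invr_gt0 ?subr_gt0// subr_le0.
Qed.

Lemma max0_lip (p q : R) : `|Num.max 0 p - Num.max 0 q| <= `|p - q|.
Proof.
have h1 := ler_norm (p - q); have h2 := ler_norm (- (p - q)); rewrite normrN in h2.
rewrite ler_norml !maxEle.
by case: (leP 0 p) => ?; case: (leP 0 q) => ?; apply/andP; split; qlra.
Qed.

Lemma min1_lip (p q : R) : `|Num.min 1 p - Num.min 1 q| <= `|p - q|.
Proof.
have E (z : R) : Num.min 1 z = 1 - Num.max 0 (1 - z).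
  by rewrite maxEle minEle subr_ge0; case: (lerP z 1) => h; case: (lerP 1 z) => h'; qlra.
rewrite !E opprB addrC addrA subrK.
by apply: le_trans (max0_lip _ _) _; rewrite opprB addrC addrA subrK distrC.
Qed.

Lemma cut_lip x0 a b x y : a < b -> `|cut x0 a b x - cut x0 a b y| <= (b - a)^-1 * enorm (x - y).
Proof.
move=> ab; apply: le_trans (max0_lip _ _) _; apply: le_trans (min1_lip _ _) _.
rewrite -mulrBl normrM [`|(b - a)^-1|]ger0_norm ?invr_ge0 ?subr_ge0 ?(ltW ab)//.
rewrite mulrC ler_pM2l ?invr_gt0 ?subr_gt0// opprB addrC addrA subrK.
apply: le_trans (enorm_lip _ _) _.
by rewrite opprB addrA subrK enormB.
Qed.

(** Together with [ker_int] this makes squared increments of bounded Lipschitz functions integrable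
    against the kernel, uniformly in the base point. *)
Lemma sqr_le_mJ s0 (p L t : R) : 0 < s0 -> 0 <= t -> `|p| <= 1 -> `|p| <= L * t ->
  p ^+ 2 <= (1 + L ^+ 2) * mJ s0 t.
Proof.
move=> s00 t0 p1 pL; rewrite -(real_normK (num_real p)) /mJ.
have q0 : 0 <= `|p| by []; move: (`|p|) q0 p1 pL => q q0 q1 qL.
have [t1|t1] := ltP t 1; first by have := sqr_ge0 t; nra.
have : 1 <= t `^ s0 by rewrite -[leLHS](powRr0 t) ler_powR// ltW.
by have := sqr_ge0 L; nra.
Qed.

(** The interaction with a point y far from x is measured by the tail weight; A^(n+2) majorizes
    A^(n+2s) for every s < 1. *)
Lemma J_le_wt s (x y : T) A : 0 < s < 1 -> 1 <= A -> 1 + enorm y <= A * enorm (x - y) ->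
  J s x y <= A ^+ (n + 2) * wt s y.
Proof.
move=> /andP[s_0 s1] A1 h; rewrite /J /wt /Jr mulrCA ler_pM2l ?subr_gt0//.
set p := n%:R + 2 * s.
have p0 : 0 <= p by rewrite addr_ge0// mulr_ge0// ltW.
have y0 : 0 < 1 + enorm y by rewrite ltr_pwDl ?enorm_ge0.
have A0 : 0 < A by exact: lt_le_trans A1.
have xy0 : 0 < enorm (x - y) by rewrite -(pmulr_rgt0 _ A0); exact: lt_le_trans h.
have h2 : (1 + enorm y) `^ p <= A `^ p * enorm (x - y) `^ p.
  by rewrite -powRM ?enorm_ge0 ?(ltW A0)// ler_powR2// ltW.
have h3 : A `^ p <= A ^+ (n + 2).
  by rewrite -powR_mulrn ?(ltW A0)// ler_powR// natrD lerD2l; qlra.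
rewrite ler_pdivlMr ?powR_gt0// mulrC ler_pdivrMr ?powR_gt0//.
by apply: le_trans h2 _; rewrite ler_wpM2r ?powR_ge0.
Qed.

(** If only one of two points lies in the ball, [zeta] vanishes at the other, and the increment of
    the product is f times the increment of [zeta]. Hence the energy of f inside the ball controls
    an energy over the whole space. *)
Lemma adm_cut_on s0 s x0 r zeta f L : 0 < s0 < 1 -> s0 <= s < 1 ->
  mf1 zeta -> mf1 f -> (forall x, 0 <= zeta x <= 1) ->
  (forall x y, `|zeta x - zeta y| <= L * enorm (x - y)) ->
  (forall x, r <= enorm (x - x0) -> zeta x = 0) ->
  (exists a, energy_on (fun x => enorm (x - x0) < r) s f a) -> (exists a, I1 (fun x => \1[enorm (x - x0) < r] * f x ^+ 2) a) ->
  adm s x0 r (fun x => zeta x * f x).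
Proof.
move=> s01 ss mz mf z01 zL z0 [a fa] [b fb].
have [C [C0 hC]] := @ker_int R n s0 s01.
have [s00 _] := andP s01; have [_ s1] := andP ss.
split.
- mauto.
- by move=> x /z0 ->; rewrite mul0r.
- exists b; apply: ile_mono fb => x; first exact: sqr_ge0.
  have [xr|xr] := ltP (enorm (x - x0)) r; last by rewrite z0// mul0r expr0n mul0r.
  rewrite mul1r exprMn ler_piMl ?sqr_ge0// exprn_ile1//; by have /andP[] := z01 x.
pose chi x : R := \1[enorm (x - x0) < r].
have [K KE] : exists K : T -> T -> R, forall x y,
  K x y = chi x * f x ^+ 2 * (zeta x - zeta y) ^+ 2 * J s x y by eexists.
have K0 x y : 0 <= K x y by rewrite KE /chi; nneg.
have mK : mf2 K by apply: (eq_mf2 KE); rewrite /chi; mauto.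
have hK : I2 K (C * (1 + L ^+ 2) * b).
  apply: (@I2_fubini _ _ _ (fun x => C * (1 + L ^+ 2) * (chi x * f x ^+ 2))) => //.
  - move=> x; rewrite /I1 [_ * _ * _](_ : _ = chi x * f x ^+ 2 * (1 + L ^+ 2) * C); last by ring.
    apply: (ile_mono_scale (g := fun y : T => mJ s0 (enorm (x - y)) * J s x y)); last exact: (hC s x ss).
    + by rewrite /chi; nneg.
    + mauto.
    + by nneg.
    + by nneg.
    + move=> y; rewrite KE.
      apply: (@le_trans _ _ (chi x * f x ^+ 2 * ((1 + L ^+ 2) * mJ s0 (enorm (x - y)) * J s x y))); last first.
        by rewrite le_eqVlt; apply/orP; left; apply/eqP; ring.
      rewrite -[leLHS]mulrA ler_wpM2l//; first by rewrite /chi; nneg.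
      rewrite ler_wpM2r ?J_ge0//; apply: sqr_le_mJ => //; first exact: enorm_ge0.
      by have := z01 x; have := z01 y; rewrite ler_norml => /andP[? ?] /andP[? ?]; apply/andP; split; qlra.
  - apply: ile_scale fb => //; first by rewrite mulr_ge0// addr_ge0// sqr_ge0.
    + by rewrite /chi; mauto.
    + by rewrite /chi; nneg.
have hK' := I2_swap mK K0 hK.
exists (2 * (C * (1 + L ^+ 2) * b) + 2 * a + 2 * (C * (1 + L ^+ 2) * b)).
have [E EE] : exists E : T -> T -> R, forall x y,
  E x y = \1[(enorm (x - x0) < r) && (enorm (y - x0) < r)] * ((f x - f y) ^+ 2 * J s x y) by eexists.
have mE : mf2 E by apply: (eq_mf2 EE); mauto.
have E0 x y : 0 <= E x y by rewrite EE; nneg.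
have P z : 0 <= 2 * K z.1 z.2 + 2 * E z.1 z.2 by nneg.
rewrite -[X in X + _]mul1r.
apply: (ile_mono_lin2 (g := fun z : T * T => 2 * K z.1 z.2 + 2 * E z.1 z.2)
   (h := fun z => K z.2 z.1)) => //; try mauto; try nneg.
- move=> [x y]/=; rewrite mul1r !KE EE (J_sym s y x) /chi (enormB y x0) (enormB x x0).
  have JJ : 0 <= J s x y by exact: J_ge0.
  move: (J s x y) JJ => j JJ.
  suff h : (zeta x * f x - zeta y * f y) ^+ 2 <=
      2 * (\1[enorm (x0 - x) < r] * f x ^+ 2 * (zeta x - zeta y) ^+ 2) +
      2 * (\1[(enorm (x0 - x) < r) && (enorm (x0 - y) < r)] * (f x - f y) ^+ 2) + 2 * (\1[enorm (x0 - y) < r] * f y ^+ 2 * (zeta y - zeta x) ^+ 2).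
    by apply: le_trans (ler_wpM2r JJ h) _; rewrite le_eqVlt; apply/orP; left; apply/eqP; ring.
  have /andP[zx0 zx1] := z01 x; have /andP[zy0 zy1] := z01 y.
  have [xr|xr] := ltP (enorm (x0 - x)) r.
    have N0 : 0 <= 2 * (\1[enorm (x0 - y) < r] * f y ^+ 2 * (zeta y - zeta x) ^+ 2) by nneg.
    rewrite /= mul1r; have [yr|yr] := ltP (enorm (x0 - y)) r; last first.
      rewrite [zeta y]z0; last by rewrite enormB.
      by rewrite !mul0r !subr0 !mulr0 !addr0 exprMn; have := sqr_ge0 (zeta x * f x); rewrite exprMn; nra.
    rewrite /= mul1r; apply: le_trans (_ : _ <= 2 * (f x ^+ 2 * (zeta x - zeta y) ^+ 2) + 2 * (f x - f y) ^+ 2) _.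
      have := sqr_ge0 ((zeta x - zeta y) * f x - zeta y * (f x - f y)).
      have : zeta y ^+ 2 * (f x - f y) ^+ 2 <= 1 * (f x - f y) ^+ 2.
        by rewrite ler_wpM2r ?sqr_ge0// exprn_ile1.
      by clear; nra.
    by rewrite lerDl mul1r; nneg.
  have -> : zeta x = 0 by rewrite z0// enormB.
  have [yr|yr] := ltP (enorm (x0 - y)) r.
    by rewrite /= !mul1r !mul0r; have := sqr_ge0 (zeta y * f y); clear; nra.
  have -> : zeta y = 0 by rewrite z0// enormB.
  by rewrite !mul0r subrr expr0n/= !(mul0r, mulr0, add0r, addr0).
- apply: ile_add => //; try mauto; try nneg.
  + by apply: ile_scale.
  + apply: (@ile_scale _ _ _ _ (fun z : T * T => E z.1 z.2)) => //.
    by apply: ile_mono fa => z; rewrite EE//; nneg.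
Qed.

Lemma adm_cut s0 s x0 r zeta f L : 0 < s0 < 1 -> s0 <= s < 1 ->
  mf1 zeta -> mf1 f -> (forall x, 0 <= zeta x <= 1) ->
  (forall x y, `|zeta x - zeta y| <= L * enorm (x - y)) ->
  (forall x, r <= enorm (x - x0) -> zeta x = 0) ->
  (exists a, energy s f a) -> (exists a, I1 (fun x => \1[enorm (x - x0) < r] * f x ^+ 2) a) ->
  adm s x0 r (fun x => zeta x * f x).
Proof.
move=> s01 ss mz mf z01 zL z0 [a fa] fb; apply: (adm_cut_on s01 ss mz mf z01 zL z0) fb.
have [_ s1] := andP ss; exists a; apply: ile_mono fa => z; first by nneg.
by case: (_ && _); rewrite ?mul1r// mul0r; nneg.
Qed.

End weak_inequalities.
#[export] Hint Resolve mf1_cut : mdb.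

(** * Caccioppoli inequality and De Giorgi iterations *)

Section caccioppoli.
Context {R : realType} {n : nat}.
Local Notation T := 'rV[R]_n.
Local Notation leb := (@lebesgue_rV R n).
Implicit Types (v w g psi eta : T -> R) (F : T -> T -> R) (s r t a b k : R).
Variable Lambda : R.
Hypothesis Lambda1 : 1 <= Lambda.

Let Lambda0 : 0 < Lambda. Proof. exact: lt_le_trans Lambda1. Qed.

Let Li0 : 0 < Lambda^-1. Proof. by rewrite invr_gt0. Qed.
Let Li1 : Lambda^-1 <= 1. Proof. by rewrite invf_le1. Qed.

Lemma flux_coef (p f : R) : Lambda^-1 * p ^+ 2 <= f * p -> `|f| <= Lambda * `|p| ->
  exists A, [/\ Lambda^-1 <= A, A <= Lambda & f = A * p].
Proof.
move=> h1 h2; have [p0|p0] := eqVneq p 0.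
  exists 1; split => //; move: h2; rewrite p0 normr0 mulr0 normr_le0 => /eqP ->.
  by rewrite mulr0.
have pp : 0 < p ^+ 2 by rewrite exprn_even_gt0.
exists (f / p); split; last by rewrite divfK.
  by rewrite -(ler_pM2r pp); have -> : f / p * p ^+ 2 = f * p by field.
apply: le_trans (ler_norm _) _; rewrite normrM normfV.
by rewrite ler_pdivrMr// normr_gt0.
Qed.

(** If only p exceeds k, then p - q >= p - k and the flux has the good sign without any error. If
    both exceed k, complete the square. The error contains the product of the two truncations, so
    that a far point enters linearly and is controlled by the tail. *)
Lemma caccioppoli_pointwise (p q f k a b : R) : Lambda^-1 * (p - q) ^+ 2 <= f * (p - q) ->
  `|f| <= Lambda * `|p - q| ->
  Lambda^-1 * (a * Num.max 0 (p - k) - b * Num.max 0 (q - k)) ^+ 2 <=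
  f * (a ^+ 2 * Num.max 0 (p - k) - b ^+ 2 * Num.max 0 (q - k)) +
  Lambda * ((a - b) ^+ 2 * (Num.max 0 (p - k) * Num.max 0 (q - k))).
Proof.
move=> h1 h2; have [A [A1 A2 ->]] := flux_coef h1 h2.
have a2 := sqr_ge0 a; have b2 := sqr_ge0 b.
rewrite !maxEle !subr_ge0; case: (lerP k p) => kp; case: (lerP k q) => kq.
- set u := p - k; set w := q - k.
  have u0 : 0 <= u by rewrite subr_ge0.
  have w0 : 0 <= w by rewrite subr_ge0.
  have -> : p - q = u - w by rewrite /u /w; ring.
  have -> : A * (u - w) * (a ^+ 2 * u - b ^+ 2 * w) =
    A * (a * u - b * w) ^+ 2 - A * ((a - b) ^+ 2 * (u * w)) by ring.
  have := ler_wpM2r (sqr_ge0 (a * u - b * w)) A1.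
  have X0 : 0 <= (a - b) ^+ 2 * (u * w) by rewrite mulr_ge0 ?sqr_ge0// mulr_ge0.
  have := ler_wpM2r X0 A2.
  qlra.
- rewrite !mulr0 !subr0 addr0 exprMn.
  set u := p - k; have u0 : 0 <= u by rewrite subr_ge0.
  have h : Lambda^-1 * u <= A * (p - q).
    by apply: ler_pM => //; [exact: ltW|rewrite /u; qlra].
  have := ler_wpM2r (mulr_ge0 a2 u0) h; qlra.
- rewrite !(mulr0, sub0r, mul0r, addr0) mulrN sqrrN exprMn.
  set u := q - k; have u0 : 0 <= u by rewrite subr_ge0.
  have h : Lambda^-1 * u <= A * (q - p).
    by apply: ler_pM => //; [exact: ltW|rewrite /u; qlra].
  have := ler_wpM2r (mulr_ge0 b2 u0) h; qlra.
- by rewrite !mulr0 subrr expr0n/= !mulr0 addr0.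
Qed.

Lemma adm_mono s (x0 : T) r r' psi : r <= r' -> adm s x0 r psi -> adm s x0 r' psi.
Proof. by move=> rr [? h ? ?]; split => // x xr; apply: h; exact: le_trans xr. Qed.

Definition pos_part v k (x : T) : R := Num.max 0 (v x - k).

Lemma mf1_pos_part v k : mf1 v -> mf1 (pos_part v k).
Proof. by move=> mv; rewrite /pos_part; mauto. Qed.

Lemma pos_part_ge0 v k x : 0 <= pos_part v k x.
Proof. by rewrite /pos_part le_max lexx. Qed.

Lemma energy_lip s v w a : s < 1 -> (forall x y, `|w x - w y| <= `|v x - v y|) ->
  energy s v a -> energy s w a.
Proof.
move=> s1 h; apply: ile_mono => -[x y]/=; first by nneg.
rewrite ler_wpM2r ?J_ge0//.
by rewrite -(real_normK (num_real (w x - w y))) -(real_normK (num_real (v x - v y))) ler_pXn2r ?nnegrE.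
Qed.

(** The test function is eta^2 (v - k)_+. The local L2 bound only makes it admissible; its value
    does not enter the estimate. *)
Lemma caccioppoli_test s0 s (x0 : T) r v F g k eta L c1 c2 : 0 < s0 < 1 -> s0 <= s < 1 ->
  sol Lambda s x0 r v F g -> mf1 eta -> (forall x, 0 <= eta x <= 1) ->
  (forall x y, `|eta x - eta y| <= L * enorm (x - y)) ->
  (forall x, r <= enorm (x - x0) -> eta x = 0) ->
  (exists a, I1 (fun x => \1[enorm (x - x0) < r] * pos_part v k x ^+ 2) a) ->
  I2 (fun x y => (eta x - eta y) ^+ 2 * (pos_part v k x * pos_part v k y) * J s x y) c1 ->
  I1 (fun x => g x * (eta x ^+ 2 * pos_part v k x)) c2 ->
  adm s x0 r (fun x => eta x * pos_part v k x) /\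
  energy s (fun x => eta x * pos_part v k x) (Lambda * (c2 + Lambda * c1)).
Proof.
move=> s01 ss [mv [e ve] [mF F1 F2] vs] meta eta01 etaL eta0 wb hc1 hc2.
have [_ s1] := andP ss.
have mw := mf1_pos_part k mv.
have [w wE] : exists w, w = pos_part v k by eexists.
rewrite -wE in mw wb hc1 hc2 *.
have w0 x : 0 <= w x by rewrite wE pos_part_ge0.
have we : exists a, energy s w a.
  exists e; apply: energy_lip ve => // x y; rewrite wE /pos_part.
  by apply: le_trans (max0_lip _ _) _; rewrite opprB addrA subrK.
split; first exact: (adm_cut s01 ss meta mw eta01 etaL eta0).
have hadm : adm s x0 r (fun x => eta x ^+ 2 * w x).
  apply: (@adm_cut _ _ s0 s x0 r (fun x => eta x ^+ 2) w (2 * L)) => //; first by mauto.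
  - by move=> x; have /andP[e0 e1] := eta01 x; rewrite sqr_ge0 exprn_ile1.
  - move=> x y; have /andP[ex0 ex1] := eta01 x; have /andP[ey0 ey1] := eta01 y.
    rewrite subr_sqr normrM mulrC -mulrA; apply: ler_pM => //.
    by rewrite ger0_norm ?addr_ge0//; qlra.
  - by move=> x /eta0 ->; rewrite expr0n.
have [|a ha hab] := vs _ hadm c2.
  apply: I1_eq hc2 => x.
  by rewrite ger0_norm// mulr_ge0 ?sqr_ge0.
have hq : I2 (fun x y => Lambda * ((eta x - eta y) ^+ 2 * (w x * w y) * J s x y)) (Lambda * c1).
  apply: ile_scale hc1; [exact: ltW|mauto|by nneg].
have hp : I2 (fun x y => Lambda^-1 * ((eta x * w x - eta y * w y) ^+ 2 * J s x y)) (a + Lambda * c1).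
  apply: (ile_hasint ha) hq => //; [mauto|by nneg|by nneg|].
  move=> [x y]/=.
  have := @caccioppoli_pointwise _ _ _ k (eta x) (eta y) (F1 x y) (F2 x y).
  rewrite -/(pos_part v k x) -/(pos_part v k y) -wE => /(ler_wpM2r (J_ge0 x y s1)) h.
  rewrite [leLHS]mulrA; apply: le_trans h _; rewrite le_eqVlt; apply/orP; left; apply/eqP; ring.
apply: (ile_le (a := Lambda * (a + Lambda * c1))).
  by rewrite ler_pM2l// lerD2r; apply: le_trans hab; exact: ler_norm.
apply: ile_mono_scale hp; [exact: ltW|mauto|by nneg|by nneg|].
by move=> [x y]; rewrite mulVKf ?gt_eqF.
Qed.

Lemma caccioppoli s0 : 0 < s0 < 1 -> exists C : R, 0 <= C /\
  forall s v F g k a rho W1 W2 W G, s0 <= s < 1 -> sol Lambda s (0 : T) 1 v F g ->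
  0 <= a -> a < rho -> rho <= 1 -> mf1 g -> (forall x, 0 <= g x) ->
  I1 (fun x => \1[enorm x < rho] * pos_part v k x ^+ 2) W2 ->
  I1 (fun x => \1[enorm x < rho] * pos_part v k x) W1 ->
  I1 (fun x => pos_part v k x * wt s x) W ->
  I1 (fun x => \1[enorm x < rho] * (g x * pos_part v k x)) G ->
  adm s 0 rho (fun x => cut 0 a ((a + rho) / 2) x * pos_part v k x) /\
  energy s (fun x => cut 0 a ((a + rho) / 2) x * pos_part v k x)
    (C * (((rho - a) / 2) ^- (n + 2) * (W2 + W1 * W) + G)).
Proof.
move=> s01; have [CK [CK0 hCK]] := @ker_int R n s0 s01.
pose C0 : R := 2 * CK + 2 ^+ (n + 3).
have C00 : 0 <= C0 by rewrite addr_ge0 ?mulr_ge0 ?exprn_ge0.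
exists (Lambda * (Lambda * C0 + 1)); split.
  by rewrite mulr_ge0 ?addr_ge0 ?mulr_ge0 ?(ltW Lambda0).
move=> s v F g k a rho W1 W2 W G ss hs a0 ar r1 mg g0 hW2 hW1 hW hG.
have [mv _ _ _] := hs.
have [s00 _] := andP s01; have [s0s s1] := andP ss.
have sp : 0 < s by exact: lt_le_trans s0s.
pose b : R := (a + rho) / 2.
(* [de] is the width of the cut-off layer and also the distance from the support of the cut-off to
   the complement of the ball of radius [rho]. *)
have [de [deE]] : exists de : R, de = (rho - a) / 2 /\ True by eexists.
move=> _; rewrite -deE.
have de0 : 0 < de by rewrite deE; qlra.
have de1 : de <= 2^-1 by rewrite deE; qlra.
have bE : b = a + de by rewrite deE /b; qlra.
have rE : rho = b + de by rewrite deE /b; qlra.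
have ab : a < b by rewrite bE; qlra.
have [w wE] : exists w, w = pos_part v k by eexists.
have mw : mf1 w by rewrite wE; exact: mf1_pos_part.
have w0 x : 0 <= w x by rewrite wE pos_part_ge0.
rewrite -wE in hW2 hW1 hW hG *.
have [chi chiE] : exists chi : T -> R, forall x, chi x = \1[enorm x < rho] by eexists.
have mchi : mf1 chi by rewrite (_ : chi = fun x => \1[enorm x < rho]); [mauto|exact/funext].
have chi0 x : 0 <= chi x by rewrite chiE.
have [eta etaE] : exists eta, eta = cut (0 : T) a b by eexists.
have meta : mf1 eta by rewrite etaE; exact: mf1_cut.
have eta0 x : 0 <= eta x by rewrite etaE; exact: cut_ge0.
have eta1 x : eta x <= 1 by rewrite etaE; exact: cut_le1.
have etaL x y : `|eta x - eta y| <= de^-1 * enorm (x - y).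
  by rewrite etaE (_ : de = b - a); [exact: cut_lip|rewrite bE; qlra].
have etab x : b <= enorm x -> eta x = 0.
  by move=> h; rewrite etaE cut0// subr0.
have chi1 x : enorm x < rho -> chi x = 1 by rewrite chiE => ->.
have [A AE] : exists A : R, A = 2 / de by eexists.
have A1 : 1 <= A by rewrite AE ler_pdivlMr//; qlra.
have far x y : eta x != 0 -> rho <= enorm y -> J s x y <= A ^+ (n + 2) * wt s y.
  move=> ex yr; apply: J_le_wt => //; first by rewrite sp.
  have xb : enorm x < b by rewrite ltNge; apply: contra_neqN ex; exact: etab.
  have h1 : enorm y - b <= enorm (x - y) by rewrite enormB; have := enormBle y x; qlra.
  have -> : A * enorm (x - y) = 2 * (enorm (x - y) / de) by rewrite AE; field; rewrite gt_eqF.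
  rewrite -ler_pdivrMl// ler_pdivlMr//.
  apply: le_trans h1; have : 0 <= enorm y - rho by qlra.
  by move: (enorm y) de0 de1 rE r1 => t; nra.
have [k1 k1E] : exists k1 : T -> T -> R, forall x y,
  k1 x y = chi x * w x ^+ 2 * ((eta x - eta y) ^+ 2 * J s x y) by eexists.
have [k2 k2E] : exists k2 : T -> T -> R, forall x y,
  k2 x y = chi x * w x * (w y * wt s y) by eexists.
have k10 x y : 0 <= k1 x y by rewrite k1E; nneg.
have k20 x y : 0 <= k2 x y by rewrite k2E; nneg.
have mk1 : mf2 k1 by apply: (eq_mf2 k1E); mauto.
have mk2 : mf2 k2 by apply: (eq_mf2 k2E); mauto.
have hk1 : I2 k1 ((1 + de ^- 2) * CK * W2).
  apply: (@I2_fubini _ _ _ (fun x => (1 + de ^- 2) * CK * (chi x * w x ^+ 2))).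
  - by [].
  - by [].
  - move=> x; rewrite /I1 [_ * _ * _](_ : _ = chi x * w x ^+ 2 * (1 + de ^- 2) * CK); last by ring.
    apply: (ile_mono_scale (g := fun y : T => mJ s0 (enorm (x - y)) * J s x y)); last exact: (hCK s x ss).
    + by nneg.
    + mauto.
    + by nneg.
    + by [].
    + move=> y; rewrite k1E -[leRHS]mulrA; apply: ler_wpM2l; first by nneg.
      rewrite mulrA; apply: ler_wpM2r; first exact: J_ge0.
      rewrite -exprVn; apply: sqr_le_mJ => //; first exact: enorm_ge0.
      by have := eta0 x; have := eta0 y; have := eta1 x; have := eta1 y; rewrite ler_norml => *; apply/andP; split; qlra.
  - apply: ile_scale; [by nneg|by mauto|by nneg|].
    by apply: I1_eq hW2 => x; rewrite chiE.
have hk2 : I2 k2 (W1 * W).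
  apply: (I2_eq k2E).
  apply: (I2_prod (f := fun x => chi x * w x) (g := fun y => w y * wt s y)) => //; try mauto; try nneg.
  by apply: I1_eq hW1 => x; rewrite chiE.
(* Pairs inside the ball of radius [rho] go to [k1] by w x w y <= (w x ^ 2 + w y ^ 2) / 2; pairs
   with one point outside go to [k2], the product of local mass and tail. *)
have pw x y : (eta x - eta y) ^+ 2 * (w x * w y) * J s x y <=
    2^-1 * (k1 x y + k1 y x) + A ^+ (n + 2) * (k2 x y + k2 y x).
  have A0 : 0 <= A ^+ (n + 2) by rewrite exprn_ge0// (le_trans ler01).
  have JJ : 0 <= J s x y by exact: J_ge0.
  have [xr|xr] := ltP (enorm x) rho; have [yr|yr] := ltP (enorm y) rho.
  - apply: le_trans (_ : _ <= 2^-1 * (k1 x y + k1 y x)) _; last by rewrite lerDl mulr_ge0// addr_ge0.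
    rewrite !k1E (J_sym s y x) !chi1// !mul1r -[(eta y - eta x) ^+ 2]sqrrN opprB.
    have : 0 <= (eta x - eta y) ^+ 2 * J s x y by nneg.
    rewrite mulrAC; move: ((eta x - eta y) ^+ 2 * J s x y) (w x) (w y) => j p q j0.
    by have := mulr_ge0 j0 (sqr_ge0 (p - q)); clear; nra.
  - apply: le_trans (_ : _ <= A ^+ (n + 2) * k2 x y) _.
      rewrite (etab y); last by rewrite rE in yr; qlra.
      have [->|ex] := eqVneq (eta x) 0; first by rewrite subr0 expr0n !mul0r mulr_ge0.
      rewrite k2E chi1// mul1r subr0.
      apply: (@le_trans _ _ (1 * (w x * w y) * (A ^+ (n + 2) * wt s y))).
        apply: ler_pM; [by nneg|exact: J_ge0| |exact: far].
        by rewrite ler_wpM2r ?mulr_ge0// exprn_ile1.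
      by rewrite mul1r le_eqVlt; apply/orP; left; apply/eqP; ring.
    rewrite [X in _ <= _ + X]mulrDr -[leLHS]add0r; apply: lerD; first by rewrite mulr_ge0// addr_ge0.
    by rewrite lerDl mulr_ge0.
  - apply: le_trans (_ : _ <= A ^+ (n + 2) * k2 y x) _.
      rewrite (etab x); last by rewrite rE in xr; qlra.
      have [->|ey] := eqVneq (eta y) 0; first by rewrite subr0 expr0n !mul0r mulr_ge0.
      rewrite k2E chi1// mul1r sub0r sqrrN J_sym.
      apply: (@le_trans _ _ (1 * (w x * w y) * (A ^+ (n + 2) * wt s x))).
        apply: ler_pM; [by nneg|exact: J_ge0| |exact: far].
        by rewrite ler_wpM2r ?mulr_ge0// exprn_ile1.
      by rewrite mul1r le_eqVlt; apply/orP; left; apply/eqP; ring.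
    rewrite [X in _ <= _ + X]mulrDr -[leLHS]add0r; apply: lerD; first by rewrite mulr_ge0// addr_ge0.
    by rewrite lerDr mulr_ge0.
  - rewrite (etab x); last by rewrite rE in xr; qlra.
    rewrite (etab y); last by rewrite rE in yr; qlra.
    by rewrite subrr expr0n !mul0r addr_ge0// mulr_ge0// addr_ge0.
have W20 : 0 <= W2 by apply: ile_ge0 hW2 => x; nneg.
have W1W : 0 <= W1 * W by apply: ile_ge0 hk2 => -[x y]; exact: k20.
have c1 : I2 (fun x y => (eta x - eta y) ^+ 2 * (w x * w y) * J s x y)
    (C0 * (de ^- (n + 2) * (W2 + W1 * W))).
  apply: (ile_le (a := 2^-1 * ((1 + de ^- 2) * CK * W2 + (1 + de ^- 2) * CK * W2) +
     A ^+ (n + 2) * (W1 * W + W1 * W))).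
    rewrite AE expr_div_n.
    have -> : 2 ^+ (n + 2) / de ^+ (n + 2) * (W1 * W + W1 * W) = 2 ^+ (n + 3) * de ^- (n + 2) * (W1 * W).
      by rewrite !addnS !exprS; ring.
    have D1 : de ^- 2 <= de ^- (n + 2).
      by rewrite lef_pV2 ?posrE ?exprn_gt0// ler_wiXn2l ?leq_addl//; [exact: ltW|qlra].
    have D2 : 1 <= de ^- 2 by rewrite invf_ge1 ?exprn_gt0// exprn_ile1//; [exact: ltW|qlra].
    rewrite /C0; move: (de ^- 2) (de ^- (n + 2)) D1 D2 => p q pq p1.
    have e0 : 0 <= 2 ^+ (n + 3) :> R by rewrite exprn_ge0.
    move: (2 ^+ (n + 3)) e0 => e e0.
    have h1 : 0 <= (2 * q - 1 - p) * (CK * W2) by rewrite mulr_ge0 ?mulr_ge0//; qlra.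
    have h2 : 0 <= 2 * CK * q * (W1 * W) by rewrite mulr_ge0// mulr_ge0 ?mulr_ge0//; qlra.
    have h3 : 0 <= e * q * W2 by rewrite mulr_ge0// mulr_ge0//; qlra.
    by move: h1 h2 h3; clear; nra.
  apply: (ile_mono_lin2 (g := fun z : T * T => k1 z.1 z.2 + k1 z.2 z.1)
     (h := fun z => k2 z.1 z.2 + k2 z.2 z.1)).
  - by [].
  - by rewrite exprn_ge0// (le_trans ler01).
  - mauto.
  - mauto.
  - by move=> z; rewrite addr_ge0.
  - by move=> z; rewrite addr_ge0.
  - by nneg.
  - by move=> z; exact: pw.
  - apply: (ile_add (f := fun z : T * T => k1 z.1 z.2) (g := fun z => k1 z.2 z.1)) => //; try mauto.
    exact: I2_swap.
  - apply: (ile_add (f := fun z : T * T => k2 z.1 z.2) (g := fun z => k2 z.2 z.1)) => //; try mauto.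
    exact: I2_swap.
have hs' : sol Lambda s (0 : T) rho v F g.
  have [h1 h2 h3 h4] := hs; split => // psi /(adm_mono r1); exact: h4.
have [] := @caccioppoli_test s0 s 0 rho v F g k eta de^-1
   (C0 * (de ^- (n + 2) * (W2 + W1 * W))) G s01 ss hs' meta.
- by move=> x; rewrite eta0 eta1.
- exact: etaL.
- by move=> x; rewrite subr0 => h; apply: etab; rewrite rE in h; qlra.
- by exists W2; rewrite -wE; under eq_fun do rewrite subr0.
- by rewrite -wE.
- apply: ile_mono hG => x; first by rewrite mulr_ge0// mulr_ge0 ?sqr_ge0 -?wE.
  rewrite -wE; have [xr|xr] := ltP (enorm x) rho.
    by rewrite /= mul1r ler_wpM2l// ler_piMl// exprn_ile1.
  by rewrite etab ?expr0n ?mul0r ?mulr0//; rewrite rE in xr; qlra.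
rewrite -wE etaE => ad en; split => //; apply: ile_le en.
have G0 : 0 <= G by apply: ile_ge0 hG => x; nneg.
have : 0 <= de ^- (n + 2) * (W2 + W1 * W) by rewrite mulr_ge0 ?addr_ge0// invr_ge0 exprn_ge0// ltW.
move: (de ^- (n + 2) * _) => X X0.
have h1 : 0 <= Lambda * (Lambda * C0) * G by rewrite !mulr_ge0// ltW.
have h2 : 0 <= Lambda * X by rewrite mulr_ge0// ltW.
by move: h1 h2; clear; qlra.
Qed.

End caccioppoli.

Section de_giorgi.
Context {R : realType} {n : nat}.
Local Notation T := 'rV[R]_n.
Local Notation leb := (@lebesgue_rV R n).
Implicit Types (v w g psi eta : T -> R) (F : T -> T -> R) (s r t a b k : R).
Variable Lambda s0 : R.
Hypothesis Lambda1 : 1 <= Lambda.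
Hypothesis s01 : 0 < s0 < 1.
Hypothesis n_gt0 : (1 <= n)%N.

Let s0_gt0 : 0 < s0. Proof. by case/andP: s01. Qed.

Lemma exprn_small (q e : R) : 0 <= q < 1 -> 0 < e -> exists N : nat, q ^+ N < e.
Proof.
move=> /andP[q0 q1] e0.
have /cvgrPdist_lt/(_ e e0) : (q : R) ^+ k @[k --> \oo] --> (0 : R).
  by apply: cvg_expr; rewrite ger0_norm.
by case=> k _ /(_ k (leqnn k)); rewrite /= sub0r normrN ger0_norm ?exprn_ge0// => h; exists k.
Qed.

Lemma I1_0_ae (f : T -> R) : mf1 f -> (forall x, 0 <= f x) -> I1 f 0 -> {ae leb, forall x, f x = 0}.
Proof.
move=> mf f0 h.
have h0 : (\int[leb]_x `|(f x)%:E| = 0)%E.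
  apply/eqP; rewrite eq_le integral_ge0// andbT; apply: le_trans h.
  rewrite le_eqVlt; apply/orP; left; apply/eqP.
  by apply: eq_integral => x _; rewrite gee0_abs ?lee_fin.
have mf' : measurable_fun setT (fun x => (f x)%:E) by exact/measurable_EFinP.
have [A [mA A0 sub]] := (ae_eq_integral_abs leb measurableT mf').1 h0.
exists A; split => // x /= nfx; apply: sub => /= fx; apply: nfx.
by have := fx I => -[].
Qed.

(** Caccioppoli followed by [nash] at a scale r left free: the energy is multiplied by r^(2 s0), at
    the price of r^-n times the squared L1 norm. Both iterations below let r shrink geometrically to
    beat the growth of the cut-off constants. The restriction r <= 1 allows 2 s to be replaced by 2
    s0. *)
Lemma local_step : exists C : R, 0 <= C /\
  forall s v F g k a rho W1 W2 W G r, s0 <= s < 1 -> sol Lambda s (0 : T) 1 v F g ->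
  0 <= a -> a < rho -> rho <= 1 -> mf1 g -> (forall x, 0 <= g x) ->
  I1 (fun x => \1[enorm x < rho] * pos_part v k x ^+ 2) W2 ->
  I1 (fun x => \1[enorm x < rho] * pos_part v k x) W1 ->
  I1 (fun x => pos_part v k x * wt s x) W ->
  I1 (fun x => \1[enorm x < rho] * (g x * pos_part v k x)) G ->
  0 < r -> r <= 1 ->
  I1 (fun x => \1[enorm x < a] * pos_part v k x ^+ 2)
   (C * (r `^ (2 * s0) * (((rho - a) / 2) ^- (n + 2) * (W2 + W1 * W) + G) + r ^- n * W1 ^+ 2)).
Proof.
have [C1 [C10 hC1]] := @caccioppoli R n Lambda Lambda1 s0 s01.
have [C2 [C20 hC2]] := @nash R n n_gt0.
exists (C2 * (C1 + 1)); split; first by rewrite mulr_ge0// addr_ge0.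
move=> s v F g k a rho W1 W2 W G r ss hs a0 ar r1 mg g0 hW2 hW1 hW hG rr0 rr1.
have [ad en] := hC1 _ _ _ _ _ _ _ _ _ _ _ ss hs a0 ar r1 mg g0 hW2 hW1 hW hG.
have [mv _ _ _] := hs; have mw := mf1_pos_part k mv.
have s_01 : 0 < s < 1 by case/andP: ss => h ->; rewrite (lt_le_trans s0_gt0).
have w0 := @pos_part_ge0 R n v k.
move: (pos_part v k) mw w0 hW2 hW1 hW hG ad en => w mw w0 hW2 hW1 hW hG ad en.
set b := (a + rho) / 2 in ad en.
have ab : a < b by rewrite /b; qlra.
have hA : I1 (fun x => `|cut 0 a b x * w x|) W1.
  apply: ile_mono hW1 => x //; rewrite ger0_norm ?mulr_ge0 ?cut_ge0//.
  have [xr|xr] := ltP (enorm x) rho; first by rewrite mul1r ler_piMl// cut_le1.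
  by rewrite cut0 ?mul0r// subr0; apply: le_trans xr; rewrite /b; qlra.
have mc : mf1 (fun x => cut 0 a b x * w x) by mauto.
have := hC2 s _ r _ _ s_01 mc rr0 en hA.
have {en hA} : 0 <= ((rho - a) / 2) ^- (n + 2) * (W2 + W1 * W) + G.
  have W20 : 0 <= W2 by apply: ile_ge0 hW2 => x; nneg.
  have W10 : 0 <= W1 by apply: ile_ge0 hW1 => x; nneg.
  have WW : 0 <= W by apply: ile_ge0 hW => x; case/andP: s_01 => _ ?; nneg.
  have GG : 0 <= G by apply: ile_ge0 hG => x; nneg.
  by rewrite addr_ge0// mulr_ge0 ?addr_ge0 ?mulr_ge0// invr_ge0 exprn_ge0// divr_ge0// subr_ge0 ltW.
move: (_ + G) => E E0 h.
apply: (ile_le (a := C2 * (r `^ (2 * s) * (C1 * E) + r ^- n * W1 ^+ 2))).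
  rewrite -mulrA ler_wpM2l//.
  have -> : (C1 + 1) * (r `^ (2 * s0) * E + r ^- n * W1 ^+ 2) =
     r `^ (2 * s0) * (C1 * E) + r ^- n * W1 ^+ 2 + (r `^ (2 * s0) * E + C1 * (r ^- n * W1 ^+ 2)) by ring.
  have rs : r `^ (2 * s) <= r `^ (2 * s0).
    apply: ger_powR; first by rewrite rr0.
    by case/andP: ss => h1 _; qlra.
  apply: (@le_trans _ _ (r `^ (2 * s0) * (C1 * E) + r ^- n * W1 ^+ 2)).
    by rewrite lerD2r ler_wpM2r// mulr_ge0.
  by rewrite lerDl; nneg.
apply: ile_mono h => x; first by nneg.
have [xa|xa] := ltP (enorm x) a; last by rewrite mul0r sqr_ge0.
by rewrite mul1r cut1 ?mul1r// subr0 ltW.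
Qed.

Lemma powR_root (q : R) : 0 <= q -> (q `^ (2 * s0)^-1) `^ (2 * s0) = q.
Proof. by move=> q0; rewrite -powRrM mulVf ?powRr1// gt_eqF// mulr_gt0. Qed.

Lemma powR_root_le1 (q : R) : 0 <= q -> q <= 1 -> q `^ (2 * s0)^-1 <= 1.
Proof.
move=> q0 q1; rewrite -[leRHS](congr1 (fun f => f (2 * s0)^-1) (powR1 R)).
by rewrite ler_powR2// invr_ge0 mulr_ge0// ltW.
Qed.

Lemma pos_part_le v k k' x : k <= k' -> pos_part v k' x <= pos_part v k x.
Proof.
move=> kk; rewrite /pos_part !maxEle.
by case: (leP 0 (v x - k)) => ?; case: (leP 0 (v x - k')) => ?; qlra.
Qed.

(** Chebyshev: where v > k' the truncation at k is at least k' - k, so the L1 norm at one level is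
    controlled by the L2 norm at the previous one. *)
Lemma pos_part_le_sqr v k k' x p : 0 < p -> p * (k' - k) = 1 ->
  pos_part v k' x <= p * pos_part v k x ^+ 2.
Proof.
move=> p0 pk; have kk : k <= k'.
  by rewrite -subr_ge0 -(ler_pM2l p0) mulr0 pk.
rewrite /pos_part [leLHS]maxEle; case: (leP 0 (v x - k')) => h; last by nneg.
rewrite max_r; last by qlra.
have -> : v x - k = (v x - k') + (k' - k) by ring.
move: (v x - k') (k' - k) pk h => u q pq u0.
have -> : p * (u + q) ^+ 2 = p * u ^+ 2 + 2 * u * (p * q) + (p * q) * q by ring.
have q0 : 0 <= q by rewrite -(ler_pM2l p0) mulr0 pq.
rewrite pq; have := mulr_ge0 (ltW p0) (sqr_ge0 u); qlra.
Qed.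

Lemma de_giorgi_arith (K p b e Y : R) : 0 <= K -> 1 <= p -> 1 <= b -> 0 <= e -> 0 <= Y ->
  e * b * (Y + 2 * p * Y * K) + (2 * K * (2 * p * Y) + K * Y) <=
  (e * (1 + 2 * K) + 5 * K) * (p * b) * Y.
Proof.
move=> K0 p1 b1 e0 Y0.
have p0 : 0 <= p by qlra.
have b0 : 0 <= b by qlra.
have z1 : 0 <= e * b * (p - 1) * Y by rewrite !mulr_ge0// subr_ge0.
have z2 : 0 <= K * p * (b - 1) * Y by rewrite !mulr_ge0// subr_ge0.
have z3 : 0 <= K * (p - 1) * Y by rewrite !mulr_ge0// subr_ge0.
by move: z1 z2 z3; qlra.
Qed.

(** Iteration over the levels 1 - 2^-j and the radii 1/2 + 2^-(j+1), with the claim that the squared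
    truncations have mass at most eps th^j. *)
Lemma de_giorgi_first K : 1 <= K -> exists eps : R, 0 < eps /\
  forall s v F g, s0 <= s < 1 -> sol Lambda s (0 : T) 1 v F g -> mf1 g -> (forall x, 0 <= g x) ->
  (forall x, enorm x < 1 -> g x <= K * (1 + `|v x|)) ->
  I1 (fun x => \1[enorm x < 1] * pos_part v 0 x ^+ 2) eps ->
  I1 (fun x => pos_part v 0 x * wt s x) K ->
  {ae leb, forall x, enorm x < 2^-1 -> v x <= 1}.
Proof.
move=> K1; have [C [C0 hC]] := local_step.
have K0 : 0 <= K by apply: le_trans K1.
pose B : R := 2 ^+ (n + 2).
have B0 : 0 < B by rewrite exprn_gt0.
pose C' : R := 8 ^+ (n + 2) * (1 + 2 * K) + 5 * K.
have C'0 : 0 <= C' by rewrite addr_ge0 ?mulr_ge0 ?exprn_ge0 ?addr_ge0 ?mulr_ge0.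
(* The Nash scale of step j is r0 tau^j. The factor tau^(2 s0) = 1 / (2 B) cancels the growth B^j of
   the cut-off constants and 2^j of the Chebyshev factor. *)
have [tau [tau0 tau1 tauE]] : exists t : R, [/\ 0 < t, t <= 1 & t `^ (2 * s0) = (2 * B)^-1].
  exists ((2 * B)^-1 `^ (2 * s0)^-1); split; last by rewrite powR_root// invr_ge0 mulr_ge0// ltW.
    by rewrite powR_gt0 ?invr_gt0 ?mulr_gt0.
  apply: powR_root_le1; first by rewrite invr_ge0 mulr_ge0 ?(ltW B0).
  by rewrite invf_le1 ?mulr_gt0// mulr_ege1//; [qlra|rewrite exprn_ege1//; qlra].
(* The quadratic term is of size 4^j tau^(-n j) Y^2 with Y = eps th^j. For th = tau^n / 4 one has
   4^j tau^(-n j) th^j = 1, so the dependence on j disappears. *)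
have [th [th0 thE]] : exists t : R, 0 < t /\ t = tau ^+ n / 4.
  by exists (tau ^+ n / 4); split => //; rewrite divr_gt0 ?exprn_gt0.
have th1 : th <= 4^-1 by rewrite thE ler_pdivrMr// mulVf// exprn_ile1// ltW.
(* [r0] brings the linear term below (th / 2) Y; after that, [eps] does the same for the quadratic
   term. *)
have [r0 [r00 r01 r0E]] : exists r : R, [/\ 0 < r, r <= 1 & C * C' * r `^ (2 * s0) <= th / 2].
  pose q := th / 2 / (C * C' + 1).
  have CC : 0 < C * C' + 1 by rewrite ltr_wpDl// mulr_ge0.
  have q0 : 0 < q by rewrite !divr_gt0.
  have q1 : q <= 1 by rewrite ler_pdivrMr// mul1r; apply: (@le_trans _ _ 1); [qlra|rewrite lerDr mulr_ge0].
  exists (q `^ (2 * s0)^-1); split; first by rewrite powR_gt0.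
    exact: powR_root_le1 (ltW q0) q1.
  rewrite powR_root ?(ltW q0)// /q mulrCA ger_pMr ?divr_gt0//.
  by rewrite ler_pdivrMr// mul1r lerDl.
pose eps : R := th * r0 ^+ n / (8 * (C + 1)).
have C10 : 0 < C + 1 by rewrite ltr_wpDl.
have eps0 : 0 < eps by rewrite /eps divr_gt0 ?mulr_gt0 ?exprn_gt0.
exists eps; split => // s v F g ss hs mg g0 gK hv hW.
have [mv _ _ _] := hs.
pose kk (j : nat) : R := 1 - 2^-1 ^+ j.
pose rh (j : nat) : R := 2^-1 + 2^-1 ^+ j.+1.
have h0 (j : nat) : 0 < (2^-1 : R) ^+ j by rewrite exprn_gt0.
have h1 (j : nat) : (2^-1 : R) ^+ j <= 1 by rewrite exprn_ile1 ?invr_ge0// invf_le1//; qlra.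
have hS (j : nat) : (2^-1 : R) ^+ j.+1 = 2^-1 ^+ j / 2 by rewrite exprSr.
have kS j : kk j <= kk j.+1 by rewrite /kk hS; have := h0 j; qlra.
have posS j x : pos_part v (kk j.+1) x <= pos_part v (kk j) x by exact: pos_part_le.
have pos1 j x : pos_part v (kk j.+1) x <= 2 ^+ j.+1 * pos_part v (kk j) x ^+ 2.
  apply: pos_part_le_sqr; first by rewrite exprn_gt0.
  have -> : kk j.+1 - kk j = 2^-1 ^+ j.+1 by rewrite /kk hS; field.
  by rewrite -exprMn mulfV// expr1n.
have main j : I1 (fun x => \1[enorm x < rh j] * pos_part v (kk j) x ^+ 2) (eps * th ^+ j).
  elim: j => [|j ih].
    rewrite expr0 mulr1; apply: I1_eq hv => x.
    by rewrite /rh /kk expr0 expr1 subrr (_ : 2^-1 + 2^-1 = 1)//; qlra.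
  have [Y YE] : exists Y, Y = eps * th ^+ j by eexists.
  have Y0 : 0 <= Y by rewrite YE mulr_ge0 ?exprn_ge0 ?(ltW eps0) ?(ltW th0).
  rewrite -YE in ih.
  have hW2 : I1 (fun x => \1[enorm x < rh j] * pos_part v (kk j.+1) x ^+ 2) Y.
    apply: ile_mono ih => x; first by nneg.
    by rewrite ler_wpM2l// ler_pXn2r// nnegrE pos_part_ge0.
  have mpj := mf1_pos_part (kk j) mv; have mpj1 := mf1_pos_part (kk j.+1) mv.
  have p0 i x : 0 <= pos_part v (kk i) x by exact: pos_part_ge0.
  have hW1 : I1 (fun x => \1[enorm x < rh j] * pos_part v (kk j.+1) x) (2 ^+ j.+1 * Y).
    apply: ile_mono_scale ih; [by rewrite exprn_ge0|mauto|by nneg|by move=> x; rewrite mulr_ge0|].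
    by move=> x; rewrite mulrCA ler_wpM2l.
  have hWw : I1 (fun x => pos_part v (kk j.+1) x * wt s x) K.
    have s1 : s < 1 by case/andP: ss.
    apply: ile_mono hW => x; first by rewrite mulr_ge0// wt_ge0.
    by rewrite ler_wpM2r ?wt_ge0// pos_part_le// subr_ge0.
  have hG : I1 (fun x => \1[enorm x < rh j] * (g x * pos_part v (kk j.+1) x))
      (2 * K * (2 ^+ j.+1 * Y) + K * Y).
    apply: (ile_mono_lin2 _ _ _ _ _ _ _ _ hW1 hW2); rewrite ?mulr_ge0//; try mauto.
    - by move=> x; rewrite mulr_ge0.
    - by move=> x; rewrite mulr_ge0 ?sqr_ge0.
    - by move=> x; rewrite mulr_ge0// mulr_ge0.
    - move=> x; have [xr|xr] := ltP (enorm x) (rh j); last by rewrite !mul0r !mulr0 addr0.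
      rewrite !mul1r.
      have x1 : enorm x < 1.
        by apply: lt_le_trans xr _; rewrite /rh hS; have := h1 j; qlra.
      have := gK x x1; rewrite /pos_part maxEle; case: (leP 0 (v x - kk j.+1)) => h gx; last first.
        by rewrite expr0n/= !mulr0 addr0.
      have v0 : 0 <= v x by move: h; rewrite /kk; have := h1 j.+1; qlra.
      rewrite ger0_norm// in gx.
      apply: le_trans (ler_wpM2r h gx) _.
      have : kk j.+1 <= 1 by rewrite /kk; have := h0 j.+1; qlra.
      set u := v x - kk j.+1 in h *; have -> : v x = u + kk j.+1 by rewrite /u; ring.
      move: (kk j.+1) => k k1.
      have : 0 <= K * u * (1 - k) by rewrite mulr_ge0 ?mulr_ge0// subr_ge0.
      by clear; qlra.
  have rhj : rh j.+1 < rh j by rewrite /rh hS; have := h0 j.+1; qlra.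
  have rhj0 : 0 <= rh j.+1 by rewrite /rh; have := h0 j.+2; qlra.
  have rhj1 : rh j <= 1 by rewrite /rh hS; have := h1 j; qlra.
  pose r := r0 * tau ^+ j.
  have rr0 : 0 < r by rewrite mulr_gt0// exprn_gt0.
  have rr1 : r <= 1 by rewrite mulr_ile1 ?(ltW r00) ?exprn_ge0 ?exprn_ile1 ?(ltW tau0).
  have := hC s v F g _ _ _ _ _ _ _ r ss hs rhj0 rhj rhj1 mg g0 hW2 hW1 hWw hG rr0 rr1.
  apply: ile_le.
  have -> : ((rh j - rh j.+1) / 2) ^- (n + 2) = 8 ^+ (n + 2) * B ^+ j.
    rewrite /rh !hS (_ : (_ - _) / 2 = 2^-1 ^+ j / 8); last by field.
    by rewrite -exprVn invf_div exprMn -[(2^-1 ^+ j)^-1]exprVn invrK exprAC.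
  have rE : r `^ (2 * s0) = r0 `^ (2 * s0) * (2 * B) ^- j.
    by rewrite powRM ?exprn_ge0 ?(ltW r00) ?(ltW tau0)// powR_exprn ?(ltW tau0)// tauE exprVn.
  have t1 : C * (r `^ (2 * s0) * (8 ^+ (n + 2) * B ^+ j * (Y + 2 ^+ j.+1 * Y * K) +
      (2 * K * (2 ^+ j.+1 * Y) + K * Y))) <= th / 2 * Y.
    have : 8 ^+ (n + 2) * B ^+ j * (Y + 2 ^+ j.+1 * Y * K) + (2 * K * (2 ^+ j.+1 * Y) + K * Y)
       <= C' * (2 * B) ^+ j * Y.
      have e2 : 1 <= (2 : R) ^+ j by rewrite exprn_ege1//; qlra.
      have eB : 1 <= B ^+ j by rewrite exprn_ege1// exprn_ege1//; qlra.
      have e8 : 0 <= (8 : R) ^+ (n + 2) by rewrite exprn_ge0.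
      rewrite exprMn exprS /C'.
      exact: de_giorgi_arith.
    have rp : 0 <= C * r `^ (2 * s0) by rewrite mulr_ge0 ?powR_ge0.
    move=> /(ler_wpM2l rp) hh; apply: le_trans (le_trans _ hh) _; first by rewrite mulrA.
    rewrite rE; have -> : C * (r0 `^ (2 * s0) * (2 * B) ^- j) * (C' * (2 * B) ^+ j * Y) =
       C * C' * r0 `^ (2 * s0) * Y.
      by field; rewrite gt_eqF// exprn_gt0// mulr_gt0.
    by rewrite ler_wpM2r.
  have t2 : C * (r ^- n * (2 ^+ j.+1 * Y) ^+ 2) <= th / 2 * Y.
    have -> : (2 ^+ j.+1 * Y) ^+ 2 = 4 * 4 ^+ j * Y * Y.
      rewrite exprMn -exprM mulnC exprM exprS (_ : 2 ^+ 2 = 4); last by rewrite expr2; qlra.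
      by ring.
    rewrite {1}YE; have -> : th ^+ j = (tau ^+ n) ^+ j / 4 ^+ j by rewrite thE expr_div_n.
    rewrite /r exprMn -[(tau ^+ j) ^+ n]exprM mulnC exprM.
    have -> : C * ((r0 ^+ n * (tau ^+ n) ^+ j)^-1 * (4 * 4 ^+ j * (eps * ((tau ^+ n) ^+ j / 4 ^+ j)) * Y)) =
       4 * C * r0 ^- n * eps * Y.
      by field; rewrite !gt_eqF ?exprn_gt0// exprn_gt0.
    rewrite ler_wpM2r// /eps.
    have -> : 4 * C * r0 ^- n * (th * r0 ^+ n / (8 * (C + 1))) = th / 2 * (C / (C + 1)).
      by field; rewrite !gt_eqF ?exprn_gt0.
    by rewrite ger_pMr ?divr_gt0// ler_pdivrMr// mul1r lerDl.
  have -> : eps * th ^+ j.+1 = th / 2 * Y + th / 2 * Y by rewrite YE exprSr; field.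
  by rewrite mulrDr; exact: lerD.
have fin : I1 (fun x => \1[enorm x < 2^-1] * pos_part v 1 x ^+ 2) 0.
  apply: ile_addgt0 => e e0; rewrite add0r.
  have [|j hj] := @exprn_small th (e / eps) _ (divr_gt0 e0 eps0).
    by rewrite (ltW th0)/=; qlra.
  apply: ile_le (_ : eps * th ^+ j <= e) _; first by rewrite mulrC -ler_pdivlMr// ltW.
  apply: ile_mono (main j) => x; first by nneg.
  apply: ler_pM; rewrite ?sqr_ge0//.
    by rewrite ler_nat; case: ltP => //= xr; rewrite (lt_trans xr)// /rh ltrDl.
  rewrite ler_pXn2r ?nnegrE ?pos_part_ge0// pos_part_le// /kk.
  by rewrite gerBl; exact: ltW.
have mp := mf1_pos_part 1 mv.
have := I1_0_ae (f := fun x => \1[enorm x < 2^-1] * pos_part v 1 x ^+ 2) _ _ fin.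
move=> h; have {}h := h ltac:(mauto) ltac:(nneg).
apply: filterS h => x hx xr; move: hx; rewrite xr mul1r => /eqP.
rewrite expf_eq0/= /pos_part => /eqP; rewrite maxEle; case: (leP 0 (v x - 1)) => h2; qlra.
Qed.

End de_giorgi.

Section L2_bound.
Context {R : realType} {n : nat}.
Local Notation T := 'rV[R]_n.
Local Notation leb := (@lebesgue_rV R n).
Implicit Types (v w g psi eta : T -> R) (F : T -> T -> R) (s r t a b k : R).
Variable Lambda s0 : R.
Hypothesis Lambda1 : 1 <= Lambda.
Hypothesis s01 : 0 < s0 < 1.
Hypothesis n_gt0 : (1 <= n)%N.

Let s0_gt0 : 0 < s0. Proof. by case/andP: s01. Qed.

Lemma L2_bound_arith (C E K b q D c y : R) : 0 <= C -> 0 <= K -> 1 <= b -> 0 <= y -> 0 <= E ->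
  0 < q -> C * (E + K) * q <= c -> c <= D ->
  C * (q / b * (E * b * (y + 1) + K * (1 + y))) <= c * y + D.
Proof.
move=> C0 K0 b1 y0 E0 q0 h cD.
have b0 : 0 < b by qlra.
have e1 : C * (q / b * (E * b * (y + 1) + K * (1 + y))) <= C * (E + K) * q * (1 + y).
  have -> : C * (E + K) * q * (1 + y) = C * (q / b * (E * b * (y + 1) + K * b * (1 + y))).
    by field; rewrite gt_eqF.
  rewrite ler_wpM2l// ler_pM2l ?divr_gt0// lerD2l ler_wpM2r; [by []|qlra|].
  by rewrite ler_peMr.
apply: le_trans e1 _; apply: le_trans (ler_wpM2r _ h) _; qlra.
Qed.

(** De Giorgi's lemma starts from a small L2 norm, while the data bound L1 norms. The L2 norm on the
    unit ball is finite but not controlled. On an increasing sequence of balls it is bounded by a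
    small multiple of itself on the next ball plus L1 data, and the uncontrolled part is iterated
    away. *)
Lemma L2_bound K : 1 <= K -> exists C : R, 0 <= C /\
  forall s v F g, s0 <= s < 1 -> sol Lambda s (0 : T) 1 v F g -> mf1 g -> (forall x, 0 <= g x) ->
  (forall x, enorm x < 1 -> g x <= K * (1 + `|v x|)) ->
  I1 (fun x => \1[enorm x < 1] * pos_part v 0 x) 1 ->
  I1 (fun x => pos_part v 0 x * wt s x) 1 ->
  (exists X, I1 (fun x => \1[enorm x < 1] * pos_part v 0 x ^+ 2) X) ->
  I1 (fun x => \1[enorm x < 2^-1] * pos_part v 0 x ^+ 2) C.
Proof.
move=> K1; have [C [C0 hC]] := @local_step R n Lambda s0 Lambda1 s01 n_gt0.
have K0 : 0 <= K by apply: le_trans K1.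
have [B BE] : exists B : R, B = 2 ^+ (n + 2) by eexists.
have B0 : 0 < B by rewrite BE exprn_gt0.
have B1 : 1 <= B by rewrite BE exprn_ege1//; qlra.
have [tau [tau0 tau1 tauE]] : exists t : R, [/\ 0 < t, t <= 1 & t `^ (2 * s0) = B^-1].
  exists (B^-1 `^ (2 * s0)^-1); split.
  - by rewrite powR_gt0 ?invr_gt0.
  - by apply: powR_root_le1 => //; [rewrite invr_ge0 ltW|rewrite invf_le1].
  - by rewrite powR_root// invr_ge0 ltW.
have [D DE] : exists D : R, D = tau ^- n by eexists.
have D0 : 0 < D by rewrite DE invr_gt0 exprn_gt0.
have D1 : 1 <= D by rewrite DE invf_ge1 ?exprn_gt0// exprn_ile1// ltW.
have [E8 E8E] : exists E : R, E = 8 ^+ (n + 2) by eexists.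
have E80 : 0 <= E8 by rewrite E8E exprn_ge0.
have [r0 [r00 r01 r0E]] : exists r : R, [/\ 0 < r, r <= 1 & C * (E8 + K) * r `^ (2 * s0) <= (2 * D)^-1].
  have [q qE] : exists q : R, q = (2 * D)^-1 / (C * (E8 + K) + 1) by eexists.
  have CE : 0 <= C * (E8 + K) by rewrite mulr_ge0// addr_ge0.
  have CC : 0 < C * (E8 + K) + 1 by rewrite ltr_wpDl.
  have q0 : 0 < q by rewrite qE divr_gt0// invr_gt0 mulr_gt0.
  have q1 : q <= 1.
    rewrite qE ler_pdivrMr// mul1r; apply: (@le_trans _ _ 1); last by rewrite lerDr.
    by rewrite invf_le1 ?mulr_gt0//; qlra.
  exists (q `^ (2 * s0)^-1); split; first by rewrite powR_gt0.
    by apply: powR_root_le1 q1 => //; exact: ltW.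
  rewrite powR_root ?(ltW q0)// qE mulrCA ger_pMr ?invr_gt0 ?mulr_gt0//.
  by rewrite ler_pdivrMr// mul1r lerDl.
have [C2 C2E] : exists C2 : R, C2 = 1 + C * r0 ^- n by eexists.
have C21 : 1 <= C2 by rewrite C2E lerDl mulr_ge0 ?invr_ge0 ?exprn_ge0 ?(ltW r00).
exists (2 * C2); split; first by qlra.
move=> s v F g ss hs mg g0 gK hW1 hW [X hX].
have [mv _ _ _] := hs; have mw := mf1_pos_part 0 mv.
have w0 := @pos_part_ge0 R n v 0.
have X0 : 0 <= X by apply: ile_ge0 hX => x; nneg.
have s1 : s < 1 by case/andP: ss.
have [rh rhE] : exists rh : nat -> R, forall j, rh j = 1 - 2^-1 ^+ j.+1 by eexists.
have h0 (j : nat) : 0 < (2^-1 : R) ^+ j by rewrite exprn_gt0.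
have h1 (j : nat) : (2^-1 : R) ^+ j <= 1 by rewrite exprn_ile1 ?invr_ge0// invf_le1//; qlra.
have hS (j : nat) : (2^-1 : R) ^+ j.+1 = 2^-1 ^+ j / 2 by rewrite exprSr.
have rh1 j : rh j <= 1 by rewrite rhE; have := h0 j.+1; qlra.
have mono j h : (forall x, 0 <= h x) -> forall c, I1 (fun x => \1[enorm x < 1] * h x) c -> I1 (fun x => \1[enorm x < rh j] * h x) c.
  move=> hh c; apply: ile_mono => x; first by rewrite mulr_ge0.
  by rewrite ler_wpM2r// ler_nat; case: ltP => //= xr; rewrite (lt_le_trans xr).
(* Each step multiplies the uncontrolled bound X by 1 / (2 D), while the controlled part may grow by
   D from one ball to the next: 2 C2 D^(j+1) / (2 D) + C2 D^j = 2 C2 D^j closes the induction. *)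
have main m : forall j, I1 (fun x => \1[enorm x < rh j] * pos_part v 0 x ^+ 2)
    (X / (2 * D) ^+ m + 2 * C2 * D ^+ j).
  elim: m => [|m ih] j.
    rewrite expr0 divr1; apply: (ile_le (a := X)); first by rewrite lerDl !mulr_ge0 ?exprn_ge0 ?(ltW D0)//; qlra.
    by apply: mono => // x; exact: sqr_ge0.
  have [y yE] : exists y, y = X / (2 * D) ^+ m + 2 * C2 * D ^+ j.+1 by eexists.
  have hW2 : I1 (fun x => \1[enorm x < rh j.+1] * pos_part v 0 x ^+ 2) y by rewrite yE.
  have y0 : 0 <= y by apply: ile_ge0 hW2 => x; nneg.
  have hW1' : I1 (fun x => \1[enorm x < rh j.+1] * pos_part v 0 x) 1 by exact: mono.
  have hG : I1 (fun x => \1[enorm x < rh j.+1] * (g x * pos_part v 0 x)) (K * 1 + K * y).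
    apply: (ile_mono_lin2 _ _ _ _ _ _ _ _ hW1' hW2) => //; try mauto; try nneg.
    move=> x; have [xr|xr] := ltP (enorm x) (rh j.+1); last by rewrite !mul0r !mulr0 addr0.
    rewrite !mul1r; have /gK gx : enorm x < 1 by exact: lt_le_trans xr _.
    move: gx; rewrite /pos_part subr0 maxEle; case: (leP 0 (v x)) => vx gx; last first.
      by rewrite expr0n/= !mulr0 addr0.
    rewrite ger0_norm// in gx.
    by apply: le_trans (ler_wpM2r vx gx) _; rewrite expr2; qlra.
  have rhj : rh j < rh j.+1 by rewrite !rhE (hS j.+1); have := h0 j.+1; qlra.
  have rhj0 : 0 <= rh j by rewrite rhE subr_ge0.
  have [r rE] : exists r, r = r0 * tau ^+ j by eexists.
  have rr0 : 0 < r by rewrite rE mulr_gt0// exprn_gt0.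
  have rr1 : r <= 1 by rewrite rE mulr_ile1 ?(ltW r00) ?exprn_ge0 ?exprn_ile1 ?(ltW tau0).
  have := hC s v F g _ _ _ _ _ _ _ r ss hs rhj0 rhj (rh1 _) mg g0 hW2 hW1' hW hG rr0 rr1.
  apply: ile_le.
  have -> : ((rh j.+1 - rh j) / 2) ^- (n + 2) = E8 * B ^+ j.
    rewrite !rhE !hS (_ : (_ - _) / 2 = 2^-1 ^+ j / 8); last by field.
    by rewrite -exprVn invf_div exprMn -[(2^-1 ^+ j)^-1]exprVn invrK exprAC BE E8E.
  have -> : r `^ (2 * s0) = r0 `^ (2 * s0) / B ^+ j.
    by rewrite rE powRM ?exprn_ge0 ?(ltW r00) ?(ltW tau0)// powR_exprn ?(ltW tau0)// tauE exprVn.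
  have -> : r ^- n = r0 ^- n * D ^+ j.
    by rewrite rE exprMn invfM DE exprVn exprAC.
  have Dj : 1 <= D ^+ j by rewrite exprn_ege1.
  have cD : (2 * D)^-1 <= D ^+ j.
    by apply: le_trans Dj; rewrite invf_le1 ?mulr_gt0//; qlra.
  have Bj : 1 <= B ^+ j by rewrite exprn_ege1.
  have q0 : 0 < r0 `^ (2 * s0) by rewrite powR_gt0.
  have := L2_bound_arith C0 K0 Bj y0 E80 q0 r0E cD.
  have -> : K * 1 + K * y = K * (1 + y) by ring.
  rewrite !mulr1 expr1n !mulr1 => h.
  rewrite mulrDr; apply: le_trans (lerD h (lexx _)) _.
  rewrite yE !exprS C2E le_eqVlt; apply/orP; left; apply/eqP.
  by field; rewrite !gt_eqF ?exprn_gt0 ?mulr_gt0.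
apply: ile_addgt0 => e e0.
have [m hm] : exists m : nat, (2 * D)^-1 ^+ m < e / (X + 1).
  apply: exprn_small; last by rewrite divr_gt0// ltr_wpDl.
  by rewrite invr_ge0 mulr_ge0 ?(ltW D0)//= invf_lt1 ?mulr_gt0//; qlra.
have := main m 0%N; rewrite (_ : rh 0%N = 2^-1); last by rewrite rhE expr1; qlra.
apply: ile_le.
rewrite expr0 mulr1 addrC lerD2l -exprVn.
apply: (@le_trans _ _ ((X + 1) * (2 * D)^-1 ^+ m)).
  by rewrite ler_wpM2r ?lerDl// exprn_ge0// invr_ge0 mulr_ge0// ltW.
by rewrite mulrC -ler_pdivlMr ?ltr_wpDl// ltW.
Qed.

End L2_bound.

(** * Scaling, logarithmic estimate and growth lemma *)

Section affine_invariance.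
Context {R : realType} {n : nat}.
Local Notation T := 'rV[R]_n.
Local Notation leb := (@lebesgue_rV R n).
Implicit Types (v w g psi eta : T -> R) (F k : T -> T -> R) (s r t a b : R).

Lemma ae_affine (x0 : T) r (Q : T -> Prop) : 0 < r ->
  {ae leb, forall x, Q (x0 + r *: x)} -> {ae leb, forall x, Q x}.
Proof.
move=> r0 [N [mN N0 sub]]; have ri : 0 < r^-1 by rewrite invr_gt0.
exists [set x | N (- (r^-1 *: x0) + r^-1 *: x)]; split.
- have m : measurable_fun setT (fun x : T => - (r^-1 *: x0) + r^-1 *: x) by mauto.
  by have := m measurableT N mN; rewrite setTI.
- apply: etrans (lebesgue_rV_affine _ ri mN) _.
  by rewrite N0 mule0.
- move=> x /= nQ; apply: sub => /=.
  by rewrite scalerDr scalerN !scalerA mulfV ?gt_eqF// !scale1r addrA subrr add0r.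
Qed.

Lemma integral2_affine (x0 : T) r k : 0 < r -> mf2 k -> (forall x y, 0 <= k x y) ->
  (\int[leb \x leb]_z (k (x0 + r *: z.1) (x0 + r *: z.2))%:E =
   (r ^- n * r ^- n)%:E * \int[leb \x leb]_z (k z.1 z.2)%:E)%E.
Proof.
move=> r0 mk k0.
have rn : (0 <= (r ^- n)%:E)%E by rewrite lee_fin invr_ge0 exprn_ge0// ltW.
have mF : measurable_fun setT (fun x => \int[leb]_y (k x y)%:E)%E.
  apply: (@measurable_fun_fubini_tonelli_F _ _ _ _ _ leb (fun z : T * T => (k z.1 z.2)%:E)).
    exact/measurable_EFinP.
  by move=> z; rewrite lee_fin.
have F0 x : (0 <= \int[leb]_y (k x y)%:E)%E by apply: integral_ge0 => y _; rewrite lee_fin.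
rewrite !fubini_tonelli1//; last 4 first.
- exact/measurable_EFinP.
- by move=> z; rewrite lee_fin.
- by apply/measurable_EFinP; mauto.
- by move=> z; rewrite lee_fin.
rewrite /fubini_F/=.
have eqF x : (\int[leb]_y (k (x0 + r *: x) (x0 + r *: y))%:E =
    (r ^- n)%:E * \int[leb]_y (k (x0 + r *: x) y)%:E)%E.
  apply: (@integral_affine _ _ _ _ (fun y => (k (x0 + r *: x) y)%:E)) => //.
    by apply/measurable_EFinP; mauto.
  by move=> y; rewrite lee_fin.
under eq_integral do rewrite eqF.
have mF' : measurable_fun setT (fun x : T => \int[leb]_y (k (x0 + r *: x) y)%:E)%E.
  by apply: (measurableT_comp (f := fun x => \int[leb]_y (k x y)%:E)%E) => //; mauto.
rewrite (ge0_integralZl _ _ mF' (fun x _ => F0 (x0 + r *: x)) rn); last exact: measurableT.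
rewrite (@integral_affine _ _ _ _ (fun x => \int[leb]_y (k x y)%:E)%E)//.
by rewrite muleA EFinM.
Qed.

(** The change of variables is available for nonnegative integrands, so positive and negative parts
    are transformed separately. *)
Lemma hasint2_affine (x0 : T) r k a : 0 < r -> mf2 k -> hasint2 k a ->
  hasint2 (fun x y => k (x0 + r *: x) (x0 + r *: y)) (r ^- n * r ^- n * a).
Proof.
move=> r0 mk [ki ka].
have rn : 0 <= r ^- n by rewrite invr_ge0 exprn_ge0// ltW.
pose kp x y := Num.max 0 (k x y); pose km x y := Num.max 0 (- k x y).
have p0 x y : 0 <= kp x y by rewrite le_max lexx.
have m0 x y : 0 <= km x y by rewrite le_max lexx.
have mp : mf2 kp by rewrite /kp; mauto.
have mm : mf2 km by rewrite /km; mauto.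
have abs : I2 (fun x y => `|k x y|) (fine (\int[leb \x leb]_z `|(k z.1 z.2)%:E|)%E).
  rewrite /I2 /ile fineK//.
  by apply: integrable_fin_num => //; exact: integrable_abse.
have kE x y : k x y = kp x y - km x y.
  rewrite /kp /km !maxEle; case: (leP 0 (k x y)) => h; case: (leP 0 (- k x y)) => h'; qlra.
have kpl x y : kp x y <= `|k x y| by rewrite /kp ge_max normr_ge0 ler_norm.
have kml x y : km x y <= `|k x y| by rewrite /km ge_max normr_ge0 -normrN ler_norm.
have [ap [_ _ apE]] := ile_value (fun z => p0 z.1 z.2) (ile_mono (fun z => p0 z.1 z.2) (fun z => kpl z.1 z.2) abs).
have [am [_ _ amE]] := ile_value (fun z => m0 z.1 z.2) (ile_mono (fun z => m0 z.1 z.2) (fun z => kml z.1 z.2) abs).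
have H (q : T -> T -> R) c : mf2 q -> (forall x y, 0 <= q x y) -> (\int[leb \x leb]_z (q z.1 z.2)%:E = c%:E)%E ->
    hasint2 q c.
  move=> mq q0 qc; split => //.
  by apply: (integrable_of_ile mq (g := fun z : T * T => q z.1 z.2) (a := c)); [move=> z; rewrite ger0_norm|rewrite /ile qc].
have aE : a = ap - am.
  apply: (@hasint_uniq _ _ _ (leb \x leb)%E (fun z : T * T => k z.1 z.2)); first by split.
  rewrite (_ : (fun z : T * T => k z.1 z.2) = (fun z => kp z.1 z.2 - km z.1 z.2)).
    by apply: hasintB; exact: H.
  by apply/funext => z; exact: kE.
rewrite aE mulrBr /hasint2.
have -> : (fun z : T * T => k (x0 + r *: z.1) (x0 + r *: z.2)) =
  (fun z => kp (x0 + r *: z.1) (x0 + r *: z.2) - km (x0 + r *: z.1) (x0 + r *: z.2)).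
  by apply/funext => z; exact: kE.
apply: hasintB.
  apply: (H (fun x y => kp (x0 + r *: x) (x0 + r *: y))) => //; first by mauto.
  by rewrite integral2_affine// apE.
apply: (H (fun x y => km (x0 + r *: x) (x0 + r *: y))) => //; first by mauto.
by rewrite integral2_affine// amE.
Qed.

Lemma J_affine s (x0 : T) r x y : 0 < r ->
  J s x y = r `^ (n%:R + 2 * s) * J s (x0 + r *: x) (x0 + r *: y).
Proof.
move=> r0; rewrite /J /Jr (_ : x0 + r *: x - (x0 + r *: y) = r *: (x - y)).
  rewrite enormZ ger0_norm ?(ltW r0)// powRM ?enorm_ge0 ?(ltW r0)// invfM.
  by rewrite mulrCA !mulrA mulfK// gt_eqF// powR_gt0.
by rewrite opprD addrACA subrr add0r scalerBr.
Qed.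

Lemma energy_affine s (x0 : T) r v e : s < 1 -> 0 < r -> mf1 v -> energy s v e ->
  energy s (fun x => v (x0 + r *: x)) (r `^ (n%:R + 2 * s) * (r ^- n * (r ^- n * e))).
Proof.
move=> s1 r0 mv ve.
have h := I2_affine (k := fun x y => (v x - v y) ^+ 2 * J s x y) x0 r0 _ _ ve.
have {}h := h ltac:(mauto) ltac:(nneg).
apply: ile_mono_scale h; [by nneg|mauto|by nneg|by nneg|].
move=> [x y]/=; rewrite (J_affine s x0 x y r0) le_eqVlt; apply/orP; left; apply/eqP; ring.
Qed.

Lemma energy_scale s v e lam m : s < 1 -> mf1 v -> energy s v e ->
  energy s (fun x => lam * (v x - m)) (lam ^+ 2 * e).
Proof.
move=> s1 mv; apply: ile_mono_scale; [by nneg|mauto|by nneg|by nneg|].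
by move=> [x y]/=; rewrite le_eqVlt; apply/orP; left; apply/eqP; ring.
Qed.

(** Estimates are proved on the unit ball and transported from there. The kernel contributes
    r^(n+2s) and the double integral r^(-2n), against r^-n for the right-hand side; the factor
    r^(2s) remains. *)
Lemma sol_affine Lambda s (x0 : T) r v F g lam m : 0 < s < 1 -> 0 < r -> lam != 0 ->
  mf1 g -> (forall x, 0 <= g x) ->
  sol Lambda s x0 r v F g ->
  sol Lambda s 0 1 (fun x => lam * (v (x0 + r *: x) - m))
    (fun x y => lam * F (x0 + r *: x) (x0 + r *: y))
    (fun x => `|lam| * r `^ (2 * s) * g (x0 + r *: x)).
Proof.
move=> /andP[s_0 s1] r0 lam0 mg g0 [mv [e ve] [mF F1 F2] vs].
have rp0 : 0 < r `^ (n%:R + 2 * s) by rewrite powR_gt0.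
have ri : 0 < r^-1 by rewrite invr_gt0.
split.
- mauto.
- exists (lam ^+ 2 * (r `^ (n%:R + 2 * s) * (r ^- n * (r ^- n * e)))).
  by apply: (energy_scale (v := fun x => v (x0 + r *: x))) => //; [mauto|exact: energy_affine].
- split.
  + mauto.
  + move=> x y; have := F1 (x0 + r *: x) (x0 + r *: y).
    move=> /(ler_wpM2l (sqr_ge0 lam)) h.
    have -> : lam * (v (x0 + r *: x) - m) - lam * (v (x0 + r *: y) - m) =
      lam * (v (x0 + r *: x) - v (x0 + r *: y)) by ring.
    move: h; set A := Lambda^-1; set d := v _ - v _; set f := F _ _ => h.
    have -> : A * (lam * d) ^+ 2 = lam ^+ 2 * (A * d ^+ 2) by ring.
    by have -> : lam * f * (lam * d) = lam ^+ 2 * (f * d) by ring.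
  + move=> x y.
    have -> : lam * (v (x0 + r *: x) - m) - lam * (v (x0 + r *: y) - m) =
      lam * (v (x0 + r *: x) - v (x0 + r *: y)) by ring.
    by rewrite !normrM mulrCA ler_wpM2l.
move=> psi [mpsi psi0 [a pa] [b pb]] c hc.
pose inv x : T := - (r^-1 *: x0) + r^-1 *: x.
pose phi x := psi (inv x).
have invK x : inv (x0 + r *: x) = x.
  by rewrite /inv scalerDr scalerA mulVf ?gt_eqF// scale1r addrA addNr add0r.
have invK' x : x0 + r *: inv x = x.
  by rewrite /inv scalerDr scalerN !scalerA mulfV ?gt_eqF// !scale1r addrA subrr add0r.
have mphi : mf1 phi by rewrite /phi /inv; mauto.
have aphi : adm s x0 r phi.
  split => //.
  - move=> x xr; rewrite /phi psi0// subr0.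
    have -> : inv x = r^-1 *: (x - x0) by rewrite /inv scalerBr addrC.
    by rewrite enormZ ger0_norm ?(ltW ri)// mulrC ler_pdivlMr// mul1r.
  - exists (r^-1 ^- n * a).
    by apply: (@I1_affine R n (- (r^-1 *: x0)) r^-1 (fun x => psi x ^+ 2)) => //; [mauto|nneg].
  - exists (r^-1 `^ (n%:R + 2 * s) * (r^-1 ^- n * (r^-1 ^- n * b))).
    exact: energy_affine.
have rs : 0 < `|lam| * r `^ (2 * s) by rewrite mulr_gt0 ?normr_gt0 ?powR_gt0.
pose h x := `|lam| * r `^ (2 * s) * g (x0 + r *: x) * `|psi x|.
have h0 x : 0 <= h x by rewrite /h !mulr_ge0 ?powR_ge0.
have mh : mf1 h by rewrite /h; mauto.
have hc1 := @I1_affine R n (- (r^-1 *: x0)) r^-1 h c ri mh h0 hc.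
have hc2 : I1 (fun x => g x * `|phi x|) ((`|lam| * r `^ (2 * s))^-1 * (r^-1 ^- n * c)).
  apply: ile_mono_scale hc1.
  - by rewrite invr_ge0 ltW.
  - mauto.
  - by move=> x; exact: h0.
  - by move=> x; rewrite mulr_ge0.
  - by move=> x; rewrite /h -/(inv x) invK' -[X in _ <= _ * X]mulrA mulKf ?gt_eqF.
have [a1 ha hab] := vs phi aphi _ hc2.
exists (lam * r `^ (n%:R + 2 * s) * (r ^- n * r ^- n * a1)).
  have := hasint2_affine x0 r0 _ ha => /(_ ltac:(mauto)) /(hasintZ (lam * r `^ (n%:R + 2 * s))).
  rewrite /hasint2; congr (hasint _ _ _); apply/funext => z /=.
  by rewrite /phi !invK (J_affine s x0 z.1 z.2 r0); ring.
rewrite !normrM (ger0_norm (powR_ge0 _ _)) ![`|r ^- n|]ger0_norm ?invr_ge0 ?exprn_ge0 ?(ltW r0)//.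
have l0 : 0 < `|lam| by rewrite normr_gt0.
apply: (@le_trans _ _ (`|lam| * r `^ (n%:R + 2 * s) * (r ^- n * r ^- n * ((`|lam| * r `^ (2 * s))^-1 * (r^-1 ^- n * c))))).
  by rewrite ler_wpM2l ?mulr_ge0 ?powR_ge0// ler_wpM2l// mulr_ge0 ?invr_ge0 ?exprn_ge0// ltW.
rewrite powRDp// powR_mulrn ?(ltW r0)// exprVn invrK le_eqVlt; apply/orP; left; apply/eqP.
by field; rewrite !gt_eqF ?powR_gt0 ?exprn_gt0.
Qed.

End affine_invariance.

Section growth_lemma.
Context {R : realType} {n : nat}.
Local Notation T := 'rV[R]_n.
Local Notation leb := (@lebesgue_rV R n).
Implicit Types (v w g psi eta : T -> R) (F : T -> T -> R) (s r t a b k : R).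
Variable Lambda s0 : R.
Hypothesis Lambda1 : 1 <= Lambda.
Hypothesis s01 : 0 < s0 < 1.
Hypothesis n_gt0 : (1 <= n)%N.

Let s0_gt0 : 0 < s0. Proof. by case/andP: s01. Qed.
Let Lambda0 : 0 < Lambda. Proof. exact: lt_le_trans Lambda1. Qed.
Let V : R := @unit_volume R n.
Let V0 : 0 < V. Proof. exact: unit_volume_gt0. Qed.

Lemma wt_anti s (x y : T) : 0 < s < 1 -> enorm x <= enorm y -> wt s y <= wt s x.
Proof.
move=> /andP[s_0 s1] xy; rewrite /wt /Jr ler_pM2l ?subr_gt0//.
rewrite lef_pV2 ?posrE ?powR_gt0 ?ltr_pwDl ?enorm_ge0// ler_powR2 ?lerD2l ?addr_ge0 ?enorm_ge0//.
by rewrite mulr_ge0// ltW.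
Qed.

(** The weight is at most 1 in the unit ball, and outside it is below the kernel with pole at the
    origin. *)
Lemma wt_int : exists C : R, 0 <= C /\ forall s, s0 <= s < 1 -> I1 (@wt R n s) C.
Proof.
have [C [C0 hC]] := @ker_int R n s0 s01.
exists (1 * (1 ^+ n * V) + 1 * C); split.
  by rewrite addr_ge0// ?mulr_ge0 ?(ltW V0).
move=> s ss; have [s0s s1] := andP ss.
apply: (ile_mono_lin2 _ _ _ _ _ _ _ _ (I1_ball (0 : T) ltr01) (hC s 0 ss)) => //.
- mauto.
- mauto.
- by nneg.
- by nneg.
- move=> y; rewrite !mul1r subr0 sub0r enormN.
  have s_0 : 0 < s by exact: lt_le_trans s0s.
  have p0 : 0 <= n%:R + 2 * s by rewrite addr_ge0// mulr_ge0// ltW.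
  have [y1|y1] := ltP (enorm y) 1.
    apply: (@le_trans _ _ 1); last by rewrite lerDl mulr_ge0 ?mJ_ge0 ?J_ge0.
    rewrite /wt /Jr mulr_ile1 ?invr_ge0 ?powR_ge0 ?subr_ge0 ?(ltW s1)//.
      by rewrite gerBl ltW.
    rewrite invf_le1 ?powR_gt0 ?ltr_pwDl ?enorm_ge0//.
    by rewrite -[leLHS](congr1 (fun f => f (n%:R + 2 * s)) (powR1 R)) ler_powR2// lerDl enorm_ge0.
  rewrite /= add0r; apply: (@le_trans _ _ (J s 0 y)).
    rewrite /wt /J sub0r enormN /Jr ler_pM2l ?subr_gt0//.
    rewrite lef_pV2 ?posrE ?powR_gt0// ?(lt_le_trans ltr01 y1)// ?ltr_pwDl ?enorm_ge0//.
    by rewrite ler_powR2 ?enorm_ge0// lerDr.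
  rewrite ler_peMl ?J_ge0// /mJ ltNge y1/=.
  by rewrite -[leLHS](powRr0 (enorm y)) ler_powR// ltW.
Qed.

(** For p = a^2 and q = b^2 with a >= b, the left-hand side is 4 (ln a - ln b)^2, at most 4 (a / b -
    1)^2 by ln t <= t - 1. *)
Lemma sqr_ln_le (p q : R) : 0 < p -> 0 < q ->
  (ln p - ln q) ^+ 2 <= 4 * ((p - q) ^+ 2 / (p * q)).
Proof.
wlog pq : p q / q <= p.
  move=> h p0 q0; have [/h|/ltW/h] := leP q p; first exact.
  move=> /(_ q0 p0); rewrite -sqrrN opprB -[(q - p) ^+ 2]sqrrN opprB.
  by rewrite [q * p]mulrC.
move=> p0 q0.
have [a [a0 pE]] : exists a, 0 < a /\ p = a ^+ 2.
  by exists (Num.sqrt p); rewrite sqrtr_gt0 sqr_sqrtr ?(ltW p0).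
have [b [b0 qE]] : exists b, 0 < b /\ q = b ^+ 2.
  by exists (Num.sqrt q); rewrite sqrtr_gt0 sqr_sqrtr ?(ltW q0).
move: p0 q0 pq; rewrite {p}pE {q}qE => _ _ ab2.
have ab : b <= a by move: ab2; rewrite ler_pXn2r// nnegrE ltW.
have l1 : ln a - ln b <= a / b - 1.
  rewrite -ln_div ?posrE//; have -> : a / b = 1 + (a / b - 1) by ring.
  by rewrite [leRHS]addrAC subrr add0r le_ln1Dx// ltrBrDl addrN divr_gt0.
have l0 : 0 <= ln a - ln b by rewrite subr_ge0 ler_ln ?posrE.
rewrite !lnXn//.
have -> : (ln a *+ 2 - ln b *+ 2) ^+ 2 = 4 * (ln a - ln b) ^+ 2 by ring.
rewrite ler_pM2l//.
apply: (@le_trans _ _ ((a / b - 1) ^+ 2)); first by rewrite ler_pXn2r// nnegrE// (le_trans l0).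
have -> : (a ^+ 2 - b ^+ 2) ^+ 2 / (a ^+ 2 * b ^+ 2) = (a / b - 1) ^+ 2 * (1 + b / a) ^+ 2.
  by field; rewrite !gt_eqF.
by rewrite ler_peMr ?sqr_ge0// exprn_ege1// lerDl divr_ge0// ltW.
Qed.

(** The inequality behind testing with eta^2 / (v_+ + d). For two nonnegative values it is a
    completed square. If one value is negative, the cut-off vanishes there, and the flux divided by
    v_+ + d is at most Lambda (1 + v_- / d), which gives the tail term. *)
Lemma log_pointwise (vx vy f a b d : R) : 0 < d ->
  Lambda^-1 * (vx - vy) ^+ 2 <= f * (vx - vy) -> `|f| <= Lambda * `|vx - vy| ->
  (vx < 0 -> a = 0) -> (vy < 0 -> b = 0) ->
  let p := Num.max 0 vx + d in let q := Num.max 0 vy + d in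
  Lambda^-1 * ((a * q - b * p) ^+ 2 / (p * q)) * \1[(0 <= vx) && (0 <= vy)] <=
  - (f * (a ^+ 2 * p^-1 - b ^+ 2 * q^-1)) +
  (Lambda * (a - b) ^+ 2 + Lambda / d * (a ^+ 2 * Num.max 0 (- vy) + b ^+ 2 * Num.max 0 (- vx))).
Proof.
move=> d0 h1 h2 ax bY; have [A [A1 A2 ->]] := flux_coef Lambda1 h1 h2.
have A0 : 0 < A by apply: lt_le_trans A1; rewrite invr_gt0.
have Ld : 0 <= Lambda / d by rewrite divr_ge0// ltW.
move=> /=; have [vx0|vx0] := leP 0 vx; have [vy0|vy0] := leP 0 vy => /=.
- have -> : Num.max 0 (- vx) = 0 by rewrite max_l// oppr_le0.
  have -> : Num.max 0 (- vy) = 0 by rewrite max_l// oppr_le0.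
  rewrite !mulr0 addr0 mulr0 addr0 mulr1.
  have p0 : 0 < vx + d by rewrite ltr_wpDl.
  have q0 : 0 < vy + d by rewrite ltr_wpDl.
  have -> : vx - vy = (vx + d) - (vy + d) by ring.
  move: (vx + d) (vy + d) p0 q0 => p q p0 q0.
  have -> : - (A * (p - q) * (a ^+ 2 * p^-1 - b ^+ 2 * q^-1)) =
     A * ((a * q - b * p) ^+ 2 / (p * q)) - A * (a - b) ^+ 2.
    by field; rewrite !gt_eqF.
  have X0 : 0 <= (a * q - b * p) ^+ 2 / (p * q) by rewrite divr_ge0 ?sqr_ge0 ?mulr_ge0 ?(ltW p0) ?(ltW q0).
  have := ler_wpM2r X0 A1; have := ler_wpM2r (sqr_ge0 (a - b)) A2; qlra.
- rewrite (bY vy0) mulr0 !expr0n/= !mul0r !subr0 addr0.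
  have -> : Num.max 0 (- vy) = - vy by rewrite max_r// oppr_ge0 ltW.
  have p0 : 0 < vx + d by rewrite ltr_wpDl.
  have -> : - (A * (vx - vy) * (a ^+ 2 * (vx + d)^-1)) + (Lambda * a ^+ 2 + Lambda / d * (a ^+ 2 * - vy)) =
    a ^+ 2 * (Lambda * (1 + - vy / d) - A * ((vx - vy) / (vx + d))).
    by field; rewrite !gt_eqF.
  rewrite mulr_ge0 ?sqr_ge0// subr_ge0.
  apply: ler_pM => //; [exact: ltW|by rewrite divr_ge0 ?(ltW p0)//; qlra|].
  have -> : (vx - vy) / (vx + d) = vx / (vx + d) + - vy / (vx + d) by rewrite -mulrDl.
  apply: lerD; first by rewrite ler_pdivrMr// mul1r lerDl ltW.
  by rewrite ler_wpM2l ?oppr_ge0 ?(ltW vy0)// lef_pV2 ?posrE// lerDr.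
- rewrite (ax vx0) !mulr0 !expr0n/= !mul0r sub0r add0r sqrrN.
  have -> : Num.max 0 (- vx) = - vx by rewrite max_r// oppr_ge0 ltW.
  have p0 : 0 < vy + d by rewrite ltr_wpDl.
  rewrite add0r.
  have -> : - (A * (vx - vy) * - (b ^+ 2 * (vy + d)^-1)) + (Lambda * b ^+ 2 + Lambda / d * (b ^+ 2 * - vx)) =
    b ^+ 2 * (Lambda * (1 + - vx / d) - A * ((vy - vx) / (vy + d))).
    by field; rewrite !gt_eqF.
  rewrite mulr_ge0 ?sqr_ge0// subr_ge0.
  apply: ler_pM => //; [exact: ltW|by rewrite divr_ge0 ?(ltW p0)//; qlra|].
  have -> : (vy - vx) / (vy + d) = vy / (vy + d) + - vx / (vy + d) by rewrite -mulrDl.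
  apply: lerD; first by rewrite ler_pdivrMr// mul1r lerDl ltW.
  by rewrite ler_wpM2l ?oppr_ge0 ?(ltW vx0)// lef_pV2 ?posrE// lerDr.
- rewrite (ax vx0) (bY vy0) [leLHS]mulr0 !add0r expr0n/= !(mul0r, mulr0, subrr, oppr0, addr0).
  by rewrite add0r expr0n/= mulr0; exact: lexx.
Qed.

(** The shift d dominates both the right-hand side and the negative tail. The two errors appear
    divided by d, so the bound on the logarithmic energy does not depend on d. *)
Lemma log_estimate : exists C : R, 0 <= C /\ forall s v F g d, s0 <= s < 1 ->
  sol Lambda s (0 : T) 1 v F g -> 0 < d -> mf1 g -> (forall x, 0 <= g x) ->
  (forall x, enorm x < 1 -> g x <= d) -> (forall x, enorm x < 1 -> 0 <= v x) ->
  I1 (fun x => Num.max 0 (- v x) * wt s x) d ->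
  energy_on (fun x => enorm x < 2^-1) s (fun x => ln (Num.max 0 (v x) + d)) C.
Proof.
have [CK [CK0 hCK]] := @ker_int R n s0 s01.
pose C1 : R := 2 * ((1 + 16) * CK * V).
pose C2 : R := 2 * (8 ^+ (n + 2) * V).
exists (4 * Lambda * (V + Lambda * C1 + Lambda * C2)); split.
  by rewrite !mulr_ge0 ?addr_ge0 ?mulr_ge0 ?exprn_ge0 ?(ltW Lambda0) ?(ltW V0).
move=> s v F g d ss hs d0 mg g0 gd v0 hv.
have [s0s s1] := andP ss; have s_0 : 0 < s by exact: lt_le_trans s0s.
have [mv [e ve] [mF F1 F2] vs] := hs.
have [eta etaE] : exists eta, eta = cut (0 : T) 2^-1 (3 / 4) by eexists.
have e34 : (2^-1 : R) < 3 / 4 by qlra.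
have meta : mf1 eta by rewrite etaE; exact: mf1_cut.
have eta0 x : 0 <= eta x by rewrite etaE; exact: cut_ge0.
have eta1 x : eta x <= 1 by rewrite etaE; exact: cut_le1.
have etaL x y : `|eta x - eta y| <= 4 * enorm (x - y).
  have := @cut_lip R n 0 2^-1 (3 / 4) x y e34; rewrite -etaE.
  by rewrite (_ : (3 / 4 - 2^-1)^-1 = 4 :> R)//; field.
have eta_0 x : 3 / 4 <= enorm x -> eta x = 0 by move=> h; rewrite etaE cut0// subr0.
have eta_1 x : enorm x < 2^-1 -> eta x = 1 by move=> h; rewrite etaE cut1// subr0 ltW.
have [chi chiE] : exists chi : T -> R, forall x, chi x = \1[enorm (x - 0) < 1] by eexists.
have mchi : mf1 chi by rewrite (_ : chi = fun x => \1[enorm (x - 0) < 1]); [mauto|exact/funext].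
have chi0 x : 0 <= chi x by rewrite chiE.
have hchi : I1 chi V.
  by have := I1_ball (0 : T) ltr01; rewrite expr1n mul1r; apply: I1_eq => x; rewrite chiE.
have etachi x : eta x <= chi x.
  by rewrite chiE subr0; case: ltP => //= h; rewrite eta_0//; qlra.
have eta2chi x : eta x ^+ 2 <= chi x.
  by apply: le_trans (etachi x); rewrite expr2 ler_piMl.
have [q qE] : exists q : T -> R, forall x, q x = Num.max 0 (v x) + d by eexists.
have mq : mf1 q by rewrite (_ : q = fun x => Num.max 0 (v x) + d); [mauto|exact/funext].
have qd x : d <= q x by rewrite qE lerDr le_max lexx.
have q0 x : 0 < q x by exact: lt_le_trans (qd x).
have qi x : (q x)^-1 <= d^-1 by rewrite lef_pV2 ?posrE.
have qlip x y : `|q x - q y| <= `|v x - v y|.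
  by rewrite !qE opprD addrACA subrr addr0; exact: max0_lip.
have hadm : adm s (0 : T) 1 (fun x => eta x ^+ 2 * (q x)^-1).
  apply: (@adm_cut R n s0 s 0 1 (fun x => eta x ^+ 2) (fun x => (q x)^-1) 8) => //.
  - mauto.
  - mauto.
  - by move=> x; rewrite sqr_ge0 exprn_ile1.
  - move=> x y; rewrite subr_sqr normrM mulrC.
    have -> : 8 * enorm (x - y) = 2 * (4 * enorm (x - y)) by ring.
    apply: ler_pM => //; rewrite ger0_norm ?addr_ge0//.
    by have := eta1 x; have := eta1 y; qlra.
  - by move=> x; rewrite subr0 => x1; rewrite eta_0 ?expr0n//; qlra.
  (* d^2 / q is a 1-Lipschitz function of v because q >= d. *)
  - have mf : mf1 (fun x => d ^+ 2 / q x) by mauto.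
    have ef : energy s (fun x => d ^+ 2 / q x) e.
      apply: energy_lip ve => // x y; apply: le_trans (qlip x y).
      have -> : d ^+ 2 / q x - d ^+ 2 / q y = (d / q x) * (d / q y) * (q y - q x).
        by field; rewrite !gt_eqF.
      rewrite normrM distrC ler_piMl// ger0_norm; last by rewrite !mulr_ge0 ?invr_ge0 ?(ltW d0) ?(ltW (q0 _)).
      by rewrite mulr_ile1 ?divr_ge0 ?(ltW d0) ?(ltW (q0 _))// ler_pdivrMr// mul1r.
    exists (d ^- 2 ^+ 2 * e); have := @energy_scale _ _ s _ e (d ^- 2) 0 s1 mf ef.
    by apply: I2_eq => x y; rewrite !subr0 !mulKf// gt_eqF// exprn_gt0.
  - exists (d ^- 2 * V); apply: ile_mono_scale hchi => //; try nneg.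
    move=> x; rewrite -chiE mulrC ler_wpM2r// -exprVn ler_pXn2r ?nnegrE ?invr_ge0 ?(ltW d0) ?(ltW (q0 _))//.
have [|a ha hab] := vs _ hadm V.
  apply: ile_mono hchi => x; first by rewrite mulr_ge0.
  rewrite ger0_norm ?mulr_ge0 ?sqr_ge0 ?invr_ge0 ?(ltW (q0 _))//.
  have [x1|x1] := ltP (enorm x) 1; last by rewrite eta_0 ?expr0n ?mul0r ?mulr0//; qlra.
  rewrite mulrCA; apply: le_trans (eta2chi x); rewrite ler_piMr ?sqr_ge0//.
  apply: (@le_trans _ _ (d * d^-1)); last by rewrite mulfV// gt_eqF.
  by apply: ler_pM; rewrite ?invr_ge0 ?(ltW (q0 _))//; exact: gd.
have [nv nvE] : exists nv : T -> R, forall x, nv x = Num.max 0 (- v x) by eexists.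
have mnv : mf1 nv by rewrite (_ : nv = fun x => Num.max 0 (- v x)); [mauto|exact/funext].
have nv0 x : 0 <= nv x by rewrite nvE le_max lexx.
have v1 x : v x < 0 -> 1 <= enorm x.
  by move=> h; rewrite leNgt; apply/negP => /v0; rewrite leNgt h.
have [k1 k1E] : exists k1 : T -> T -> R, forall x y, k1 x y = chi x * ((eta x - eta y) ^+ 2 * J s x y) by eexists.
have [k2 k2E] : exists k2 : T -> T -> R, forall x y, k2 x y = eta x ^+ 2 * nv y * J s x y by eexists.
have mk1 : mf2 k1 by apply: (eq_mf2 k1E); mauto.
have mk2 : mf2 k2 by apply: (eq_mf2 k2E); mauto.
have k10 x y : 0 <= k1 x y by rewrite k1E; nneg.
have k20 x y : 0 <= k2 x y by rewrite k2E; nneg.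
have hk1 : I2 k1 ((1 + 16) * CK * V).
  apply: (@I2_fubini _ _ _ (fun x => (1 + 16) * CK * chi x)) => //.
  - move=> x; rewrite /I1 [_ * _ * _](_ : _ = chi x * (1 + 16) * CK); last by ring.
    apply: (ile_mono_scale (g := fun y : T => mJ s0 (enorm (x - y)) * J s x y)); last exact: (hCK s x ss).
    + by nneg.
    + mauto.
    + by nneg.
    + by [].
    + move=> y; rewrite k1E -[leRHS]mulrA; apply: ler_wpM2l; first by nneg.
      rewrite mulrA; apply: ler_wpM2r; first exact: J_ge0.
      rewrite (_ : 16 = 4 ^+ 2); last by rewrite expr2; qlra.
      apply: sqr_le_mJ => //; first exact: enorm_ge0.
      by have := eta0 x; have := eta0 y; have := eta1 x; have := eta1 y; rewrite ler_norml => *; apply/andP; split; qlra.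
  - by apply: ile_scale => //; nneg.
have hk2 : I2 k2 (8 ^+ (n + 2) * (V * d)).
  apply: (ile_mono_scale (g := fun z : T * T => chi z.1 * (nv z.2 * wt s z.2))).
  - by [].
  - mauto.
  - by nneg.
  - by [].
  - move=> [x y]/=; rewrite k2E.
    have R0 : 0 <= 8 ^+ (n + 2) * (chi x * (nv y * wt s y)) by nneg.
    have [ex|ex] := eqVneq (eta x) 0; first by rewrite ex expr0n/= !mul0r.
    have [ny|ny] := eqVneq (nv y) 0; first by rewrite ny !(mulr0, mul0r).
    have xb : enorm x < 3 / 4 by rewrite ltNge; apply: contra_neqN ex; exact: eta_0.
    have y1 : 1 <= enorm y.
      apply: v1; rewrite ltNge; apply: contra_neqN ny => vy.
      by rewrite nvE max_l// oppr_le0.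
    have -> : 8 ^+ (n + 2) * (chi x * (nv y * wt s y)) = chi x * nv y * (8 ^+ (n + 2) * wt s y) by ring.
    apply: ler_pM; [by nneg|exact: J_ge0|by rewrite ler_wpM2r|].
    apply: J_le_wt; [by rewrite s_0|by qlra|].
    by have := enormBle y x; rewrite (enormB y x); qlra.
  - apply: (I2_prod (f := chi) (g := fun y => nv y * wt s y)) => //; try mauto; try nneg.
    by apply: I1_eq hv => x; rewrite nvE.
have [Q QE] : exists Q : T -> T -> R, forall x y,
  Q x y = Lambda * (k1 x y + k1 y x) + Lambda / d * (k2 x y + k2 y x) by eexists.
have mQ : mf2 Q by apply: (eq_mf2 QE); mauto.
have Ld : 0 <= Lambda / d by rewrite divr_ge0// ltW.
have Q0 x y : 0 <= Q x y by rewrite QE; apply: addr_ge0; apply: mulr_ge0; rewrite ?(ltW Lambda0)//; apply: addr_ge0.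
have hQ : I2 Q (Lambda * C1 + Lambda * C2).
  have -> : Lambda * C2 = Lambda / d * (8 ^+ (n + 2) * (V * d) + 8 ^+ (n + 2) * (V * d)).
    by rewrite /C2; field; rewrite gt_eqF.
  rewrite /C1 (_ : 2 * ((1 + 16) * CK * V) = (1 + 16) * CK * V + (1 + 16) * CK * V); last by ring.
  apply: (ile_mono_lin2 (g := fun z : T * T => k1 z.1 z.2 + k1 z.2 z.1)
     (h := fun z => k2 z.1 z.2 + k2 z.2 z.1)) => //; try mauto.
  - exact: ltW.
  - by move=> z; rewrite addr_ge0.
  - by move=> z; rewrite addr_ge0.
  - by move=> z; rewrite QE.
  - apply: (ile_add (f := fun z : T * T => k1 z.1 z.2) (g := fun z => k1 z.2 z.1)) => //; try mauto.
    exact: I2_swap.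
  - apply: (ile_add (f := fun z : T * T => k2 z.1 z.2) (g := fun z => k2 z.2 z.1)) => //; try mauto.
    exact: I2_swap.
have mb : measurable_fun setT (fun x : T => enorm x < 2^-1) by mauto.
have hp : I2 (fun x y => (4 * Lambda)^-1 * (\1[(enorm x < 2^-1) && (enorm y < 2^-1)] *
    ((ln (q x) - ln (q y)) ^+ 2 * J s x y))) (-1 * a + (Lambda * C1 + Lambda * C2)).
  apply: (ile_hasint (hasintZ (-1) ha) mQ) hQ => //.
    by move=> z; nneg.
  move=> [x y]/=.
  have JJ : 0 <= J s x y by exact: J_ge0.
  have := log_pointwise (a := eta x) (b := eta y) d0 (F1 x y) (F2 x y).
  rewrite -!qE -!nvE => h.
  have {}h := h (fun vx => eta_0 _ (le_trans _ (v1 _ vx))) (fun vy => eta_0 _ (le_trans _ (v1 _ vy))).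
  have {}h := h ltac:(qlra) ltac:(qlra).
  have {h} := ler_wpM2r JJ h; rewrite mulrDl => h.
  have [X XE] : exists X, X = (eta x - eta y) ^+ 2 * J s x y by eexists.
  have X0 : 0 <= X by rewrite XE; nneg.
  have e1 : X <= chi x * X + chi y * X.
    rewrite !chiE !subr0; have [x1|x1] := ltP (enorm x) 1; first by rewrite mul1r lerDl mulr_ge0.
    have [y1|y1] := ltP (enorm y) 1; first by rewrite mul1r mul0r add0r.
    by rewrite XE !eta_0 ?subrr ?expr0n ?mul0r ?mulr0 ?addr0//; qlra.
  apply: le_trans (le_trans _ h) _; last first.
    rewrite QE !k1E !k2E (J_sym s y x) mulN1r mulNr lerD2l.
    have -> : (eta y - eta x) ^+ 2 = (eta x - eta y) ^+ 2 by ring.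
    rewrite -XE [leLHS]mulrDl; apply: lerD.
      by rewrite -mulrA -XE ler_wpM2l// ltW.
    by rewrite -[leLHS]mulrA mulrDl.
  case: (boolP (_ && _)) => [/andP[x1 y1]|_]; last first.
    by have := ltW (q0 x); have := ltW (q0 y) => ? ?; rewrite mul0r mulr0; nneg.
  rewrite !eta_1// !v0 ?(lt_trans x1) ?(lt_trans y1) ?invf_lt1 ?ltr1n//= !mul1r mulr1 mulrA.
  apply: ler_wpM2r => //; rewrite invfM -mulrA mulrCA.
  apply: ler_wpM2l; first by rewrite invr_ge0 ltW.
  rewrite ler_pdivrMl//; apply: le_trans (sqr_ln_le (q0 x) (q0 y)) _.
  by rewrite -[(q x - q y) ^+ 2]sqrrN opprB.
have L4 : 0 < 4 * Lambda by rewrite mulr_gt0.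
have [p pE] : exists p : T -> T -> R, forall x y, p x y = \1[(enorm x < 2^-1) && (enorm y < 2^-1)] *
    ((ln (q x) - ln (q y)) ^+ 2 * J s x y) by eexists.
apply: (@I2_eq _ _ _ p); first by move=> x y; rewrite pE !qE.
apply: (ile_mono_scale (c := 4 * Lambda) _ _ _ _ _ (ile_le _ hp)).
- exact: ltW.
- by have mp := eq_mf2 pE; mauto.
- by nneg.
- by move=> z; rewrite pE; nneg.
- by move=> z; rewrite -pE mulVKf// gt_eqF.
- have : - V <= a by move: hab; rewrite ler_norml => /andP[].
  qlra.
Qed.

(** The truncated logarithm G = (- ln (v_+ + dl))_+ vanishes where v >= 1, by assumption at least
    half of the ball of radius 1/2 in measure, so [faber_krahn] bounds its L2 norm. Where v < dl it
    is at least L. Hence (dl - v)_+ / dl has L2 norm of order 1/L there, small enough for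
    [de_giorgi_first]. *)
Lemma growth : exists dl : R, 0 < dl /\ dl <= 2^-1 /\
  forall s v F g, s0 <= s < 1 -> sol Lambda s (0 : T) 1 v F g -> mf1 g -> (forall x, 0 <= g x) ->
  (forall x, enorm x < 1 -> g x <= dl) -> (forall x, enorm x < 1 -> 0 <= v x) ->
  I1 (fun x => Num.max 0 (- v x) * wt s x) dl ->
  ((V / 2 ^+ n.+1)%:E <= \int[leb]_y (\1[(enorm y < 2^-1) && (1 <= v y)] : R)%:E)%E ->
  {ae leb, forall x, enorm x < 4^-1 -> dl / 2 <= v x}.
Proof.
have [C [C0 hlog]] := log_estimate.
have [Cf [Cf0 hf]] := @faber_krahn R n n_gt0.
have [Cw [Cw0 hw]] := wt_int.
(* The first 2 bounds the rescaled right-hand side. The tail of (2 / dl) (dl - v)_+ after zooming in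
   by 1/2 is at most 2 Cw, from the constant 2, plus 2^(n+1), from the negative part of v, whose
   tail is at most dl. *)
pose K : R := 2 + 2 * Cw + 2 ^+ n.+1.
have K1 : 1 <= K by rewrite /K; have : 0 <= (2 : R) ^+ n.+1 by []; qlra.
have [eps [eps0 hdg]] := @de_giorgi_first R n Lambda s0 Lambda1 s01 n_gt0 K K1.
have m0 : 0 < V / 2 ^+ n.+1 by rewrite divr_gt0 ?exprn_gt0.
have [m mE] : exists m, m = V / 2 ^+ n.+1 by eexists.
rewrite -mE in m0 *.
have [D DE] : exists D, D = 4 * (2 ^+ n * (Cf * (m^-1 * C))) by eexists.
have D0 : 0 <= D by rewrite DE !mulr_ge0 ?invr_ge0 ?exprn_ge0 ?(ltW m0).
have [L [L1 LD]] : exists L, 1 <= L /\ D <= eps * L ^+ 2.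
  exists (1 + D / eps); have De : 0 <= D / eps by rewrite divr_ge0 ?(ltW eps0).
  split; first by rewrite lerDl.
  apply: (@le_trans _ _ (eps * (1 + D / eps))); first by rewrite mulrDr mulr1 mulrCA mulfV ?gt_eqF// mulr1 lerDr ltW.
  by rewrite ler_wpM2l ?(ltW eps0)// expr2 ler_peMr ?addr_ge0// lerDl.
(* As 2 dl = exp(-L), v < dl gives v_+ + dl <= 2 dl and therefore G >= L. *)
have [dl dlE] : exists dl, dl = expR (- L) / 2 by eexists.
have dl0 : 0 < dl by rewrite dlE divr_gt0 ?expR_gt0.
have dl2 : dl <= 2^-1.
  by rewrite dlE ler_pdivrMr// mulVf ?pnatr_eq0// -[leRHS]expR0 ler_expR; qlra.
exists dl; split=> //; split=> //.
move=> s v F g ss hs mg g0 gd v0 hv hm.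
have [s0s s1] := andP ss; have s_0 : 0 < s by exact: lt_le_trans s0s.
have [mv [e ve] [mF F1 F2] vs] := hs.
have [q qE] : exists q : T -> R, forall x, q x = Num.max 0 (v x) + dl by eexists.
have mq : mf1 q by rewrite (_ : q = fun x => Num.max 0 (v x) + dl); [mauto|exact/funext].
have [G GE] : exists G : T -> R, forall x, G x = Num.max 0 (- ln (q x)) by eexists.
have mG : mf1 G by rewrite (_ : G = fun x => Num.max 0 (- ln (q x))); [mauto|exact/funext].
have mb : measurable_fun setT (fun x : T => enorm x < 2^-1) by mauto.
have eG : energy_on (fun x : T => enorm x < 2^-1) s G C.
  apply: ile_mono (hlog s v F g dl ss hs dl0 mg g0 gd v0 hv); first by move=> z; nneg.
  move=> [x y]/=; rewrite -!qE; apply: ler_wpM2l => //; apply: ler_wpM2r; first exact: J_ge0.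
  rewrite -[leLHS](real_normK (num_real _)) -[leRHS](real_normK (num_real _)) ler_pXn2r ?nnegrE// !GE.
  by apply: le_trans (max0_lip _ _) _; rewrite -opprD normrN.
have hG : I1 (fun x => \1[enorm x < 2^-1] * G x ^+ 2) (Cf * (m^-1 * C)).
  have -> : m^-1 * C = m^-1 * 1 `^ (n%:R + 2 * s) * C by rewrite powR1 mulr1.
  apply: (hf s (fun x : T => enorm x < 2^-1) G 1 C m) => //; first by rewrite s_0.
  - move=> x y xb yb; rewrite enormZ ger0_norm ?invr_ge0//.
    by have := enormD x y; move: xb yb; qlra.
  - by move=> x y xb yb; have := enormD x (- y); rewrite enormN; move: xb yb; qlra.
  - apply: le_trans hm _.
    apply: ge0_mono_integral => x; first by rewrite lee_fin.
    rewrite lee_fin ler_nat; case: (enorm x < 2^-1) => //=.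
    case: leP => //= vx; rewrite GE max_l ?eqxx// oppr_le0 ln_ge0// qE.
    by rewrite (le_trans vx)// (le_trans (_ : v x <= Num.max 0 (v x)))// ?le_max ?lexx ?orbT// lerDl ltW.
have G0 x : 0 <= G x by rewrite GE le_max lexx.
have r0 : 0 < 2^-1 :> R by rewrite invr_gt0.
have lam0 : - (2 / dl) != 0 by rewrite oppr_eq0 gt_eqF// divr_gt0.
have hs2 : sol Lambda s (0 : T) 2^-1 v F g.
  split=> //; first by exists e.
  by move=> psi hpsi; apply: vs; apply: adm_mono hpsi; qlra.
have s_in : 0 < s < 1 by rewrite s_0.
have h2 := sol_affine dl s_in r0 lam0 mg g0 hs2.
have wE x : - (2 / dl) * (v (0 + 2^-1 *: x) - dl) = 2 / dl * (dl - v (0 + 2^-1 *: x)) by ring.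
have B1 (x : T) : enorm (0 + 2^-1 *: x) = 2^-1 * enorm x by rewrite add0r enormZ ger0_norm ?invr_ge0.
have ld : 0 < 2 / dl by rewrite divr_gt0.
suff : {ae leb, forall x : T, enorm x < 2^-1 -> - (2 / dl) * (v (0 + 2^-1 *: x) - dl) <= 1}.
  move=> hN; apply: (@ae_affine R n 0 2^-1 (fun x => enorm x < 4^-1 -> dl / 2 <= v x)) => //.
  apply: filterS hN => x h; rewrite B1 => x1.
  have {h} := h ltac:(move: x1; qlra); rewrite wE.
  rewrite -ler_pdivlMl// invf_div mulr1; qlra.
apply: (hdg s _ _ _ ss h2).
- mauto.
- by move=> x; rewrite !mulr_ge0 ?powR_ge0.
- move=> x x1; rewrite normrN (ger0_norm (ltW ld)).
  apply: (@le_trans _ _ (2 / dl * 1 * dl)).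
    apply: ler_pM => //; first by rewrite mulr_ge0 ?powR_ge0 ?(ltW ld).
      apply: ler_wpM2l; first exact: ltW.
      by rewrite -[leRHS](congr1 (fun f => f (2 * s)) (powR1 R)) ler_powR2 ?mulr_ge0 ?(ltW s_0)//; qlra.
    by apply: gd; rewrite B1; move: x1; qlra.
  rewrite mulr1 mulfVK ?gt_eqF//; apply: (@le_trans _ _ (K * 1)).
    by rewrite mulr1 /K; have : 0 <= (2 : R) ^+ n.+1 by []; qlra.
  by rewrite ler_wpM2l ?(le_trans _ K1)// lerDl.
- have mf : mf1 (fun x => \1[enorm x < 2^-1] * G x ^+ 2) by mauto.
  have f0 x : 0 <= \1[enorm x < 2^-1] * G x ^+ 2 by nneg.
  have L2 : 0 < L ^+ 2 by rewrite exprn_gt0// (lt_le_trans _ L1).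
  have H := I1_affine 0 r0 mf f0 hG.
  apply: (@ile_le _ _ _ _ _ (4 / L ^+ 2 * (2^-1 ^- n * (Cf * (m^-1 * C))))).
    rewrite exprVn invrK; have -> : 4 / L ^+ 2 * (2 ^+ n * (Cf * (m^-1 * C))) = D / L ^+ 2 by rewrite DE mulrAC.
    by rewrite ler_pdivrMr.
  apply: (ile_mono_scale _ _ _ _ _ H).
  + by rewrite divr_ge0 ?(ltW L2).
  + mauto.
  + by nneg.
  + by nneg.
  + move=> x; rewrite B1; case: ltP => x1; last by rewrite mul0r; nneg.
    have x2 : 2^-1 * enorm x < 2^-1 by move: x1; qlra.
    rewrite x2 !mul1r /pos_part subr0 wE.
    have [vd|vd] := leP dl (v (0 + 2^-1 *: x)).
      rewrite max_l; last by rewrite mulr_ge0_le0 ?(ltW ld)// subr_le0.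
      by rewrite expr0n/= mulr_ge0 ?divr_ge0 ?sqr_ge0 ?(ltW L2).
    have vx0 : 0 <= v (0 + 2^-1 *: x) by apply: v0; rewrite B1; qlra.
    apply: (@le_trans _ _ (2 ^+ 2)).
      rewrite lerXn2r ?nnegrE ?le_max ?lexx// ge_max ler0n/=.
      by rewrite -mulrA ler_piMr// ler_pdivrMl// mulr1 gerBl.
    rewrite -mulrA (_ : 2 ^+ 2 = 4 :> R); last by rewrite expr2; qlra.
    rewrite ler_peMr// ler_pdivlMl// mulr1 ler_pXn2r ?nnegrE ?(le_trans _ L1)//.
    rewrite GE le_max; apply/orP; right; rewrite lerNr -(expRK (- L)) ler_ln ?posrE ?expR_gt0//.
      rewrite qE max_r//; have -> : expR (- L) = 2 * dl by rewrite dlE mulrCA mulfV ?mulr1.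
      by move: vd; qlra.
    by rewrite qE max_r// ltr_wpDl.
- have mh : mf1 (fun x => Num.max 0 (- v x) * wt s x) by mauto.
  have h0 (x : T) : 0 <= Num.max 0 (- v x) * wt s x by rewrite mulr_ge0 ?wt_ge0// le_max lexx.
  have H := I1_affine 0 r0 mh h0 hv.
  apply: (@ile_le _ _ _ _ _ (2 * Cw + 2 / dl * (2^-1 ^- n * dl))).
    rewrite exprVn invrK [2 / dl * _]mulrCA mulfVK ?gt_eqF//.
    by rewrite /K exprS; qlra.
  apply: (ile_mono_lin2 _ _ _ _ _ _ _ _ (hw s ss) H).
  + by [].
  + exact: ltW.
  + mauto.
  + mauto.
  + by move=> x; exact: wt_ge0.
  + by move=> x; apply: h0.
  + by move=> x; rewrite mulr_ge0 ?wt_ge0// /pos_part le_max lexx.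
  + move=> x; have wl : wt s x <= wt s (0 + 2^-1 *: x).
      by apply: wt_anti => //; rewrite B1; have := enorm_ge0 x; qlra.
    have w0 := wt_ge0 x s1.
    set N := Num.max 0 (- v _).
    have N0 : 0 <= N by rewrite le_max lexx.
    apply: (@le_trans _ _ ((2 + 2 / dl * N) * wt s x)).
      rewrite ler_wpM2r// /pos_part subr0 wE ge_max; apply/andP; split.
        by rewrite addr_ge0// mulr_ge0// ltW.
      rewrite mulrBr mulfVK ?gt_eqF// -mulrN lerD2l ler_wpM2l ?(ltW ld)//.
      by rewrite /N le_max lexx orbT.
    by rewrite mulrDl lerD2l -mulrA; apply: (ler_wpM2l (ltW ld)); exact: (ler_wpM2l N0).
Qed.

End growth_lemma.

(** * Oscillation decay and the Hoelder estimate *)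

Section almost_everywhere_modification.
Context {R : realType} {n : nat}.
Local Notation T := 'rV[R]_n.
Local Notation leb := (@lebesgue_rV R n).
Implicit Types (v w g psi eta : T -> R) (F k : T -> T -> R) (s r t a b : R).

Lemma ae_prod (P : T -> Prop) : {ae leb, forall x, P x} ->
  {ae (leb \x leb)%E, forall z : T * T, P z.1 /\ P z.2}.
Proof.
move=> [N [mN N0 hN]].
have z1 : (leb \x leb)%E (N `*` setT) = 0%E.
  by transitivity (leb N * leb setT)%E; [exact: product_measure1E | rewrite N0 mul0e].
have z2 : (leb \x leb)%E (setT `*` N) = 0%E.
  by transitivity (leb setT * leb N)%E; [exact: product_measure1E | rewrite N0 mule0].
have mN1 : measurable (N `*` [set: T]) by exact: measurableX.
have mN2 : measurable ([set: T] `*` N) by exact: measurableX.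
exists ((N `*` setT) `|` (setT `*` N)); split; first exact: measurableU.
  apply/eqP; rewrite eq_le measure_ge0 andbT.
  apply: le_trans (measureU2 _ mN1 mN2) _; rewrite -[leRHS]adde0.
  by apply: leeD; rewrite le_eqVlt; apply/orP; left; apply/eqP.
move=> [x y]/= /not_andP[h|h]; [left|right]; split=> //=; exact: hN.
Qed.

Lemma hasint_ae {d} {X : measurableType d} (mu : {measure set X -> \bar R}) (f h : X -> R) a :
  measurable_fun setT h -> {ae mu, forall x, f x = h x} -> hasint mu f a -> hasint mu h a.
Proof.
move=> mh fh [fi fa]; have mf : measurable_fun setT (fun x => (f x)%:E) by case/integrableP: fi.
have mhE : measurable_fun setT (fun x => (h x)%:E) by exact/measurable_EFinP.
have fhE : ae_eq mu setT (fun x => (f x)%:E) (fun x => (h x)%:E).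
  by apply: filterS fh => x e _; rewrite e.
split; last by rewrite -fa; apply: ae_eq_integral => //; apply: filterS fh => x e _; rewrite e.
apply/integrableP; split=> //.
have /integrableP[_] := fi; congr (_ < _)%E; apply: ae_eq_integral => //.
- exact: measurableT_comp.
- exact: measurableT_comp.
- by apply: filterS fh => x e _; rewrite e.
Qed.

(** The flux bounds are required at every pair of points. Where v and w disagree the flux is
    replaced by w x - w y, which satisfies them since Lambda >= 1. *)
Lemma sol_ae Lambda s (x0 : T) r v w F g : 1 <= Lambda -> s < 1 -> mf1 w ->
  {ae leb, forall x, v x = w x} ->
  sol Lambda s x0 r v F g -> exists G, sol Lambda s x0 r w G g.
Proof.
move=> L1 s1 mw vw [mv [e ve] [mF F1 F2] vs].
have L0 : 0 < Lambda by exact: lt_le_trans L1.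
have [G GE] : exists G : T -> T -> R, forall x y,
  G x y = \1[(v x == w x) && (v y == w y)] * (F x y - (w x - w y)) + (w x - w y) by eexists.
have mG : mf2 G by apply: (eq_mf2 GE); mauto.
exists G; split=> //.
- exists e; apply: ile_ae ve; [mauto|mauto|by nneg|by nneg|].
  by apply: filterS (ae_prod vw) => -[x y]/= [-> ->].
- split=> // x y; rewrite GE.
    case: eqP => [<-|_]/=; last first.
      rewrite mul0r add0r -expr2 ler_piMl ?sqr_ge0// invf_le1//.
    case: eqP => [<-|_]/=; last first.
      rewrite mul0r add0r -expr2 ler_piMl ?sqr_ge0// invf_le1//.
    by rewrite mul1r subrK.
  case: eqP => [<-|_]/=; last by rewrite mul0r add0r ler_peMl.
  case: eqP => [<-|_]/=; last by rewrite mul0r add0r ler_peMl.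
  by rewrite mul1r subrK.
- move=> psi hpsi b hb; have [a ha hab] := vs _ hpsi b hb.
  have [mpsi _ _ _] := hpsi.
  exists a => //; apply: hasint_ae ha; first by mauto.
  apply: filterS (ae_prod vw) => -[x y]/= [vx vy].
  by rewrite GE vx vy !eqxx mul1r subrK.
Qed.

Lemma sol_scale Lambda s v F g lam m : 0 < s < 1 -> lam != 0 -> mf1 g -> (forall x, 0 <= g x) ->
  sol Lambda s (0 : T) 1 v F g ->
  sol Lambda s 0 1 (fun x => lam * (v x - m)) (fun x y => lam * F x y) (fun x => `|lam| * g x).
Proof.
move=> ss l0 mg g0 hs; have := sol_affine m ss ltr01 l0 mg g0 hs.
by congr sol; rewrite ?powR1 ?mulr1; do ?apply/funext => ?; rewrite ?add0r ?scale1r ?powR1 ?mulr1.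
Qed.

End almost_everywhere_modification.

Section oscillation_decay.
Context {R : realType} {n : nat}.
Local Notation T := 'rV[R]_n.
Local Notation leb := (@lebesgue_rV R n).
Implicit Types (v w g psi eta : T -> R) (F : T -> T -> R) (s r t a b k : R).
(** With x = ln t: e^z - 1 <= z e^z for z = gam x, and (p / 2) x <= e^(p x / 2) absorbs the factor
    x. *)
Lemma powR_sub1_le (t gam p : R) : 1 <= t -> 0 < p -> 0 <= gam -> 2 * gam <= p ->
  t `^ gam - 1 <= 2 * gam / p * t `^ p.
Proof.
move=> t1 p0 gam0 gp; have t0 : 0 < t by exact: lt_le_trans t1.
have l0 : 0 <= ln t by rewrite ln_ge0.
have tE q : t `^ q = expR (q * ln t) by rewrite /powR gt_eqF.
rewrite !tE; have [x xE] : exists x, x = ln t by eexists.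
rewrite -xE in l0 *.
have h1 : expR (gam * x) - 1 <= gam * x * expR (gam * x).
  have := expR_ge1Dx (- (gam * x)); rewrite -(ler_pM2r (expR_gt0 (gam * x))) -expRD addNr expR0.
  by rewrite mulrDl mul1r mulNr; qlra.
have h2 : p / 2 * x <= expR (p / 2 * x) by have := expR_ge1Dx (p / 2 * x); qlra.
apply: le_trans h1 _.
have h3 : expR (gam * x) <= expR (p / 2 * x) by rewrite ler_expR ler_wpM2r//; qlra.
have -> : 2 * gam / p * expR (p * x) = gam * (2 / p * expR (p / 2 * x)) * expR (p / 2 * x).
  have -> : p * x = p / 2 * x + p / 2 * x by field.
  by rewrite expRD; ring.
apply: ler_pM; rewrite ?expR_ge0 ?mulr_ge0//.
by apply: ler_wpM2l => //; rewrite -ler_pdivrMl ?divr_gt0// invf_div.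
Qed.

Variable Lambda s0 : R.
Hypothesis Lambda1 : 1 <= Lambda.
Hypothesis s01 : 0 < s0 < 1.
Hypothesis n_gt0 : (1 <= n)%N.

Let s0_gt0 : 0 < s0. Proof. by case/andP: s01. Qed.
Let s0_lt1 : s0 < 1. Proof. by case/andP: s01. Qed.
Let V : R := @unit_volume R n.
Let V0 : 0 < V. Proof. exact: unit_volume_gt0. Qed.

(* Invariant under [v -> 4 `^ gam * (v (x / 4) - m)] for [|m| <= 1 - 4 `^ (- gam)]. *)
Definition envelope gam (x : T) : R := if enorm x < 1 then 1 else 2 * (4 * enorm x) `^ gam - 1.

Lemma mf1_envelope gam : mf1 (envelope gam).
Proof. by rewrite /mf1 /envelope; mauto. Qed.

(** The bound is linear in the exponent: a slowly growing envelope exceeds 1 only by a small tail,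
    and this is the smallness that [growth] asks for. *)
Lemma envelope_tail : exists C : R, 0 <= C /\ forall s gam, s0 <= s < 1 -> 0 <= gam -> 2 * gam <= s0 ->
  I1 (fun x => (envelope gam x - 1) * wt s x) (C * gam).
Proof.
have [CK [CK0 hCK]] := @ker_int R n s0 s01.
exists (16 / s0 * CK); split; first by rewrite mulr_ge0 ?divr_ge0 ?(ltW s0_gt0).
move=> s gam ss gam0 gs; have [s0s s1] := andP ss.
have s_0 : 0 < s by exact: lt_le_trans s0s.
rewrite mulrAC; apply: (ile_mono_scale _ _ _ _ _ (hCK s 0 ss)).
- by rewrite mulr_ge0 ?divr_ge0 ?(ltW s0_gt0).
- mauto.
- by nneg.
- move=> x; rewrite /envelope; case: ltP => x1; first by rewrite subrr mul0r.
  rewrite mulr_ge0 ?wt_ge0// -addrA -opprD subr_ge0.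
  have : 1 <= (4 * enorm x) `^ gam.
    by rewrite -[leLHS](powRr0 (4 * enorm x)) ler_powR//; qlra.
  qlra.
- move=> x; rewrite sub0r enormN /envelope; case: ltP => x1.
    by rewrite subrr mul0r; nneg.
  have x0 : 0 < enorm x by exact: lt_le_trans x1.
  rewrite mulrA; apply: ler_pM; [|exact: wt_ge0| |].
  + have : 1 <= (4 * enorm x) `^ gam.
      by rewrite -[leLHS](powRr0 (4 * enorm x)) ler_powR//; qlra.
    qlra.
  + rewrite /mJ ltNge x1/=.
    have x4 : 1 <= 4 * enorm x by qlra.
    have h := powR_sub1_le x4 s0_gt0 gam0 gs.
    have h4 : (4 * enorm x) `^ s0 <= 4 * enorm x `^ s0.
      rewrite powRM ?(ltW x0)// ler_wpM2r ?powR_ge0// -[leRHS]powRr1// ler_powR// ?ltW//; qlra.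
    have gs0 : 0 <= 2 * gam / s0 by rewrite divr_ge0 ?(ltW s0_gt0)// mulr_ge0.
    have := ler_wpM2l gs0 h4.
    have -> : 16 / s0 * gam * enorm x `^ s0 = 2 * (2 * gam / s0 * (4 * enorm x `^ s0)) by ring.
    qlra.
  + rewrite /wt /J sub0r enormN /Jr ler_pM2l ?subr_gt0//.
    rewrite lef_pV2 ?posrE ?powR_gt0// ?ltr_pwDl ?enorm_ge0//.
    by rewrite ler_powR2 ?enorm_ge0 ?addr_ge0 ?mulr_ge0 ?(ltW s_0)// lerDr.
Qed.

Definition decaying dl gam s v := exists F g, [/\ sol Lambda s (0 : T) 1 v F g, mf1 g,
  (forall x, 0 <= g x), (forall x, enorm x < 1 -> g x <= dl) &
  {ae leb, forall x, `|v x| <= envelope gam x}].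

(** One of the sets where w >= 0 or w <= 0 fills half of the ball of radius 1/2. Accordingly
    [growth] applied to 1 + w or 1 - w cuts dl / 2 off the oscillation on one side. *)
Lemma osc_step : exists dl gam : R, [/\ 0 < dl, 0 < gam, gam <= s0 & forall s v, s0 <= s < 1 ->
  decaying dl gam s v -> exists m,
  {ae leb, forall x, enorm x < 4^-1 -> `|v x - m| <= 4 `^ (- gam)} /\
  decaying dl gam s (fun x => 4 `^ gam * (v (0 + 4^-1 *: x) - m))].
Proof.
have [dl [dl0 [dl2 hg]]] := @growth R n Lambda s0 Lambda1 s01 n_gt0.
have [C [C0 hC]] := envelope_tail.
have [gam [gam0 gs gd gC]] : exists gam : R, [/\ 0 < gam, 2 * gam <= s0, 8 * gam <= dl & C * gam <= dl].
  (* Small enough for 4 (1 - 4^-gam) <= 8 gam <= dl, by ln 4 <= 2, and for the tail C gam of the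
     envelope to be at most dl. *)
  exists (s0 * dl / (8 * (1 + C))).
  have c1 : 0 < 8 * (1 + C) by rewrite mulr_gt0 ?ltr_pwDl.
  have sd : 0 < s0 * dl by rewrite mulr_gt0.
  have sd1 : s0 * dl <= dl by rewrite ger_pMl// ltW.
  have sd2 : s0 * dl <= s0 by rewrite ger_pMr// (le_trans dl2)// invf_le1// ler1n.
  split; first by rewrite divr_gt0.
  - by rewrite mulrA ler_pdivrMr//; nra.
  - by rewrite mulrA ler_pdivrMr//; nra.
  - by rewrite mulrA ler_pdivrMr//; nra.
have [eps epsE] : exists eps, eps = 1 - 4 `^ (- gam) by eexists.
have l4 : ln (4 : R) <= 2.
  have -> : (4 : R) = 2 ^+ 2 by rewrite expr2; qlra.
  rewrite lnXn//; have n11 : -1 < (1 : R) by qlra.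
  have := le_ln1Dx n11; rewrite (_ : 1 + 1 = 2)//; last by qlra.
have l40 : 0 <= ln (4 : R) by rewrite ln_ge0// ler1n.
have p4 q : 4 `^ q = expR (q * ln (4 : R)) :> R by rewrite /powR gt_eqF.
have eps0 : 0 <= eps.
  by rewrite epsE p4 subr_ge0 -[leRHS]expR0 ler_expR mulNr oppr_le0 mulr_ge0// ltW.
have epsd : 4 * eps <= dl.
  have := expR_ge1Dx (- gam * ln 4); rewrite -p4 epsE.
  have : gam * ln 4 <= gam * 2 by rewrite ler_pM2l.
  by move: gd; rewrite mulNr; qlra.
have g4 : 4 `^ gam * 4 `^ (- gam) = 1 :> R.
  by rewrite -powRD ?subrr ?powRr0// pnatr_eq0 implybT.
have q0 : 0 < 4 `^ gam :> R by rewrite powR_gt0.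
exists dl, gam; split=> //; first by qlra.
move=> s v ss [F [g [hs mg g0 gd1 hv]]]; have [s0s s1] := andP ss.
have s_0 : 0 < s by exact: lt_le_trans s0s.
have s_in : 0 < s < 1 by rewrite s_0.
have [mv _ _ _] := hs.
(* Clamping to the envelope changes v on a null set only and makes the bound hold everywhere. *)
have [w wE] : exists w : T -> R, forall x, w x = Num.max (- envelope gam x) (Num.min (envelope gam x) (v x)) by eexists.
have mE := @mf1_envelope gam.
have mw : mf1 w by rewrite (_ : w = fun x => Num.max (- envelope gam x) (Num.min (envelope gam x) (v x))); [mauto|exact/funext].
have en0 (x : T) : 1 <= envelope gam x.
  rewrite /envelope; case: ltP => // x1.
  have : 1 <= (4 * enorm x) `^ gam.
    by rewrite -[leLHS](powRr0 (4 * enorm x)) ler_powR ?(ltW gam0)//; qlra.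
  qlra.
have wb x : `|w x| <= envelope gam x.
  rewrite wE ler_norml le_max lexx/= ge_max ge_min lexx/= andbT.
  by have := en0 x; qlra.
have vw : {ae leb, forall x, v x = w x}.
  apply: filterS hv => x; rewrite ler_norml wE => /andP[h1 h2].
  by rewrite (min_r h2) max_r.
have [G hG] := sol_ae Lambda1 s1 mw vw hs.
(* [lam] is 1 or -1 and stands for the two alternatives. *)
have half (lam : R) : `|lam| = 1 -> lam ^+ 2 = 1 ->
  ((V / 2 ^+ n.+1)%:E <= \int[leb]_y (\1[(enorm y < 2^-1) && (1 <= 1 + lam * w y)] : R)%:E)%E ->
  {ae leb, forall x, enorm x < 4^-1 -> -1 + dl / 2 <= lam * w x}.
  move=> l1 l2 hm; have l0 : lam != 0 by rewrite -normr_eq0 l1 oner_eq0.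
  have zE x : lam * (w x - - lam) = 1 + lam * w x by rewrite opprK mulrDr -expr2 l2 addrC.
  have g1 x : `|lam| * g x = g x by rewrite l1 mul1r.
  have H := hg s _ _ _ ss (sol_scale (- lam) s_in l0 mg g0 hG).
  have : {ae leb, forall x, enorm x < 4^-1 -> dl / 2 <= lam * (w x - - lam)}.
    apply: H.
    - mauto.
    - by move=> x; rewrite g1.
    - by move=> x /gd1; rewrite g1.
    - move=> x x1; rewrite zE; have := wb x; rewrite /envelope x1 => wx.
      have : `|lam * w x| <= 1 by rewrite normrM l1 mul1r.
      by rewrite ler_norml => /andP[]; qlra.
    - apply: (ile_mono _ _ (ile_le gC (hC s gam ss (ltW gam0) gs))) => x.
        by rewrite mulr_ge0 ?wt_ge0// le_max lexx.
      rewrite ler_wpM2r ?wt_ge0// zE ge_max subr_ge0 en0/=.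
      have : `|lam * w x| <= envelope gam x by rewrite normrM l1 mul1r.
      by rewrite ler_norml => /andP[]; qlra.
    - by under eq_integral do rewrite zE.
  by apply: filterS => x h /h; rewrite zE; qlra.
(* The centre will be eps or - eps: an interval of length 2 - dl / 2 fits into radius 1 - eps =
   4^-gam because dl / 2 >= 2 eps. Outside the ball the rescaled function stays below the envelope
   by the invariance of the latter. *)
have final (m : R) : `|m| <= eps -> {ae leb, forall x, enorm x < 4^-1 -> `|w x - m| <= 4 `^ (- gam)} ->
  exists m, {ae leb, forall x, enorm x < 4^-1 -> `|v x - m| <= 4 `^ (- gam)} /\
  decaying dl gam s (fun x => 4 `^ gam * (v (0 + 4^-1 *: x) - m)).
  move=> me hm; exists m; split.
    by apply: filterS2 hm vw => x h ->.
  have r4 : 0 < 4^-1 :> R by rewrite invr_gt0.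
  have hs4 : sol Lambda s (0 : T) 4^-1 v F g.
    have [_ e fl vs] := hs; split=> // psi hpsi; apply: vs; apply: adm_mono hpsi.
    by rewrite invf_le1// ler1n.
  have := sol_affine m s_in r4 (lt0r_neq0 q0) mg g0 hs4.
  rewrite (ger0_norm (ltW q0)) => h4.
  eexists; eexists; split; first exact: h4.
  - mauto.
  - by move=> x; rewrite !mulr_ge0 ?powR_ge0.
  (* The right-hand side picks up the factor 4^gam 4^(-2s) <= 1, since gam <= s0 <= s. *)
  - move=> x x1; apply: (@le_trans _ _ (1 * dl)); last by rewrite mul1r.
    apply: ler_pM; [by rewrite mulr_ge0 ?powR_ge0|exact: g0| |].
      rewrite -(powR_inv1 (ler0n _ 4)) -powRrM -powRD ?pnatr_eq0 ?implybT//.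
      by rewrite -[leRHS](powRr0 4) ler_powR ?ler1n//; qlra.
    apply: gd1; rewrite add0r enormZ ger0_norm ?(ltW r4)//.
    by have := enorm_ge0 x; qlra.
  - refine (@ae_affine R n 0 4 (fun x : T => `|4 `^ gam * (v (0 + 4^-1 *: x) - m)| <= envelope gam x) (ltr0n R 4) _).
    apply: filterS2 hm vw => x h vx.
    have -> : 0 + 4^-1 *: (0 + 4 *: x) = x by rewrite !add0r scalerA mulVf ?scale1r.
    have e4 : enorm (0 + 4 *: x) = 4 * enorm x by rewrite add0r enormZ ger0_norm.
    rewrite normrM (ger0_norm (ltW q0)) vx.
    rewrite {1}/envelope e4; case: ltP => x4.
      by rewrite -[leRHS]g4 ler_pM2l// h//; move: x4; qlra.
    have wm : `|w x - m| <= envelope gam x + eps.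
      by rewrite (le_trans (ler_normB _ _))// lerD.
    apply: (@le_trans _ _ (4 `^ gam * (envelope gam x + eps))); first by rewrite ler_pM2l.
    have hx : envelope gam x <= 2 * (4 * enorm x) `^ gam - 1.
      rewrite /envelope; case: ltP => // x1.
      have : 1 <= (4 * enorm x) `^ gam.
        by rewrite -[leLHS](powRr0 (4 * enorm x)) ler_powR ?(ltW gam0).
      qlra.
    rewrite [(4 * (4 * enorm x)) `^ gam]powRM ?mulr_ge0 ?enorm_ge0//.
    apply: (@le_trans _ _ (4 `^ gam * (2 * (4 * enorm x) `^ gam - 4 `^ (- gam)))).
      by rewrite ler_pM2l//; move: hx; rewrite epsE; qlra.
    by rewrite mulrBr g4; qlra.
have [h1|h1] := leP (V / 2 ^+ n.+1)%:E (\int[leb]_y (\1[(enorm y < 2^-1) && (1 <= 1 + 1 * w y)] : R)%:E)%E.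
  apply: (final eps); first by rewrite ger0_norm.
  apply: filterS (half 1 (normr1 _) (expr1n _ _) h1) => x h x4; have := h x4; rewrite mul1r.
  have := wb x; rewrite /envelope ifT; last by move: x4; qlra.
  rewrite !ler_norml => /andP[? ?] ?; have e1 : 4 `^ (- gam) = 1 - eps by rewrite epsE; ring.
  by rewrite e1; apply/andP; split; move: epsd dl0 eps0; qlra.
apply: (final (- eps)); first by rewrite normrN ger0_norm.
have h2 : ((V / 2 ^+ n.+1)%:E <= \int[leb]_y (\1[(enorm y < 2^-1) && (1 <= 1 + -1 * w y)] : R)%:E)%E.
  rewrite leNgt; apply/negP => h2.
  have [f1 f1E] : exists f1 : T -> R, forall x, f1 x = \1[(enorm x < 2^-1) && (1 <= 1 + 1 * w x)] by eexists.
  have [f2 f2E] : exists f2 : T -> R, forall x, f2 x = \1[(enorm x < 2^-1) && (1 <= 1 + -1 * w x)] by eexists.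
  have : (\int[leb]_y (\1[enorm (y - 0%R) < 2^-1] : R)%:E <=
     \int[leb]_y ((f1 y)%:E + (f2 y)%:E))%E.
    apply: ge0_mono_integral => x; first by rewrite lee_fin.
    rewrite f1E f2E subr0 -EFinD lee_fin -natrD ler_nat; case: (enorm x < 2^-1) => //=.
    have /orP[->|->] : (1 <= 1 + 1 * w x) || (1 <= 1 + -1 * w x).
      by case: (leP 1 (1 + 1 * w x)) => //=; qlra.
    - by rewrite leq_addr.
    - by rewrite leq_addl.
  rewrite integral_ball ?invr_gt0// ge0_integralD//=.
  - under [X in (_ <= X + _)%E -> _]eq_integral do rewrite f1E.
    under [X in (_ <= _ + X)%E -> _]eq_integral do rewrite f2E.
    rewrite leNgt => /negP; apply.
    have e2 : 2^-1 ^+ n * @unit_volume R n = V / 2 ^+ n.+1 + V / 2 ^+ n.+1.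
      rewrite exprVn exprS /V; have : (2 : R) ^+ n != 0 by rewrite expf_neq0.
      by move: (2 ^+ n) (@unit_volume R n) => p U p0; field.
    rewrite e2 EFinD.
    exact: lteD.
  - by move=> x _; rewrite lee_fin f1E.
  - apply/measurable_EFinP; rewrite (_ : f1 = fun x => \1[(enorm x < 2^-1) && (1 <= 1 + 1 * w x)]); [mauto|exact/funext].
  - by move=> x _; rewrite lee_fin f2E.
  - apply/measurable_EFinP; rewrite (_ : f2 = fun x => \1[(enorm x < 2^-1) && (1 <= 1 + -1 * w x)]); [mauto|exact/funext].
apply: filterS (half (-1) (normrN1 _) (etrans (sqrrN _) (expr1n _ _)) h2) => x h x4; have := h x4; rewrite mulN1r.
have := wb x; rewrite /envelope ifT; last by move: x4; qlra.
rewrite !ler_norml => /andP[? ?] ?; have e1 : 4 `^ (- gam) = 1 - eps by rewrite epsE; ring.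
by rewrite e1; apply/andP; split; move: epsd dl0 eps0; qlra.
Qed.

(** The constant m may depend on k: the Hoelder estimate compares two points with the same m. *)
Lemma osc_iter : exists dl gam : R, [/\ 0 < dl, 0 < gam, gam <= s0 & forall s v (k : nat), s0 <= s < 1 ->
  decaying dl gam s v -> exists m,
  {ae leb, forall x, enorm x < 4^-1 ^+ k -> `|v x - m| <= (4 `^ (- gam)) ^+ k}].
Proof.
have [dl [gam [dl0 gam0 gs h]]] := osc_step.
exists dl, gam; split=> // s v k ss; elim: k v => [|k IH] v hv.
  exists 0; have [F [g [_ _ _ _]]] := hv; apply: filterS => x; rewrite /envelope !expr0 subr0.
  by case: ltP.
have [m [_ /IH[m' h']]] := h s v ss hv.
have q0 : 0 < 4 `^ gam :> R by rewrite powR_gt0.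
have g4 : 4 `^ gam * 4 `^ (- gam) = 1 :> R.
  by rewrite -powRD ?subrr ?powRr0// pnatr_eq0 implybT.
exists (m + 4 `^ (- gam) * m').
apply: (@ae_affine R n 0 4^-1 (fun x => enorm x < 4^-1 ^+ k.+1 -> `|v x - (m + 4 `^ (- gam) * m')| <= (4 `^ (- gam)) ^+ k.+1)).
  by rewrite invr_gt0.
apply: filterS h' => x hx; rewrite {1}add0r enormZ ger0_norm ?invr_ge0// exprS ltr_pM2l ?invr_gt0// => /hx.
rewrite -(ler_pM2l (powR_gt0 (- gam) (ltr0n R 4))) -exprS; apply: le_trans.
have -> : v (0 + 4^-1 *: x) - (m + 4 `^ (- gam) * m') =
    4 `^ (- gam) * (4 `^ gam * (v (0 + 4^-1 *: x) - m) - m').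
  by rewrite mulrBr mulrA [4 `^ (- gam) * 4 `^ gam]mulrC g4 mul1r opprD addrA.
by rewrite normrM (ger0_norm (powR_ge0 _ _)).
Qed.

Lemma base4_scale (d : R) : 0 < d -> d < 8^-1 -> exists k : nat, 4^-1 ^+ k.+1 <= 8 * d < 4^-1 ^+ k.
Proof.
move=> d0 d8; have q1 : 0 <= (4^-1 : R) < 1 by rewrite invr_ge0 ler0n/= invf_lt1// ltr1n.
have d80 : 0 < 8 * d by rewrite mulr_gt0.
have ex : exists k : nat, 4^-1 ^+ k.+1 <= 8 * d.
  have [k hk] := exprn_small q1 d80; exists k; apply: le_trans (ltW hk).
  by rewrite exprS ler_piMl ?exprn_ge0 ?invr_ge0// invf_le1// ler1n.
case: (ex_minnP ex) => -[|k] hk hmin; first by exists 0%N; rewrite hk expr0/=; qlra.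
exists k.+1; rewrite hk ltNge; apply/negP => /hmin; by rewrite ltnn.
Qed.

(** The decay around a centre holds off a null set that depends on centre and scale. Rational
    centres and the scales 4^-k leave one null set in all, and two close points always share a
    suitable ball with rational centre. *)
Lemma holder_bounded : exists gam C : R, [/\ 0 < gam, gam <= s0, 0 <= C &
  forall s v F g A M, s0 <= s < 1 -> sol Lambda s (0 : T) 1 v F g -> mf1 g -> (forall x, 0 <= g x) ->
  (forall x, enorm x < 1 -> g x <= M) -> {ae leb, forall x, `|v x| <= A} -> 0 < A -> 0 <= M ->
  exists N, [/\ measurable N, leb N = 0%E & forall x y, enorm x < 2^-1 -> enorm y < 2^-1 ->
    ~ N x -> ~ N y -> `|v x - v y| <= C * (A + M) * enorm (x - y) `^ gam]].
Proof.
have [dl [gam [dl0 gam0 gs h]]] := osc_iter.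
(* 64 = 2 times 32: two deviations from the common constant, and 4^-k <= 32 |x - y| at the scale
   that [base4_scale] chooses. *)
exists gam, (64 * (1 + dl^-1)); split=> //; first by rewrite mulr_ge0// addr_ge0 ?invr_ge0 ?(ltW dl0).
move=> s v F g A M ss hs mg g0 gM hv A0 M0; have [s0s s1] := andP ss.
have s_0 : 0 < s by exact: lt_le_trans s0s.
have s_in : 0 < s < 1 by rewrite s_0.
have [mv _ _ _] := hs.
have [c cE] : exists c : R, c = A + M / dl by eexists.
have Md : 0 <= M / dl by rewrite divr_ge0 ?(ltW dl0).
have c0 : 0 < c by rewrite cE ltr_pwDl.
have ci : 0 < c^-1 by rewrite invr_gt0.
have cA : c <= (1 + dl^-1) * (A + M).
  have : 0 <= dl^-1 * A by rewrite mulr_ge0 ?invr_ge0 ?(ltW dl0) ?(ltW A0).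
  by rewrite cE mulrDl mul1r mulrDr [dl^-1 * M]mulrC; qlra.
have r0 : 0 < 4^-1 :> R by rewrite invr_gt0.
have loc (q : T) (k : nat) : exists m, {ae leb, forall x, enorm q < 3 / 4 ->
    enorm (x - q) < 4^-1 * 4^-1 ^+ k -> `|v x - m| <= c * (4 `^ (- gam)) ^+ k}.
  have [q34|q34] := ltP (enorm q) (3 / 4); last first.
    by exists 0; apply: nearW => x; rewrite ltNge.
  have hs4 : sol Lambda s q 4^-1 v F g.
    have [_ e fl vs] := hs; split=> // psi [p1 p2 p3 p4]; apply: vs; split=> // x.
    rewrite subr0 => x1; apply: p2.
    by have := enormBle x q; move: x1 q34; qlra.
  have h4 := sol_affine 0 s_in r0 (lt0r_neq0 ci) mg g0 hs4.
  have [|m hm] := h s (fun x => c^-1 * (v (q + 4^-1 *: x) - 0)) k ss.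
    eexists; eexists; split; first exact: h4.
    - mauto.
    - by move=> x; rewrite !mulr_ge0 ?powR_ge0.
    - move=> x x1; rewrite (ger0_norm (ltW ci)).
      have p1 : 4^-1 `^ (2 * s) <= 1 :> R.
        by rewrite -[leRHS](congr1 (fun f => f (2 * s)) (powR1 R)) ler_powR2 ?mulr_ge0 ?(ltW s_0)// ?(ltW r0)// invf_le1// ler1n.
      have gx : g (q + 4^-1 *: x) <= M.
        apply: gM; have := enormD q (4^-1 *: x); rewrite enormZ ger0_norm ?(ltW r0)//.
        by move: q34 x1; qlra.
      apply: (@le_trans _ _ (c^-1 * M)).
        by rewrite -mulrA ler_pM2l// -[leRHS]mul1r ler_pM ?powR_ge0.
      by rewrite ler_pdivrMl// mulrC -ler_pdivrMl// cE; qlra.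
    - apply: (@ae_affine R n (- (4 *: q)) 4 (fun x => `|c^-1 * (v (q + 4^-1 *: x) - 0)| <= envelope gam x)) => //.
      apply: filterS hv => x vx.
      have -> : q + 4^-1 *: (- (4 *: q) + 4 *: x) = x.
        by rewrite scalerDr scalerN !scalerA mulVf// !scale1r addNKr.
      apply: (@le_trans _ _ 1).
        rewrite subr0 normrM (ger0_norm (ltW ci)) ler_pdivrMl// mulr1 (le_trans vx)// cE lerDl//.
      rewrite /envelope; case: ltP => // x1.
      have : 1 <= (4 * enorm (- (4 *: q) + 4 *: x)) `^ gam.
        by rewrite -[leLHS](powRr0 (4 * enorm (- (4 *: q) + 4 *: x))) ler_powR ?(ltW gam0)//; qlra.
      qlra.
  exists (c * m).
  refine (@ae_affine R n q 4^-1 (fun x : T => true ->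
    enorm (x - q) < 4^-1 * 4^-1 ^+ k -> `|v x - c * m| <= c * (4 `^ (- gam)) ^+ k) r0 _).
  apply: filterS hm => x hx _; rewrite addrAC subrr add0r enormZ (ger0_norm (ltW r0)) ltr_pM2l// => /hx.
  rewrite subr0 -(ler_pM2l c0); apply: le_trans.
  by rewrite -{2}(ger0_norm (ltW c0)) -normrM mulrBr mulVKf ?gt_eqF.
have {loc} [mm hmm] : exists mm : 'rV[rat]_n * nat -> R, forall i : 'rV[rat]_n * nat,
    {ae leb, forall x : T, enorm (map_mx ratr i.1 : T) < 3 / 4 ->
    enorm (x - map_mx ratr i.1) < 4^-1 * 4^-1 ^+ i.2 -> `|v x - mm i| <= c * (4 `^ (- gam)) ^+ i.2}.
  have [f hf] := boolp.choice (fun i : 'rV[rat]_n * nat => loc (map_mx ratr i.1) i.2).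
  by exists f.
have : {ae leb, forall x : T, forall j : nat, if unpickle j is Some i then
   (enorm (map_mx ratr i.1 : T) < 3 / 4 ->
    enorm (x - map_mx ratr i.1) < 4^-1 * 4^-1 ^+ i.2 -> `|v x - mm i| <= c * (4 `^ (- gam)) ^+ i.2) else True}.
  apply: ae_foralln => j; case: (unpickle j) => [i|]; first exact: hmm.
  exact: nearW.
move=> hN; have [N [mN N0 NP]] := filterI hv hN.
exists N; split=> // x y x1 y1 Nx Ny.
have {}NP (z : T) : ~ N z -> `|v z| <= A /\ forall (i : 'rV[rat]_n * nat), enorm (map_mx ratr i.1 : T) < 3 / 4 ->
    enorm (z - map_mx ratr i.1) < 4^-1 * 4^-1 ^+ i.2 -> `|v z - mm i| <= c * (4 `^ (- gam)) ^+ i.2.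
  move=> Nz; have [vz hz] : `|v z| <= A /\ forall j : nat, if unpickle j is Some i then
   (enorm (map_mx ratr i.1 : T) < 3 / 4 ->
    enorm (z - map_mx ratr i.1) < 4^-1 * 4^-1 ^+ i.2 -> `|v z - mm i| <= c * (4 `^ (- gam)) ^+ i.2) else True.
    by apply: contrapT => hz; apply: Nz; exact: NP.
  by split=> // i; have := hz (pickle i); rewrite pickleK.
have [vx hx] := NP _ Nx; have [vy hy] := NP _ Ny.
apply: (@le_trans _ _ (64 * c * enorm (x - y) `^ gam)); last first.
  by rewrite ler_wpM2r ?powR_ge0// -mulrA ler_pM2l.
have gam1 : gam <= 1 by rewrite (le_trans gs)// ltW.
have pw (a : R) : 1 <= a -> a `^ gam <= a.
  by move=> a1; rewrite -[leRHS]powRr1 ?(le_trans _ a1)// ler_powR.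
have [xy|xy] := leP 8^-1 (enorm (x - y)).
  apply: (@le_trans _ _ (2 * c)).
    by rewrite (le_trans (ler_normB _ _))//; move: vx vy; rewrite cE; qlra.
  rewrite -mulrA [64 * _](_ : _ = 2 * (c * (32 * enorm (x - y) `^ gam))); last by ring.
  rewrite ler_pM2l// ler_peMr ?(ltW c0)//.
  have h8 : 1 <= (8 * enorm (x - y)) `^ gam.
    by rewrite -[leLHS](powRr0 (8 * enorm (x - y))) ler_powR ?(ltW gam0)//; qlra.
  apply: le_trans h8 _; rewrite powRM ?enorm_ge0// ler_wpM2r ?powR_ge0//.
  by apply: (le_trans (pw _ _)); rewrite ?ler1n// ler_nat.
have [d0|d0] := eqVneq (enorm (x - y)) 0.
  have -> : x = y by apply/eqP; rewrite -subr_eq0; apply/eqP/enorm_eq0.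
  by rewrite subrr normr0 mulr_ge0 ?powR_ge0// mulr_ge0// ltW.
have {}d0 : 0 < enorm (x - y) by rewrite lt0r d0 enorm_ge0.
have [k /andP[k1 k2]] := base4_scale d0 xy.
have k0 : 0 < 4^-1 ^+ k / 8 :> R by rewrite divr_gt0 ?exprn_gt0.
have [q xq] := ratV_dense x k0.
have k3 : 4^-1 ^+ k <= 1 :> R by rewrite exprn_ile1// ?(ltW r0)// invf_le1// ler1n.
have q34 : enorm (map_mx ratr q : T) < 3 / 4.
  have := enormBle (map_mx ratr q : T) x; rewrite enormB.
  by move: xq x1 k3; qlra.
have ex := hx (q, k) q34 ltac:(move: xq k0; rewrite /=; qlra).
have ey : `|v y - mm (q, k)| <= c * (4 `^ (- gam)) ^+ k.
  apply: (hy (q, k)) => //=; have := enorm_triangle x y (map_mx ratr q).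
  by rewrite (enormB y x); move: xq k2 k0; qlra.
apply: (@le_trans _ _ (2 * (c * (4 `^ (- gam)) ^+ k))).
  have -> : v x - v y = (v x - mm (q, k)) - (v y - mm (q, k)) by ring.
  by rewrite (le_trans (ler_normB _ _))//; move: ex ey => /=; qlra.
rewrite -mulrA [64 * _](_ : _ = 2 * (c * (32 * enorm (x - y) `^ gam))); last by ring.
rewrite ler_pM2l// ler_pM2l//.
have -> : 4 `^ (- gam) = 4^-1 `^ gam :> R by rewrite -[4^-1](powR_inv1 (ler0n R 4)) -powRrM mulN1r.
rewrite -powR_exprn ?(ltW r0)//.
apply: (@le_trans _ _ ((32 * enorm (x - y)) `^ gam)).
  apply: ler_powR2; rewrite ?(ltW gam0) ?exprn_ge0 ?(ltW r0)//.
  by move: k1; rewrite exprS; qlra.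
by rewrite powRM ?enorm_ge0// ler_wpM2r ?powR_ge0// pw// ler1n.
Qed.

End oscillation_decay.

(** * Smooth bumps *)

Section flat_functions.
Context {R : realType}.
Implicit Types (t h : R) (m : nat).

(** The family that differentiation generates from e^(-1/t): a derivative combines the indices m + 1
    and m + 2. *)
Definition flat m t : R := if 0 < t then t^-1 ^+ m * expR (- t^-1) else 0.

Lemma flat_ge0 m t : 0 <= flat m t.
Proof. by rewrite /flat; case: ifP => // t0; rewrite mulr_ge0 ?expR_ge0// exprn_ge0// invr_ge0 ltW. Qed.

Lemma flat_le0 m t : t <= 0 -> flat m t = 0.
Proof. by rewrite /flat leNgt => /negbTE ->. Qed.

Lemma flat_mul m t : flat m t = t * flat m.+1 t.
Proof.
by rewrite /flat; case: ifP => t0; rewrite ?mulr0// exprS !mulrA mulfV ?mul1r// gt_eqF.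
Qed.

Lemma flat_bound m t : flat m t <= (m.+1)`!%:R.
Proof.
rewrite /flat; case: ifP => // t0; rewrite expRN ler_pdivrMr ?expR_gt0//.
have x0 : 0 <= t^-1 by rewrite invr_ge0 ltW.
case: m => [|m].
  by rewrite expr0 mul1r; have := expR_ge1Dx t^-1; lra.
have h := expR_ge1Dxn m x0.
have f0 : 0 < m.+1`!%:R :> R by rewrite ltr0n fact_gt0.
have h2 : t^-1 ^+ m.+1 <= m.+1`!%:R * expR t^-1.
  by rewrite -ler_pdivrMl// mulrC (le_trans _ h)// lerDr.
by apply: le_trans h2 _; rewrite ler_wpM2r ?expR_ge0// ler_nat factS leq_pmull.
Qed.

Definition dflat m t : R := - m%:R * flat m.+1 t + flat m.+2 t.

(** At 0 the difference quotient is h times the function of index m + 2, which is bounded, so it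
    tends to 0. *)
Lemma is_derive_flat m t : is_derive t 1 (flat m) (dflat m t).
Proof.
have [t0|t0|->] := ltgtP t 0.
- rewrite /dflat !flat_le0 ?(ltW t0)// mulr0 addr0.
  apply: (near_eq_is_derive (f := cst 0)).
  by near=> y; rewrite flat_le0//; apply/ltW; near: y; exact: lt_nbhsl.
- apply: (near_eq_is_derive (f := fun t => t^-1 ^+ m * expR (- t^-1))).
    by near=> y; rewrite /flat ifT//; near: y; exact: lt_nbhsr.
  have tn : t != 0 by rewrite gt_eqF.
  have d1 : is_derive t 1 (fun t : R => t^-1) (- t ^- 2).
    by have := is_deriveV tn (is_derive_id t 1); rewrite [_ *: _]mulr1.
  have d3 : is_derive t 1 (fun t : R => expR (- t^-1)) (expR (- t^-1) * t ^- 2).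
    have d2 : is_derive t 1 (fun t : R => - t^-1) (t ^- 2) by have := is_deriveN d1; rewrite opprK.
    exact: (@is_derive1_comp R expR (fun t => - t^-1) t _ _ (is_derive_expR (- t^-1)) d2).
  have -> : (fun t : R => t^-1 ^+ m * expR (- t^-1)) = (fun t : R => t^-1) ^+ m * (fun t => expR (- t^-1)).
    by apply/funext => x; rewrite mulrfctE exprfctE.
  apply: is_derive_eq (is_deriveM (is_deriveX m d1) d3) _; rewrite exprfctE.
  rewrite /dflat /flat t0 /GRing.scale/= -!exprVn.
  case: m => [|m]; first by rewrite !expr0; ring.
  by rewrite !exprS /=; ring.
- rewrite /dflat !flat_le0// mulr0 addr0.
  have L : h^-1 *: (flat m (h *: 1 + 0) - flat m 0) @[h --> (0 : R)^'] --> (0 : R).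
    apply/cvgr0Pnorm_lt => e e0; near=> h.
    have h0 : h != 0 by near: h; exact: nbhs_dnbhs_neq.
    have he : `|h| < e / (m.+3)`!%:R.
      by near: h; apply: dnbhs0_lt; rewrite divr_gt0// ltr0n fact_gt0.
    rewrite (flat_le0 m (lexx 0)) subr0 addr0 [h *: 1]mulr1 flat_mul flat_mul [_ *: _]mulKf//.
    move: he; rewrite ltr_pdivlMr ?ltr0n ?fact_gt0//; apply: le_lt_trans.
    by rewrite normrM ler_wpM2l// ger0_norm ?flat_ge0 ?flat_bound.
  apply: DeriveDef; first by apply/cvg_ex; exists 0.
  exact: cvg_lim L.
Unshelve. all: by end_near. Qed.

Lemma flat_lip t h : `|flat 0 t - flat 0 h| <= 6 * `|t - h|.
Proof.
wlog th : t h / h < t.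
  move=> W; have [/W//|/W|->] := ltgtP h t; last by rewrite !subrr normr0 mulr0.
  by rewrite distrC [`|h - t|]distrC.
have [|c _] := @MVT R (flat 0) (dflat 0) h t th (fun x _ => is_derive_flat 0 x).
  apply: continuous_subspaceT => x; apply: differentiable_continuous.
  by apply/derivable1_diffP; case: (is_derive_flat 0 x).
move=> ->; rewrite normrM ler_wpM2r// /dflat oppr0 mul0r add0r ger0_norm ?flat_ge0//.
by apply: le_trans (flat_bound _ _) _; rewrite (_ : 3`! = 6)%N.
Qed.

End flat_functions.

Section bumps.
Context {R : realType} {n : nat}.
Local Notation T := 'rV[R]_n.
Implicit Types (x y z : T) (e : R).

Definition bump_arg z e x : R := 1 - (e ^- 2) * \sum_i (x ord0 i - z ord0 i) ^+ 2.
Definition bump z e x : R := flat 0 (bump_arg z e x).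

Lemma bump_argE z e x : bump_arg z e x = 1 - (enorm (x - z) / e) ^+ 2.
Proof.
rewrite /bump_arg expr_div_n sqr_enorm mulrC; congr (1 - _ / _).
by apply: eq_bigr => i _; rewrite !mxE.
Qed.

Lemma mf1_bump z e : mf1 (bump z e).
Proof.
have -> : bump z e = fun x => flat 0 (1 - (enorm (x - z) / e) ^+ 2).
  by apply/funext => x; rewrite /bump bump_argE.
have mflat : mf1 (@flat R 0).
  apply: continuous_measurable_fun => x; apply: differentiable_continuous.
  by apply/derivable1_diffP; case: (is_derive_flat 0 x).
mauto.
Qed.

Lemma bump_ge0 z e x : 0 <= bump z e x. Proof. exact: flat_ge0. Qed.

Lemma bump_le1 z e x : bump z e x <= 1.
Proof. by apply: le_trans (flat_bound _ _) _; rewrite factE. Qed.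

Lemma bump0 z e x : 0 < e -> e <= enorm (x - z) -> bump z e x = 0.
Proof.
move=> e0 xz; rewrite /bump flat_le0// bump_argE subr_le0 exprn_ege1//.
by rewrite ler_pdivlMr// mul1r.
Qed.

(** The argument of [flat] is quadratic in the distance. Clamping the distance at e, where the bump
    already vanishes, makes it Lipschitz. *)
Lemma bump_lip z e x y : 0 < e -> `|bump z e x - bump z e y| <= 12 / e * enorm (x - y).
Proof.
move=> e0; pose m w : R := Num.min e (enorm (w - z)).
have bE w : bump z e w = flat 0 (1 - (m w / e) ^+ 2).
  rewrite /m; case: leP => h; last by rewrite /bump bump_argE.
  by rewrite bump0// divff ?gt_eqF// expr1n subrr flat_le0.
rewrite !bE; apply: le_trans (flat_lip _ _) _.
have mm w : 0 <= m w <= e by rewrite /m ge_min lexx/= le_min (ltW e0) enorm_ge0.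
have [/andP[x0 xe] /andP[y0 ye]] := (mm x, mm y).
have -> : 1 - (m x / e) ^+ 2 - (1 - (m y / e) ^+ 2) = (m y - m x) * ((m y + m x) / e ^+ 2).
  by field; rewrite gt_eqF.
have h1 : `|m y - m x| <= enorm (x - y).
  have -> : enorm (x - y) = enorm ((y - z) - (x - z)) by rewrite (enormB x) opprB addrA subrK.
  apply: le_trans (enorm_lip _ _); rewrite /m.
  by case: (leP e) => a; case: (leP e) => b; rewrite ler_norml; case: (ler0P (enorm (y - z) - enorm (x - z))) => ?; apply/andP; split; lra.
have h2 : 0 <= (m y + m x) / e ^+ 2 by rewrite divr_ge0 ?addr_ge0 ?sqr_ge0.
have h3 : (m y + m x) / e ^+ 2 <= 2 / e.
  rewrite ler_pdivrMr ?exprn_gt0// expr2 mulrA mulfVK ?gt_eqF//; lra.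
rewrite normrM (ger0_norm h2) [12 / e](_ : _ = 6 * (2 / e)); last by ring.
by rewrite -mulrA ler_pM2l// [leRHS]mulrC; apply: ler_pM.
Qed.

(** A class that contains the bump and is stable under partial derivatives; differentiability of all
    orders follows by induction without computing higher derivatives. *)
Inductive flat_class z e : (T -> R) -> Prop :=
| flat_class_flat m : flat_class z e (fun x => flat m (bump_arg z e x))
| flat_class_coord i : flat_class z e (fun x => x ord0 i)
| flat_class_cst c : flat_class z e (fun=> c)
| flat_classD f g : flat_class z e f -> flat_class z e g -> flat_class z e (fun x => f x + g x)
| flat_classM f g : flat_class z e f -> flat_class z e g -> flat_class z e (fun x => f x * g x).

Let derive_coord j (v x : T) : 'D_v (fun y : T => y ord0 j) x = v ord0 j.
Proof.
rewrite /derive; apply: cvg_lim => //; apply: cvg_near_cst; near=> h; have h0 : h != 0 by near: h; exact: nbhs_dnbhs_neq.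
by rewrite /= !mxE addrK [_ *: _]mulKf.
Unshelve. all: by end_near. Qed.

Let bump_arg_fctE z e : bump_arg z e =
  cst 1 - (e ^- 2) *: (\sum_(i < n) ((fun y : T => y ord0 i) - cst (z ord0 i)) ^+ 2).
Proof.
apply/funext => x; rewrite /bump_arg; congr (1 - _ * _).
by rewrite fct_sumE; apply: eq_bigr => i _; rewrite exprfctE.
Qed.

Let diff_term z i x : differentiable (((fun y : T => y ord0 i) - cst (z ord0 i)) ^+ 2) x.
Proof. by apply: differentiableX; apply: differentiableB => //; exact: differentiable_coord. Qed.

Lemma differentiable_bump_arg z e x : differentiable (bump_arg z e) x.
Proof.
rewrite bump_arg_fctE; apply: differentiableB => //; apply: differentiableZ.
by apply: differentiable_sum => i; exact: diff_term.
Qed.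

Lemma partial_bump_arg z e i x : partial i (bump_arg z e) x = - (2 * e ^- 2) * (x ord0 i - z ord0 i).
Proof.
have dc j : derivable (fun y : T => y ord0 j : R) x (delta_mx ord0 i).
  by apply: diff_derivable; exact: differentiable_coord.
have dt j : derivable (((fun y : T => y ord0 j) - cst (z ord0 j)) ^+ 2) x (delta_mx ord0 i).
  by apply: diff_derivable; exact: diff_term.
rewrite /partial bump_arg_fctE deriveB//; last first.
  by apply: derivableZ; exact: derivable_sum.
rewrite derive_cst sub0r deriveZ; last exact: derivable_sum.
rewrite derive_sum// (bigD1 i)//= big1 ?addr0 => [|j ji].
  rewrite deriveX//; last by apply: derivableB.
  rewrite deriveB// derive_coord derive_cst mxE !eqxx subr0.
  rewrite /GRing.scale/= expr1 [X in 2 * X](_ : _ = x ord0 i - z ord0 i)//.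
  by ring.
rewrite deriveX//; last by apply: derivableB.
rewrite deriveB// derive_coord derive_cst mxE (negbTE ji) andbF subr0.
by rewrite scaler0.
Qed.

Lemma flat_class_partial z e f : flat_class z e f ->
  (forall x, differentiable f x) /\ forall i, flat_class z e (partial i f).
Proof.
elim=> {f} [m|j|c|f g hf [df sf] hg [dg sg]|f g hf [df sf] hg [dg sg]].
- have dE x : differentiable (fun x => flat m (bump_arg z e x)) x.
    apply: differentiable_comp; first exact: differentiable_bump_arg.
    by apply/derivable1_diffP; case: (is_derive_flat m (bump_arg z e x)).
  split=> // i.
  have -> : partial i (fun x => flat m (bump_arg z e x)) = fun x =>
     (- m%:R * flat m.+1 (bump_arg z e x) + flat m.+2 (bump_arg z e x)) *
     (- (2 * e ^- 2) * (x ord0 i + - z ord0 i)).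
    apply/funext => x; rewrite -partial_bump_arg /partial deriveE// deriveE; last exact: differentiable_bump_arg.
    have df : derivable (flat m) (bump_arg z e x) 1 by case: (is_derive_flat m (bump_arg z e x)).
    rewrite (diff_comp (differentiable_bump_arg z e x)); last exact/derivable1_diffP.
    rewrite /= deriv1E// derive1E.
    by have [_ ->] := is_derive_flat m (bump_arg z e x); rewrite /GRing.scale/= mulrC.
  apply: flat_classM.
    apply: flat_classD; last exact: flat_class_flat.
    by apply: flat_classM; [exact: flat_class_cst|exact: flat_class_flat].
  apply: flat_classM; first exact: flat_class_cst.
  by apply: flat_classD; [exact: flat_class_coord|exact: flat_class_cst].
- split=> [x|i]; first exact: differentiable_coord.
  rewrite (_ : partial i _ = fun=> (i == j)%:R); first exact: flat_class_cst.
  by apply/funext => x; rewrite /partial derive_coord mxE eqxx eq_sym.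
- split=> [x|i]; first exact: differentiable_cst.
  rewrite (_ : partial i _ = fun=> 0); first exact: flat_class_cst.
  by apply/funext => x; rewrite /partial derive_cst.
- split=> [x|i]; first exact: differentiableD.
  rewrite (_ : partial i _ = fun x => partial i f x + partial i g x).
    exact: flat_classD.
  by apply/funext => x; rewrite /partial deriveD//; exact: diff_derivable.
- split=> [x|i]; first exact: differentiableM.
  rewrite (_ : partial i _ = fun x => f x * partial i g x + g x * partial i f x).
    by apply: flat_classD; exact: flat_classM.
  by apply/funext => x; rewrite /partial deriveM//; exact: diff_derivable.
Qed.

Lemma bump_test z e (Om : set T) : 0 < e -> (forall x, enorm (x - z) <= e -> Om x) ->
  test_function Om (bump z e).
Proof.
move=> e0 h; split.
  suff S k f : flat_class z e f -> Ck k f by move=> k; apply: S; exact: flat_class_flat.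
  elim: k f => [|k IH] f /flat_class_partial[df sf] /=.
    by move=> x; exact: differentiable_continuous.
  by split=> // i; exact: IH.
have b x : [set x | bump z e x != 0] x -> enorm (x - z) <= e.
  by rewrite /= => hx; rewrite leNgt; apply: contra_neqN hx => /ltW; exact: bump0.
split; first exact: (@compactly_contained_eball _ _ z e).
move=> x cx; apply: h; apply/ler_addgt0Pr => d d0; apply: closure_eball.
by apply: closure_subset cx => w /b; rewrite /eball /=; lra.
Qed.

End bumps.

(** * The nonlinear equation tested with bumps, and its localization *)

Section weak_solutions_tested_with_bumps.
Context {R : realType} {n : nat}.
Local Notation T := 'rV[R]_n.
Local Notation leb := (@lebesgue_rV R n).
Implicit Types (u v w g psi : T -> R) (F k : T -> T -> R) (s r t a b e : R) (Phi : R -> R).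

(* [pflux s Phi v x y * J s x y] is the flux of the equation, and a [flux] in the sense above. *)
Definition pflux s Phi v (x y : T) : R :=
  enorm (x - y) `^ s * Phi ((v x - v y) / enorm (x - y) `^ s).

(* A weak solution in the ball of center [x0] and radius [r], tested against bumps only. *)
Definition wsol (x0 : T) r s Phi v :=
  [/\ mf1 v, (exists a, energy_on (fun x => enorm (x - x0) < r) s v a),
    (exists a, I1 (fun x => \1[enorm (x - x0) < r] * v x ^+ 2) a),
    (exists a, I1 (fun x => `|v x| * wt s x) a) &
    forall z e, 0 < e -> enorm (z - x0) + e < r ->
    hasint2 (fun x y => pflux s Phi v x y * (bump z e x - bump z e y) * J s x y) 0].

Lemma mf1_structure Lambda Phi : structure_assumption Lambda Phi -> mf1 Phi.
Proof.
move=> [_ h _]; apply: continuous_measurable_fun => t; apply/cvgrPdist_lt => e e0.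
have [L0|L0] := leP Lambda 0.
  by apply: nearW => t'; rewrite (le_lt_trans (h _ _))// (le_lt_trans _ e0)// mulr_le0_ge0.
apply/nbhs_ballP; exists (e / Lambda); first by rewrite /= divr_gt0.
move=> t' /= tt'; apply: le_lt_trans (h _ _) _.
by rewrite mulrC -ltr_pdivlMr.
Qed.

Lemma mf2_pflux Lambda s Phi v : structure_assumption Lambda Phi -> mf1 v -> mf2 (pflux s Phi v).
Proof. by move=> /mf1_structure mP mv; rewrite /mf2 /pflux; mauto. Qed.

Lemma pflux_sym Lambda s Phi v x y : structure_assumption Lambda Phi ->
  pflux s Phi v y x = - pflux s Phi v x y.
Proof. by move=> [h _ _]; rewrite /pflux enormB -[v y - v x]opprB mulNr h mulrN. Qed.

Lemma enorm_powR_cases (x y : T) s : s != 0 -> x = y \/ 0 < enorm (x - y) `^ s.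
Proof.
move=> s0; have [->|xy] := eqVneq x y; [by left|right].
by rewrite powR_gt0// enorm_gt0 subr_eq0.
Qed.

(** Multiplying the values of [Phi] and dividing its arguments by the same |x - y|^s preserves the
    Lipschitz and monotonicity constants. With w = 0 this concerns one solution, in general the
    difference of two. *)
Lemma pflux_bounds Lambda s Phi v w x y : s != 0 -> structure_assumption Lambda Phi ->
  let d := (v x - v y) - (w x - w y) in let f := pflux s Phi v x y - pflux s Phi w x y in
  Lambda^-1 * d ^+ 2 <= f * d /\ `|f| <= Lambda * `|d|.
Proof.
move=> s0 [_ h1 h2]; have [->|p0] := enorm_powR_cases x y s0.
  have e : enorm (y - y) = 0 by rewrite subrr enorm0.
  by rewrite /= /pflux e powR0// !mul0r !subrr expr0n/= !mulr0 normr0 mulr0.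
rewrite /pflux /=; set p := _ `^ _ in p0 *; set a := v x - v y; set b := w x - w y.
have dE : (a - b) = p * (a / p - b / p) by field; rewrite gt_eqF.
rewrite -mulrBr dE; split.
  have := ler_wpM2l (sqr_ge0 p) (h2 (a / p) (b / p)); rewrite real_normK ?num_real//; nra.
rewrite !normrM (ger0_norm (ltW p0)) mulrCA; apply: ler_wpM2l; first exact: ltW.
exact: h1.
Qed.

Lemma flux_pfluxB Lambda s Phi v w : s != 0 -> structure_assumption Lambda Phi -> mf1 v -> mf1 w ->
  flux Lambda (fun x => v x - w x) (fun x y => pflux s Phi v x y - pflux s Phi w x y).
Proof.
move=> s0 hP mv mw; have m1 := mf2_pflux s hP mv; have m2 := mf2_pflux s hP mw.
split; first by mauto.
- move=> x y; have [h _] := @pflux_bounds Lambda s Phi v w x y s0 hP.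
  by have -> : v x - w x - (v y - w y) = v x - v y - (w x - w y) by ring.
- move=> x y; have [_ h] := @pflux_bounds Lambda s Phi v w x y s0 hP.
  by have -> : v x - w x - (v y - w y) = v x - v y - (w x - w y) by ring.
Qed.

Lemma pflux0 Lambda s Phi x y : structure_assumption Lambda Phi -> pflux s Phi (fun=> 0) x y = 0.
Proof.
move=> [h _ _]; rewrite /pflux subrr mul0r; have := h 0; rewrite oppr0 => e.
by rewrite (_ : Phi 0 = 0) ?mulr0//; move: e; qlra.
Qed.

Lemma flux_pflux Lambda s Phi v : s != 0 -> structure_assumption Lambda Phi -> mf1 v ->
  flux Lambda v (pflux s Phi v).
Proof.
move=> s0 hP mv; have [m1 m2 m3] := flux_pfluxB s0 hP mv (measurable_cst (0 : R)).
split; first exact: mf2_pflux hP mv.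
- by move=> x y; have := m2 x y; rewrite (pflux0 _ _ _ hP) !subr0.
- by move=> x y; have := m3 x y; rewrite (pflux0 _ _ _ hP) !subr0.
Qed.

Lemma wsol_mono (x0 x1 : T) r r1 s Phi v : s < 1 -> enorm (x1 - x0) + r1 <= r ->
  wsol x0 r s Phi v -> wsol x1 r1 s Phi v.
Proof.
move=> s1 hr [mv [a ha] [b hb] hc hd].
have sub x : enorm (x - x1) < r1 -> enorm (x - x0) < r.
  by move=> h; have := enorm_triangle x1 x x0; qlra.
split=> //.
- exists a; apply: ile_mono ha; first by move=> z; nneg.
  move=> [x y]/=; apply: ler_wpM2r; first by nneg.
  rewrite ler_nat; case: (boolP (_ && _)) => // /andP[h1 h2].
  by rewrite !sub.
- exists b; apply: ile_mono hb; first by move=> z; nneg.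
  move=> x; apply: ler_wpM2r; first by nneg.
  by rewrite ler_nat; case: (boolP (_ < r1)) => // h1; rewrite sub.
- move=> z e e0 ze; apply: hd => //.
  by have := enorm_triangle x1 z x0; qlra.
Qed.

Lemma structure_scale Lambda Phi (k : R) : k != 0 -> structure_assumption Lambda Phi ->
  structure_assumption Lambda (fun t => k * Phi (t / k)).
Proof.
move=> k0 [h1 h2 h3]; split.
- by move=> t; rewrite mulNr h1 mulrN.
- move=> t t'; rewrite -mulrBr normrM.
  apply: le_trans (ler_wpM2l (normr_ge0 k) (h2 _ _)) _.
  by rewrite -mulrBl normrM normfV mulrCA [`|k| * _]mulrCA mulfV ?mulr1// normr_eq0.
- move=> t t'; have := ler_wpM2l (sqr_ge0 k) (h3 (t / k) (t' / k)).
  rewrite -mulrBl normrM exprMn normfV exprVn (real_normK (num_real k)).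
  have -> : k ^+ 2 * (Lambda^-1 * (`|t - t'| ^+ 2 / k ^+ 2)) = Lambda^-1 * `|t - t'| ^+ 2.
    by rewrite mulrCA [k ^+ 2 * _]mulrCA mulfV ?expf_neq0// mulr1.
  have -> : k ^+ 2 * ((Phi (t / k) - Phi (t' / k)) * ((t - t') / k)) =
    (k * Phi (t / k) - k * Phi (t' / k)) * (t - t') by field.
  by [].
Qed.

Lemma bump_affine (x0 z x : T) r e : 0 < r ->
  bump (x0 + r *: z) (r * e) (x0 + r *: x) = bump z e x.
Proof.
move=> r0; rewrite /bump !bump_argE; congr (flat 0 (1 - _ ^+ 2)).
have -> : x0 + r *: x - (x0 + r *: z) = r *: (x - z).
  by rewrite opprD addrACA subrr add0r scalerBr.
by rewrite enormZ (gtr0_norm r0) invfM mulrACA mulfV ?mul1r// gt_eqF.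
Qed.

Lemma wt_affine s (x0 x : T) r : 0 < s < 1 -> 0 < r ->
  wt s x <= (1 + enorm x0 + r) ^+ (n + 2) * wt s (x0 + r *: x).
Proof.
move=> /andP[s_0 s1] r0; set A := 1 + enorm x0 + r.
have A1 : 1 <= A by rewrite /A -addrA lerDl addr_ge0 ?enorm_ge0 ?(ltW r0).
have A0 : 0 < A by exact: lt_le_trans A1.
have x1 : 0 < 1 + enorm x by rewrite ltr_pwDl ?enorm_ge0.
have X1 : 0 < 1 + enorm (x0 + r *: x) by rewrite ltr_pwDl ?enorm_ge0.
have h : 1 + enorm (x0 + r *: x) <= A * (1 + enorm x).
  have := enormD x0 (r *: x); rewrite enormZ (gtr0_norm r0) /A => h1.
  have : 0 <= (1 + enorm x0) * enorm x by rewrite mulr_ge0 ?enorm_ge0// addr_ge0 ?enorm_ge0.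
  have := enorm_ge0 x0; move: h1 r0; rewrite !mulrDl !mulrDr; qlra.
have p0 : 0 <= n%:R + 2 * s by rewrite addr_ge0// mulr_ge0// ltW.
rewrite /wt /Jr mulrCA; apply: ler_wpM2l; first by rewrite subr_ge0 ltW.
rewrite -ler_pdivrMr ?invr_gt0 ?powR_gt0// invrK mulrC.
apply: (@le_trans _ _ (A `^ (n%:R + 2 * s))); last first.
  rewrite -powR_mulrn ?(ltW A0)// natrD ler_powR// lerD2l; qlra.
rewrite ler_pdivrMr ?powR_gt0// -powRM ?(ltW A0) ?(ltW x1)//.
by apply: ler_powR2 => //; exact: ltW.
Qed.

Lemma tail_affine s (x0 : T) r v a : 0 < s < 1 -> 0 < r -> mf1 v ->
  I1 (fun x => `|v x| * wt s x) a ->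
  I1 (fun x => `|v (x0 + r *: x)| * wt s x) ((1 + enorm x0 + r) ^+ (n + 2) * (r ^- n * a)).
Proof.
move=> ss r0 mv ha; have [s_0 s1] := andP ss.
have mh : mf1 (fun x => `|v x| * wt s x) by mauto.
have h0 (x : T) : 0 <= `|v x| * wt s x by nneg.
apply: (ile_mono_scale _ _ _ _ _ (I1_affine x0 r0 mh h0 ha)).
- by rewrite exprn_ge0 ?addr_ge0 ?enorm_ge0 ?(ltW r0).
- mauto.
- by nneg.
- by nneg.
- by move=> x; rewrite [leRHS]mulrCA; apply: ler_wpM2l => //; exact: wt_affine.
Qed.

(** [Phi] becomes k Phi (t / k) with k = lam r^s, which satisfies the structure assumption with the
    same Lambda. The bumps are mapped to bumps. *)
Lemma wsol_affine Lambda (x0 : T) r s Phi v lam m : 0 < s < 1 -> 0 < r -> lam != 0 ->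
  structure_assumption Lambda Phi -> wsol x0 r s Phi v -> exists Phi',
  structure_assumption Lambda Phi' /\ wsol 0 1 s Phi' (fun x => lam * (v (x0 + r *: x) - m)).
Proof.
move=> ss r0 l0 hP [mv [a ha] [b hb] [c hc] hd]; have [s_0 s1] := andP ss.
have k0 : lam * r `^ s != 0 by rewrite mulf_neq0// gt_eqF// powR_gt0.
exists (fun t => lam * r `^ s * Phi (t / (lam * r `^ s))); split; first exact: structure_scale.
have eB (x : T) : (enorm (x0 + r *: x - x0) < r) = (enorm (x - 0) < 1).
  by rewrite addrAC subrr add0r subr0 enormZ (gtr0_norm r0) gtr_pMr.
split.
- mauto.
- exists (lam ^+ 2 * r `^ (n%:R + 2 * s) * (r ^- n * (r ^- n * a))).
  have mk : mf2 (fun x y => \1[(enorm (x - x0) < r) && (enorm (y - x0) < r)] * ((v x - v y) ^+ 2 * J s x y)) by mauto.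
  have k1 x y : 0 <= \1[(enorm (x - x0) < r) && (enorm (y - x0) < r)] * ((v x - v y) ^+ 2 * J s x y) by nneg.
  apply: (ile_mono_scale _ _ _ _ _ (I2_affine x0 r0 mk k1 ha)).
  + by nneg.
  + mauto.
  + by move=> z; nneg.
  + by move=> z; nneg.
  + move=> [x y]/=; rewrite !eB (J_affine s x0 x y r0) le_eqVlt; apply/orP; left; apply/eqP.
    have -> : lam * (v (x0 + r *: x) - m) - lam * (v (x0 + r *: y) - m) = lam * (v (x0 + r *: x) - v (x0 + r *: y)) by ring.
    by rewrite exprMn; ring.
- have mk : mf1 (fun x : T => \1[enorm (x - x0) < r] * v x ^+ 2) by mauto.
  have k1 (x : T) : 0 <= \1[enorm (x - x0) < r] * v x ^+ 2 by nneg.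
  exists (2 * lam ^+ 2 * (r ^- n * b) + 2 * lam ^+ 2 * m ^+ 2 * (1 ^+ n * @unit_volume R n)).
  apply: (ile_mono_lin2 _ _ _ _ _ _ _ _ (I1_affine x0 r0 mk k1 hb) (I1_ball 0 ltr01)).
  + by nneg.
  + by nneg.
  + mauto.
  + mauto.
  + by nneg.
  + by nneg.
  + by nneg.
  + move=> x; rewrite eB; case: (_ < 1); rewrite ?mul0r ?mul1r ?mulr0 ?addr0//.
    by have := sqr_ge0 (lam * (v (x0 + r *: x) + m)); rewrite /= mulr1; nra.
- have [C [C0 hC]] := @wt_int R n s ss.
  have s11 : s <= s < 1 by rewrite lexx.
  exists (`|lam| * ((1 + enorm x0 + r) ^+ (n + 2) * (r ^- n * c)) + `|lam| * `|m| * C).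
  apply: (ile_mono_lin2 _ _ _ _ _ _ _ _ (tail_affine x0 ss r0 mv hc) (hC s s11)).
  + by [].
  + by nneg.
  + mauto.
  + mauto.
  + by nneg.
  + by nneg.
  + by nneg.
  + move=> x; rewrite [X in _ <= X + _]mulrA -mulrDl; apply: ler_wpM2r; first by nneg.
    by rewrite normrM -mulrDr; apply: ler_wpM2l => //; exact: ler_normB.
- move=> z e e0; rewrite subr0 => ze.
  have re : 0 < r * e by rewrite mulr_gt0.
  have := hd (x0 + r *: z) (r * e) re.
  rewrite addrAC subrr add0r enormZ (gtr0_norm r0) -mulrDr gtr_pMr// => /(_ ze) hi.
  have mp := mf2_pflux s hP mv; have mb := mf1_bump (x0 + r *: z) (r * e).
  have mk : mf2 (fun x y => pflux s Phi v x y * (bump (x0 + r *: z) (r * e) x - bump (x0 + r *: z) (r * e) y) * J s x y) by mauto.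
  have := hasintZ (lam * r `^ (n%:R + 2 * s)) (hasint2_affine x0 r0 mk hi); rewrite !mulr0.
  rewrite /hasint2; congr hasint; apply/funext => -[x y]/=.
  rewrite !bump_affine// (J_affine s x0 x y r0) /pflux.
  have -> : x0 + r *: x - (x0 + r *: y) = r *: (x - y) by rewrite opprD addrACA subrr add0r scalerBr.
  rewrite enormZ (gtr0_norm r0) powRM ?enorm_ge0 ?(ltW r0)//.
  have -> : lam * (v (x0 + r *: x) - m) - lam * (v (x0 + r *: y) - m) = lam * (v (x0 + r *: x) - v (x0 + r *: y)) by ring.
  set d := v _ - v _; set p := enorm _ `^ s.
  have -> : lam * d / p / (lam * r `^ s) = d / (r `^ s * p).
    by rewrite !invfM; have : r `^ s != 0 by [rewrite gt_eqF// powR_gt0]; move: (p^-1) (r `^ s) => q t t0; field; rewrite t0 l0.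
  by ring.
Qed.

(** The value 0 excludes infinite positive and negative parts, even both at once, as +oo - +oo is
    -oo by convention. So the weak formulation itself contains the integrability of its
    integrand. *)
Lemma hasint0 {d} {X : measurableType d} (mu : {measure set X -> \bar R}) (f : X -> R) :
  measurable_fun setT f -> (\int[mu]_x (f x)%:E = 0)%E -> hasint mu f 0.
Proof.
move=> mf f0; split=> //; have mfE : measurable_fun setT (EFin \o f) by exact/measurable_EFinP.
apply/integrableP; split=> //; move: f0; rewrite integralE.
have A0 : (0 <= \int[mu]_x ((EFin \o f)^\+ x))%E by apply: integral_ge0.
have B0 : (0 <= \int[mu]_x ((EFin \o f)^\- x))%E by apply: integral_ge0.
have -> : (\int[mu]_x `|(f x)%:E| = \int[mu]_x ((EFin \o f)^\+ x) + \int[mu]_x ((EFin \o f)^\- x))%E.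
  rewrite -ge0_integralD//; last 2 first.
  - exact: measurable_funepos.
  - exact: measurable_funeneg.
  by apply: eq_integral => x _; rewrite -[RHS]/(((EFin \o f)^\+ \+ (EFin \o f)^\-) x)%E -fune_abse.
move: A0 B0; rewrite -[(fun x : X => (f x)%:E)]/(EFin \o f).
by case: (\int[mu]_x _)%E => [p| |]; case: (\int[mu]_x _)%E => [q| |]//= _ _ _; rewrite ltry.
Qed.

Lemma ile_ex {d} {X : measurableType d} (mu : {measure set X -> \bar R}) (f : X -> R) :
  (forall x, 0 <= f x) -> (\int[mu]_x (f x)%:E < +oo)%E -> exists a, ile mu f a.
Proof.
move=> f0 h; exists (fine (\int[mu]_x (f x)%:E)); rewrite /ile fineK// ge0_fin_numE//.
by apply: integral_ge0 => x _; rewrite lee_fin.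
Qed.

Lemma ile_restrict {d} {X : measurableType d} (mu : {measure set X -> \bar R}) (D : set X) (f g : X -> R) :
  (forall x, 0 <= g x) -> (forall x, 0 <= f x) -> (forall x, D x -> g x <= f x) -> (forall x, ~ D x -> g x = 0) ->
  (\int[mu]_(x in D) (f x)%:E < +oo)%E -> exists a, ile mu g a.
Proof.
move=> g0 f0 gf gD; rewrite integral_mkcond => h; apply: ile_ex => //; apply: le_lt_trans h.
apply: ge0_mono_integral => x; first by rewrite lee_fin.
rewrite patchE; case: (boolP (x \in D)); first by rewrite inE lee_fin => /gf.
by move=> /negP xD; rewrite gD// => Dx; apply: xD; rewrite inE.
Qed.

(** Multiplying and dividing by |x - y|^s turns the given double integral into the form with [pflux]
    and [J]; the latter absorbs the factor 1 - s. *)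
Lemma wsol_of_weak_solution Lambda Om (x0 : T) r s Phi u : 0 < s < 1 -> 0 < r ->
  structure_assumption Lambda Phi -> weak_solution s Phi Om u ->
  compactly_contained (eball x0 r) Om -> wsol x0 r s Phi u.
Proof.
move=> ss r0 hP [hW [mu _ ht] htest] hc; have [s_0 s1] := andP ss.
have [_ h2 h3] := hW _ (@open_eball _ _ x0 r) hc.
have p0 (x y : T) : 0 <= (u x - u y) ^+ 2 / enorm (x - y) `^ (n%:R + 2 * s).
  by rewrite divr_ge0 ?sqr_ge0 ?powR_ge0.
split=> //.
- apply: (@ile_restrict _ _ _ (eball x0 r `*` eball x0 r)
    (fun z : T * T => (u z.1 - u z.2) ^+ 2 / enorm (z.1 - z.2) `^ (n%:R + 2 * s))) => //.
  + by move=> z; nneg.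
  + move=> [x y]/= [/= xb yb]; rewrite /eball/= in xb yb; rewrite xb yb mul1r /J /Jr.
    rewrite mulrCA ler_piMl//; qlra.
  + move=> [x y]/=; rewrite /eball/= => h; case: (boolP (_ && _)); last by rewrite mul0r.
    by move=> /andP[h4 h5]; case: h.
- apply: (@ile_restrict _ _ _ (eball x0 r) (fun x : T => u x ^+ 2)) => //.
  + by nneg.
  + by move=> x; exact: sqr_ge0.
  + by move=> x xb; rewrite /eball/= in xb; rewrite xb mul1r.
  + by move=> x; rewrite /eball/= => /negP/negbTE ->; rewrite mul0r.
- apply: ile_ex; first by nneg.
  apply: le_lt_trans ht; apply: ge0_mono_integral => x; first by rewrite lee_fin; nneg.
  rewrite lee_fin powRN; apply: ler_wpM2l => //; rewrite /wt /Jr ler_piMl ?invr_ge0 ?powR_ge0//; qlra.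
- move=> z e e0 ze; have tb : test_function Om (bump z e).
    apply: bump_test => // x xz; case: hc => _; apply; apply: subset_closure; rewrite /eball/=.
    by have := enorm_triangle z x x0; qlra.
  have mP := mf1_structure hP; have mb := mf1_bump z e.
  have := htest _ tb; rewrite /weak_form => /eqP; rewrite mule_eq0 eqe subr_eq0 [1 == s]eq_sym (lt_eqF s1)/= => /eqP h0.
  have h1 : hasint (leb \x leb)%E (fun z0 : T * T => Phi ((u z0.1 - u z0.2) / enorm (z0.1 - z0.2) `^ s) *
       ((bump z e z0.1 - bump z e z0.2) / enorm (z0.1 - z0.2) `^ s) / enorm (z0.1 - z0.2) ^+ n) 0.
    by apply: hasint0 => //; mauto.
  have := hasintZ (1 - s) h1; rewrite mulr0; congr hasint; apply/funext => -[x y]/=.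
  have [->|xy] := eqVneq x y; first by rewrite !subrr !(mul0r, mulr0).
  have q0 : 0 < enorm (x - y) by rewrite enorm_gt0 subr_eq0.
  have qs : enorm (x - y) `^ s != 0 by rewrite gt_eqF// powR_gt0.
  have qn : enorm (x - y) ^+ n != 0 by rewrite gt_eqF// exprn_gt0.
  rewrite /pflux /J /Jr powRDp// powR_mulrn ?(ltW q0)// [2 * s]mulr_natl mulr2n powRDp//.
  move: qs qn (Phi _); set p := _ `^ s; set q := _ ^+ n => qs qn P.
  by field; rewrite qs qn.
Qed.

End weak_solutions_tested_with_bumps.

Section signed_fubini.
Context {R : realType} {n : nat}.
Local Notation T := 'rV[R]_n.
Local Notation leb := (@lebesgue_rV R n).
Implicit Types (f : T -> R) (k : T -> T -> R) (a b : R).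

Lemma hasint2_fubini k f a : hasint2 k a -> (forall x, hasint1 (k x) (f x)) -> hasint1 f a.
Proof.
move=> [ki ka] h; have fE : (fun x => \int[leb]_y (k x y)%:E)%E = (fun x => (f x)%:E).
  by apply/funext => x; have [_ ->] := h x.
split; first by rewrite -fE; exact: integrable_fubini_F ki.
by rewrite -ka -(integral12_prod_meas1 ki) /fubini_F; apply: eq_integral => x _; have [_ ->] := h x.
Qed.

Lemma hasint2_swap k a : mf2 k -> hasint2 k a -> hasint2 (fun x y => k y x) a.
Proof.
move=> mk [ki ka].
have [b hb] : exists b, I2 (fun x y => `|k x y|) b.
  by apply: ile_ex => //; case/integrableP: ki.
have mk' : mf2 (fun x y => k y x) by mauto.
have ki' : (leb \x leb)%E.-integrable setT (fun z : T * T => (k z.2 z.1)%:E).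
  apply: (integrable_of_ile (g := fun z : T * T => `|k z.2 z.1|)) => //.
  have mabs : mf2 (fun x y => `|k x y|) by mauto.
  exact: (@I2_swap R n (fun x y => `|k x y|) b mabs (fun _ _ => normr_ge0 _) hb).
split=> //; rewrite -ka -(integral21_prod_meas1 ki') -(integral12_prod_meas1 ki).
by apply: eq_integral.
Qed.

Lemma hasint_eq {d} {X : measurableType d} (mu : {measure set X -> \bar R}) (f g : X -> R) a :
  (forall x, f x = g x) -> hasint mu f a -> hasint mu g a.
Proof. by move=> /funext ->. Qed.

Lemma hasint_of_ile {d} {X : measurableType d} (mu : {measure set X -> \bar R}) (f g : X -> R) a :
  measurable_fun setT f -> (forall x, `|f x| <= g x) -> ile mu g a -> exists b, hasint mu f b.
Proof. by move=> mf fg hg; apply: hasint_ex; exact: integrable_of_ile hg. Qed.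

End signed_fubini.

Section cutoff.
Context {R : realType} {n : nat}.
Local Notation T := 'rV[R]_n.
Local Notation leb := (@lebesgue_rV R n).
Implicit Types (u v w g psi : T -> R) (F k : T -> T -> R) (s r t a b c e p q : R) (Phi : R -> R).
Variable Lambda s0 : R.
Hypothesis Lambda1 : 1 <= Lambda.
Hypothesis s01 : 0 < s0 < 1.

Let s0_gt0 : 0 < s0. Proof. by case/andP: s01. Qed.
Let Lambda0 : 0 < Lambda. Proof. exact: lt_le_trans Lambda1. Qed.
Let N := (n + 2)%N.

(** After r1^-q is factored out, (r1 / r2)^(n+2) <= (r1 / r2)^q and Bernoulli's inequality give a
    constant free of q, hence uniform in s. *)
Lemma powRN_lip (q r1 r2 : R) : 0 <= q -> q <= N%:R -> 4^-1 <= r1 -> 4^-1 <= r2 ->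
  `|r1 `^ (- q) - r2 `^ (- q)| <= 4 * N%:R * `|r1 - r2| * (Num.min r1 r2) `^ (- q).
Proof.
wlog r12 : r1 r2 / r1 <= r2.
  move=> H q0 qN h1 h2; have /orP[r12|r12] := le_total r1 r2; first exact: H.
  by rewrite distrC [`|r1 - r2|]distrC [Num.min r1 r2]minC; exact: H.
move=> q0 qN h1 h2.
have p1 : 0 < r1 by apply: lt_le_trans h1; rewrite invr_gt0.
have p2 : 0 < r2 by apply: lt_le_trans h2; rewrite invr_gt0.
rewrite (min_l r12).
have tE : r2 `^ (- q) = r1 `^ (- q) * (r1 / r2) `^ q.
  have e1 : r1 `^ (- q) * r1 `^ q = 1 by rewrite -powRD ?(gt_eqF p1) ?implybT// addNr powRr0.
  rewrite powRM ?invr_ge0 ?(ltW p1) ?(ltW p2)// [RHS]mulrA e1 mul1r.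
  by rewrite -powR_inv1 ?(ltW p2)// -powRrM mulN1r.
have t0 : 0 < r1 / r2 by rewrite divr_gt0.
have t1 : r1 / r2 <= 1 by rewrite ler_pdivrMr// mul1r.
have bern : 1 - (r1 / r2) `^ q <= N%:R * (1 - r1 / r2).
  have h : (r1 / r2) ^+ N <= (r1 / r2) `^ q.
    by rewrite -powR_mulrn ?(ltW t0)//; apply: ger_powR => //; rewrite t0.
  have : 1 - N%:R * (1 - r1 / r2) <= (r1 / r2) ^+ N.
    move: (r1 / r2) t0 t1 => t t0 t1 {h}; elim: N => [|k IH]; first by rewrite mul0r subr0 expr0.
    rewrite exprS -natr1; have := ler_wpM2l (ltW t0) IH; have := mulr_ge0 (ler0n R k) (sqr_ge0 (1 - t)).
    by rewrite expr2; qlra.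
  qlra.
rewrite tE -{1}[r1 `^ (- q)]mulr1 -mulrBr normrM (ger0_norm (powR_ge0 _ _)) mulrC.
apply: ler_wpM2r; first exact: powR_ge0.
have q1 : (r1 / r2) `^ q <= 1.
  by rewrite -[leRHS](congr1 (fun f => f q) (powR1 R)) ler_powR2 ?(ltW t0).
rewrite ger0_norm ?subr_ge0//; apply: le_trans bern _.
rewrite [4 * _]mulrC -mulrA; apply: ler_wpM2l => //.
rewrite ler0_norm ?subr_le0// opprB.
have -> : 1 - r1 / r2 = (r2 - r1) / r2 by field; rewrite gt_eqF.
by rewrite mulrC ler_wpM2r ?subr_ge0// -[leRHS]invrK lef_pV2 ?posrE ?invr_gt0.
Qed.

(* The kernel of the equation as a function of the increment [p] and the distance [r]. *)
Definition kerH s Phi p r := Phi (p / r `^ s) * r `^ (- (n%:R + s)).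

Lemma kerHE s Phi v (x y : T) : x != y ->
  pflux s Phi v x y * J s x y = (1 - s) * kerH s Phi (v x - v y) (enorm (x - y)).
Proof.
move=> xy; have q0 : 0 < enorm (x - y) by rewrite enorm_gt0 subr_eq0.
rewrite /pflux /kerH /J /Jr powRN.
have -> : n%:R + 2 * s = s + (n%:R + s) by ring.
rewrite powRDp//; have := gt_eqF (powR_gt0 s q0); have := gt_eqF (powR_gt0 (n%:R + s) q0).
by move: (_ `^ s) (_ `^ (_ + _)) => a b /negbT a0 /negbT b0; field; rewrite a0 b0.
Qed.

(** Change first the increment, then the distance inside [Phi], then the distance in the outer
    factor. In the application Y = 1 + |t| for a far point t. *)
Lemma kerH_lip s Phi p1 p2 r1 r2 Y : 0 < s < 1 -> structure_assumption Lambda Phi -> 1 <= Y ->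
  Y / 6 <= r1 -> Y / 6 <= r2 -> 4^-1 <= r1 -> 4^-1 <= r2 ->
  `|kerH s Phi p1 r1 - kerH s Phi p2 r2| <=
  Lambda * 6 ^+ (2 * N) * (8 * N%:R + 1) * (`|p1 - p2| + `|p2| * `|r1 - r2|) * Y `^ (- (n%:R + 2 * s)).
Proof.
move=> /andP[s_0 s1] hP Y1 hr1 hr2 h1 h2; have [odd lip _] := hP.
have Y0 : 0 < Y by exact: lt_le_trans Y1.
have P0 : Phi 0 = 0 by have := odd 0; rewrite oppr0; qlra.
have p1' : 0 < r1 by apply: lt_le_trans h1; rewrite invr_gt0.
have p2' : 0 < r2 by apply: lt_le_trans h2; rewrite invr_gt0.
have low r q : 0 < r -> Y / 6 <= r -> 0 <= q -> q <= N%:R -> r `^ (- q) <= 6 ^+ N * Y `^ (- q).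
  move=> r0 Yr q0 qN; apply: (@le_trans _ _ ((Y / 6) `^ (- q))).
    rewrite !powRN lef_pV2 ?posrE ?powR_gt0 ?divr_gt0//.
    by apply: ler_powR2 => //; rewrite divr_ge0// ltW.
  rewrite powRM ?invr_ge0 ?(ltW Y0)// mulrC ler_wpM2r ?powR_ge0//.
  rewrite -powR_inv1// -powRrM mulN1r opprK -powR_mulrn//.
  by rewrite ler_powR// ler1n.
have N0 : 0 <= N%:R :> R by [].
have nsN : n%:R + s <= N%:R by rewrite /N natrD; qlra.
have ns0 : 0 <= n%:R + s by rewrite addr_ge0// ltW.
have sN : s <= N%:R by apply: le_trans nsN; rewrite lerDr.
set A := Y `^ (- s); set B := Y `^ (- (n%:R + s)).
have AB : A * B = Y `^ (- (n%:R + 2 * s)).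
  have -> : - (n%:R + 2 * s) = - s + - (n%:R + s) by ring.
  by rewrite powRD ?(gt_eqF Y0) ?implybT.
have A0 : 0 <= A by exact: powR_ge0.
have B0 : 0 <= B by exact: powR_ge0.
have S0 : 0 <= (6 : R) ^+ N by [].
have a1 := low r1 s p1' hr1 (ltW s_0) sN.
have a2 := low r2 s p2' hr2 (ltW s_0) sN.
have b1 := low r1 _ p1' hr1 ns0 nsN.
have b2 := low r2 _ p2' hr2 ns0 nsN.
have mE q : 0 <= q -> q <= N%:R -> (Num.min r1 r2) `^ (- q) <= 6 ^+ N * Y `^ (- q).
  by move=> q0 qN; apply: low => //; [rewrite lt_min p1'|rewrite le_min hr1].
have da := powRN_lip (ltW s_0) sN h1 h2.
have db := powRN_lip ns0 nsN h1 h2.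
have K0 : 0 <= 4 * N%:R * `|r1 - r2| by rewrite !mulr_ge0.
have {}da := le_trans da (ler_wpM2l K0 (mE _ (ltW s_0) sN)).
have {}db := le_trans db (ler_wpM2l K0 (mE _ ns0 nsN)).
rewrite -/A in a1 a2 da; rewrite -/B in b1 b2 db.
have i1 : kerH s Phi p1 r1 - kerH s Phi p2 r2 =
  (Phi (p1 * r1 `^ (- s)) - Phi (p2 * r1 `^ (- s))) * r1 `^ (- (n%:R + s)) +
  (Phi (p2 * r1 `^ (- s)) - Phi (p2 * r2 `^ (- s))) * r1 `^ (- (n%:R + s)) +
  (Phi (p2 * r2 `^ (- s)) - Phi 0) * (r1 `^ (- (n%:R + s)) - r2 `^ (- (n%:R + s))).
  by rewrite /kerH P0 -!powRN; ring.
rewrite i1; set E := `|p1 - p2| + _.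
have t1 : `|(Phi (p1 * r1 `^ (- s)) - Phi (p2 * r1 `^ (- s))) * r1 `^ (- (n%:R + s))| <=
   Lambda * (`|p1 - p2| * (6 ^+ N * A)) * (6 ^+ N * B).
  rewrite normrM; apply: ler_pM => //; last by rewrite ger0_norm ?powR_ge0.
  apply: le_trans (lip _ _) _; rewrite ler_pM2l// -mulrBl normrM ler_wpM2l//.
  by rewrite ger0_norm ?powR_ge0.
have t2 : `|(Phi (p2 * r1 `^ (- s)) - Phi (p2 * r2 `^ (- s))) * r1 `^ (- (n%:R + s))| <=
   Lambda * (`|p2| * (4 * N%:R * `|r1 - r2| * (6 ^+ N * A))) * (6 ^+ N * B).
  rewrite normrM; apply: ler_pM => //; last by rewrite ger0_norm ?powR_ge0.
  by apply: le_trans (lip _ _) _; rewrite ler_pM2l// -mulrBr normrM ler_wpM2l.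
have t3 : `|(Phi (p2 * r2 `^ (- s)) - Phi 0) * (r1 `^ (- (n%:R + s)) - r2 `^ (- (n%:R + s)))| <=
   Lambda * (`|p2| * (6 ^+ N * A)) * (4 * N%:R * `|r1 - r2| * (6 ^+ N * B)).
  rewrite normrM; apply: ler_pM => //.
  apply: le_trans (lip _ _) _; rewrite ler_pM2l// subr0 normrM ler_wpM2l//.
  by rewrite ger0_norm ?powR_ge0.
apply: le_trans (ler_normD _ _) _; apply: le_trans (lerD (ler_normD _ _) (lexx _)) _.
apply: le_trans (lerD (lerD t1 t2) t3) _; rewrite -AB.
have -> : Lambda * (`|p1 - p2| * (6 ^+ N * A)) * (6 ^+ N * B) +
   Lambda * (`|p2| * (4 * N%:R * `|r1 - r2| * (6 ^+ N * A))) * (6 ^+ N * B) +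
   Lambda * (`|p2| * (6 ^+ N * A)) * (4 * N%:R * `|r1 - r2| * (6 ^+ N * B)) =
   Lambda * (6 ^+ N * 6 ^+ N) * (`|p1 - p2| + 8 * N%:R * (`|p2| * `|r1 - r2|)) * (A * B) by ring.
have -> : (6 : R) ^+ (2 * N) = 6 ^+ N * 6 ^+ N by rewrite mul2n -addnn exprD.
apply: ler_wpM2r; first exact: mulr_ge0.
rewrite -[leRHS]mulrA; apply: ler_wpM2l; first by rewrite !mulr_ge0// ltW.
rewrite /E; have := normr_ge0 (p1 - p2).
have : 0 <= `|p2| * `|r1 - r2| by rewrite mulr_ge0.
by move: N0; move: `|p1 - p2| (`|p2| * `|r1 - r2|) (N%:R) => X Z M M0 Z0 X0; nra.
Qed.

(* [f] comes from replacing [v x - v y] by [w x - w y] in the equation of [v]: near the origin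
   they differ only for [y] away from [x], where the kernel is Lipschitz. *)
Lemma cutoff : exists K : R, 0 <= K /\ forall s Phi v c, s0 <= s < 1 ->
  structure_assumption Lambda Phi -> wsol (0 : T) 1 s Phi v -> I1 (fun x => `|v x| * wt s x) c ->
  let w := fun x => cut 0 2^-1 (3 / 4) x * v x in
  adm s (0 : T) 1 w /\ exists f,
  [/\ mf1 f, (forall x, enorm x < 4^-1 -> `|f x| <= K * c),
    (forall x y, enorm x < 4^-1 -> enorm y < 4^-1 ->
      `|f x - f y| <= K * (`|v x - v y| + (`|v y| + c) * enorm (x - y))) &
    forall z e, 0 < e -> enorm z + e < 4^-1 -> exists a,
      hasint2 (fun x y => pflux s Phi w x y * (bump z e x - bump z e y) * J s x y) a /\
      hasint1 (fun x => f x * bump z e x) a].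
Proof.
have [Cw [Cw0 hCw]] := @wt_int R n s0 s01.
have [M [M0 ME]] : exists M : R, 0 <= M /\ M = Lambda * 6 ^+ N by exists (Lambda * 6 ^+ N); rewrite mulr_ge0 ?exprn_ge0 ?(ltW Lambda0).
have [H [H0 HE]] : exists H : R, 0 <= H /\ H = Lambda * 6 ^+ (2 * N) * (8 * N%:R + 1).
  by exists (Lambda * 6 ^+ (2 * N) * (8 * N%:R + 1)); rewrite !mulr_ge0 ?exprn_ge0 ?addr_ge0 ?mulr_ge0 ?(ltW Lambda0).
have [K [K0 [KM [KH KHC]]]] : exists K : R, 0 <= K /\ 2 * M <= K /\ 4 * H <= K /\ 4 * H * Cw <= K.
  exists (2 * M + 4 * H + 4 * H * Cw).
  by have := mulr_ge0 H0 Cw0; rewrite -[4 * H * Cw]mulrA => ?; repeat split; qlra.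
exists K; split=> // s Phi v c ss hP [mv [ea hea] [eb heb] _ hb] hc w.
have [s0s s1] := andP ss; have s_0 : 0 < s by exact: lt_le_trans s0s.
have s_in : 0 < s < 1 by rewrite s_0.
have sn0 : s != 0 by rewrite gt_eqF.
have e34 : (2^-1 : R) < 3 / 4 by qlra.
have w01 (x : T) : 0 <= cut (0 : T) 2^-1 (3 / 4 : R) x <= 1 by rewrite cut_ge0 cut_le1.
have wL (x y : T) : `|cut 0 2^-1 (3 / 4) x - cut 0 2^-1 (3 / 4) y| <= (3 / 4 - 2^-1)^-1 * enorm (x - y).
  exact: cut_lip.
have hw : adm s (0 : T) 1 w.
  apply: (adm_cut_on s01 ss (mf1_cut _ _ _) mv w01 wL); [|by exists ea|by exists eb].
  by move=> x; rewrite subr0 => x1; rewrite cut0// subr0; qlra.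
split=> //.
have [mw _ _ _] := hw.
have wv x : enorm x < 2^-1 -> w x = v x by move=> x1; rewrite /w cut1 ?mul1r// subr0 ltW.
have wlev x : `|w x - v x| <= `|v x|.
  have -> : w x - v x = - ((1 - cut 0 2^-1 (3 / 4) x) * v x) by rewrite /w; ring.
  rewrite normrN normrM ler_piMl// ger0_norm; have := w01 x; qlra.
have wle x : `|w x| <= `|v x|.
  by rewrite /w normrM ler_piMl// ger0_norm; have /andP[] := w01 x.
have c0 : 0 <= c by apply: ile_ge0 hc => x; nneg.
have [D DE] : exists D : T -> T -> R, forall x y, D x y = pflux s Phi w x y - pflux s Phi v x y by eexists.
have mpw := mf2_pflux s hP mw; have mpv := mf2_pflux s hP mv.
have mD : mf2 D by apply: (eq_mf2 DE); mauto.
have Dsym x y : D y x = - D x y.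
  by rewrite !DE (pflux_sym s w x y hP) (pflux_sym s v x y hP); ring.
(* For x near the origin w x = v x, so the two fluxes can differ only through the value at y, and
   only if |y| >= 1/2. *)
have Dle x y : enorm x < 4^-1 -> `|D x y| <= Lambda * (\1[2^-1 <= enorm y] * `|v y|).
  move=> x4; have [_ h] := @pflux_bounds R n Lambda s Phi w v x y sn0 hP.
  rewrite DE; apply: le_trans h _; rewrite ler_pM2l//.
  have x2 : enorm x < 2^-1 by qlra.
  rewrite (wv x x2); have -> : v x - w y - (v x - v y) = - (w y - v y) by ring.
  rewrite normrN; case: (leP 2^-1 (enorm y)) => y2 /=; first by rewrite mul1r.
  by rewrite wv// subrr normr0 mul0r.
have far (x y : T) : enorm x < 4^-1 -> 2^-1 <= enorm y -> 1 + enorm y <= 6 * enorm (x - y).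
  by move=> x4 y2; have := enormBle y x; rewrite enormB; qlra.
have [k kE] : exists k : T -> T -> R, forall x y, k x y = \1[enorm x < 4^-1] * (D x y * J s x y) by eexists.
have kE4 (z t : T) : enorm z < 4^-1 -> k z t = D z t * J s z t by move=> z4; rewrite kE z4 mul1r.
have mk : mf2 k by apply: (eq_mf2 kE); mauto.
have kle x y : `|k x y| <= M * (\1[enorm x < 4^-1] * (`|v y| * wt s y)).
  rewrite kE; case: ltP => x4 /=; last by rewrite !mul0r normr0 mulr0.
  rewrite !mul1r normrM [`|J _ _ _|]ger0_norm ?J_ge0// ME.
  have := Dle x y x4; case: (leP 2^-1 (enorm y)) => y2 /=; last first.
    rewrite mul0r mulr0 normr_le0 => /eqP ->; rewrite normr0 mul0r.
    by have := ltW Lambda0 => L0; nneg.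
  rewrite mul1r => h; have hJ := J_le_wt s_in (ler1n _ 6) (far x y x4 y2).
  rewrite [leRHS](_ : _ = Lambda * `|v y| * (6 ^+ N * wt s y)); last by ring.
  by apply: ler_pM => //; exact: J_ge0.
have khas x : exists b, hasint1 (k x) b.
  have mkx : mf1 (k x) by mauto.
  apply: (hasint_of_ile (g := fun y : T => M * (\1[enorm x < 4^-1] * (`|v y| * wt s y))) mkx (kle x)).
  apply: ile_scale => //; [mauto|by nneg|].
  by apply: (@ile_scale _ _ _ _ _ c) => //; [mauto|by nneg].
have [g hg] := boolp.choice khas.
have kint : exists b, hasint2 k b.
  have mk2 : measurable_fun setT (fun z : T * T => k z.1 z.2) by mauto.
  apply: (hasint_of_ile (g := fun z : T * T => M * (\1[enorm z.1 < 4^-1] * (`|v z.2| * wt s z.2))) mk2).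
    by move=> [x y]; exact: kle.
  apply: ile_scale => //; [mauto|by move=> z; nneg|].
  apply: (I2_prod (f := fun x : T => \1[enorm x < 4^-1]) (g := fun y : T => `|v y| * wt s y)) hc; try mauto; try by nneg.
  have r4 : 0 < 4^-1 :> R by rewrite invr_gt0.
  by apply: I1_eq (I1_ball (0 : T) r4) => x; rewrite subr0.
have [kk hkk] := kint.
have [gi ga] := hasint2_fubini hkk hg.
have mg : mf1 g by case/integrableP: gi => /measurable_EFinP.
(* [D] is antisymmetric and [J] symmetric, so the two terms of the increment of the bump contribute
   equally: hence the factor 2. *)
exists (fun x => 2 * g x); split.
- mauto.
- move=> x x4; rewrite normrM ger0_norm//.
  apply: (@le_trans _ _ (2 * (M * c))); last by rewrite mulrA ler_wpM2r.
  rewrite ler_pM2l//; apply: (hasint_abs_le (hg x) (g := fun y : T => M * (`|v y| * wt s y))); first by mauto.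
    by move=> y; have := kle x y; rewrite x4 mul1r.
  by apply: ile_scale => //; [mauto|by nneg].
- move=> x y x4 y4.
  have hd := hasintB (hg x) (hg y).
  rewrite -mulrBr normrM ger0_norm//.
  have [E EE] : exists E, E = `|v x - v y| + `|v y| * enorm (x - y) by eexists.
  have E0 : 0 <= E by rewrite EE addr_ge0// mulr_ge0 ?enorm_ge0.
  have hle : `|g x - g y| <= 2 * H * E * Cw + 2 * H * enorm (x - y) * c.
    apply: (hasint_abs_le hd (g := fun t : T => 2 * H * E * wt s t + 2 * H * enorm (x - y) * (`|v t| * wt s t))).
    - mauto.
    - move=> t; rewrite (kE4 _ t x4) (kE4 _ t y4).
      have [t2|t2] := ltP (enorm t) 2^-1.
        have D0 z : enorm z < 4^-1 -> D z t = 0.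
          by move=> z4; have := Dle z t z4; rewrite (leNgt 2^-1) t2/= mul0r mulr0 normr_le0 => /eqP.
        have E4 z : enorm z < 4^-1 -> D z t * J s z t = 0 by move=> z4; rewrite (D0 z z4) mul0r.
        rewrite (E4 x x4) (E4 y y4) subrr normr0.
        by have := enorm_ge0 (x - y) => ?; nneg.
      have neq z : enorm z < 4^-1 -> z != t by move=> z4; apply/eqP => zt; move: z4 t2; rewrite zt; qlra.
      have wx : w x = v x by apply: wv; qlra.
      have wy : w y = v y by apply: wv; qlra.
      (* The fluxes of w and v at (z, t) differ only in the increment, v z - w t against v z - v t;
         [kerH_lip] is applied to each of them separately. *)
      have DJ z : enorm z < 4^-1 -> w z = v z -> D z t * J s z t =
          (1 - s) * kerH s Phi (v z - w t) (enorm (z - t)) - (1 - s) * kerH s Phi (v z - v t) (enorm (z - t)).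
        by move=> z4 wz; rewrite DE mulrBl (kerHE s Phi w (neq z z4)) (kerHE s Phi v (neq z z4)) wz.
      rewrite (DJ x x4 wx) (DJ y y4 wy).
      set r1 := enorm (x - t); set r2 := enorm (y - t).
      have f1 := far x t x4 t2; have f2 := far y t y4 t2; rewrite -/r1 in f1; rewrite -/r2 in f2.
      have Y1 : 1 <= 1 + enorm t by rewrite lerDl enorm_ge0.
      have dr : `|r1 - r2| <= enorm (x - y).
        apply: le_trans (enorm_lip _ _) _; rewrite (_ : x - t - (y - t) = x - y)//.
        by rewrite opprB addrA subrK.
      have l1 := @kerH_lip s Phi (v x - w t) (v y - w t) r1 r2 _ s_in hP Y1 ltac:(qlra) ltac:(qlra) ltac:(qlra) ltac:(qlra).
      have l2 := @kerH_lip s Phi (v x - v t) (v y - v t) r1 r2 _ s_in hP Y1 ltac:(qlra) ltac:(qlra) ltac:(qlra) ltac:(qlra).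
      rewrite -HE in l1 l2.
      rewrite [X in `|X|](_ : _ = (1 - s) * ((kerH s Phi (v x - w t) r1 - kerH s Phi (v y - w t) r2) -
         (kerH s Phi (v x - v t) r1 - kerH s Phi (v y - v t) r2))); last first.
        by move: (kerH s Phi (v x - w t) r1) (kerH s Phi (v y - w t) r2) (kerH s Phi (v x - v t) r1) (kerH s Phi (v y - v t) r2) => p q p' q'; ring.
      rewrite normrM ger0_norm; last by rewrite subr_ge0 ltW.
      rewrite [leRHS](_ : _ = (1 - s) * (2 * H * (E + enorm (x - y) * `|v t|) * (1 + enorm t) `^ (- (n%:R + 2 * s)))); last first.
        by rewrite /wt /Jr powRN; ring.
      rewrite ler_pM2l ?subr_gt0//.
      apply: le_trans (ler_normB _ _) _.
      have P0 := powR_ge0 (1 + enorm t) (- (n%:R + 2 * s)).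
      have bb p : `|p| <= `|v t| -> H * (`|v x - p - (v y - p)| + `|v y - p| * `|r1 - r2|) * (1 + enorm t) `^ (- (n%:R + 2 * s)) <=
         H * (E + enorm (x - y) * `|v t|) * (1 + enorm t) `^ (- (n%:R + 2 * s)).
        move=> pv; apply: ler_wpM2r => //; apply: ler_wpM2l => //.
        have -> : v x - p - (v y - p) = v x - v y by ring.
        rewrite EE -addrA lerD2l.
        apply: le_trans (_ : _ <= (`|v y| + `|v t|) * enorm (x - y)) _.
          by apply: ler_pM => //; apply: le_trans (ler_normB _ _) _; rewrite lerD2l.
        by rewrite mulrDl [`|v t| * _]mulrC.
      apply: le_trans (lerD (le_trans l1 (bb _ (wle t))) (le_trans l2 (bb _ (lexx _)))) _.
      by rewrite le_eqVlt; apply/orP; left; apply/eqP; ring.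
    - have d0 := enorm_ge0 (x - y).
      apply: (ile_mono_lin2 _ _ _ _ _ _ _ _ (hCw s ss) hc).
      + by nneg.
      + by nneg.
      + mauto.
      + mauto.
      + by nneg.
      + by nneg.
      + by nneg.
      + by [].
  apply: le_trans (ler_wpM2l _ hle) _ => //.
  rewrite EE; have := enorm_ge0 (x - y) => d0.
  have e1 : 4 * H * Cw * (`|v x - v y| + `|v y| * enorm (x - y)) <= K * (`|v x - v y| + `|v y| * enorm (x - y)).
    by apply: ler_wpM2r KHC; nneg.
  have e2 : 4 * H * (enorm (x - y) * c) <= K * (enorm (x - y) * c).
    by apply: ler_wpM2r KH; nneg.
  rewrite [leLHS](_ : _ = 4 * H * Cw * (`|v x - v y| + `|v y| * enorm (x - y)) + 4 * H * (enorm (x - y) * c)); last by ring.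
  rewrite [leRHS](_ : _ = K * (`|v x - v y| + `|v y| * enorm (x - y)) + K * (enorm (x - y) * c)); last by ring.
  exact: lerD.
- move=> z e e0 ze.
  have mb := mf1_bump z e.
  have b4 x : 4^-1 <= enorm x -> bump z e x = 0.
    by move=> x4; rewrite bump0//; have := enormBle x z; qlra.
  have [k' k'E] : exists k' : T -> T -> R, forall x y, k' x y = k x y * bump z e x by eexists.
  have mk' : mf2 k' by apply: (eq_mf2 k'E); mauto.
  have [a ha] : exists a, hasint2 k' a.
    have [ki _] := hkk; have [b hb'] : exists b, I2 (fun x y => `|k x y|) b.
      by apply: ile_ex => //; case/integrableP: ki.
    have mk2 : measurable_fun setT (fun z : T * T => k' z.1 z.2) by mauto.
    apply: (hasint_of_ile (g := fun z : T * T => `|k z.1 z.2|) mk2) hb'.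
    move=> [x y]; rewrite k'E normrM ler_piMr// ger0_norm ?bump_ge0 ?bump_le1//.
  exists (0 + (a + a)); split.
    have h0 := hb z e e0; rewrite subr0 in h0; have {}h0 := h0 ltac:(qlra).
    apply: hasint_eq (hasintD h0 (hasintD ha (hasint2_swap mk' ha))) => -[x y]/=.
    rewrite !k'E !kE (J_sym s y x) (Dsym x y).
    have bx : \1[enorm x < 4^-1] * bump z e x = bump z e x.
      by case: ltP => x4; rewrite ?mul1r// mul0r b4.
    have bY : \1[enorm y < 4^-1] * bump z e y = bump z e y.
      by case: ltP => y4; rewrite ?mul1r// mul0r b4.
    have -> : \1[enorm x < 4^-1] * (D x y * J s x y) * bump z e x =
        (\1[enorm x < 4^-1] * bump z e x) * (D x y * J s x y) by ring.
    have -> : \1[enorm y < 4^-1] * (- D x y * J s x y) * bump z e y =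
        (\1[enorm y < 4^-1] * bump z e y) * (- D x y * J s x y) by ring.
    by rewrite bx bY DE; ring.
  rewrite add0r (_ : a + a = 2 * a); last by ring.
  have hgk x : hasint1 (k' x) (g x * bump z e x).
    rewrite mulrC; apply: hasint_eq (hasintZ (bump z e x) (hg x)) => y.
    by rewrite k'E mulrC.
  apply: hasint_eq (hasintZ 2 (hasint2_fubini ha hgk)) => x.
  by rewrite mulrA.
Qed.

End cutoff.

(** * Mollification and passage from bumps to all admissible test functions *)

Section mollification.
Context {R : realType} {n : nat}.
Local Notation T := 'rV[R]_n.
Local Notation leb := (@lebesgue_rV R n).
Implicit Types (f g w psi phi : T -> R) (F k : T -> T -> R) (s r a b e : R).

Lemma hasint_ge0 {d} {X : measurableType d} (mu : {measure set X -> \bar R}) (f : X -> R) a :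
  measurable_fun setT f -> (forall x, 0 <= f x) -> (\int[mu]_x (f x)%:E = a%:E)%E -> hasint mu f a.
Proof.
move=> mf f0 fa; split=> //; apply: (integrable_of_ile mf (g := f) (a := a)); last by rewrite /ile fa.
by move=> x; rewrite ger0_norm.
Qed.

Lemma ile_of_hasint {d} {X : measurableType d} (mu : {measure set X -> \bar R}) (f : X -> R) a :
  hasint mu f a -> ile mu f a.
Proof. by move=> [_ fa]; rewrite /ile fa. Qed.

Lemma hasint_posneg {d} {X : measurableType d} (mu : {measure set X -> \bar R}) (f : X -> R) a :
  hasint mu f a -> exists ap am, [/\ hasint mu (fun x => Num.max 0 (f x)) ap,
    hasint mu (fun x => Num.max 0 (- f x)) am & a = ap - am].
Proof.
move=> hf; have [/integrableP[mfE fo] _] := hf.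
have mf : measurable_fun setT f by exact/measurable_EFinP.
have [b hb] : exists b, ile mu (fun x => `|f x|) b by apply: ile_ex.
have m1 : measurable_fun setT (fun x => Num.max 0 (f x)) by mauto.
have m2 : measurable_fun setT (fun x => Num.max 0 (- f x)) by mauto.
have [ap hap] : exists ap, hasint mu (fun x => Num.max 0 (f x)) ap.
  apply: hasint_of_ile m1 _ hb => x; rewrite ger0_norm ?le_max ?lexx//.
  by rewrite ge_max normr_ge0 ler_norm.
have [am ham] : exists am, hasint mu (fun x => Num.max 0 (- f x)) am.
  apply: hasint_of_ile m2 _ hb => x; rewrite ger0_norm ?le_max ?lexx//.
  by rewrite ge_max normr_ge0 -normrN ler_norm.
exists ap, am; split=> //; apply: hasint_uniq hf _; apply: hasint_eq (hasintB hap ham) => x.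
case: (leP 0 (f x)) => h; case: (leP 0 (- f x)) => h' /=; qlra.
Qed.

Lemma hasint1_shift (x0 : T) f a : hasint1 f a -> hasint1 (fun x => f (x0 + x)) a.
Proof.
move=> hf; have [/integrableP[mfE _] _] := hf.
have mf : mf1 f by exact/measurable_EFinP.
have tr q b : mf1 q -> (forall x, 0 <= q x) -> hasint1 q b -> hasint1 (fun x => q (x0 + x)) b.
  move=> mq q0 [_ qb]; apply: hasint_ge0 => //; first by mauto.
  have mqE : measurable_fun setT (fun x => (q x)%:E) by exact/measurable_EFinP.
  have := @integral_affine R n x0 1 (fun x => (q x)%:E) ltr01 mqE (fun x => q0 x).
  rewrite expr1n invr1 mul1e qb => <-.
  by apply: eq_integral => x _; rewrite scale1r.
have [ap [am [h1 h2 ->]]] := hasint_posneg hf.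
apply: hasint_eq (hasintB (tr _ _ _ _ h1) (tr _ _ _ _ h2)) => [x||x||x].
- case: (leP 0 (f (x0 + x))) => h; case: (leP 0 (- f (x0 + x))) => h' /=; qlra.
- mauto.
- by rewrite le_max lexx.
- mauto.
- by rewrite le_max lexx.
Qed.

Lemma I2_unshear k a : mf2 k -> (forall x y, 0 <= k x y) -> I2 k a -> I2 (fun x y => k x (y - x)) a.
Proof.
move=> mk k0; have mk' : mf2 (fun x y => k x (y - x)) by mauto.
rewrite (I2E a mk k0) (I2E a mk' (fun x y => k0 x (y - x))).
apply: le_trans; apply: ge0_mono_integral => x.
  by apply: integral_ge0 => y _; rewrite lee_fin.
have := (@integral_affine R n (- x) 1 (fun y => (k x y)%:E) ltr01).
rewrite expr1n invr1 mul1e => <-//; last 2 first.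
- by apply/measurable_EFinP; mauto.
- by move=> y; rewrite lee_fin.
by under [leRHS]eq_integral => y _ do rewrite scale1r addrC.
Qed.

(** Integrate p (g - a)^2 >= 0. *)
Lemma jensen (p g : T -> R) a b : mf1 p -> mf1 g -> (forall x, 0 <= p x) -> I1 p 1 ->
  hasint1 (fun x => p x * g x) a -> I1 (fun x => p x * g x ^+ 2) b -> a ^+ 2 <= b.
Proof.
move=> mp mg p0 hp ha hb.
have hq : I1 (fun x => p x * g x ^+ 2 + a ^+ 2 * p x) (b + a ^+ 2 * 1).
  apply: ile_add => //; try mauto; try by nneg.
  by apply: ile_scale hp => //; exact: sqr_ge0.
have := ile_hasint (hasintZ (- (2 * a)) ha) _ _ _ _ hq.
have mq : measurable_fun setT (fun x => p x * g x ^+ 2 + a ^+ 2 * p x) by mauto.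
move=> /(_ (fun=> 0) mq (fun=> lexx _)) H.
have : ile leb (fun=> 0 : R) (- (2 * a) * a + (b + a ^+ 2 * 1)).
  apply: H => x; first by have := p0 x => ?; nneg.
  by rewrite [leRHS](_ : _ = p x * (g x - a) ^+ 2); [nneg|ring].
by move/(ile_ge0 (fun=> lexx _)); rewrite expr2; qlra.
Qed.

(** [jensen] at every point, then Fubini: all translates of d have the same L2 norm. *)
Lemma young (p d D : T -> R) M : mf1 p -> mf1 d -> (forall x, 0 <= p x) -> I1 p 1 ->
  I1 (fun x => d x ^+ 2) M -> (forall x : T, hasint1 (fun t => p t * d (x + t)) (D x)) ->
  I1 (fun x => D x ^+ 2) M.
Proof.
move=> mp md p0 hp hM hD.
have mk : mf2 (fun x t => p t * d (x + t) ^+ 2) by mauto.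
have k0 x t : 0 <= p t * d (x + t) ^+ 2 by nneg.
apply: (@I1_of_I2 R n (fun x t => p t * d (x + t) ^+ 2)) => //.
- by move=> x; exact: sqr_ge0.
- move=> x; have : (0 <= \int[leb]_t (p t * d (x + t) ^+ 2)%:E)%E.
    by apply: integral_ge0 => t _; rewrite lee_fin.
  case E : (\int[leb]_t _)%E => [b| |]// _; last by rewrite leey.
  rewrite lee_fin; apply: (jensen (g := fun t => d (x + t)) mp _ p0 hp (hD x)); first by mauto.
  by rewrite /I1 /ile E.
- apply: (@I2_fubini2 R n _ (fun t => M * p t)) => //.
    move=> t; rewrite mulrC; apply: ile_scale => //; [by mauto|by nneg|].
    have md2 : mf1 (fun x => d x ^+ 2) by mauto.
    by apply: I1_eq (I1_shift t md2 (fun x => sqr_ge0 _) hM) => x; rewrite addrC.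
  have M0 : 0 <= M by apply: ile_ge0 hM => x; nneg.
  by rewrite -[X in I1 _ X]mulr1; exact: ile_scale hp.
Qed.

Lemma adm_L1 s (x0 : T) r psi : adm s x0 r psi -> exists b, I1 (fun x => `|psi x|) b.
Proof.
move=> [mpsi psi0 [b hb] _].
have r1 : 0 < `|r| + 1 by rewrite ltr_wpDl.
exists ((`|r| + 1) ^+ n * @unit_volume R n + b).
have hl : ile leb (fun x : T => \1[enorm (x - x0) < `|r| + 1] + psi x ^+ 2) ((`|r| + 1) ^+ n * @unit_volume R n + b).
  by apply: ile_add (I1_ball _ r1) hb; [mauto|mauto|by nneg|by nneg].
apply: ile_mono hl => x; first by [].
case: (ltP (enorm (x - x0)) (`|r| + 1)) => xr /=.
  have := sqr_ge0 (`|psi x| - 1); rewrite -[psi x ^+ 2]real_normK ?num_real//.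
  by have := normr_ge0 (psi x); qlra.
by rewrite psi0 ?normr0 ?expr0n ?addr0//; have := ler_norm r; qlra.
Qed.

(* [psie] is [psi] mollified at scale [e], with normalizing constant [m]. *)
Lemma mollify s e psi r b E : 0 < s < 1 -> 0 < e -> adm s (0 : T) r psi ->
  I1 (fun x => psi x ^+ 2) b -> energy s psi E ->
  exists (m : R) (psie : T -> R), [/\ 0 < m, m^-1 <= (2 / e) ^+ n / (flat 0 (3 / 4) * @unit_volume R n),
    hasint1 (fun t => m^-1 * bump (0 : T) e t) 1 &
    (forall x, hasint1 (fun t => m^-1 * bump (0 : T) e t * psi (x + t)) (psie x))] /\
  [/\ adm s 0 (r + e) psie, energy s psie E &
   I1 (fun x => (psie x - psi x) ^+ 2)
     (e `^ (n%:R + 2 * s) / (m * (1 - s)) * E)].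
Proof.
move=> ss e0 hadm hb hE; have [s_0 s1] := andP ss; have [mpsi psi0 _ _] := hadm.
have mb := mf1_bump (0 : T) e.
have b0 (x : T) : 0 <= bump 0 e x by exact: bump_ge0.
have b1 (x : T) : bump 0 e x <= \1[enorm (x - 0) < e].
  case: (ltP (enorm (x - 0)) e) => xe; first exact: bump_le1.
  by rewrite bump0.
have [m hm] : exists m, hasint1 (bump (0 : T) e) m.
  apply: hasint_of_ile mb _ (I1_ball (0 : T) e0) => x; rewrite ger0_norm//.
have fl0 : 0 < flat 0 (3 / 4 : R).
  by rewrite /flat divr_gt0// mulr_gt0 ?exprn_gt0 ?expR_gt0// invr_gt0 divr_gt0.
have V0 := @unit_volume_gt0 R n.
have e2 : 0 < e / 2 by rewrite divr_gt0.
(* On the ball of half the radius the argument of the bump is at least 1 - 1/4, so its mass m is at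
   least of order e^n. *)
have mlow : flat 0 (3 / 4) * ((e / 2) ^+ n * @unit_volume R n) <= m.
  have [_ hmE] := hm; rewrite -lee_fin -hmE EFinM -(integral_ball (0 : T) e2).
  have mI : measurable_fun setT (fun y : T => (\1[enorm (y - 0) < e / 2] : R)%:E) by apply/measurable_EFinP; mauto.
  rewrite -ge0_integralZl_EFin//; last exact: ltW.
  apply: ge0_mono_integral => x; first by rewrite lee_fin mulr_ge0// ltW.
  rewrite lee_fin; case: (ltP (enorm (x - 0)) (e / 2)) => xe /=; last by rewrite mulr0.
  rewrite mulr1 /bump bump_argE /flat divr_gt0//=.
  have x1 : (enorm (x - 0) / e) ^+ 2 <= 4^-1.
    have -> : 4^-1 = (2^-1) ^+ 2 :> R by rewrite exprVn expr2 -natrM.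
    rewrite ler_pXn2r ?nnegrE ?divr_ge0 ?enorm_ge0 ?(ltW e0)// ler_pdivrMr// mulrC; exact: ltW.
  have q0 : 3 / 4 <= 1 - (enorm (x - 0) / e) ^+ 2 by move: x1; qlra.
  have q1 : 0 < 1 - (enorm (x - 0) / e) ^+ 2 by apply: lt_le_trans q0; rewrite divr_gt0.
  rewrite q1 !expr0 !mul1r ler_expR lerN2 lef_pV2// posrE// divr_gt0//.
have m0 : 0 < m by apply: lt_le_trans mlow; rewrite !mulr_gt0 ?exprn_gt0.
have mi0 : 0 < m^-1 by rewrite invr_gt0.
have [p pE] : exists p : T -> R, forall t, p t = m^-1 * bump 0 e t by eexists.
have mp : mf1 p by rewrite (_ : p = fun t => m^-1 * bump 0 e t); [mauto|exact/funext].
have p0 t : 0 <= p t by rewrite pE mulr_ge0// ltW.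
have hp : hasint1 p 1.
  apply: hasint_eq (fun x => esym (pE x)) _; rewrite -(mulVf (lt0r_neq0 m0)); exact: hasintZ.
have hpI : I1 p 1 by exact: ile_of_hasint.
have psiL x : exists a, hasint1 (fun t => p t * psi (x + t)) a.
  have mk : mf1 (fun t => p t * psi (x + t)) by mauto.
  refine (@hasint_of_ile _ _ _ leb _ (fun t : T => m^-1 * (\1[enorm (t - 0) < e] + psi (x + t) ^+ 2)) _ mk _ _) => [t|].
    rewrite pE -mulrA normrM ger0_norm ?(ltW mi0)//; apply: ler_wpM2l; first exact: ltW.
    rewrite normrM ger0_norm//; have := b1 t; have := b0 t; have := bump_le1 (0 : T) e t.
    have := sqr_ge0 (`|psi (x + t)| - 1); rewrite -[psi (x + t) ^+ 2]real_normK ?num_real//.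
    have := normr_ge0 (psi (x + t)).
    by move: (\1[_]) (bump 0 e t) (`|psi _|) => i u v; nra.
  apply: ile_scale; [exact: ltW|mauto|by nneg|].
  apply: ile_add (I1_ball (0 : T) e0) _; [mauto|mauto|by nneg|by nneg|].
  have m2 : mf1 (fun x => psi x ^+ 2) by mauto.
  exact: (I1_shift x m2 (fun x => sqr_ge0 _) hb).
have [psie hpsie] := boolp.choice psiL.
have mpsie : mf1 psie.
  have mk : mf2 (fun x t => p t * psi (x + t)) by mauto.
  have [a ha] : exists a, hasint2 (fun x t => p t * psi (x + t)) a.
    have [M hM] := adm_L1 hadm.
    have mk2 : measurable_fun setT (fun z : T * T => p z.2 * psi (z.1 + z.2)) by mauto.
    apply: (hasint_of_ile mk2 (g := fun z : T * T => p z.2 * `|psi (z.1 + z.2)|)) => [z|].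
      by rewrite normrM ger0_norm.
    apply: (@I2_fubini2 R n (fun x t => p t * `|psi (x + t)|) (fun t => M * p t)); first by mauto.
    + by nneg.
    + move=> t; rewrite mulrC; apply: ile_scale => //; [by mauto|].
      have ma : mf1 (fun x => `|psi x|) by mauto.
      by apply: I1_eq (I1_shift t ma (fun x => normr_ge0 _) hM) => x; rewrite addrC.
    + by apply: ile_scale hpI => //; apply: ile_ge0 hM => x.
  by have [/integrableP[/measurable_EFinP]] := hasint2_fubini ha hpsie.
have diffE h x : hasint1 (fun t => p t * (psi (x + t) - psi (x + t + h))) (psie x - psie (x + h)).
  by apply: hasint_eq (hasintB (hpsie x) (hpsie (x + h))) => t; rewrite mulrBr addrAC.
(* In the variables (x, h) the energy is an integral over h of L2 norms of increments, none of which
   grows under averaging. *)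
have E1 : energy s psie E.
  have mk : mf2 (fun x h => (psi x - psi (x + h)) ^+ 2 * @Jr R n s (enorm h)) by mauto.
  have k0 x h : 0 <= (psi x - psi (x + h)) ^+ 2 * @Jr R n s (enorm h) by rewrite mulr_ge0 ?sqr_ge0 ?Jr_ge0.
  have hsh : I2 (fun h x => (psi x - psi (x + h)) ^+ 2 * @Jr R n s (enorm h)) E.
    refine (@I2_swap R n (fun x h => (psi x - psi (x + h)) ^+ 2 * @Jr R n s (enorm h)) _ mk k0 _).
    have mE : mf2 (fun x y => (psi x - psi y) ^+ 2 * J s x y) by mauto.
    have E00 x y : 0 <= (psi x - psi y) ^+ 2 * J s x y by nneg.
    apply: I2_eq (I2_shear mE E00 hE) => x h.
    by rewrite /J opprD addrA subrr sub0r enormN.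
  have hex h : exists a, hasint1 (fun x => (psi x - psi (x + h)) ^+ 2) a.
    have mh : mf1 (fun x => (psi x - psi (x + h)) ^+ 2) by mauto.
    apply: (hasint_of_ile mh (g := fun x => 2 * psi x ^+ 2 + 2 * psi (h + x) ^+ 2)) => [x|].
      rewrite ger0_norm ?sqr_ge0// [x + h]addrC; have := sqr_ge0 (psi x + psi (h + x)); nra.
    have m2 : mf1 (fun x => psi x ^+ 2) by mauto.
    apply: ile_add; [mauto|mauto|by nneg|by nneg|by apply: ile_scale hb => //; nneg|].
    by apply: (ile_scale _ _ _ (I1_shift h m2 (fun x => sqr_ge0 _) hb)) => //; [mauto|nneg].
  have [M hM] := boolp.choice hex.
  have M0 h : 0 <= M h by apply: ile_ge0 (ile_of_hasint (hM h)) => x; exact: sqr_ge0.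
  have hMJ : I1 (fun h => M h * @Jr R n s (enorm h)) E.
    refine (@I1_of_I2 R n (fun h x => (psi x - psi (x + h)) ^+ 2 * @Jr R n s (enorm h)) _ _ _ (fun h x => k0 x h) _ _ hsh).
    - by mauto.
    - by move=> h; rewrite mulr_ge0 ?Jr_ge0.
    - move=> h; have := hasintZ (@Jr R n s (enorm h)) (hM h).
      move=> [_ hE2]; rewrite [M h * _]mulrC -hE2; apply: ge0_mono_integral => x; rewrite lee_fin.
        by rewrite mulr_ge0 ?Jr_ge0 ?sqr_ge0.
      by rewrite mulrC.
  have mke : mf2 (fun x h => (psie x - psie (x + h)) ^+ 2 * @Jr R n s (enorm h)) by mauto.
  have ke0 x h : 0 <= (psie x - psie (x + h)) ^+ 2 * @Jr R n s (enorm h) by rewrite mulr_ge0 ?sqr_ge0 ?Jr_ge0.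
  have hke : I2 (fun x h => (psie x - psie (x + h)) ^+ 2 * @Jr R n s (enorm h)) E.
    refine (@I2_fubini2 R n _ (fun h => M h * @Jr R n s (enorm h)) _ mke ke0 _ hMJ) => h.
    rewrite mulrC; apply: (@ile_mono_scale _ _ _ _ _ (fun x => (psie x - psie (x + h)) ^+ 2)).
    - exact: Jr_ge0.
    - mauto.
    - by nneg.
    - by [].
    - by move=> x; rewrite mulrC.
    - have md : mf1 (fun x => psi x - psi (x + h)) by mauto.
      exact: (young mp md p0 hpI (ile_of_hasint (hM h)) (diffE h)).
  apply: I2_eq (I2_unshear mke ke0 hke) => x y.
  by rewrite /J (enormB x y) [x + _]addrC subrK.
(* On the support of the bump 1 <= e^(n+2s) / |t|^(n+2s), so the L2 distance is paid for by the
   energy. As m is of order e^n, the factor is of order e^(2s). *)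
have cl : I1 (fun x => (psie x - psi x) ^+ 2) (e `^ (n%:R + 2 * s) / (m * (1 - s)) * E).
  have s11 : 0 < 1 - s by rewrite subr_gt0.
  have Q0 : 0 <= e `^ (n%:R + 2 * s) / (m * (1 - s)) by rewrite divr_ge0 ?powR_ge0// ltW// mulr_gt0.
  have [c cE] : exists c : R, c = e `^ (n%:R + 2 * s) / (m * (1 - s)) by eexists.
  rewrite -cE in Q0 *.
  have [k2 k2E] : exists k2 : T -> T -> R, forall x y, k2 x y = c * ((psi x - psi y) ^+ 2 * J s x y) by eexists.
  have mk2 : mf2 k2 by apply: (eq_mf2 k2E); mauto.
  have k20 x y : 0 <= k2 x y by rewrite k2E; nneg.
  have hk2 : I2 k2 (c * E).
    apply: (ile_mono_scale _ _ _ _ _ hE); [exact: Q0|mauto|by move=> z; nneg|by move=> z; exact: k20|].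
    by move=> z; rewrite k2E.
  refine (@I1_of_I2 R n (fun x t => k2 x (x + t)) _ _ _ (fun x t => k20 x (x + t)) _ _ (I2_shear mk2 k20 hk2)).
  - by mauto.
  - by move=> x; exact: sqr_ge0.
  - move=> x; have hd : hasint1 (fun t => p t * (psi (x + t) - psi x)) (psie x - psi x).
      have := hasintB (hpsie x) (hasintZ (psi x) hp); rewrite mulr1; apply: hasint_eq => t; ring.
    have mdt : mf1 (fun t => psi (x + t) - psi x) by mauto.
    have pw t : p t * (psi (x + t) - psi x) ^+ 2 <=
        k2 x (x + t).
      rewrite k2E cE; have J0 := J_ge0 x (x + t) s1.
      have [te|te] := ltP (enorm t) e; last first.
        by rewrite -cE pE bump0 ?subr0// mulr0 mul0r; nneg.
      have [->|tn] := eqVneq t 0; first by rewrite addr0 subrr expr0n/= mulr0 mul0r mulr0.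
      have t0 : 0 < enorm t by rewrite enorm_gt0.
      have -> : (psi x - psi (x + t)) ^+ 2 = (psi (x + t) - psi x) ^+ 2 by ring.
      rewrite [leRHS]mulrCA [leLHS]mulrC; apply: ler_wpM2l; first exact: sqr_ge0.
      rewrite /J opprD addrA subrr sub0r enormN /Jr.
      have -> : e `^ (n%:R + 2 * s) / (m * (1 - s)) * ((1 - s) / enorm t `^ (n%:R + 2 * s)) =
         m^-1 * (e `^ (n%:R + 2 * s) / enorm t `^ (n%:R + 2 * s)).
        move: (_ `^ _) (_ `^ _)^-1 => A B; field; rewrite gt_eqF//= gt_eqF//.
      rewrite pE; apply: ler_wpM2l; first exact: ltW.
      apply: le_trans (bump_le1 _ _ _) _; rewrite ler_pdivlMr ?powR_gt0// mul1r.
      by apply: ler_powR2; [rewrite addr_ge0// mulr_ge0// ltW|exact: ltW|exact: ltW].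
    have : (0 <= \int[leb]_t (p t * (psi (x + t) - psi x) ^+ 2)%:E)%E.
      by apply: integral_ge0 => t _; rewrite lee_fin; nneg.
    have hle : (\int[leb]_t (p t * (psi (x + t) - psi x) ^+ 2)%:E <= \int[leb]_t (k2 x (x + t))%:E)%E.
      by apply: ge0_mono_integral => t; rewrite lee_fin; [nneg|exact: pw].
    move=> I0; apply: le_trans hle; case Eb : (\int[leb]_t _)%E I0 => [bb| |]// _; last by rewrite leey.
    by rewrite lee_fin; apply: (jensen mp mdt p0 hpI hd); rewrite /I1 /ile Eb.
exists m, psie; split; split=> //.
- apply: (@le_trans _ _ (flat 0 (3 / 4) * ((e / 2) ^+ n * @unit_volume R n))^-1).
    by rewrite lef_pV2 ?posrE// !mulr_gt0 ?exprn_gt0.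
  by rewrite mulrCA [leLHS]invfM -exprVn invf_div.
- by apply: hasint_eq hp.
- by move=> x; apply: hasint_eq (hpsie x) => t; rewrite pE.
- split=> //; last by exists E.
  + move=> x; rewrite subr0 => xr; apply: hasint_uniq (hpsie x) _.
    have := hasintZ 0 hp; rewrite mul0r; apply: hasint_eq => t; rewrite mul0r.
    case: (ltP (enorm t) e) => te.
      rewrite psi0 ?mulr0// subr0; have := enormBle x (- t); rewrite enormN opprK; qlra.
    by rewrite pE bump0 ?subr0// mulr0 mul0r.
  + by exists b; exact: (young mp mpsi p0 hpI hb hpsie).
Qed.

End mollification.

Section bump_density.
Context {R : realType} {n : nat}.
Local Notation T := 'rV[R]_n.
Local Notation leb := (@lebesgue_rV R n).
Implicit Types (f g w psi phi : T -> R) (F k : T -> T -> R) (s r a b e M : R).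

(** Otherwise the parts at distance at least 1/(j+1) would all stay below A - eta, and Fatou would
    give this bound for the whole integral A. *)
Lemma small_diagonal k a (eta : R) : mf2 k -> (forall x y, 0 <= k x y) -> (forall x, k x x = 0) ->
  I2 k a -> 0 < eta ->
  exists d : R, 0 < d /\ I2 (fun x y => \1[enorm (x - y) < d] * k x y) eta.
Proof.
move=> mk k0 kd ha eta0.
have [A [A0 _ AE]] := ile_value (fun z : T * T => k0 z.1 z.2) ha.
have hA : hasint2 k A by apply: hasint_ge0.
have mkj (j : nat) : mf2 (fun x y => \1[j.+1%:R^-1 <= enorm (x - y)] * k x y) by mauto.
have kj0 (j : nat) (z : T * T) : 0 <= \1[j.+1%:R^-1 <= enorm (z.1 - z.2)] * k z.1 z.2 by nneg.
have kjle (j : nat) (z : T * T) : `|\1[j.+1%:R^-1 <= enorm (z.1 - z.2)] * k z.1 z.2| <= k z.1 z.2.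
  by rewrite ger0_norm//; case: (j.+1%:R^-1 <= enorm _); rewrite ?mul1r// mul0r.
have hj (j : nat) : exists b, hasint2 (fun x y => \1[j.+1%:R^-1 <= enorm (x - y)] * k x y) b.
  by apply: (hasint_of_ile (mkj j) (kjle j)) ha.
have [b hb] := boolp.choice hj.
have [[j bj]|nj] := pselect (exists j : nat, A - eta < b j); last first.
  have : I2 k (A - eta).
    apply: (@ile_fatou _ _ _ _ (fun (j : nat) (z : T * T) => \1[j.+1%:R^-1 <= enorm (z.1 - z.2)] * k z.1 z.2)) => //.
    - move=> [x y] /=; have [->|xy] := eqVneq x y.
        by rewrite kd; under eq_fun do rewrite mulr0; exact: cvg_cst.
      have xy0 : 0 < enorm (x - y) by rewrite enorm_gt0 subr_eq0.
      apply: cvg_near_cst; near=> j; rewrite (_ : _ <= _) ?mul1r//.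
      apply/ltW; near: j; exact: (@near_infty_natSinv_lt R (PosNum xy0)).
    - move=> j; apply: ile_le (ile_of_hasint (hb j)).
      by rewrite leNgt; apply/negP => h; apply: nj; exists j.
  have [_ AE'] := hA; rewrite /I2 /ile AE' lee_fin; qlra.
exists j.+1%:R^-1; split; first by rewrite invr_gt0 ltr0n.
apply: ile_le (_ : A - b j <= eta) _; first by qlra.
apply: ile_of_hasint; apply: hasint_eq (hasintB hA (hb j)) => z.
by case: (ltP (enorm (z.1 - z.2)) (j.+1%:R^-1)) => h /=; rewrite ?mul1r ?mul0r ?subr0 ?subrr.
Unshelve. all: by end_near. Qed.

Lemma hasint_cross s F w phi Lambda a : s < 1 -> mf2 F -> mf1 phi -> (forall x y, `|F x y| <= Lambda * `|w x - w y|) ->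
  energy s w a -> (exists b, energy s phi b) -> mf1 w -> exists c, hasint2 (fun x y => F x y * (phi x - phi y) * J s x y) c.
Proof.
move=> s1 mF mphi hF ha [b hb] mw.
have mk : measurable_fun setT (fun z : T * T => F z.1 z.2 * (phi z.1 - phi z.2) * J s z.1 z.2) by mauto.
apply: (hasint_of_ile mk (g := fun z : T * T => Lambda ^+ 2 * ((w z.1 - w z.2) ^+ 2 * J s z.1 z.2) +
   1 * ((phi z.1 - phi z.2) ^+ 2 * J s z.1 z.2))).
  move=> [x y] /=; have J0 := J_ge0 x y s1; rewrite normrM (ger0_norm J0) mul1r [Lambda ^+ 2 * _]mulrA -mulrDl.
  apply: ler_wpM2r => //; rewrite normrM.
  apply: (@le_trans _ _ (Lambda * `|w x - w y| * `|phi x - phi y|)); first by rewrite ler_wpM2r.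
  rewrite -[(w x - w y) ^+ 2]real_normK ?num_real// -[(phi x - phi y) ^+ 2]real_normK ?num_real//.
  by move: `|w x - w y| `|phi x - phi y| => p q; have := sqr_ge0 (Lambda * p - q); have := sqr_ge0 (Lambda * p + q); nra.
apply: (ile_mono_lin2 (c := Lambda ^+ 2) (e := 1) _ _ _ _ _ _ _ _ ha hb); [by nneg|by []|mauto|mauto|by move=> z; nneg|by move=> z; nneg|by move=> z; nneg|by []].
Qed.

(** Away from the diagonal the kernel is integrable, so the terms phi x and phi y may be separated
    and the form becomes the pairing of phi with a function. *)
Lemma truncated_flux s F w (Lambda d : R) : 0 < s < 1 -> 0 <= Lambda -> 0 < d -> adm s (0 : T) 1 w ->
  mf2 F -> (forall x y, F y x = - F x y) -> (forall x y, `|F x y| <= Lambda * `|w x - w y|) ->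
  exists (fd : T -> R) (C : R), [/\ mf1 fd, 0 <= C, (forall x, `|fd x| <= C * (`|w x| + 1)) &
   forall phi, adm s (0 : T) 1 phi -> exists a, hasint1 (fun x => fd x * phi x) a /\
    hasint2 (fun x y => \1[d <= enorm (x - y)] * (F x y * (phi x - phi y) * J s x y)) a].
Proof.
move=> ss L0 d0 hw mF Fsym hF; have [s_0 s1] := andP ss; have [mw w0 [b hb] _] := hw.
have [W hW] := adm_L1 hw.
have W0 : 0 <= W by apply: ile_ge0 hW => x.
have [CK [CK0 hCK]] := @ker_int R n s ss.
have s11 : s <= s < 1 by rewrite lexx.
pose A := 1 + (d ^+ 2)^-1.
have A1 : 1 <= A by rewrite /A lerDl invr_ge0 sqr_ge0.
have A0 : 0 <= A by apply: le_trans A1.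
have ke (x y : T) : \1[d <= enorm (x - y)] * J s x y <= A * (mJ s (enorm (x - y)) * J s x y).
  have J0 := J_ge0 x y s1; case: (leP d (enorm (x - y))) => h /=; last by rewrite mul0r; nneg.
  rewrite mul1r mulrA ler_peMl// /mJ; case: ltP => h1.
    have : 1 <= (d ^+ 2)^-1 * enorm (x - y) ^+ 2.
      by rewrite ler_pdivlMl ?exprn_gt0// mulr1 ler_pXn2r ?nnegrE ?enorm_ge0 ?(ltW d0).
    by rewrite /A mulrDl; have := sqr_ge0 (enorm (x - y)); qlra.
  have : 1 <= enorm (x - y) `^ s by rewrite -[leLHS](powRr0 (enorm (x - y))) ler_powR// ltW.
  by move=> h2; apply: le_trans A1 _; rewrite ler_peMr.
have Jd0 : 0 <= @Jr R n s d by exact: Jr_ge0.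
have Jd (x y : T) : \1[d <= enorm (x - y)] * J s x y <= @Jr R n s d.
  case: (leP d (enorm (x - y))) => h /=; last by rewrite mul0r.
  rewrite mul1r /J /Jr; apply: ler_wpM2l; first by rewrite subr_ge0 ltW.
  rewrite lef_pV2 ?posrE ?powR_gt0 ?(lt_le_trans d0)//.
  by apply: ler_powR2 => //; [rewrite addr_ge0// mulr_ge0// ltW|exact: ltW].
have [k kE] : exists k : T -> T -> R, forall x y, k x y = \1[d <= enorm (x - y)] * (F x y * J s x y) by eexists.
have mk : mf2 k by apply: (eq_mf2 kE); mauto.
have ksym x y : k y x = - k x y by rewrite !kE enormB (J_sym s y x) (Fsym x y) mulNr mulrN.
have kle x y : `|k x y| <= Lambda * `|w x| * A * (mJ s (enorm (x - y)) * J s x y) + Lambda * @Jr R n s d * `|w y|.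
  have J0 := J_ge0 x y s1; rewrite kE normrM normrM (ger0_norm J0) ger0_norm//.
  apply: (@le_trans _ _ (Lambda * (`|w x| + `|w y|) * (\1[d <= enorm (x - y)] * J s x y))).
    rewrite mulrCA; apply: ler_wpM2r; first by nneg.
    by apply: le_trans (hF x y) _; rewrite ler_wpM2l// ler_normB.
  have := ler_wpM2l (mulr_ge0 L0 (normr_ge0 (w x))) (ke x y).
  have := ler_wpM2l (mulr_ge0 L0 (normr_ge0 (w y))) (Jd x y).
  by move: (\1[_] * _) => X; rewrite mulrDr mulrDl; qlra.
have kx x : I1 (fun y => Lambda * `|w x| * A * (mJ s (enorm (x - y)) * J s x y) + Lambda * @Jr R n s d * `|w y|)
    (Lambda * `|w x| * A * CK + Lambda * @Jr R n s d * W).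
  by apply: ile_mono_lin2 (hCK s x s11) hW => //; [nneg|nneg|mauto|mauto|nneg|nneg].
have gex x : exists b, hasint1 (k x) b.
  have mkx : mf1 (k x) by mauto.
  exact: hasint_of_ile mkx (kle x) (kx x).
have [g hg] := boolp.choice gex.
have gle x : `|g x| <= Lambda * `|w x| * A * CK + Lambda * @Jr R n s d * W.
  by apply: hasint_abs_le (hg x) _ (kle x) (kx x); mauto.
have key phi : mf1 phi -> (exists c, I1 (fun x => `|phi x| * (Lambda * `|w x| * A * CK + Lambda * @Jr R n s d * W)) c) ->
    exists a, hasint2 (fun x y => k x y * phi x) a /\ hasint1 (fun x => g x * phi x) a.
  move=> mphi [c hc]; have mkp : mf2 (fun x y => k x y * phi x) by mauto.
  have mka : mf2 (fun x y => `|k x y * phi x|) by mauto.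
  have [a ha] : exists a, hasint2 (fun x y => k x y * phi x) a.
    apply: (hasint_of_ile mkp (g := fun z : T * T => `|k z.1 z.2 * phi z.1|)) => //.
    refine (@I2_fubini R n (fun x y => `|k x y * phi x|) (fun x => `|phi x| * (Lambda * `|w x| * A * CK + Lambda * @Jr R n s d * W)) c mka (fun _ _ => normr_ge0 _) _ hc) => x.
    apply: (ile_mono_scale _ _ _ _ _ (kx x)) => //; [mauto|by nneg|].
    by move=> y; rewrite normrM mulrC ler_wpM2l.
  exists a; split=> //; apply: hasint2_fubini ha _ => x.
  by rewrite mulrC; apply: hasint_eq (hasintZ (phi x) (hg x)) => y; rewrite mulrC.
(* Fubini gives the measurability of g times a suitable weight; [wt] is positive and can be divided
   out again. *)
have mg : mf1 g.
  have [Cw [Cw0 hCw]] := @wt_int R n s ss.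
  have wt0 (x : T) : 0 < wt s x by rewrite /wt /Jr divr_gt0 ?subr_gt0 ?powR_gt0// ltr_pwDl ?enorm_ge0.
  have wt1 (x : T) : wt s x <= 1.
    have p1 : 1 <= (1 + enorm x) `^ (n%:R + 2 * s).
      by rewrite -[leLHS](powRr0 (1 + enorm x)) ler_powR ?lerDl ?enorm_ge0// addr_ge0// mulr_ge0// ltW.
    rewrite /wt /Jr ler_pdivrMr ?(lt_le_trans ltr01)// mul1r (le_trans _ p1)//; qlra.
  have [|a [_ [/integrableP[/measurable_EFinP mgw _] _]]] := key (@wt R n s) (@mf1_wt R n s).
    exists (Lambda * A * CK * W + Lambda * @Jr R n s d * W * Cw).
    apply: (ile_mono_lin2 _ _ _ _ _ _ _ _ hW (hCw s s11)); [nneg|nneg|mauto|mauto|nneg|nneg|nneg|].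
    move=> x; rewrite ger0_norm ?(ltW (wt0 x))// mulrDr lerD//; last by rewrite mulrC.
    rewrite [leLHS](_ : _ = Lambda * A * CK * `|w x| * wt s x); last by ring.
    by rewrite ler_piMr//; nneg.
  have -> : g = fun x => g x * wt s x / wt s x.
    by apply/funext => x; rewrite mulfK// gt_eqF.
  by apply: (@measurable_funM _ _ _ setT (fun x => g x * wt s x) (fun x => (wt s x)^-1)); [exact: mgw|mauto].
exists (fun x => 2 * g x), (2 * (Lambda * A * CK + Lambda * @Jr R n s d * W)); split.
- mauto.
- by nneg.
- move=> x; rewrite normrM ger0_norm// -mulrA ler_pM2l//; apply: le_trans (gle x) _.
  have : 0 <= Lambda * A * CK by nneg.
  have : 0 <= Lambda * @Jr R n s d * W by nneg.
  have -> : Lambda * `|w x| * A * CK = Lambda * A * CK * `|w x| by ring.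
  by have := normr_ge0 (w x); move: (Lambda * A * CK) (Lambda * @Jr R n s d * W) `|w x| => X Y Z; nra.
- move=> phi hphi; have [mphi _ [c hc] _] := hphi; have [P hP] := adm_L1 hphi.
  have [|a [ha1 ha2]] := key phi mphi.
    exists (Lambda * A * CK * (1 * b + 1 * c) + Lambda * @Jr R n s d * W * P).
    have hwp : I1 (fun x => `|w x| * `|phi x|) (1 * b + 1 * c).
      apply: (ile_mono_lin2 _ _ _ _ _ _ _ _ hb hc); [by []|by []|mauto|mauto|by nneg|by nneg|by nneg|].
      move=> x; rewrite !mul1r -[w x ^+ 2]real_normK ?num_real// -[phi x ^+ 2]real_normK ?num_real//.
      by move: `|w x| `|phi x| => X Y; have := sqr_ge0 (X - Y); have := sqr_ge0 (X + Y); nra.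
    by apply: (ile_mono_lin2 _ _ _ _ _ _ _ _ hwp hP); [nneg|nneg|mauto|mauto|nneg|nneg|nneg|move=> x; rewrite le_eqVlt; apply/orP; left; apply/eqP; ring].
  have mkp : mf2 (fun x y => k x y * phi x) by mauto.
  exists (2 * a); split.
    by apply: hasint_eq (hasintZ 2 ha2) => x; rewrite mulrA.
  have -> : 2 * a = a + a by ring.
  apply: hasint_eq (hasintD ha1 (hasint2_swap mkp ha1)) => -[x y] /=.
  by rewrite (ksym x y) kE; ring.
Qed.

(** Cauchy-Schwarz on the strip near the diagonal, with a square root of [J] given to each
    factor. *)
Lemma residual s F w (Lambda d : R) phi a b e (eta : R) : 0 < s < 1 -> 0 <= Lambda -> mf2 F -> mf1 phi -> mf1 w ->
  I2 (fun x y => \1[enorm (x - y) < d] * (F x y ^+ 2 * J s x y)) eta -> energy s phi e ->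
  hasint2 (fun x y => F x y * (phi x - phi y) * J s x y) a ->
  hasint2 (fun x y => \1[d <= enorm (x - y)] * (F x y * (phi x - phi y) * J s x y)) b ->
  `|a - b| <= Num.sqrt eta * Num.sqrt e.
Proof.
move=> /andP[s_0 s1] L0 mF mphi mw heta he ha hb.
have m1 : measurable_fun setT (fun z : T * T => \1[enorm (z.1 - z.2) < d] * F z.1 z.2 * Num.sqrt (J s z.1 z.2)) by mauto.
have m2 : measurable_fun setT (fun z : T * T => (phi z.1 - phi z.2) * Num.sqrt (J s z.1 z.2)) by mauto.
have sJ (x y : T) : Num.sqrt (J s x y) ^+ 2 = J s x y by rewrite sqr_sqrtr ?J_ge0.
have h1 : ile (leb \x leb)%E (fun z : T * T => (\1[enorm (z.1 - z.2) < d] * F z.1 z.2 * Num.sqrt (J s z.1 z.2)) ^+ 2) eta.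
  apply: ile_mono heta => -[x y] /=; first by nneg.
  by rewrite !exprMn sJ; case: (_ < d); rewrite ?expr1n ?expr0n/= ?mul1r ?mul0r.
have h2 : ile (leb \x leb)%E (fun z : T * T => ((phi z.1 - phi z.2) * Num.sqrt (J s z.1 z.2)) ^+ 2) e.
  by apply: ile_mono he => -[x y] /=; [nneg|rewrite !exprMn sJ].
apply: (hasint_abs_le (hasintB ha hb) _ _ (ile_amgm m1 m2 h1 h2)); first by mauto.
move=> [x y] /=; rewrite le_eqVlt; apply/orP; left; apply/eqP; congr `|_|.
rewrite -{1 2}(sJ x y); case: (ltP (enorm (x - y)) d) => h /=; ring.
Qed.

(** A mollified function is a superposition of bumps, but the form cannot simply be exchanged with
    this superposition: near the diagonal the two terms of an increment are not separately
    integrable. The flux is truncated at a distance at which the remainder is at most kap times the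
    square root of the energy of the test function. Mollification does not increase the energy and
    converges in L2, which suffices for the truncated form; convergence in energy is thus
    avoided. *)
Lemma bump_density s F w f Lambda M : 0 < s < 1 -> 0 <= Lambda -> adm s (0 : T) 1 w ->
  mf2 F -> (forall x y, F y x = - F x y) -> (forall x y, `|F x y| <= Lambda * `|w x - w y|) ->
  mf1 f -> (forall x, enorm x < 4^-1 -> `|f x| <= M) ->
  (forall z e, 0 < e -> enorm z + e < 4^-1 -> exists a,
    hasint2 (fun x y => F x y * (bump z e x - bump z e y) * J s x y) a /\
    hasint1 (fun x => f x * bump z e x) a) ->
  forall psi, adm s (0 : T) 8^-1 psi -> exists a,
    hasint2 (fun x y => F x y * (psi x - psi y) * J s x y) a /\ hasint1 (fun x => f x * psi x) a.
Proof.
move=> ss L0 hw mF Fsym hF mf fM hbump psi hpsi; have [s_0 s1] := andP ss.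
have [mw _ _ [ew hew]] := hw; have [mpsi psi0 [b hb] [E hE]] := hpsi.
have mFJ : mf2 (fun x y => F x y ^+ 2 * J s x y) by mauto.
have FJ0 x y : 0 <= F x y ^+ 2 * J s x y by nneg.
have FJd x : F x x ^+ 2 * J s x x = 0.
  by have := Fsym x x => h; have -> : F x x = 0 by [qlra]; rewrite expr0n mul0r.
have hFJ : I2 (fun x y => F x y ^+ 2 * J s x y) (Lambda ^+ 2 * ew).
  apply: (ile_mono_scale _ _ _ _ _ hew) => //; [by nneg|mauto|by move=> z; nneg|move=> [x y] /=].
  rewrite mulrA; apply: ler_wpM2r; first exact: J_ge0.
  rewrite -[F x y ^+ 2]real_normK ?num_real// -[(w x - w y) ^+ 2]real_normK ?num_real// -exprMn.
  by rewrite ler_pXn2r ?nnegrE// mulr_ge0.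
have M0 : 0 <= M by apply: le_trans (fM 0 _); rewrite ?enorm0 ?invr_gt0.
have E0 : 0 <= E by apply: ile_ge0 hE => z; nneg.
have hL r phi : r <= 4^-1 -> adm s (0 : T) r phi -> forall c, I1 (fun x => phi x ^+ 2) c ->
    exists l, hasint1 (fun x => f x * phi x) l /\ `|l| <= Num.sqrt (M ^+ 2 * (1 ^+ n * @unit_volume R n)) * Num.sqrt c.
  move=> r4 [mphi phi0 _ _] c hc.
  have mfc : mf1 (fun x => f x * \1[enorm x < 4^-1]) by mauto.
  have hfc : I1 (fun x => (f x * \1[enorm x < 4^-1]) ^+ 2) (M ^+ 2 * (1 ^+ n * @unit_volume R n)).
    apply: (ile_mono_scale _ _ _ _ _ (I1_ball (0 : T) ltr01)); [by nneg|mauto|by nneg|by nneg|move=> x].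
    case: (ltP (enorm x) 4^-1) => x4; last first.
      by rewrite /= mulr0 expr0n /= mulr_ge0 ?sqr_ge0.
    rewrite (_ : enorm (x - 0) < 1); last by rewrite subr0; qlra.
    by rewrite !mulr1 -[f x ^+ 2]real_normK ?num_real// ler_pXn2r ?nnegrE//; exact: fM.
  have mm : mf1 (fun x => f x * phi x) by mauto.
  have bb x : `|f x * phi x| <= `|(f x * \1[enorm x < 4^-1]) * phi x|.
    case: (ltP (enorm x) 4^-1) => x4; rewrite ?mulr1//.
    by rewrite phi0 ?mulr0 ?normr0// subr0 (le_trans r4).
  have hh := ile_amgm mfc mphi hfc hc.
  have [l hl] := hasint_of_ile mm bb hh.
  by exists l; split=> //; apply: hasint_abs_le hl _ bb hh; mauto.
have [L1 hL1] := adm_L1 hpsi.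
have e84 : 8^-1 <= 4^-1 :> R by qlra.
have [l [hl _]] := hL _ _ e84 hpsi b hb.
have [a ha] := hasint_cross s1 mF mpsi hF hew (ex_intro _ E hE) mw.
exists a; split=> //; suff -> : a = l by [].
have step (kap : R) : 0 < kap -> exists (fd : T -> R) (Cd : R), [/\ mf1 fd, 0 <= Cd, I1 (fun x => (fd x * \1[enorm (x - 0) < 1]) ^+ 2) Cd &
   forall phi e a0, adm s (0 : T) 1 phi -> energy s phi e ->
   hasint2 (fun x y => F x y * (phi x - phi y) * J s x y) a0 ->
   exists a', hasint1 (fun x => fd x * phi x) a' /\ `|a0 - a'| <= kap * Num.sqrt e].
  move=> kap0; have k2 : 0 < kap ^+ 2 by rewrite exprn_gt0.
  have [d [d0 hd]] := small_diagonal mFJ FJ0 FJd hFJ k2.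
  have [fd [C [mfd C0 fdC hfd]]] := truncated_flux ss L0 d0 hw mF Fsym hF.
  have [_ _ [bw hbw] _] := hw.
  exists fd, (2 * C ^+ 2 * bw + 2 * C ^+ 2 * (1 ^+ n * @unit_volume R n)); split=> //.
  - have : 0 <= bw by apply: ile_ge0 hbw => x; exact: sqr_ge0.
    by have := @unit_volume_gt0 R n => /ltW ? ?; nneg.
  - apply: (ile_mono_lin2 _ _ _ _ _ _ _ _ hbw (I1_ball (0 : T) ltr01)); [by nneg|by nneg|mauto|mauto|by nneg|by nneg|by nneg|].
    move=> x; case: (ltP (enorm (x - 0)) 1) => x1 /=; last first.
      by rewrite !mulr0 expr0n /= addr0; exact: mulr_ge0 (mulr_ge0 _ (sqr_ge0 _)) (sqr_ge0 _).
    rewrite !mulr1.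
    have := fdC x; have := normr_ge0 (fd x); rewrite -[fd x ^+ 2]real_normK ?num_real// -[w x ^+ 2]real_normK ?num_real//.
    move=> h1 h2; apply: (@le_trans _ _ ((C * (`|w x| + 1)) ^+ 2)).
      by rewrite ler_pXn2r ?nnegrE// mulr_ge0// addr_ge0.
    have := mulr_ge0 (sqr_ge0 C) (sqr_ge0 (`|w x| - 1)); rewrite exprMn; move: (C ^+ 2) `|w x| => X Y h3.
    by rewrite -subr_ge0 (_ : _ - _ = X * (Y - 1) ^+ 2)//; ring.
  - move=> phi e a0 hphi he ha0; have [a' [h1 h2]] := hfd _ hphi; exists a'; split=> //.
    have [mphi _ _ _] := hphi.
    have := residual ss L0 mF mphi mw hd he ha0 h2.
    by rewrite sqrtr_sqr (gtr0_norm kap0).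
have cs (h : T -> R) Ch phi c v : mf1 h -> I1 (fun x => (h x * \1[enorm (x - 0) < 1]) ^+ 2) Ch -> mf1 phi ->
    (forall x, 1 <= enorm x -> phi x = 0) -> I1 (fun x => phi x ^+ 2) c -> hasint1 (fun x => h x * phi x) v ->
    `|v| <= Num.sqrt Ch * Num.sqrt c.
  move=> mh hh mphi phi0 hc hv; have mh1 : mf1 (fun x => h x * \1[enorm (x - 0) < 1]) by mauto.
  apply: (hasint_abs_le hv _ _ (ile_amgm mh1 mphi hh hc)); first by mauto.
  move=> x; rewrite subr0; case: (ltP (enorm x) 1) => x1; rewrite ?mulr1//.
  by rewrite phi0// !mulr0 normr0.
have [fq [mfq fqE hfq]] : exists fq : T -> R, [/\ mf1 fq, (forall x, enorm x < 4^-1 -> fq x = f x) &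
    I1 (fun x => (fq x * \1[enorm (x - 0) < 1]) ^+ 2) (M ^+ 2 * (1 ^+ n * @unit_volume R n))].
  exists (fun x => f x * \1[enorm x < 4^-1]); split; [mauto|by move=> x ->; rewrite mulr1|].
  apply: (ile_mono_scale _ _ _ _ _ (I1_ball (0 : T) ltr01)); [by nneg|mauto|by nneg|by nneg|move=> x].
  case: (enorm (x - 0) < 1); last first.
      by rewrite /= mulr0 expr0n /= mulr_ge0 ?sqr_ge0.
  rewrite !mulr1; case: (ltP (enorm x) 4^-1) => x4; last first.
      by rewrite /= mulr0 expr0n /= mulr_ge0 ?sqr_ge0.
  by rewrite mulr1 -[f x ^+ 2]real_normK ?num_real// ler_pXn2r ?nnegrE//; exact: fM.
(* The identity for mollified functions: their pairings are integrals, over the centre z, of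
   pairings with bumps. *)
have claim e : 0 < e -> e < 16^-1 -> exists psie B, [/\ adm s (0 : T) 4^-1 psie, energy s psie E,
    I1 (fun x => (psie x - psi x) ^+ 2) ((2 / e) ^+ n / (flat 0 (3 / 4) * @unit_volume R n) * (e `^ (n%:R + 2 * s) / (1 - s)) * E),
    hasint2 (fun x y => F x y * (psie x - psie y) * J s x y) B & hasint1 (fun x => f x * psie x) B].
  move=> e0 e16; have [m [psie [[m0 mi hp hpsie] [hadm hEe hcl]]]] := mollify ss e0 hpsi hb hE.
  have h4 : adm s (0 : T) 4^-1 psie by apply: adm_mono hadm; qlra.
  have [mpe pe0 [be hbe] _] := h4.
  have [le' [hle _]] := hL _ _ (lexx _) h4 be hbe.
  have [B hB] := hasint_cross s1 mF mpe hF hew (ex_intro _ E hEe) mw.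
  exists psie, B; split=> //.
    apply: ile_le hcl; apply: ler_wpM2r => //.
    have -> : e `^ (n%:R + 2 * s) / (m * (1 - s)) = m^-1 * (e `^ (n%:R + 2 * s) / (1 - s)).
      by rewrite invfM mulrCA.
    by apply: ler_wpM2r mi; rewrite divr_ge0 ?powR_ge0// subr_ge0 ltW.
  suff -> : B = le' by [].
  (* One energy bound serves all bumps of radius e, by translation invariance. *)
  have [Eb hEb] : exists Eb, forall z : T, energy s (bump z e) Eb.
    have z01 (x : T) : 0 <= bump (0 : T) e x <= 1 by rewrite bump_ge0 bump_le1.
    have c0 : exists a, energy s (fun _ : T => 1 : R) a.
      by exists 0; apply: I2_eq (@ile0 _ _ _ _) => x y; rewrite subrr expr0n mul0r.
    have c1 : exists a, I1 (fun x : T => \1[enorm (x - 0) < e] * (1 : R) ^+ 2) a.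
      by eexists; apply: I1_eq (I1_ball (0 : T) e0) => x; rewrite expr1n mulr1.
    have bz (x : T) : e <= enorm (x - 0) -> bump (0 : T) e x = 0 by exact: bump0.
    have ss' : s <= s < 1 by rewrite lexx.
    have [_ _ _ [Eb hEb]] := adm_cut ss ss' (mf1_bump (0 : T) e) (measurable_cst (1 : R)) z01 (fun x y => bump_lip (0 : T) x y e0) bz c0 c1.
    exists (1 `^ (n%:R + 2 * s) * (1 ^- n * (1 ^- n * Eb))) => z.
    have mb1 : mf1 (fun x => bump (0 : T) e x * (1 : R)) by have := mf1_bump (0 : T) e => ?; mauto.
    have hEb1 : energy s (fun x => bump (0 : T) e x * (1 : R)) Eb by exact: hEb.
    have h := energy_affine (- z) s1 ltr01 mb1 hEb1.
    apply: (I2_eq (k' := fun x y => (bump (0 : T) e (- z + 1 *: x) * 1 - bump (0 : T) e (- z + 1 *: y) * 1) ^+ 2 * J s x y) _ h) => x y.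
    by rewrite !mulr1 /bump !bump_argE !scale1r !subr0 ![- z + _]addrC.
  have Eb0 : 0 <= Eb by apply: ile_ge0 (hEb 0) => z; nneg.
  have mi0 : 0 <= m^-1 by rewrite invr_ge0 ltW.
  suff lim (kap : R) : 0 < kap -> `|B - le'| <= kap * (Num.sqrt E + m^-1 * Num.sqrt Eb * L1).
    apply/eqP; rewrite -subr_eq0 -normr_le0; apply/ler_addgt0Pr => q q0; rewrite add0r.
    have Q0 : 0 <= Num.sqrt E + m^-1 * Num.sqrt Eb * L1.
      by have := ile_ge0 (fun x => normr_ge0 (psi x)) hL1 => ?; nneg.
    have Q1 : 0 < Num.sqrt E + m^-1 * Num.sqrt Eb * L1 + 1 by rewrite ltr_wpDl.
    have kq : 0 < q / (Num.sqrt E + m^-1 * Num.sqrt Eb * L1 + 1) by rewrite divr_gt0.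
    apply: le_trans (lim _ kq) _.
    by rewrite mulrAC ler_pdivrMr// ler_wpM2l ?(ltW q0)// lerDl.
  move=> kap0; have [fd [Cd [mfd Cd0 hCd P3]]] := step kap kap0.
  have a41 : adm s (0 : T) 1 psie by apply: adm_mono h4; qlra.
  have [a' [ha' hd]] := P3 _ _ _ a41 hEe hB.
  have [h [mh hE1]] : exists h : T -> R, mf1 h /\ forall x, h x = \1[enorm x < 4^-1] * (fd x - f x).
    by exists (fun x => \1[enorm x < 4^-1] * (fd x - f x)); split=> //; mauto.
  have htot : hasint1 (fun x => h x * psie x) (a' - le').
    apply: hasint_eq (hasintB ha' hle) => x; rewrite hE1.
    case: (ltP (enorm x) 4^-1) => x4 /=; first by rewrite mul1r mulrBl.
    by rewrite pe0 ?subr0// !mulr0 subrr.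
  have [Ih hIh] : exists c, I1 (fun x => `|h x|) c.
    eexists; apply: (ile_mono_lin2 (c := 1) (e := 1 + M) _ _ _ _ _ _ _ _ hCd (I1_ball (0 : T) ltr01)); [by []|by nneg|mauto|mauto|by nneg|by nneg|by nneg|].
    move=> x; rewrite hE1 mul1r; case: (ltP (enorm x) 4^-1) => x4 /=.
      rewrite mul1r (_ : enorm (x - 0) < 1); last by rewrite subr0; qlra.
      rewrite !mulr1; apply: le_trans (ler_normB _ _) _; have := fM x x4.
      by rewrite -[fd x ^+ 2]real_normK ?num_real//; have := sqr_ge0 (`|fd x| - 1); have := normr_ge0 (fd x); nra.
    by rewrite mul0r normr0; nneg.
  (* Fubini for k: integrating first in z gives h times the mollified function; integrating first in
     x gives the bump pairings, which are small because the bump identity holds up to the truncation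
     error. *)
  have [k kE] : exists k : T -> T -> R, forall x z, k x z = h x * (m^-1 * bump z e x * psi z) by eexists.
  have bE x z : bump z e x = bump (0 : T) e (- x + z).
    by rewrite /bump !bump_argE subr0 (enormB x z) [- x + z]addrC.
  have mk : mf2 k.
    have mb0 := mf1_bump (0 : T) e.
    have kE' x z : k x z = h x * (m^-1 * bump 0 e (- x + z) * psi z) by rewrite kE bE.
    by apply: (eq_mf2 kE'); mauto.
  have [tot hk] : exists tot, hasint2 k tot.
    refine (@hasint_of_ile _ _ _ _ _ (fun z : T * T => `|h z.1| * (m^-1 * `|psi z.2|)) _ mk _ _) => [[x z]/=|].
      rewrite kE normrM; apply: ler_wpM2l => //; rewrite normrM; apply: ler_wpM2r => //.
      by rewrite ger0_norm ?mulr_ge0 ?bump_ge0// ler_piMr// bump_le1.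
    apply: (I2_prod (f := fun x => `|h x|) (g := fun z => m^-1 * `|psi z|)) hIh _; try mauto; try by nneg.
    by apply: (ile_scale _ _ _ hL1); [exact: mi0|mauto|nneg].
  have hx x : hasint1 (k x) (h x * psie x).
    apply: hasint_eq (hasintZ (h x) (hasint1_shift (- x) (hpsie x))) => z.
    by rewrite kE (bE x z) addrA subrr add0r.
  have tE : tot = a' - le' by apply: hasint_uniq (hasint2_fubini hk hx) htot.
  have hz z : exists H, hasint1 (fun x => k x z) H /\ `|H| <= kap * (m^-1 * Num.sqrt Eb) * `|psi z|.
    have [z8|z8] := ltP (enorm z) 8^-1; last first.
      exists 0; rewrite normr0; split; last by nneg.
      have := hasintZ 0 htot; rewrite mul0r; apply: hasint_eq => x.
      by rewrite kE psi0 ?subr0// !mulr0 mul0r.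
    have ze : enorm z + e < 4^-1 by move: e16 z8; qlra.
    have [a0 [h1 h2]] := hbump z e e0 ze.
    have abz : adm s (0 : T) 1 (bump z e).
      split; [exact: mf1_bump| | |by exists Eb].
        by move=> x; rewrite subr0 => x1; rewrite bump0//; have := enormBle x z; qlra.
      eexists; apply: ile_mono (I1_ball z e0) => x; first exact: sqr_ge0.
      case: ltP => xz; last by rewrite bump0// expr0n.
      by rewrite exprn_ile1 ?bump_ge0 ?bump_le1.
    have [a1 [h3 h4']] := P3 _ _ _ abz (hEb z) h1.
    exists (m^-1 * psi z * (a1 - a0)); split.
      apply: hasint_eq (hasintZ (m^-1 * psi z) (hasintB h3 h2)) => x; rewrite kE hE1.
      case: (ltP (enorm x) 4^-1) => x4 /=; first by ring.
      rewrite (bump0 _) ?mulr0 ?subrr ?mulr0 ?mul0r ?mulr0//.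
      by have := enormBle x z; qlra.
    rewrite distrC in h4'; rewrite !normrM (ger0_norm mi0).
    rewrite [leRHS](_ : _ = m^-1 * `|psi z| * (kap * Num.sqrt Eb)); last by ring.
    by apply: ler_wpM2l => //; nneg.
  have [H hH] := boolp.choice hz.
  have htot2 : hasint1 H tot.
    by apply: (hasint2_fubini (hasint2_swap mk hk)) => z; have [] := hH z.
  have : `|tot| <= kap * (m^-1 * Num.sqrt Eb) * L1.
    apply: (hasint_abs_le htot2 _ _ (ile_scale _ _ _ hL1)); [mauto|by move=> z; have [] := hH z|by nneg|mauto|by nneg].
  rewrite tE => ht; have -> : B - le' = (B - a') + (a' - le') by ring.
  apply: le_trans (ler_normD _ _) _; rewrite mulrDr.
  by apply: lerD => //; apply: le_trans ht _; rewrite !mulrA.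
(* Passage to the limit: the truncation errors of psi and of its mollification, both of energy at
   most E, take one half of q; the L2 distance between the two takes the other half. *)
apply/eqP; rewrite -subr_eq0 -normr_le0; apply/ler_addgt0Pr => q q0; rewrite add0r.
have sE0 : 0 <= Num.sqrt E by exact: sqrtr_ge0.
have kap0 : 0 < q / (2 * (2 * Num.sqrt E + 1)) by rewrite divr_gt0// mulr_gt0// ltr_wpDl// mulr_ge0.
have [fd [Cd [mfd Cd0 hCd P3]]] := step _ kap0.
set kap := q / _ in kap0 P3.
have [D DE] : exists D, D = Num.sqrt Cd + Num.sqrt (M ^+ 2 * (1 ^+ n * @unit_volume R n)) by eexists.
have D0 : 0 <= D by rewrite DE; nneg.
have [e [e0 e16 hcl]] : exists e, [/\ 0 < e, e < 16^-1 & D * Num.sqrt ((2 / e) ^+ n / (flat 0 (3 / 4) * @unit_volume R n) * (e `^ (n%:R + 2 * s) / (1 - s)) * E) <= q / 2].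
  have fl0 : 0 < flat 0 (3 / 4 : R).
    by rewrite /flat divr_gt0// mulr_gt0 ?exprn_gt0 ?expR_gt0// invr_gt0 divr_gt0.
  have s10 : 0 < 1 - s by rewrite subr_gt0.
  have [C1 [C10 C1E]] : exists C1, 0 <= C1 /\ C1 = 2 ^+ n / (flat 0 (3 / 4) * @unit_volume R n) / (1 - s) * E.
    eexists; split; last by []; have := @unit_volume_gt0 R n => /ltW; move: (ltW fl0) (ltW s10) => *.
    by nneg.
  have tE e : 0 < e -> (2 / e) ^+ n / (flat 0 (3 / 4) * @unit_volume R n) * (e `^ (n%:R + 2 * s) / (1 - s)) * E = C1 * e `^ (2 * s).
    move=> e0; rewrite powRDp// powR_mulrn ?(ltW e0)// expr_div_n C1E.
    have : e ^+ n != 0 by rewrite gt_eqF// exprn_gt0.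
    move: (e ^+ n) (flat _ _ * _)^-1 (1 - s)^-1 (2 ^+ n) => P X Y Z P0; field.
    by [].
  pose t := (q / 2 / (D + 1)) ^+ 2 / (C1 + 1).
  have D1 : 0 < D + 1 by rewrite ltr_wpDl.
  have C11 : 0 < C1 + 1 by rewrite ltr_wpDl.
  have q2 : 0 < q / 2 / (D + 1) by rewrite !divr_gt0.
  have t0 : 0 < t by rewrite divr_gt0// exprn_gt0.
  exists (Num.min 32^-1 (t `^ (2 * s)^-1)).
  have e0 : 0 < Num.min 32^-1 (t `^ (2 * s)^-1) by rewrite lt_min invr_gt0 ltr0n powR_gt0.
  split=> //; first by rewrite gt_min ltf_pV2 ?posrE// ltr_nat.
  rewrite tE//; apply: (@le_trans _ _ (D * (q / 2 / (D + 1)))); last first.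
    by rewrite mulrCA ler_piMr ?divr_ge0 ?(ltW q0)// ler_pdivrMr// mul1r lerDl.
  apply: ler_wpM2l => //; rewrite -[leRHS](ger0_norm (ltW q2)) -sqrtr_sqr; apply: ler_wsqrtr.
  apply: (@le_trans _ _ (C1 * t)).
    apply: ler_wpM2l => //; rewrite -[leRHS](@powR_root R s ss t (ltW t0)).
    by apply: ler_powR2; [rewrite mulr_ge0// ltW|exact: ltW|rewrite ge_min lexx orbT].
  by rewrite /t mulrCA ler_piMr ?sqr_ge0// ler_pdivrMr// mul1r lerDl.
have [psie [B [h4 hEe hc hB hl']]] := claim e e0 e16.
have [mpe pe0 _ _] := h4.
have a81 : adm s (0 : T) 1 psi by apply: adm_mono hpsi; qlra.
have a41 : adm s (0 : T) 1 psie by apply: adm_mono h4; qlra.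
have [a1 [ha1 da1]] := P3 _ _ _ a81 hE ha.
have [a2 [ha2 da2]] := P3 _ _ _ a41 hEe hB.
have md : mf1 (fun x => psie x - psi x) by mauto.
have d0 x : 1 <= enorm x -> psie x - psi x = 0.
  by move=> x1; rewrite pe0 ?psi0 ?subrr// subr0; qlra.
have d1 : `|a2 - a1| <= Num.sqrt Cd * Num.sqrt ((2 / e) ^+ n / (flat 0 (3 / 4) * @unit_volume R n) * (e `^ (n%:R + 2 * s) / (1 - s)) * E).
  apply: (cs fd Cd (fun x => psie x - psi x)) => //.
  by apply: hasint_eq (hasintB ha2 ha1) => x; rewrite mulrBr.
have d2 : `|B - l| <= Num.sqrt (M ^+ 2 * (1 ^+ n * @unit_volume R n)) * Num.sqrt ((2 / e) ^+ n / (flat 0 (3 / 4) * @unit_volume R n) * (e `^ (n%:R + 2 * s) / (1 - s)) * E).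
  apply: (cs fq _ (fun x => psie x - psi x)) => //.
  apply: hasint_eq (hasintB hl' hl) => x; case: (ltP (enorm x) 4^-1) => x4; first by rewrite fqE// mulrBr.
  by rewrite pe0 ?psi0 ?subr0 ?mulr0 ?subrr//; qlra.
have -> : a - l = (a - a1) - (a2 - a1) - (B - a2) + (B - l) by ring.
apply: le_trans (ler_normD _ _) _; apply: le_trans (lerD (ler_normB _ _) (lexx _)) _.
apply: le_trans (lerD (lerD (ler_normB _ _) (lexx _)) (lexx _)) _.
have kq : kap * (2 * Num.sqrt E + 1) = q / 2.
  by rewrite /kap; field; rewrite gt_eqF// ltr_wpDl// mulr_ge0.
move: hcl; rewrite DE mulrDl; move: kq da1 da2 d1 d2 kap0; rewrite mulrDr mulrCA mulr1; qlra.
Qed.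

End bump_density.

(** * The localized equation, its differences, and local boundedness *)

Section localized_equation.
Context {R : realType} {n : nat}.
Local Notation T := 'rV[R]_n.
Local Notation leb := (@lebesgue_rV R n).
Implicit Types (f g v w psi : T -> R) (s r a b c e : R) (Phi : R -> R).

Lemma energy_shift s (h : T) v e : s < 1 -> mf1 v -> energy s v e -> energy s (fun x => v (h + x)) e.
Proof.
move=> s1 mv hv; have := energy_affine h s1 ltr01 mv hv.
rewrite powR1 expr1n invr1 !mul1r; congr energy; apply/funext => x.
by rewrite scale1r.
Qed.

Lemma adm_shift s r psi (h : T) : s < 1 -> adm s (0 : T) r psi -> adm s 0 (r + enorm h) (fun x => psi (h + x)).
Proof.
move=> s1 [mpsi psi0 [b hb] [e he]]; split.
- by mauto.
- move=> x; rewrite subr0 => hx; apply: psi0; rewrite subr0.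
  by have := enormBle x (- h); rewrite opprK enormN [x + h]addrC; move: hx; qlra.
- by exists b; apply: (@I1_shift _ _ _ (fun x => psi x ^+ 2)) hb; [mauto|by nneg].
- by exists e; exact: energy_shift.
Qed.

Variable Lambda s0 : R.
Hypothesis Lambda1 : 1 <= Lambda.
Hypothesis s01 : 0 < s0 < 1.

Let s0_gt0 : 0 < s0. Proof. by case/andP: s01. Qed.
Let Lambda0 : 0 <= Lambda. Proof. exact: le_trans Lambda1. Qed.

Definition loc v : T -> R := fun x => cut 0 2^-1 (3 / 4) x * v x.

Lemma locE v x : enorm x <= 2^-1 -> loc v x = v x.
Proof. by move=> x2; rewrite /loc cut1 ?mul1r ?subr0//; qlra. Qed.

Lemma le_loc v x : `|loc v x| <= `|v x|.
Proof. by rewrite /loc normrM ger0_norm ?cut_ge0// ler_piMl// cut_le1. Qed.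

Lemma localized : exists K : R, 0 <= K /\ forall s Phi v c, s0 <= s < 1 ->
  structure_assumption Lambda Phi -> wsol (0 : T) 1 s Phi v -> I1 (fun x => `|v x| * wt s x) c ->
  adm s (0 : T) 1 (loc v) /\ exists f,
  [/\ mf1 f, (forall x, enorm x < 4^-1 -> `|f x| <= K * c),
    (forall x y, enorm x < 4^-1 -> enorm y < 4^-1 ->
      `|f x - f y| <= K * (`|v x - v y| + (`|v y| + c) * enorm (x - y))) &
    forall psi, adm s (0 : T) 8^-1 psi -> exists a,
      hasint2 (fun x y => pflux s Phi (loc v) x y * (psi x - psi y) * J s x y) a /\
      hasint1 (fun x => f x * psi x) a].
Proof.
have [K [K0 hK]] := @cutoff R n Lambda s0 Lambda1 s01.
exists K; split=> // s Phi v c ss hP hv hc; have [s0s s1] := andP ss.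
have s_0 : 0 < s by exact: lt_le_trans s0s.
have [hw [f [mf f1 f2 f3]]] := hK _ _ _ _ ss hP hv hc; split=> //.
exists f; split=> // psi; have [mw _ _ _] := hw.
have [mF _ F2] := flux_pflux (lt0r_neq0 s_0) hP mw.
by apply: (bump_density (M := K * c) _ Lambda0 hw mF _ F2 mf f1 f3) => [|x y]; [rewrite s_0|exact: pflux_sym hP].
Qed.

Lemma localized_sol : exists K : R, 0 <= K /\ forall s Phi v c, s0 <= s < 1 ->
  structure_assumption Lambda Phi -> wsol (0 : T) 1 s Phi v -> I1 (fun x => `|v x| * wt s x) c ->
  sol Lambda s (0 : T) 8^-1 (loc v) (pflux s Phi (loc v)) (fun=> K * c).
Proof.
have [K [K0 hK]] := localized; exists K; split=> // s Phi v c ss hP hv hc.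
have [s0s s1] := andP ss; have s_0 : 0 < s by exact: lt_le_trans s0s.
have [[mw _ _ ew] [f [mf f1 _ f3]]] := hK _ _ _ _ ss hP hv hc.
split=> //; first exact: flux_pflux (lt0r_neq0 s_0) hP mw.
move=> psi hpsi b hb; have [mpsi psi0 _ _] := hpsi.
have [a [ha1 ha2]] := f3 _ hpsi; exists a => //.
apply: (hasint_abs_le ha2 _ _ hb) => [|x]; first by mauto.
have [x8|x8] := leP 8^-1 (enorm x); first by rewrite psi0 ?subr0// mulr0 !normr0 mulr0.
by rewrite normrM ler_wpM2r// f1//; qlra.
Qed.

(** Testing the translate with psi is testing [loc v] with a translate of psi, whose support stays
    in the ball of radius 1/8 = 1/16 + 1/16. After subtraction the flux is a difference of fluxes,
    covered by [flux_pfluxB]. *)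
Lemma localized_shift : exists K : R, 0 <= K /\ forall s Phi v c, s0 <= s < 1 ->
  structure_assumption Lambda Phi -> wsol (0 : T) 1 s Phi v -> I1 (fun x => `|v x| * wt s x) c ->
  exists f, [/\ mf1 f,
    (forall x y, enorm x < 4^-1 -> enorm y < 4^-1 ->
      `|f x - f y| <= K * (`|v x - v y| + (`|v y| + c) * enorm (x - y))) &
    forall h, enorm h < 16^-1 -> exists F,
      sol Lambda s (0 : T) 16^-1 (fun x => loc v (h + x) - loc v x) F (fun x => `|f (h + x) - f x|)].
Proof.
have [K [K0 hK]] := localized; exists K; split=> // s Phi v c ss hP hv hc.
have [s0s s1] := andP ss; have s_0 : 0 < s by exact: lt_le_trans s0s.
have [[mw _ _ [e he]] [f [mf f1 f2 f3]]] := hK _ _ _ _ ss hP hv hc.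
exists f; split=> // h h16; have mwh : mf1 (fun x => loc v (h + x)) by mauto.
exists (fun x y => pflux s Phi (fun x => loc v (h + x)) x y - pflux s Phi (loc v) x y).
split; [by mauto| |exact: flux_pfluxB (lt0r_neq0 s_0) hP mwh mw|].
  have heh := energy_shift h s1 mw he.
  eexists; apply: (ile_mono_lin2 (c := 2) (e := 2) _ _ _ _ _ _ _ _ heh he); [by []|by []|mauto|mauto|by nneg|by nneg|by nneg|].
  move=> [x y] /=; have := J_ge0 x y s1; move: (J s x y) => j j0.
  move: (loc v (h + x)) (loc v (h + y)) (loc v x) (loc v y) => p q p' q'.
  by rewrite -subr_ge0 [leRHS](_ : _ = (p - q + (p' - q')) ^+ 2 * j); [nneg|ring].
move=> psi hpsi b hb; have [mpsi psi0 _ _] := hpsi.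
have a1 : adm s (0 : T) 8^-1 psi by apply: adm_mono hpsi; qlra.
have a2 : adm s (0 : T) 8^-1 (fun x => psi (- h + x)).
  by apply: adm_mono (adm_shift (- h) s1 hpsi); rewrite enormN; qlra.
have [p [hp1 hp2]] := f3 _ a1; have [q [hq1 hq2]] := f3 _ a2.
have hq3 := hasint1_shift h hq2.
have mk : mf2 (fun x y => pflux s Phi (loc v) x y * (psi (- h + x) - psi (- h + y)) * J s x y).
  have := mf2_pflux s hP mw => ?; mauto.
have hq4 := hasint2_affine h ltr01 mk hq1.
rewrite expr1n invr1 !mul1r in hq4.
exists (q - p).
  apply: hasint_eq (hasintB hq4 hp1) => -[x y] /=.
  have E : h + 1 *: x - (h + 1 *: y) = x - y by rewrite !scale1r opprD addrACA subrr add0r.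
  by rewrite /pflux /J E !addKr !scale1r -!mulrBl.
apply: (hasint_abs_le (hasintB hq3 hp2) _ _ hb) => [|x]; first by mauto.
by rewrite addKr -mulrBl normrM.
Qed.

End localized_equation.

Section boundedness.
Context {R : realType} {n : nat}.
Local Notation T := 'rV[R]_n.
Local Notation leb := (@lebesgue_rV R n).
Implicit Types (f g v w psi : T -> R) (s r a b c e : R) (Phi : R -> R).
Variable Lambda s0 : R.
Hypothesis Lambda1 : 1 <= Lambda.
Hypothesis s01 : 0 < s0 < 1.
Hypothesis n_gt0 : (1 <= n)%N.

Let s0_gt0 : 0 < s0. Proof. by case/andP: s01. Qed.

Lemma localized_rescaled : exists K : R, 0 <= K /\ forall s Phi v r lam, s0 <= s < 1 ->
  structure_assumption Lambda Phi -> wsol (0 : T) 1 s Phi v -> I1 (fun x => `|v x| * wt s x) 1 ->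
  0 < r <= 8^-1 -> lam != 0 -> `|lam| <= 1 ->
  exists F g, [/\ sol Lambda s (0 : T) 1 (fun x => lam * loc v (r *: x)) F g, mf1 g,
    (forall x, 0 <= g x) & (forall x, g x <= K)].
Proof.
have [K [K0 hK]] := @localized_sol R n Lambda s0 Lambda1 s01.
exists K; split=> // s Phi v r lam ss hP hv hc /andP[r0 r8] l0 l1.
have [s0s s1] := andP ss; have s_in : 0 < s < 1 by rewrite (lt_le_trans s0_gt0 s0s).
have [mw ew fw hs] := hK _ _ _ _ ss hP hv hc.
have hs' : sol Lambda s (0 : T) r (loc v) (pflux s Phi (loc v)) (fun=> K * 1).
  by split=> // psi hpsi; apply: hs; apply: adm_mono hpsi.
have mK : mf1 (fun _ : T => K * 1) by mauto.
have := sol_affine 0 s_in r0 l0 mK _ hs'; rewrite mulr1 => /(_ (fun=> K0)) h.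
exists (fun x y => lam * pflux s Phi (loc v) (0 + r *: x) (0 + r *: y)), (fun=> `|lam| * r `^ (2 * s) * K).
have r2 : r `^ (2 * s) <= 1.
  have [s_0 _] := andP s_in.
  by rewrite -[leRHS](congr1 (fun f : R -> R => f (2 * s)) (powR1 R)); apply: ler_powR2; [rewrite mulr_ge0// ltW|exact: ltW|qlra].
split; [|by mauto|by move=> _; rewrite !mulr_ge0 ?powR_ge0| by move=> _; rewrite ler_piMl// mulr_ile1 ?powR_ge0].
by congr sol: h; apply/funext => x; rewrite add0r subr0.
Qed.

(** Two normalizations, carried out for v and for - v: mu brings mass and tail below 1, as
    [L2_bound] requires at scale 1/8; nu brings the resulting L2 bound below the threshold of
    [de_giorgi_first] at scale 1/16. *)
Lemma bounded_sol : exists K : R, 0 < K /\ forall s Phi v, s0 <= s < 1 ->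
  structure_assumption Lambda Phi -> wsol (0 : T) 1 s Phi v ->
  I1 (fun x => \1[enorm x < 1] * `|v x|) 1 -> I1 (fun x => `|v x| * wt s x) 1 ->
  {ae leb, forall x, enorm x < 32^-1 -> `|v x| <= K}.
Proof.
have [K [K0 hK]] := localized_rescaled.
have K1 : 1 <= K + 1 by rewrite lerDr.
have [C [C0 hC]] := @L2_bound R n Lambda s0 Lambda1 s01 n_gt0 (K + 1) K1.
have [eps [eps0 hE]] := @de_giorgi_first R n Lambda s0 Lambda1 s01 n_gt0 (K + 1) K1.
(* (1 + r)^(n+2) and r^-n are the losses in rescaling the tail by a factor r between 1/16 and
   1/8. *)
pose mu : R := (2 ^+ (n + 2) * 16 ^+ n)^-1.
have p0 : 0 < 2 ^+ (n + 2) * 16 ^+ n :> R by rewrite mulr_gt0 ?exprn_gt0.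
have mu0 : 0 < mu by rewrite invr_gt0.
have mu1 : mu <= 1.
  by rewrite invf_le1// mulr_ege1// exprn_ege1 ?ler1n.
pose nu : R := Num.min 1 (eps / (2 ^+ n * C + 1)).
have q0 : 0 < 2 ^+ n * C + 1 by rewrite ltr_wpDl// mulr_ge0 ?exprn_ge0.
have nu0 : 0 < nu by rewrite lt_min ltr01 divr_gt0.
have nu1 : nu <= 1 by rewrite ge_min lexx.
have nuC : nu ^+ 2 * (2 ^+ n * C) <= eps.
  apply: (@le_trans _ _ (nu * (2 ^+ n * C + 1))).
    by rewrite expr2 -mulrA ler_wpM2l ?(ltW nu0)//; have : 0 <= 2 ^+ n * C by [rewrite mulr_ge0 ?exprn_ge0]; move: nu1 nu0; move: (2 ^+ n * C) nu => ? ?; nra.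
  by rewrite -ler_pdivlMr// ge_min lexx orbT.
exists (mu * nu)^-1; split; first by rewrite invr_gt0 mulr_gt0.
move=> s Phi v ss hP hv hm ht; have [s0s s1] := andP ss.
have s_in : 0 < s < 1 by rewrite (lt_le_trans s0_gt0 s0s).
have [mv _ [e2 he2] _ _] := hv.
have mw : mf1 (loc v) by have mc := mf1_cut (0 : T) 2^-1 (3 / 4); rewrite /loc; mauto.
have tl r (z : R) : 0 < r -> 16^-1 <= r -> r <= 8^-1 -> `|z| <= mu -> I1 (fun x : T => pos_part (fun x => z * loc v (r *: x)) 0 x * wt s x) 1.
  move=> r0 r16 r8 zm; have h := tail_affine 0 s_in r0 mv ht.
  have := ile_scale (normr_ge0 z) _ _ h; rewrite enorm0 addr0 mulr1 => /(_ ltac:(mauto) ltac:(nneg)) {}h.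
  apply: ile_le (ile_mono _ _ h) => [|x|x].
  - apply: le_trans (ler_wpM2r _ zm) _; first by rewrite !mulr_ge0 ?exprn_ge0 ?invr_ge0 ?exprn_ge0 ?addr_ge0 ?(ltW r0).
    rewrite /mu mulrC ler_pdivrMr// mul1r; apply: ler_pM.
    - by rewrite exprn_ge0// addr_ge0// ltW.
    - by rewrite invr_ge0 exprn_ge0// ltW.
    - by rewrite lerXn2r ?nnegrE//; qlra.
    - by rewrite -exprVn lerXn2r ?nnegrE ?invr_ge0 ?(ltW r0)// invf_ple ?posrE//.
  - by rewrite mulr_ge0 ?pos_part_ge0 ?wt_ge0.
  - rewrite [leRHS]mulrA ler_wpM2r ?wt_ge0//; rewrite /pos_part subr0 ge_max mulr_ge0//=.
    by apply: le_trans (ler_norm _) _; rewrite normrM add0r ler_wpM2l// le_loc.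
have ms r (z : R) (x : T) : \1[enorm x < 1] * pos_part (fun x => z * loc v (r *: x)) 0 x <= `|z| * (\1[enorm x < 1] * `|v (0 + r *: x)|).
  rewrite mulrCA ler_wpM2l// ?ler0n// add0r /pos_part subr0 ge_max mulr_ge0//=.
  by apply: le_trans (ler_norm _) _; rewrite normrM ler_wpM2l// le_loc.
have sub r (x : T) : 0 < r <= 8^-1 -> enorm x < 1 -> enorm (0 + r *: x) < 1.
  move=> /andP[r0 r8] x1; rewrite add0r enormZ gtr0_norm//; apply: le_lt_trans x1.
  by rewrite ler_piMl ?enorm_ge0//; qlra.
have main (sg : R) : `|sg| = 1 -> {ae leb, forall x, enorm x < 32^-1 -> sg * v x <= (mu * nu)^-1}.
  move=> sg1; have sg0 : sg != 0 by rewrite -normr_eq0 sg1 oner_eq0.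
  have z1 : sg * mu != 0 by rewrite mulf_neq0// gt_eqF.
  have z1m : `|sg * mu| = mu by rewrite normrM sg1 mul1r gtr0_norm.
  have [F [g [hs mg g0 gK]]] := hK s Phi v 8^-1 (sg * mu) ss hP hv ht ltac:(by rewrite invr_gt0 ltr0n lexx) z1 ltac:(by rewrite z1m).
  have {}h2 : I1 (fun x => \1[enorm x < 2^-1] * pos_part (fun x : T => sg * mu * loc v (8^-1 *: x)) 0 x ^+ 2) C.
    apply: (hC s _ F g ss hs mg g0).
    - by move=> x _; apply: le_trans (gK x) _; have := normr_ge0 (sg * mu * loc v (8^-1 *: x)); move: `|_| => t t0; rewrite mulrDr mulr1; have := mulr_ge0 (le_trans ler01 K1) t0; qlra.
    - have h := I1_affine (f := fun x => \1[enorm x < 1] * `|v x|) (0 : T) (r := 8^-1) ltac:(by []) ltac:(mauto) ltac:(nneg) hm.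
      have := ile_scale (ltW mu0) _ _ h => /(_ ltac:(mauto) ltac:(nneg)) {}h.
      apply: ile_le (ile_mono _ _ h) => [|x|x].
      - rewrite mulr1 exprVn invrK /mu mulrC ler_pdivrMr// mul1r.
        apply: (@le_trans _ _ (1 * 16 ^+ n)); first by rewrite mul1r lerXn2r ?nnegrE ?ler_nat.
        by rewrite ler_wpM2r ?exprn_ge0// exprn_ege1 ?ler1n.
      - by rewrite mulr_ge0 ?pos_part_ge0.
      - apply: le_trans (ms _ _ _) _; rewrite z1m ler_wpM2l ?(ltW mu0)//.
        case: (ltP (enorm x) 1) => x1; last by rewrite mul0r mulr_ge0.
        by rewrite (sub 8^-1)// invr_gt0 ltr0n lexx.
    - by apply: tl; rewrite ?z1m//; qlra.
    - have h := I1_affine (f := fun x => \1[enorm (x - 0) < 1] * v x ^+ 2) (0 : T) (r := 8^-1) ltac:(by []) ltac:(mauto) ltac:(nneg) he2.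
      eexists; apply: (ile_mono_scale (c := mu ^+ 2) _ _ _ _ _ h); [by nneg|mauto|by nneg|by move=> x; rewrite mulr_ge0 ?sqr_ge0|move=> x].
      case: (ltP (enorm x) 1) => x1; last by rewrite mul0r; nneg.
      rewrite subr0 (sub 8^-1) ?invr_gt0 ?ltr0n ?lexx// !mul1r.
      have := ms 8^-1 (sg * mu) x; rewrite x1 !mul1r z1m => h3.
      rewrite -[v _ ^+ 2]real_normK ?num_real// -exprMn lerXn2r ?nnegrE ?pos_part_ge0//.
      by rewrite mulr_ge0// ltW.
  have z2 : sg * mu * nu != 0 by rewrite mulf_neq0// gt_eqF.
  have z2m : `|sg * mu * nu| = mu * nu by rewrite normrM z1m (gtr0_norm nu0).
  have mn1 : mu * nu <= mu by rewrite ler_piMr// ltW.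
  have [F2 [g2 [hs2 mg2 g20 gK2]]] := hK s Phi v 16^-1 (sg * mu * nu) ss hP hv ht ltac:(by rewrite invr_gt0 ltr0n lef_pV2 ?posrE ?ltr0n// ler_nat) z2 ltac:(by rewrite z2m (le_trans mn1)).
  have h3 : {ae leb, forall x : T, enorm x < 2^-1 -> sg * mu * nu * loc v (16^-1 *: x) <= 1}.
    apply: (hE s _ F2 g2 ss hs2 mg2 g20).
    - move=> x _; apply: le_trans (gK2 x) _.
      have := normr_ge0 (sg * mu * nu * loc v (16^-1 *: x)); move: `|_| => t t0; rewrite mulrDr mulr1; have := mulr_ge0 (le_trans ler01 K1) t0; qlra.
    - have h := I1_affine (0 : T) (r := 2^-1) ltac:(by []) _ _ h2.
      have {}h := h ltac:(rewrite /pos_part; mauto) ltac:(nneg).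
      apply: ile_le nuC _; rewrite exprVn invrK in h.
      apply: (ile_mono_scale _ _ _ _ _ h); [by nneg| |by nneg|by move=> x; rewrite mulr_ge0 ?sqr_ge0|move=> x].
        by rewrite /pos_part; mauto.
      rewrite (_ : (enorm (0 + 2^-1 *: x) < 2^-1) = (enorm x < 1)); last first.
        by rewrite add0r enormZ gtr0_norm// -[ltRHS]mulr1 ltr_pM2l.
      rewrite add0r.
      rewrite [leRHS]mulrCA ler_wpM2l ?ler0n// /pos_part !subr0 scalerA (_ : 8^-1 * 2^-1 = 16^-1 :> R); last by field.
      by rewrite -exprMn maxr_pMr ?(ltW nu0)// mulr0 [nu * _]mulrA [nu * _]mulrC lexx.
    - by apply: ile_le K1 _; apply: tl; rewrite ?z2m//; qlra.
  apply: (@ae_affine R n 0 16^-1); first by rewrite invr_gt0.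
  apply: filterS h3 => x h; rewrite add0r enormZ gtr0_norm// => x1.
  have x2 : enorm x < 2^-1 by move: x1; qlra.
  have := h x2; rewrite locE; last by rewrite enormZ gtr0_norm//; move: x2; qlra.
  move=> h4; rewrite -[(mu * nu)^-1]mul1r ler_pdivlMr ?mulr_gt0//.
  by rewrite (_ : _ * (mu * nu) = sg * mu * nu * v (16^-1 *: x))//; ring.
have h1 := main 1 (normr1 _); have h2 := main (- 1) ltac:(by rewrite normrN normr1).
apply: filterS2 h1 h2 => x h1 h2 x32; have := h1 x32; have := h2 x32.
by rewrite mul1r mulN1r ler_norml lerNl => -> ->.
Qed.

End boundedness.

(** * Hoelder representatives, difference quotients and improvement of the exponent *)

Section representatives.
Context {R : realType} {n : nat}.
Local Notation T := 'rV[R]_n.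
Local Notation leb := (@lebesgue_rV R n).
Implicit Types (f g v w psi : T -> R) (s r a b c e : R) (Phi : R -> R).

Lemma powR_subadd (a b gam : R) : 0 <= a -> 0 <= b -> 0 < gam <= 1 -> (a + b) `^ gam <= a `^ gam + b `^ gam.
Proof.
move=> a0 b0 /andP[g0 g1]; have [ab|ab] := leP (a + b) 0.
  have -> : a + b = 0 by qlra.
  by rewrite powR0 ?gt_eqF// addr_ge0 ?powR_ge0.
have st (t : R) : 0 <= t -> t <= a + b -> t / (a + b) * (a + b) `^ gam <= t `^ gam.
  move=> t0 tab; have [->|tn] := eqVneq t 0; first by rewrite !mul0r powR_ge0.
  have tp : 0 < t by rewrite lt_neqAle eq_sym tn.
  have u1 : 0 < t / (a + b) <= 1 by rewrite divr_gt0//= ler_pdivrMr// mul1r.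
  rewrite -[X in _ <= X `^ _](@divfK _ (a + b)) ?gt_eqF// powRM ?divr_ge0 ?(ltW ab)//.
  by rewrite ler_wpM2r ?powR_ge0// -[leLHS]powRr1 ?divr_ge0 ?(ltW ab)// ger_powR.
apply: (@le_trans _ _ (a / (a + b) * (a + b) `^ gam + b / (a + b) * (a + b) `^ gam)).
  by rewrite -!mulrDl divff ?gt_eqF// mul1r.
by apply: lerD; apply: st => //; [rewrite lerDl|rewrite lerDr].
Qed.

(** McShane's formula, the infimum over y in D of v y + K |x - y|^gam; for gam <= 1 the power of the
    distance still satisfies the triangle inequality. *)
Lemma holder_extension (D : set T) v K gam : 0 <= K -> 0 < gam <= 1 ->
  (forall x y, D x -> D y -> `|v x - v y| <= K * enorm (x - y) `^ gam) ->
  exists w, (forall x, D x -> w x = v x) /\ forall x y, `|w x - w y| <= K * enorm (x - y) `^ gam.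
Proof.
move=> K0 hg hD; have [g0 g1] := andP hg.
have [[y0 Dy0]|nD] := pselect (exists y, D y); last first.
  exists (fun=> 0); split=> [x Dx|x y]; first by exfalso; apply: nD; exists x.
  by rewrite subrr normr0 mulr_ge0 ?powR_ge0.
have [P PE] : exists P : T -> T -> R, forall x y, P x y = K * enorm (x - y) `^ gam by eexists.
have P0 x : P x x = 0 by rewrite PE subrr enorm0 powR0 ?mulr0// gt_eqF.
have Ps x y : P x y = P y x by rewrite !PE enormB.
have Pt (x y z : T) : P x z <= P x y + P y z.
  rewrite !PE -mulrDr ler_wpM2l//; apply: le_trans (powR_subadd (enorm_ge0 _) (enorm_ge0 _) hg).
  by apply: ler_powR2; [exact: ltW|exact: enorm_ge0|exact: enorm_triangle].
have {hD}hP x y : D x -> D y -> v x - v y <= P x y.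
  by move=> Dx Dy; rewrite PE (le_trans (ler_norm _))// hD.
pose S x := [set v y + P x y | y in D].
have Sl x : has_lbound (S x).
  exists (v y0 - P y0 x) => _ [y Dy <-].
  by have := hP _ _ Dy0 Dy; have := Pt y0 x y; qlra.
have S0 x : S x !=set0 by exists (v y0 + P x y0); exists y0.
have main x y : inf (S x) - inf (S y) <= P x y.
  rewrite lerBlDr -lerBlDl; apply: lb_le_inf => // _ [z Dz <-].
  have h : inf (S x) <= v z + P x z by apply: ge_inf => //; exists z.
  by have := Pt x y z; move: h; qlra.
exists (fun x => inf (S x)); split=> [x Dx|x y].
  apply/eqP; rewrite eq_le; apply/andP; split.
    by apply: ge_inf => //; exists x => //; rewrite P0 addr0.
  by apply: lb_le_inf => // _ [y Dy <-]; have := hP _ _ Dx Dy; qlra.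
rewrite -PE ler_norml; have := main x y; have := main y x; rewrite (Ps y x) => h1 h2.
by apply/andP; split; move: h1 h2; qlra.
Qed.

Lemma holder_continuous_at v K gam r x : 0 <= K -> 0 < gam -> 0 < r ->
  (forall y, enorm (y - x) < r -> `|v y - v x| <= K * enorm (y - x) `^ gam) -> {for x, continuous v}.
Proof.
move=> K0 g0 r0 hv; apply/continuous_enormP => e e0.
have K1 : 0 < K + 1 by rewrite ltr_wpDl.
exists (Num.min r ((e / (K + 1)) `^ gam^-1)); first by rewrite lt_min r0 powR_gt0 ?divr_gt0.
move=> y; rewrite lt_min => /andP[yr yx]; apply: le_lt_trans (hv _ yr) _.
have h : enorm (y - x) `^ gam < e / (K + 1).
  have -> : e / (K + 1) = ((e / (K + 1)) `^ gam^-1) `^ gam.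
    by rewrite -powRrM mulVf ?gt_eqF// powRr1// divr_ge0 ?ltW.
  by apply: gt0_ltr_powR => //; rewrite nnegrE ?enorm_ge0 ?powR_ge0.
apply: le_lt_trans (ler_wpM2r (powR_ge0 _ _) (_ : K <= K + 1)) _; first by rewrite lerDl.
by rewrite mulrC -ltr_pdivlMr.
Qed.

Lemma ae_ball (x0 : T) r (P : T -> Prop) : 0 < r -> {ae leb, forall x, P x} ->
  exists y, enorm (y - x0) < r /\ P y.
Proof.
move=> r0 [N [mN N0 sub]]; have [//|h] := pselect (exists y, enorm (y - x0) < r /\ P y).
exfalso; have : (leb (eball x0 r) <= leb N)%E.
  apply: le_measure; rewrite ?inE//; first exact: measurable_eball.
  by move=> y hy; apply: sub => /= Py; apply: h; exists y.
rewrite N0 leb_eball// lee_fin leNgt => /negP; apply.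
by rewrite mulr_gt0 ?exprn_gt0 ?unit_volume_gt0.
Qed.

Lemma ae_continuous_eq (x0 : T) r f g : 0 < r ->
  {ae leb, forall x, enorm (x - x0) < r -> f x = g x} ->
  {for x0, continuous f} -> {for x0, continuous g} -> f x0 = g x0.
Proof.
move=> r0 fg /continuous_enormP cf /continuous_enormP cg; apply/eqP; apply/negPn/negP => ne.
have d0 : 0 < `|f x0 - g x0| / 2 by rewrite divr_gt0// normr_gt0 subr_eq0.
have [r1 r10 h1] := cf _ d0; have [r2 r20 h2] := cg _ d0.
have m0 : 0 < Num.min r (Num.min r1 r2) by rewrite !lt_min r0 r10.
have [y [+ fgy]] := ae_ball x0 m0 fg; rewrite !lt_min => /and3P[yr y1 y2].
have := h1 _ y1; have := h2 _ y2; rewrite fgy// => h3 h4.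
have := le_lt_trans (ler_distD (g y) (f x0) (g x0)) (ltrD _ h3); rewrite [`|f x0 - g y|]distrC => /(_ _ h4).
by rewrite -splitr ltxx.
Qed.

Lemma wsol_ae Lambda x0 r s Phi v w : s < 1 -> structure_assumption Lambda Phi ->
  mf1 w -> {ae leb, forall x, v x = w x} -> wsol (x0 : T) r s Phi v -> wsol x0 r s Phi w.
Proof.
move=> s1 hP mw vw [mv [a ha] [b hb] [c hc] hd]; have vw2 := ae_prod vw.
have mFw := mf2_pflux s hP mw.
split=> //.
- exists a; apply: ile_ae ha; [mauto|mauto|by move=> z; nneg|by move=> z; nneg|].
  by apply: filterS vw2 => -[x y] /= [-> ->].
- exists b; apply: ile_ae hb; [mauto|mauto|by nneg|by nneg|].
  by apply: filterS vw => x ->.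
- exists c; apply: ile_ae hc; [mauto|mauto|by nneg|by nneg|].
  by apply: filterS vw => x ->.
- move=> z e e0 ze; apply: hasint_ae (hd z e e0 ze).
    by have mb := mf1_bump z e; have h : mf2 (fun x y => pflux s Phi w x y * (bump z e x - bump z e y) * J s x y) by [mauto].
  by apply: filterS vw2 => -[x y] /= [e1 e2]; rewrite /pflux e1 e2.
Qed.

End representatives.

Section difference_estimate.
Context {R : realType} {n : nat}.
Local Notation T := 'rV[R]_n.
Local Notation leb := (@lebesgue_rV R n).
Implicit Types (f g v w psi : T -> R) (s r a b c e : R) (Phi : R -> R).
Variable Lambda s0 : R.
Hypothesis Lambda1 : 1 <= Lambda.
Hypothesis s01 : 0 < s0 < 1.
Hypothesis n_gt0 : (1 <= n)%N.

Let s0_gt0 : 0 < s0. Proof. by case/andP: s01. Qed.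
Let s0_lt1 : s0 < 1. Proof. by case/andP: s01. Qed.

(** The Hoelder bound holds off a null set. The extension of the good values is the representative
    near the origin; v itself is kept elsewhere. *)
Lemma holder_representative : exists gam K : R, [/\ 0 < gam, gam < 1, 0 <= K &
  forall s Phi v, s0 <= s < 1 -> structure_assumption Lambda Phi -> wsol (0 : T) 1 s Phi v ->
  I1 (fun x => `|v x| * wt s x) 1 -> {ae leb, forall x, enorm x < 1 -> `|v x| <= 1} ->
  exists w, [/\ mf1 w, {ae leb, forall x, v x = w x}, (forall x, enorm x < 16^-1 -> `|w x| <= 1 + K) &
    forall x y, enorm x < 16^-1 -> enorm y < 16^-1 -> `|w x - w y| <= K * enorm (x - y) `^ gam]].
Proof.
have [Kl [Kl0 hKl]] := @localized_rescaled R n Lambda s0 Lambda1 s01.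
have [gam [C [g0 gs C0 hC]]] := @holder_bounded R n Lambda s0 Lambda1 s01 n_gt0.
have g1 : gam < 1 by exact: le_lt_trans s0_lt1.
have gg : 0 < gam <= 1 by rewrite g0 ltW.
exists gam, (C * (1 + Kl) * 8 `^ gam); split=> //; first by rewrite !mulr_ge0 ?addr_ge0 ?powR_ge0.
move=> s Phi v ss hP hv ht hb; have [mv _ _ _ _] := hv.
have [F [g [hs mg g_0 gK]]] := hKl s Phi v 8^-1 1 ss hP hv ht ltac:(by rewrite invr_gt0 ltr0n lexx) (oner_neq0 _) ltac:(by rewrite normr1).
have hz : {ae leb, forall x : T, `|1 * loc v (8^-1 *: x)| <= 1}.
  apply: (@ae_affine R n 0 8) => //; apply: filterS hb => x h.
  rewrite add0r scalerA mulVf ?pnatr_eq0// scale1r mul1r.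
  have [x1|x1] := ltP (enorm x) 1; first by apply: le_trans (le_loc _ _) (h x1).
  by rewrite /loc cut0 ?mul0r ?normr0// ?subr0; qlra.
have [N [mN N0 hN]] := hC s _ F g 1 Kl ss hs mg g_0 (fun x _ => gK x) hz ltr01 Kl0.
have hN' : {ae leb, forall x, ~ N (8 *: x)}.
  apply: (@ae_affine R n 0 8^-1); first by rewrite invr_gt0.
  by exists N; split=> // x /=; rewrite add0r scalerA divff ?pnatr_eq0// scale1r => /contrapT.
pose D := [set x : T | [/\ enorm x < 16^-1, ~ N (8 *: x) & `|v x| <= 1]].
have K0 : 0 <= C * (1 + Kl) * 8 `^ gam by rewrite !mulr_ge0 ?addr_ge0 ?powR_ge0.
have hD x y : D x -> D y -> `|v x - v y| <= C * (1 + Kl) * 8 `^ gam * enorm (x - y) `^ gam.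
  move=> [x16 Nx _] [y16 Ny _].
  have sc (z : T) : enorm z < 16^-1 -> enorm (8 *: z) < 2^-1 by move=> h; rewrite enormZ gtr0_norm//; move: h; qlra.
  have := hN _ _ (sc _ x16) (sc _ y16) Nx Ny.
  have e8 (z : T) : 8^-1 *: (8 *: z) = z by rewrite scalerA mulVf ?pnatr_eq0// scale1r.
  have l2 (z : T) : enorm z < 16^-1 -> loc v z = v z by move=> h; rewrite locE//; move: h; qlra.
  rewrite !e8 (l2 _ x16) (l2 _ y16) !mul1r.
  by rewrite -scalerBr enormZ (ger0_norm (_ : 0 <= 8 :> R))// powRM ?enorm_ge0// mulrA.
have [W [WD hW]] := holder_extension K0 gg hD.
have mW : mf1 W.
  apply: continuous_measurable_rV => x; apply: (holder_continuous_at (r := 1) K0 g0 ltr01) => y _.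
  exact: hW.
have hDae : {ae leb, forall x, enorm x < 16^-1 -> D x}.
  by apply: filterS2 hN' hb => x h1 h2 h3; split=> //; apply: h2; move: h3; qlra.
exists (fun x => \1[enorm x < 16^-1] * W x + \1[16^-1 <= enorm x] * v x); split.
- by mauto.
- apply: filterS hDae => x h; case: (ltP (enorm x) 16^-1) h => x16 h.
    by rewrite mul1r mul0r addr0 WD//; exact: h.
  by rewrite mul0r mul1r add0r.
- move=> x x16; rewrite x16 [16^-1 <= _]leNgt x16 mul1r mul0r addr0.
  have p0 : 0 < 16^-1 :> R by rewrite invr_gt0.
  have [y [y16 Dy]] := ae_ball (0 : T) p0 hDae; rewrite subr0 in y16; have {}Dy := Dy y16.
  have [_ _ vy] := Dy; rewrite -[W x](subrK (W y)) addrC; apply: le_trans (ler_normD _ _) _.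
  apply: lerD; first by rewrite WD.
  apply: le_trans (hW x y) _; rewrite ler_piMr//.
  rewrite -[leRHS](congr1 (fun f : R -> R => f gam) (powR1 R)); apply: ler_powR2; [exact: ltW|exact: enorm_ge0|].
  by apply: le_trans (enormD _ _) _; rewrite enormN; move: x16 y16; qlra.
- by move=> x y x16 y16; rewrite x16 y16 ![16^-1 <= _]leNgt x16 y16 !mul1r !mul0r !addr0.
Qed.

(** The quotient (loc v (h + x) - loc v x) / |h|^bet is bounded and solves an equation with bounded
    right-hand side, both because v has a Hoelder modulus of exponent bet. The claim is its Hoelder
    continuity with exponent gam. *)
Lemma difference_estimate : exists gam C : R, [/\ 0 < gam, gam < 1, 0 <= C &
  forall s Phi v bet, s0 <= s < 1 -> structure_assumption Lambda Phi -> wsol (0 : T) 1 s Phi v ->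
  I1 (fun x => `|v x| * wt s x) 1 -> 0 < bet <= 1 -> (forall x, enorm x < 1 -> `|v x| <= 1) ->
  (forall x y, enorm x < 1 -> enorm y < 1 -> `|v x - v y| <= enorm (x - y) `^ bet) ->
  forall x h k, enorm x < 64^-1 -> enorm h < 64^-1 -> enorm k < 64^-1 ->
  `|v (x + k + h) - v (x + k) - (v (x + h) - v x)| <= C * enorm h `^ bet * enorm k `^ gam].
Proof.
have [K [K0 hK]] := @localized_shift R n Lambda s0 Lambda1 s01.
have [gam [C [g0 gs C0 hC]]] := @holder_bounded R n Lambda s0 Lambda1 s01 n_gt0.
have g1 : gam < 1 by exact: le_lt_trans s0_lt1.
have gg : 0 < gam <= 1 by rewrite g0 ltW.
exists gam, (C * (5 + 3 * K) * 16 `^ gam); split=> //; first by rewrite !mulr_ge0 ?addr_ge0 ?mulr_ge0 ?powR_ge0.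
move=> s Phi v bet ss hP hv ht /andP[b0 b1] vb vh x h k x64 h64 k64.
have [s0s s1] := andP ss; have s_in : 0 < s < 1 by rewrite (lt_le_trans s0_gt0 s0s).
have [->|hn0] := eqVneq h 0.
  by rewrite !addr0 !subrr normr0 !mulr_ge0 ?addr_ge0 ?mulr_ge0 ?powR_ge0.
have [f [mf f2 f3]] := hK s Phi v 1 ss hP hv ht.
have h16 : enorm h < 16^-1 by move: h64; qlra.
have [F hs] := f3 h h16.
have [mv _ _ _ _] := hv.
have mw : mf1 (loc v) by have mc := mf1_cut (0 : T) 2^-1 (3 / 4); rewrite /loc; mauto.
have h0 : 0 < enorm h by rewrite enorm_gt0.
have hb0 : 0 < enorm h `^ bet by rewrite powR_gt0.
have il0 : 0 < (enorm h `^ bet)^-1 by rewrite invr_gt0.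
have hhb : enorm h <= enorm h `^ bet.
  by rewrite -[leLHS]powRr1 ?(ltW h0)// ger_powR// h0/=; move: h64; qlra.
have l0 : (enorm h `^ bet)^-1 != 0 by rewrite invr_neq0// gt_eqF.
have r0 : 0 < 16^-1 :> R by rewrite invr_gt0.
have mg : mf1 (fun x => `|f (h + x) - f x|) by mauto.
have hs2 := sol_affine 0 s_in r0 l0 mg (fun x => normr_ge0 _) hs.
(* 5 = 1 + 4: the increment of v, and that of the cut-off, of slope 4, times |v| <= 1, with |h| <=
   |h|^bet. *)
have bd (y : T) : `|loc v (h + y) - loc v y| <= 5 * enorm h `^ bet.
  have far (z z' : T) : 1 <= enorm z -> enorm (z' - z) = enorm h -> loc v z = 0 /\ loc v z' = 0.
    move=> z1 zz; have := enormBle z z'; rewrite enormB zz => z2.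
    by rewrite /loc !cut0 ?mul0r// ?subr0; [qlra|move: z2 z1 h64; qlra|qlra|qlra].
  have [y1|y1] := leP 1 (enorm y).
    have [-> ->] : loc v y = 0 /\ loc v (h + y) = 0 by apply: far; rewrite ?addrK.
    by rewrite subrr normr0 mulr_ge0// ltW.
  have [hy1|hy1] := leP 1 (enorm (h + y)).
    have [-> ->] : loc v (h + y) = 0 /\ loc v y = 0.
      by apply: far; rewrite ?opprD ?[y + _]addrCA ?subrr ?addr0 ?enormN.
    by rewrite subrr normr0 mulr_ge0// ltW.
  have := vh _ _ hy1 y1; rewrite addrK => v1; have v2 := vb _ y1.
  have e34 : (2^-1 : R) < 3 / 4 by qlra.
  have := cut_lip (0 : T) (h + y) y e34; rewrite addrK (_ : (3 / 4 - 2^-1)^-1 = 4 :> R); last by field.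
  move=> c1; have c2 := cut_le1 (0 : T) 2^-1 (3 / 4) (h + y); have c3 := cut_ge0 (0 : T) 2^-1 (3 / 4) (h + y).
  rewrite /loc; move: (cut _ _ _ (h + y)) (cut _ _ _ y) c1 c2 c3 => p q c1 c2 c3.
  have -> : p * v (h + y) - q * v y = p * (v (h + y) - v y) + (p - q) * v y by ring.
  apply: le_trans (ler_normD _ _) _; rewrite !normrM (ger0_norm c3).
  apply: (@le_trans _ _ (1 * enorm h `^ bet + 4 * enorm h * 1)).
    by apply: lerD; apply: ler_pM.
  by move: hhb; qlra.
have hz : {ae leb, forall y : T, `|(enorm h `^ bet)^-1 * (loc v (h + (0 + 16^-1 *: y)) - loc v (0 + 16^-1 *: y) - 0)| <= 5}.
  apply: aeW => y; rewrite subr0 normrM gtr0_norm ?invr_gt0// mulrC ler_pdivrMr//; exact: bd.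
have r2 : 16^-1 `^ (2 * s) <= 1 :> R.
  have [s_0 _] := andP s_in.
  by rewrite -[leRHS](congr1 (fun f : R -> R => f (2 * s)) (powR1 R)); apply: ler_powR2; [rewrite mulr_ge0// ltW|exact: ltW|qlra].
have mg2 : mf1 (fun y : T => `|(enorm h `^ bet)^-1| * 16^-1 `^ (2 * s) * `|f (h + (0 + 16^-1 *: y)) - f (0 + 16^-1 *: y)|) by mauto.
have gM (y : T) : enorm y < 1 ->
  `|(enorm h `^ bet)^-1| * 16^-1 `^ (2 * s) * `|f (h + (0 + 16^-1 *: y)) - f (0 + 16^-1 *: y)| <= 3 * K.
  move=> y1; rewrite add0r; have y16 : enorm (16^-1 *: y) < 16^-1.
    by rewrite enormZ gtr0_norm// -[ltRHS]mulr1 ltr_pM2l.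
  move: (16^-1 *: y) y16 => {y1}y y16.
  have hy : enorm (h + y) < 8^-1 by apply: le_lt_trans (enormD _ _) _; move: y16 h16; qlra.
  have [y4 hy4 y1 hy1] : [/\ enorm y < 4^-1, enorm (h + y) < 4^-1, enorm y < 1 & enorm (h + y) < 1].
    by split; move: hy y16; qlra.
  have := f2 _ _ hy4 y4; have := vh _ _ hy1 y1; have := vb _ y1; rewrite addrK => v1 v2 v3.
  have v4 : `|f (h + y) - f y| <= K * (3 * enorm h `^ bet).
    apply: le_trans v3 _; rewrite ler_wpM2l//.
    have := ler_wpM2r (ltW h0) v1; move: v2 hhb; rewrite mulrDl !mul1r; qlra.
  rewrite mulrAC; apply: (@le_trans _ _ (3 * K * 1)); last by rewrite mulr1.
  apply: ler_pM; [nneg|nneg| |exact: r2].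
  by rewrite (gtr0_norm il0) mulrC (ler_pdivrMr _ _ hb0) [3 * K]mulrC -mulrA.
have [N [mN N0 hN]] := hC s _ _ _ 5 (3 * K) ss hs2 mg2 ltac:(move=> y; nneg) gM hz ltac:(by []) ltac:(nneg).
pose z (y : T) := (enorm h `^ bet)^-1 * (loc v (h + (0 + 16^-1 *: y)) - loc v (0 + 16^-1 *: y) - 0).
have zE (y : T) : enorm y < 2^-1 -> z y = (enorm h `^ bet)^-1 * (v (h + 16^-1 *: y) - v (16^-1 *: y)).
  move=> y2; rewrite /z add0r subr0.
  have y32 : enorm (16^-1 *: y) < 32^-1 by rewrite enormZ gtr0_norm//; move: y2; qlra.
  rewrite !locE//; first by move: y32; qlra.
  by apply: le_trans (enormD _ _) _; move: y32 h16; qlra.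
have cz (y : T) : enorm y < 2^-1 -> {for y, continuous z}.
  move=> y2; apply: (holder_continuous_at (K := 2 * (enorm h `^ bet)^-1) (gam := bet) (r := 2^-1 - enorm y)) => //.
  - by rewrite mulr_ge0 ?invr_ge0 ?powR_ge0.
  - by rewrite subr_gt0.
  move=> y' yy; have y'2 : enorm y' < 2^-1 by have := enormBle y' y; move: yy; qlra.
  have sm (q : T) : enorm q < 2^-1 -> enorm (16^-1 *: q) < 1 /\ enorm (h + 16^-1 *: q) < 1.
    move=> q2; have q32 : enorm (16^-1 *: q) < 32^-1 by rewrite enormZ gtr0_norm//; move: q2; qlra.
    split; first by move: q32; qlra.
    by apply: le_lt_trans (enormD _ _) _; move: q32 h16; qlra.
  have [a1 a2] := sm _ y2; have [a3 a4] := sm _ y'2.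
  have := vh _ _ a3 a1; have := vh _ _ a4 a2.
  rewrite (_ : h + 16^-1 *: y' - (h + 16^-1 *: y) = 16^-1 *: (y' - y)); last by rewrite scalerBr opprD addrACA subrr add0r.
  rewrite -scalerBr => v1 v2; rewrite (zE _ y2) (zE _ y'2) -mulrBr normrM (gtr0_norm il0) [2 * _]mulrC -mulrA (ler_pM2l il0).
  have v3 : enorm (16^-1 *: (y' - y)) `^ bet <= enorm (y' - y) `^ bet.
    apply: ler_powR2; [exact: ltW|exact: enorm_ge0|]; rewrite enormZ gtr0_norm//.
    by have := enorm_ge0 (y' - y); qlra.
  rewrite (_ : _ - _ = (v (h + 16^-1 *: y') - v (h + 16^-1 *: y)) - (v (16^-1 *: y') - v (16^-1 *: y))); last by ring.
  apply: le_trans (le_trans (ler_normB _ _) (lerD (le_trans v1 v3) (le_trans v2 v3))) _.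
  by rewrite mulrDl mul1r.
pose D := [set y : T | enorm y < 2^-1 /\ ~ N y].
have C3 : 0 <= C * (5 + 3 * K) by rewrite mulr_ge0 ?addr_ge0 ?mulr_ge0.
have hD y y' : D y -> D y' -> `|z y - z y'| <= C * (5 + 3 * K) * enorm (y - y') `^ gam.
  by move=> [y1 y2] [y3 y4]; exact: hN.
(* z is continuous, hence coincides with the Hoelder extension of its values off the null set; so
   the estimate holds at every point. *)
have [W [WD hW]] := holder_extension C3 gg hD.
have Nae : {ae leb, forall y, ~ N y} by exists N; split=> // y /= /contrapT.
have zW (y : T) : enorm y < 2^-1 -> z y = W y.
  move=> y2; apply: (@ae_continuous_eq _ _ y (2^-1 - enorm y)); rewrite ?subr_gt0//.
  - apply: filterS Nae => q Nq qy; rewrite WD//; split=> //.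
    by have := enormBle q y; move: qy; qlra.
  - exact: cz.
  - by apply: (holder_continuous_at C3 g0 ltr01) => q _; exact: hW.
have e16 (q : T) : 16^-1 *: (16 *: q) = q by rewrite scalerA mulVf ?pnatr_eq0// scale1r.
have x2 : enorm (16 *: x) < 2^-1 by rewrite enormZ gtr0_norm//; move: x64; qlra.
have xk2 : enorm (16 *: (x + k)) < 2^-1.
  by rewrite enormZ gtr0_norm//; have := enormD x k; move: x64 k64; qlra.
have := hW (16 *: (x + k)) (16 *: x); rewrite -(zW _ xk2) -(zW _ x2) (zE _ xk2) (zE _ x2) !e16 -mulrBr normrM (gtr0_norm il0).
rewrite -scalerBr [x + k]addrC addrK enormZ (ger0_norm (_ : 0 <= 16 :> R))// powRM ?enorm_ge0//.
rewrite mulrC (ler_pdivrMr _ _ hb0) ![h + _]addrC => h5; apply: le_trans h5 _.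
by rewrite le_eqVlt; apply/orP; left; apply/eqP; ring.
Qed.

End difference_estimate.

Section second_differences.
Context {R : realType} {n : nat}.
Local Notation T := 'rV[R]_n.
Implicit Types (v : T -> R) (G : R -> R) (x h : T) (a M sig t : R).

(* From scale [2 t] to scale [t] by [v (x + h) - v x = ((v (x + 2 h) - v x) - (second difference)) / 2]. *)
Lemma dyadic_improvement v G a M sig : 0 < a ->
  (forall x h, enorm x < a -> enorm h < a ->
    `|v (x + h + h) - v (x + h) - (v (x + h) - v x)| <= M * enorm h `^ sig) ->
  (forall x h, enorm x < a -> enorm h < a -> `|v (x + h) - v x| <= 2) ->
  (forall t, 0 < t -> t < a / 2 -> 2^-1 * G (2 * t) + 2^-1 * (M * t `^ sig) <= G t) ->
  (forall t, a / 2 <= t -> t < a -> 2 <= G t) ->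
  forall x h, enorm x < a -> enorm h < a -> h != 0 -> `|v (x + h) - v x| <= G (enorm h).
Proof.
move=> a0 hM h2 hG hG2 x h xa ha hn0.
have main (m : nat) (h' : T) : h' != 0 -> enorm h' < a -> a * 2^-1 ^+ m.+1 <= enorm h' -> `|v (x + h') - v x| <= G (enorm h').
  elim: m h' => [|m IH] h' hn ha' hm.
    by apply: le_trans (h2 _ _ xa ha') _; apply: hG2 => //; rewrite expr1 in hm.
  have [h3|h3] := leP (a / 2) (enorm h').
    by apply: le_trans (h2 _ _ xa ha') _; exact: hG2.
  have e2 : enorm (h' + h') = 2 * enorm h'.
    by rewrite -mulr2n -scaler_nat enormZ ger0_norm.
  have h4 : `|v (x + (h' + h')) - v x| <= G (enorm (h' + h')).
    apply: IH.
    - by rewrite -enorm_gt0 e2 mulr_gt0// enorm_gt0.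
    - by rewrite e2; move: h3; qlra.
    - by rewrite e2; move: hm; rewrite exprS; move: (2^-1 ^+ m.+1) => p; qlra.
  have h5 := hM _ _ xa ha'; rewrite addrA e2 in h4.
  have h0 : 0 < enorm h' by rewrite enorm_gt0.
  apply: le_trans (hG _ h0 h3); move: (G _) (M * _) h4 h5 => p q h4 h5.
  have -> : v (x + h') - v x = 2^-1 * (v (x + h' + h') - v x) - 2^-1 * (v (x + h' + h') - v (x + h') - (v (x + h') - v x)) by field.
  apply: le_trans (ler_normB _ _) _; rewrite !normrM (ger0_norm (_ : 0 <= 2^-1 :> R)) ?invr_ge0//.
  by apply: lerD; rewrite ler_pM2l ?invr_gt0.
have h0 : 0 < enorm h by rewrite enorm_gt0.
have [m hm] : exists m : nat, 2^-1 ^+ m < enorm h / a.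
  by apply: exprn_small; [rewrite invr_ge0 ler0n invf_lt1// ltr1n|rewrite divr_gt0].
apply: (main m) => //; rewrite mulrC -ler_pdivlMr//; apply: le_trans (ltW hm).
by rewrite exprS ler_piMl ?exprn_ge0 ?invr_ge0// invf_le1// ler1n.
Qed.

(** Zygmund's argument: the halving recursion is solved by B t^sig if sig < 1 and by c t - B' t^sig
    if sig > 1. At sig = 1 it would produce t ln (1 / t). *)
Lemma holder_improvement a M sig : 0 < a -> a <= 1 -> 0 <= M -> 0 < sig -> sig != 1 -> exists B : R, 0 <= B /\
  forall v, (forall x h, enorm x < a -> enorm h < a ->
    `|v (x + h + h) - v (x + h) - (v (x + h) - v x)| <= M * enorm h `^ sig) ->
  (forall x h, enorm x < a -> enorm h < a -> `|v (x + h) - v x| <= 2) ->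
  forall x h, enorm x < a -> enorm h < a -> `|v (x + h) - v x| <= B * enorm h `^ (Num.min sig 1).
Proof.
move=> a0 a1 M0 sg0 sg1.
have p0 : 0 < 2 `^ sig :> R by rewrite powR_gt0.
have t2 (t : R) : 0 < t -> (2 * t) `^ sig = 2 `^ sig * t `^ sig by move=> t0; rewrite powRM// ltW.
have lt2 (p q : R) : p < q -> 2 `^ p < 2 `^ q.
  by move=> pq; rewrite /powR pnatr_eq0 ltr_expR ltr_pM2r// ln_gt0// ltr1n.
have zero B v x h th : 0 <= B -> (h != 0 -> `|v (x + h) - v x| <= B * enorm h `^ th) -> `|v (x + h) - v x| <= B * enorm h `^ th.
  by move=> B0; have [->|hn] := eqVneq h 0; [rewrite addr0 subrr normr0 mulr_ge0 ?powR_ge0|exact].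
have [sg|sg|sgE] := ltgtP sig 1; last by rewrite sgE eqxx in sg1.
  have p2 : 2 `^ sig < 2 :> R by rewrite -[ltRHS]powRr1// lt2.
  pose B := 2 / (a / 2) `^ sig + M / (2 - 2 `^ sig).
  have q0 : 0 < (a / 2) `^ sig by rewrite powR_gt0 ?divr_gt0.
  have b1 : 0 <= 2 / (a / 2) `^ sig by rewrite divr_ge0// ltW.
  have b2 : 0 <= M / (2 - 2 `^ sig) by rewrite divr_ge0// subr_ge0 ltW.
  have B0 : 0 <= B by rewrite addr_ge0.
  exists B; split=> // v h1 h2 x h xa ha; apply: zero => // hn.
  apply: (dyadic_improvement (G := fun t => B * t `^ sig) a0 h1 h2) => // t.
    move=> t0 _; rewrite t2//; have : M <= B * (2 - 2 `^ sig).
      by rewrite -ler_pdivrMr ?subr_gt0// lerDr.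
    move/(ler_wpM2r (powR_ge0 t sig)); move: (t `^ sig) (2 `^ sig) => p q; rewrite -subr_ge0 => h3.
    rewrite -subr_ge0 (_ : _ - _ = 2^-1 * (B * (2 - q) * p - M * p)); last by field.
    by rewrite mulr_ge0 ?invr_ge0.
  move=> ta _; apply: (@le_trans _ _ (2 / (a / 2) `^ sig * (a / 2) `^ sig)).
    by rewrite divfK// gt_eqF.
  apply: ler_pM => //; [exact: ltW|by rewrite lerDl|].
  by apply: ler_powR2; [exact: ltW|rewrite divr_ge0// ltW|].
have p2 : 2 < 2 `^ sig :> R by rewrite -[ltLHS]powRr1// lt2.
pose B' := M / (2 `^ sig - 2).
have b1 : 0 <= B' by rewrite divr_ge0// subr_ge0 ltW.
have B0 : 0 <= (2 + B') * 2 / a by rewrite divr_ge0 ?mulr_ge0 ?addr_ge0// ltW.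
exists ((2 + B') * 2 / a); split=> // v h1 h2 x h xa ha; rewrite powRr1 ?enorm_ge0//.
have := zero _ v x h 1 B0; rewrite powRr1 ?enorm_ge0//; apply=> hn.
apply: le_trans (_ : _ <= (2 + B') * 2 / a * enorm h - B' * enorm h `^ sig) _; last first.
  by rewrite lerBlDr lerDl mulr_ge0 ?powR_ge0.
apply: (dyadic_improvement (G := fun t => (2 + B') * 2 / a * t - B' * t `^ sig) a0 h1 h2) => // t.
  move=> t0 _; rewrite t2//; have : M = B' * (2 `^ sig - 2) by rewrite divfK// gt_eqF// subr_gt0.
  move=> ME; rewrite {1}ME; move: (t `^ sig) (2 `^ sig) ((2 + B') * 2 / a) => p q r.
  by rewrite le_eqVlt; apply/orP; left; apply/eqP; field.
move=> ta tla; have t1 : t `^ sig <= 1.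
  rewrite -[leRHS](congr1 (fun f : R -> R => f sig) (powR1 R)); apply: ler_powR2; [exact: ltW| |exact: le_trans (ltW tla) _].
  by apply: le_trans ta; rewrite divr_ge0// ltW.
have : 2 + B' <= (2 + B') * 2 / a * t.
  rewrite -!mulrA ler_peMr ?addr_ge0// mulrA mulrAC ler_pdivlMr// mul1r.
  by move: ta; rewrite ler_pdivrMr// mulrC.
by have := ler_wpM2l b1 t1; rewrite mulr1; move: ((2 + B') * 2 / a * t) => p; qlra.
Qed.

End second_differences.

Section bootstrap.
Context {R : realType} {n : nat}.
Local Notation T := 'rV[R]_n.
Local Notation leb := (@lebesgue_rV R n).
Implicit Types (f g v w psi : T -> R) (s r a b c e : R) (Phi : R -> R).
Variable Lambda s0 : R.
Hypothesis Lambda1 : 1 <= Lambda.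
Hypothesis s01 : 0 < s0 < 1.
Hypothesis n_gt0 : (1 <= n)%N.

Let s0_gt0 : 0 < s0. Proof. by case/andP: s01. Qed.

(* Normalized solutions: [Phi] is quantified because it changes under rescaling. *)
Definition nsol s v := exists Phi, [/\ structure_assumption Lambda Phi, wsol (0 : T) 1 s Phi v &
  I1 (fun x => `|v x| * wt s x) 1].

(** Zooming in by rho inflates the tail by at most 2^(n+2) rho^-n; a small amplitude compensates for
    this and brings a bound K down to 1 at the same time. *)
Lemma nsol_rescale rho K : 0 < rho <= 1 -> 0 <= K -> exists lam : R, [/\ 0 < lam, lam <= 1, lam * K <= 1 &
  forall s v, s0 <= s < 1 -> nsol s v -> nsol s (fun x => lam * v (rho *: x))].
Proof.
move=> /andP[r0 r1] K0; pose A : R := 2 ^+ (n + 2) * rho ^- n.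
have A1 : 1 <= A.
  by rewrite mulr_ege1// ?exprn_ege1 ?ler1n// invf_ge1 ?exprn_gt0// exprn_ile1// ltW.
have K1 : 1 <= K + 1 by rewrite lerDr.
have A0 : 0 < A by exact: lt_le_trans A1.
have AK : 0 < A * (K + 1) by rewrite mulr_gt0// (lt_le_trans _ K1).
exists (A * (K + 1))^-1; split.
- by rewrite invr_gt0.
- by rewrite invf_le1// mulr_ege1.
- rewrite mulrC ler_pdivrMr// mul1r; apply: (@le_trans _ _ (1 * (K + 1))); first by rewrite mul1r lerDl.
  by rewrite ler_wpM2r// (le_trans _ K1).
move=> s v ss [Phi [hP hv ht]]; have [s0s s1] := andP ss.
have s_in : 0 < s < 1 by rewrite (lt_le_trans s0_gt0 s0s).
have l0 : 0 < (A * (K + 1))^-1 by rewrite invr_gt0.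
have hv' : wsol (0 : T) rho s Phi v by apply: wsol_mono hv => //; rewrite subrr enorm0 add0r.
have [Phi' [hP' hw]] := wsol_affine 0 s_in r0 (lt0r_neq0 l0) hP hv'.
exists Phi'; split=> //.
  by congr (wsol _ _ _ _ _): hw; apply/funext => x; rewrite add0r subr0.
have [mv _ _ _ _] := hv; have h := tail_affine 0 s_in r0 mv ht.
have := ile_scale (ltW l0) _ _ h => /(_ ltac:(mauto) ltac:(nneg)) {}h.
apply: ile_le (ile_mono _ _ h) => [|x|x].
- rewrite enorm0 addr0 mulr1 mulrC ler_pdivrMr// mul1r; apply: (@le_trans _ _ A).
    rewrite /A ler_wpM2r ?invr_ge0 ?exprn_ge0 ?(ltW r0)// lerXn2r ?nnegrE ?addr_ge0 ?(ltW r0)//.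
    by rewrite (_ : 2 = 1 + 1)// lerD2l.
  by rewrite ler_peMr ?(ltW A0).
- by rewrite mulr_ge0// wt_ge0.
- by rewrite add0r [leRHS]mulrA normrM gtr0_norm.
Qed.

Definition holder1 s v gam := [/\ nsol s v, (forall x, enorm x < 1 -> `|v x| <= 1) &
  forall x y, enorm x < 1 -> enorm y < 1 -> `|v x - v y| <= enorm (x - y) `^ gam].

(** Radius and constant are fixed before s and v, so that finitely many improvements can be composed
    after rescaling. *)
Definition improved gam bet := exists rho K : R, [/\ 0 < rho <= 1, 0 <= K &
  forall s v, s0 <= s < 1 -> holder1 s v gam -> forall x y, enorm x < rho -> enorm y < rho ->
  `|v x - v y| <= K * enorm (x - y) `^ bet].

Lemma improved_rescale gam bet : 0 <= bet <= 1 -> improved gam bet -> exists rho lam : R, [/\ 0 < rho <= 1, 0 < lam &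
  forall s v, s0 <= s < 1 -> holder1 s v gam -> holder1 s (fun x => lam * v (rho *: x)) bet].
Proof.
move=> /andP[b0 b1] [rho [K [r01 K0 hK]]]; have [r0 r1] := andP r01.
have [lam [l0 l1 lK hl]] := nsol_rescale r01 K0.
exists rho, lam; split=> // s v ss hv; have [h1 h2 h3] := hv.
have rx (x : T) : enorm x < 1 -> enorm (rho *: x) < rho.
  by move=> x1; rewrite enormZ gtr0_norm// -[ltRHS]mulr1 ltr_pM2l.
split; first exact: hl.
  move=> x x1; rewrite normrM gtr0_norm// mulr_ile1 ?(ltW l0)// h2// (lt_le_trans (rx _ x1))//.
move=> x y x1 y1; rewrite -mulrBr normrM gtr0_norm//.
apply: le_trans (ler_wpM2l (ltW l0) (hK _ _ ss hv _ _ (rx _ x1) (rx _ y1))) _.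
rewrite mulrA; apply: le_trans (ler_wpM2r (powR_ge0 _ _) lK) _; rewrite mul1r.
apply: ler_powR2 => //; first exact: enorm_ge0.
by rewrite -scalerBr enormZ gtr0_norm// ler_piMl ?enorm_ge0.
Qed.

(** After rescaling, the difference estimate with k = h bounds pure second differences by |h|^(bet +
    del), and [holder_improvement] goes back to first differences. *)
Lemma improved_step gam bet C del : 0 < bet <= 1 -> 0 < del <= 1 -> bet + del != 1 -> 0 <= C ->
  (forall s v, s0 <= s < 1 -> holder1 s v bet -> forall x h k, enorm x < 64^-1 -> enorm h < 64^-1 -> enorm k < 64^-1 ->
    `|v (x + k + h) - v (x + k) - (v (x + h) - v x)| <= C * enorm h `^ bet * enorm k `^ del) ->
  improved gam bet -> improved gam (Num.min (bet + del) 1).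
Proof.
move=> /andP[b0 b1] /andP[d0 d1] bd C0 hC /improved_rescale.
rewrite (ltW b0) b1 => /(_ isT)[rho [lam [/andP[r0 r1] l0 hl]]].
have a0 : 0 < 64^-1 :> R by rewrite invr_gt0.
have a1 : 64^-1 <= 1 :> R by qlra.
have [B [B0 hB]] := @holder_improvement R n 64^-1 C (bet + del) a0 a1 C0 (addr_gt0 b0 d0) bd.
have [th thE] : exists th, th = Num.min (bet + del) 1 by eexists.
rewrite -thE in hB *; have r128 : 0 < rho / 128 by rewrite divr_gt0.
exists (rho / 128), (B / lam * rho^-1 `^ th); split.
- by rewrite r128/= ler_pdivrMr// mul1r; move: r1; qlra.
- by rewrite mulr_ge0 ?powR_ge0// divr_ge0// ltW.
move=> s v ss hv x y xr yr; have hw := hl _ _ ss hv.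
have dn (z : T) : enorm z < rho / 128 -> enorm (rho^-1 *: z) < 128^-1.
  by move=> zr; rewrite enormZ gtr0_norm ?invr_gt0// mulrC ltr_pdivrMr// mulrC.
have up (z : T) : rho *: (rho^-1 *: z) = z by rewrite scalerA divff ?gt_eqF// scale1r.
have hyx : enorm (rho^-1 *: x - rho^-1 *: y) < 64^-1.
  by apply: le_lt_trans (enormD _ _) _; rewrite enormN; have := dn _ xr; have := dn _ yr; qlra.
have yy : enorm (rho^-1 *: y) < 64^-1 by have := dn _ yr; qlra.
have [w wE] : exists w : T -> R, w = (fun q => lam * v (rho *: q)) by eexists.
rewrite -wE in hw; have [_ w1 w2] := hw; have c1 z h : enorm z < 64^-1 -> enorm h < 64^-1 ->
  `|w (z + h + h) - w (z + h) - (w (z + h) - w z)| <= C * enorm h `^ (bet + del).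
  move=> z64 h64; rewrite powRD; last by rewrite (gt_eqF (addr_gt0 b0 d0)).
  by rewrite mulrA; exact: (hC s w ss hw _ _ _ z64 h64 h64).
have c2 z h : enorm z < 64^-1 -> enorm h < 64^-1 -> `|w (z + h) - w z| <= 2.
  move=> z64 h64; apply: le_trans (ler_normB _ _) _; rewrite (_ : 2 = 1 + 1)//.
  by apply: lerD; apply: w1; have := enormD z h; move: z64 h64; qlra.
have := hB _ c1 c2 _ _ yy hyx; rewrite wE subrKC !up -mulrBr normrM (gtr0_norm l0) -scalerBr enormZ.
rewrite powRM ?enorm_ge0// (ger0_norm (_ : 0 <= rho^-1)) ?invr_ge0 ?(ltW r0)// mulrA mulrC => h.
by rewrite [B / _ * _]mulrAC [_ / lam * _]mulrAC ler_pdivlMr.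
Qed.

(** Boundedness, Hoelder continuity and the climb to exponent 1 are chained by rescaling; one more
    use of the difference estimate, now with bet = 1, gives the mixed second differences. *)
Lemma bootstrap : exists gam rho K : R, [/\ 0 < gam, gam < 1, 0 < rho, 0 <= K &
  forall s v, s0 <= s < 1 -> nsol s v ->
  I1 (fun x => \1[enorm x < 1] * `|v x|) 1 -> exists w,
  [/\ {ae leb, forall x, enorm x < rho -> v x = w x},
    (forall x h, enorm x < rho -> enorm h < rho -> `|w (x + h) - w x| <= K * enorm h) &
    forall x h k, enorm x < rho -> enorm h < rho -> enorm k < rho ->
    `|w (x + k + h) - w (x + k) - (w (x + h) - w x)| <= K * enorm h * enorm k `^ gam]].
Proof.
have [gam1 [K1 [g10 g11 K10 hrep]]] := @holder_representative R n Lambda s0 Lambda1 s01 n_gt0.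
have [gam2 [C [g20 g21 C0 hdiff]]] := @difference_estimate R n Lambda s0 Lambda1 s01 n_gt0.
(* For gam = 2 / (2 N + 1) one has N gam < 1 < (N + 1) gam: the multiples of gam avoid the critical
   exponent 1, and the last step jumps over it. *)
have [N [gam [gE g_1 g_2]]] : exists (N : nat) (gam : R), [/\ gam = 2 / (2 * N%:R + 1), gam <= gam1 & gam <= gam2].
  have m0 : 0 < Num.min gam1 gam2 by rewrite lt_min g10.
  have := archi_boundP (ltW (divr_gt0 (ltr01 : 0 < 1 :> R) m0)); set N := Num.bound _.
  rewrite ltr_pdivrMr// => hN; exists N, (2 / (2 * N%:R + 1)).
  have : 2 / (2 * N%:R + 1) <= Num.min gam1 gam2.
    rewrite ler_pdivrMr ?ltr_wpDl ?mulr_ge0//; move: hN m0; move: (Num.min _ _) (N%:R) => p q; rewrite mulrC; lra.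
  by rewrite le_min => /andP[].
have d0 : 0 < 2 * N%:R + 1 :> R by rewrite ltr_wpDl ?mulr_ge0.
have g0 : 0 < gam by rewrite gE divr_gt0.
have g1 : gam < 1 by exact: le_lt_trans g_1 g11.
have N1 : (1 <= N)%N.
  by rewrite lt0n; apply: contraTneq g1 => N0; rewrite gE N0 mulr0 add0r divr1 -leNgt ler1n.
have hC bet : 0 < bet <= 1 -> forall s v, s0 <= s < 1 -> holder1 s v bet ->
    forall x h k, enorm x < 64^-1 -> enorm h < 64^-1 -> enorm k < 64^-1 ->
    `|v (x + k + h) - v (x + k) - (v (x + h) - v x)| <= C * enorm h `^ bet * enorm k `^ gam.
  move=> b01 s v ss [[Phi [hP hv ht]] v1 v2] x h k x64 h64 k64.
  apply: le_trans (hdiff s Phi v bet ss hP hv ht b01 v1 v2 _ _ _ x64 h64 k64) _.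
  rewrite ler_wpM2l ?mulr_ge0 ?powR_ge0//; have [->|k0] := eqVneq k 0; first by rewrite enorm0 !powR0 ?gt_eqF.
  by rewrite ger_powR// enorm_gt0 k0/=; move: k64; qlra.
have kg (k : nat) : k%:R * gam = (2 * k%:R) / (2 * N%:R + 1) by rewrite gE mulrA [k%:R * 2]mulrC.
have imp (k : nat) : (k < N)%N -> improved gam (k.+1%:R * gam).
  elim: k => [|k IH] kN.
    rewrite mul1r; exists 1, 1; split; [by rewrite ltr01 lexx|by []|].
    by move=> s v _ [_ _ hv] x y x1 y1; rewrite mul1r; exact: hv.
  have kl (j : nat) : (j <= N)%N -> j%:R * gam < 1.
    move=> jN; rewrite kg ltr_pdivrMr// mul1r ltr_pwDr//.
    by rewrite ler_pM2l// ler_nat.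
  have -> : k.+2%:R * gam = Num.min (k.+1%:R * gam + gam) 1.
    rewrite min_l; first by rewrite -[k.+2]addn1 natrD mulrDl mul1r.
    by have := kl _ kN; rewrite -[k.+2]addn1 natrD mulrDl mul1r => /ltW.
  have b01 : 0 < k.+1%:R * gam <= 1 by rewrite mulr_gt0//= ltW// kl// ltnW.
  apply: (improved_step b01 _ _ C0 (hC _ b01)) (IH (ltnW kN)); first by rewrite g0 ltW.
  by rewrite lt_eqF//; have := kl _ kN; rewrite -[k.+2]addn1 natrD mulrDl mul1r.
have imp1 : improved gam 1.
  have NE : N = N.-1.+1 by rewrite prednK.
  have hN : improved gam (N%:R * gam) by rewrite NE; apply: imp; rewrite prednK.
  have N1g : 1 < N%:R * gam + gam.
    by rewrite -[X in _ + X]mul1r -mulrDl gE mulrCA mulrA ltr_pdivlMr// mul1r mulrDr; qlra.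
  have b01 : 0 < N%:R * gam <= 1.
    by rewrite mulr_gt0 ?ltr0n//= kg ler_pdivrMr// mul1r lerDl.
  have -> : 1 = Num.min (N%:R * gam + gam) 1 by rewrite min_r// ltW.
  by apply: (improved_step b01 _ _ C0 (hC _ b01)) hN; [rewrite g0 ltW|rewrite gt_eqF].
have b11 : (0 <= 1 :> R) && (1 <= 1 :> R) by rewrite ler01 lexx.
have [rho3 [lam3 [r3 l3 h3]]] := improved_rescale b11 imp1.
have [Kb [Kb0 hbd]] := @bounded_sol R n Lambda s0 Lambda1 s01 n_gt0.
have [lam1 [l1 _ lK1 hl1]] := @nsol_rescale 32^-1 Kb ltac:(by rewrite invr_gt0 ltr0n invf_le1// ler1n) (ltW Kb0).
have [lam2 [l2 l21 lK2 hl2]] := @nsol_rescale 16^-1 (1 + K1) ltac:(by rewrite invr_gt0 ltr0n invf_le1// ler1n) (addr_ge0 ler01 K10).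
have [r30 r31] := andP r3.
(* The zooms 1/32 for boundedness, 1/16 for Hoelder continuity and [rho3] for exponent 1, and their
   amplitudes, are undone together at the end. *)
pose sg := 16 * 32 / rho3; pose L := lam1 * lam2 * lam3.
have sg0 : 0 < sg by rewrite divr_gt0.
have L0 : 0 < L by rewrite !mulr_gt0.
have P0 : 0 <= C * sg * sg `^ gam by have sg1 := ltW sg0; nneg.
exists gam, (64^-1 / sg), ((sg + C * sg * sg `^ gam) / L); split=> //.
- by rewrite divr_gt0// invr_gt0.
- by have sg1 := ltW sg0; have L1 := ltW L0; nneg.
move=> s v ss hv hm; have [s0s s1] := andP ss.
have hb : {ae leb, forall x, enorm x < 32^-1 -> `|v x| <= Kb} by have [Phi [hP hw ht]] := hv; exact: hbd ss hP hw hm ht.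
have [Phi1 [hP1 hw1 ht1]] := hl1 s v ss hv.
have hb1 : {ae leb, forall x : T, enorm x < 1 -> `|lam1 * v (32^-1 *: x)| <= 1}.
  apply: (@ae_affine R n 0 32) => //; apply: filterS hb => x h.
  rewrite add0r scalerA mulVf ?pnatr_eq0// scale1r enormZ gtr0_norm// => x1.
  rewrite normrM gtr0_norm//; apply: le_trans lK1; rewrite ler_pM2l//; apply: h.
  by move: x1; qlra.
have [w1 [mw1 ae1 bd1 ho1]] := hrep s Phi1 _ ss hP1 hw1 ht1 hb1.
have hv2 : nsol s w1.
  exists Phi1; split=> //; first exact: (wsol_ae s1 hP1 mw1 ae1 hw1).
  have [Phi0 [_ [mv _ _ _ _] _]] := hv.
  apply: ile_ae ht1; [mauto|mauto|by move=> x; rewrite mulr_ge0 ?wt_ge0|by move=> x; rewrite mulr_ge0 ?wt_ge0|].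
  by apply: filterS ae1 => x ->.
have x16 (x : T) : enorm x < 1 -> enorm (16^-1 *: x) < 16^-1 by move=> x1; rewrite enormZ gtr0_norm// -[ltRHS]mulr1 ltr_pM2l.
have hh2 : holder1 s (fun x => lam2 * w1 (16^-1 *: x)) gam.
  split=> [|x x1|x y x1 y1]; first exact: hl2.
    by rewrite normrM gtr0_norm//; apply: le_trans lK2; rewrite ler_pM2l// bd1// x16.
  rewrite -mulrBr normrM gtr0_norm//.
  apply: le_trans (ler_wpM2l (ltW l2) (ho1 _ _ (x16 _ x1) (x16 _ y1))) _.
  rewrite mulrA -[leRHS]mul1r; apply: ler_pM; [exact: mulr_ge0 (ltW l2) K10|exact: powR_ge0| |].
    by apply: le_trans lK2; rewrite ler_pM2l// lerDr.
  have [->|xy] := eqVneq x y; first by rewrite !subrr enorm0 !powR0 ?gt_eqF.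
  have p0 : 0 < enorm (x - y) by rewrite enorm_gt0 subr_eq0.
  rewrite -scalerBr enormZ gtr0_norm//; apply: (@le_trans _ _ ((16^-1 * enorm (x - y)) `^ gam)).
    rewrite ger_powR// mulr_gt0//=; have := enormD x (- y); rewrite enormN; move: x1 y1; qlra.
  by apply: ler_powR2; [exact: ltW|rewrite mulr_ge0// ltW|rewrite ler_piMl ?(ltW p0)//; qlra].
have h11 : (0 < 1 :> R) && (1 <= 1 :> R) by rewrite ltr01 lexx.
have hh3 := h3 _ _ ss hh2; have [_ _ lip] := hh3; have dd := hC 1 h11 _ _ ss hh3.
set v3 := (fun x => lam3 * _) in hh3 lip dd.
have sm (x : T) : enorm x < 64^-1 / sg -> enorm (sg *: x) < 64^-1.
  by move=> xs; rewrite enormZ gtr0_norm// mulrC -ltr_pdivlMr.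
exists (fun x => v3 (sg *: x) / L); split.
- apply: (@ae_affine R n 0 32^-1); first by rewrite invr_gt0.
  apply: filterS ae1 => x; rewrite add0r /v3 !scalerA => e _.
  rewrite (_ : 16^-1 * rho3 * sg / 32 = 1) ?scale1r; last by rewrite /sg; field; rewrite gt_eqF.
  by rewrite -e /L; field; rewrite !gt_eqF.
- move=> x h xr hr; rewrite -mulrBl normrM (gtr0_norm (_ : 0 < L^-1)) ?invr_gt0// mulrAC ler_pM2r ?invr_gt0//.
  have xh1 : enorm (sg *: (x + h)) < 1.
    by rewrite scalerDr; have := enormD (sg *: x) (sg *: h); have := sm _ xr; have := sm _ hr; qlra.
  have x1 : enorm (sg *: x) < 1 by have := sm _ xr; qlra.
  have eh : sg *: (x + h) - sg *: x = sg *: h by rewrite scalerDr addrC addKr.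
  have := lip _ _ xh1 x1; rewrite eh powRr1 ?enorm_ge0// enormZ (gtr0_norm sg0) => e.
  by apply: le_trans e _; apply: (ler_wpM2r (enorm_ge0 h)); rewrite lerDl.
- move=> x h k xr hr kr; rewrite -!mulrBl normrM (gtr0_norm (_ : 0 < L^-1)) ?invr_gt0//.
  have := dd _ _ _ (sm _ xr) (sm _ hr) (sm _ kr); rewrite -!scalerDr => e.
  rewrite -[leRHS]mulrA mulrAC ler_pM2r ?invr_gt0//; apply: le_trans e _.
  rewrite powRr1 ?enorm_ge0// !enormZ (gtr0_norm sg0) powRM ?(ltW sg0) ?enorm_ge0//.
  have p0 := powR_ge0 (enorm k) gam; have q0 := enorm_ge0 h.
  move: (sg `^ gam) (enorm k `^ gam) (enorm h) p0 q0 => p q r p0 q0.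
  by rewrite -subr_ge0 [leRHS](_ : _ = sg * (r * q)); [exact: mulr_ge0 (ltW sg0) (mulr_ge0 _ _)|ring].
Qed.

End bootstrap.

(** * From mixed second differences to a Hoelder continuous gradient *)

Section approximately_additive.
Context {R : realType} {n : nat}.
Local Notation T := 'rV[R]_n.
Implicit Types (A L w : T -> R) (x h k l : T) (t q K rho gam : R).

(** With c = d / (1 - q), u m - c q^m increases and u m + c q^m decreases, so the limit is a
    supremum of reals and comes with its rate. *)
Lemma geometric_limit (u : nat -> R) (d q : R) : 0 <= q < 1 -> 0 <= d ->
  (forall m, `|u m.+1 - u m| <= d * q ^+ m) -> exists l : R, forall m, `|u m - l| <= d / (1 - q) * q ^+ m.
Proof.
move=> /andP[q0 q1] d0 hu; pose c := d / (1 - q).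
have q2 : 0 < 1 - q by rewrite subr_gt0.
have dE : d = c * (1 - q) by rewrite divfK// gt_eqF.
have c0 : 0 <= c by rewrite divr_ge0// ltW.
pose a m := u m - c * q ^+ m; pose b m := u m + c * q ^+ m.
have up m j : a m <= a (m + j)%N.
  elim: j => [|j IH]; first by rewrite addn0.
  apply: le_trans IH _; rewrite addnS /a; have := hu (m + j)%N; rewrite ler_norml => /andP[+ _].
  by rewrite dE exprS; move: (u _) (u _) (q ^+ _) => p r s; nra.
have dn m j : b (m + j)%N <= b m.
  elim: j => [|j IH]; first by rewrite addn0.
  apply: le_trans IH; rewrite addnS /b; have := hu (m + j)%N; rewrite ler_norml => /andP[_].
  by rewrite dE exprS; move: (u _) (u _) (q ^+ _) => p r s; nra.
have ab (m k : nat) : a m <= b k.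
  apply: le_trans (up m k) _; apply: le_trans (_ : _ <= b (k + m)%N) (dn _ _).
  by rewrite addnC lerD2l lerNl (le_trans (_ : _ <= 0))// ?oppr_le0 mulr_ge0 ?exprn_ge0.
have ub : has_ubound (range a) by exists (b 0%N) => _ [m _ <-]; exact: ab.
exists (sup (range a)) => m; rewrite -/c ler_norml; apply/andP; split.
  rewrite lerBrDr addrC lerBlDr; apply: ge_sup; first by exists (a 0%N); exists 0%N.
  by move=> _ [k _ <-]; exact: ab.
have : a m <= sup (range a) by apply: ub_le_sup => //; exists m.
by rewrite /a lerBlDr addrC -lerBlDr.
Qed.

Lemma le_geometric (x y C q : R) (M : nat) : 0 <= q < 1 -> 0 <= C ->
  (forall m, (M <= m)%N -> x <= y + C * q ^+ m) -> x <= y.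
Proof.
move=> q01 C0 h; apply/ler_addgt0Pr => e e0; have C1 : 0 < C + 1 by rewrite ltr_wpDl.
have [N hN] := exprn_small q01 (divr_gt0 e0 C1); have [q0 q1] := andP q01.
apply: le_trans (h (maxn M N) (leq_maxl _ _)) _; rewrite lerD2l.
have : q ^+ maxn M N <= q ^+ N by rewrite ler_wiXn2l// ?(ltW q1)// leq_maxr.
move: hN; rewrite ltr_pdivlMr//; move: (q ^+ maxn _ _) (exprn_ge0 (maxn M N) q0) (q ^+ N) => r r0 p; nra.
Qed.

(** The defect g s = L (s h) - s L h is additive and vanishes at 1, hence is 1-periodic and bounded;
    N g s = g (N s) then forces g = 0. *)
Lemma additive_bounded_scale L K : (forall h k, L (h + k) = L h + L k) ->
  (forall h, `|L h| <= K * enorm h) -> forall t h, L (t *: h) = t * L h.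
Proof.
move=> hD hK t h; pose g (s : R) := L (s *: h) - s * L h.
have K0 : 0 <= K * enorm h by apply: le_trans (hK h).
have gD (s r : R) : g (s + r) = g s + g r.
  by rewrite /g scalerDl hD mulrDl; ring.
have g1 : g 1 = 0 by rewrite /g scale1r mul1r subrr.
have gn (s : R) (j : nat) : g (s *+ j) = g s *+ j.
  elim: j => [|j IH]; last by rewrite !mulrS gD IH.
  by have := gD 0 0; rewrite addr0 mulr0n => e; qlra.
have g0 : g 0 = 0 by have := gn 0 0%N; rewrite !mulr0n.
have gb (r : R) : 0 <= r <= 1 -> `|g r| <= 2 * (K * enorm h).
  move=> /andP[r0 r1]; apply: le_trans (ler_normB _ _) _; rewrite mulrDl mul1r.
  apply: lerD; first by apply: le_trans (hK _) _; rewrite enormZ ger0_norm// mulrCA ler_piMl.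
  by rewrite normrM ger0_norm//; apply: le_trans (hK h); rewrite ler_piMl.
have gz (s : R) : 0 <= s -> g s = 0.
  move=> s0; apply/eqP; rewrite -normr_le0; apply/ler_addgt0Pr => e e0; rewrite add0r.
  have := archi_boundP (divr_ge0 (mulr_ge0 (ler0n R 2) K0) (ltW e0)); set N := Num.bound _.
  rewrite ltr_pdivrMr// => hN; have sN : 0 <= s *+ N by rewrite mulrn_wge0.
  have N0 : 0 < N%:R :> R by rewrite -(pmulr_lgt0 _ e0); apply: le_lt_trans hN; exact: mulr_ge0.
  have /andP[j1 j2] := truncn_itv sN; move: j1 j2; set j := Num.truncn _ => j1 j2.
  have : `|g (s *+ N - 1 *+ j + 1 *+ j)| <= 2 * (K * enorm h).
    rewrite gD gn g1 mul0rn addr0; apply: gb; rewrite subr_ge0 j1/= lerBlDr.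
    by move: j2; rewrite -addn1 natrD addrC => /ltW.
  rewrite subrK gn normrMn -[_ *+ N]mulr_natr => h1.
  have h2 : `|g s| * N%:R <= e * N%:R by apply: le_trans h1 _; rewrite [e * _]mulrC ltW.
  by rewrite (ler_pM2r N0) in h2.
suff : g t = 0 by rewrite /g => /eqP; rewrite subr_eq0 => /eqP.
have [t0|t0] := leP 0 t; first exact: gz.
by have := gD t (- t); rewrite subrr g0 (gz (- t)) ?addr0// oppr_ge0 ltW.
Qed.

Definition dot h l : R := \sum_i h ord0 i * l ord0 i.

Lemma dotZ t h l : dot (t *: h) l = t * dot h l.
Proof. by rewrite /dot mulr_sumr; apply: eq_bigr => i _; rewrite mxE mulrA. Qed.

Lemma dotBr h l l' : dot h (l - l') = dot h l - dot h l'.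
Proof. by rewrite /dot -sumrB; apply: eq_bigr => i _; rewrite !mxE mulrBr. Qed.

Lemma enorm_le_dot l K : 0 <= K -> `|dot l l| <= K * enorm l -> enorm l <= K.
Proof.
move=> K0; have -> : dot l l = enorm l ^+ 2.
  by rewrite sqr_enorm; apply: eq_bigr => i _; rewrite expr2.
rewrite ger0_norm ?sqr_ge0// expr2; have [->//|l0] := eqVneq (enorm l) 0.
by rewrite ler_pM2r// lt_neqAle eq_sym l0 enorm_ge0.
Qed.

Lemma additive_bounded_dot L K : (forall h k, L (h + k) = L h + L k) ->
  (forall h, `|L h| <= K * enorm h) -> exists l, forall h, L h = dot h l.
Proof.
move=> hD hK; have hZ := additive_bounded_scale hD hK.
have L0 : L 0 = 0 by have := hD 0 0; rewrite addr0 => e; qlra.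
exists (\row_i L (delta_mx ord0 i)) => h; rewrite {1}[h]row_sum_delta.
rewrite (big_morph L hD L0); apply: eq_bigr => i _.
by rewrite hZ mxE.
Qed.

Lemma half_powR gam : 0 < gam -> (0 <= 2^-1 `^ gam :> R) && (2^-1 `^ gam < 1 :> R).
Proof.
move=> g0; rewrite powR_ge0/= -[ltRHS](congr1 (fun f : R -> R => f gam) (powR1 R)).
by apply: gt0_ltr_powR; rewrite ?nnegrE// invf_lt1// ltr1n.
Qed.

Lemma dyadic_small rho h : 0 < rho -> exists M : nat, forall m, (M <= m)%N -> enorm (2^-1 ^+ m *: h) < rho.
Proof.
move=> r0; have e1 : 0 < enorm h + 1 by rewrite ltr_wpDl ?enorm_ge0.
have h01 : 0 <= 2^-1 :> R by rewrite invr_ge0.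
have hp (m : nat) : 0 < 2^-1 ^+ m :> R by rewrite exprn_gt0// invr_gt0.
have [M hM] := @exprn_small R 2^-1 _ ltac:(by rewrite h01 invf_lt1// ltr1n) (divr_gt0 r0 e1).
exists M => m Mm; rewrite enormZ ger0_norm ?exprn_ge0//.
have : 2^-1 ^+ m <= 2^-1 ^+ M :> R by rewrite ler_wiXn2l// invf_le1// ler1n.
move: hM; rewrite ltr_pdivlMr//; move: (hp m) (enorm_ge0 h).
move: (2^-1 ^+ m) (2^-1 ^+ M) (enorm h) => a b c; nra.
Qed.

(** Hyers' construction: L h is the limit of 2^m A (2^-m h), whose successive differences decrease
    like 2^(-m gam). The limit is additive and bounded, hence linear. *)
Lemma approximately_additive A rho K K2 gam : 0 < rho -> 0 <= K -> 0 <= K2 -> 0 < gam ->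
  (forall h, enorm h < rho -> `|A h| <= K * enorm h) ->
  (forall h k, enorm h < rho -> enorm k < rho -> `|A (k + h) - A k - A h| <= K2 * enorm h * enorm k `^ gam) ->
  exists C : R, 0 <= C /\ exists l, enorm l <= K /\
  forall h, enorm h < rho -> `|A h - dot h l| <= C * (enorm h * enorm h `^ gam).
Proof.
move=> r0 K0 K20 g0 hA hAA; pose q : R := 2^-1 `^ gam.
have h01 : 0 <= 2^-1 :> R by rewrite invr_ge0.
have q01 : 0 <= q < 1 := half_powR g0.
have [q0 q1] := andP q01.
have qm (m : nat) (t : R) : 0 <= t -> (2^-1 ^+ m * t) `^ gam = q ^+ m * t `^ gam.
  by move=> t0; rewrite powRM ?exprn_ge0// powR_exprn.
have small h := dyadic_small h r0.
pose D h := K2 * enorm h * enorm h `^ gam.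
have D0 h : 0 <= D h by rewrite !mulr_ge0 ?enorm_ge0 ?powR_ge0.
have hex h : exists l : R, forall m, enorm (2^-1 ^+ m *: h) < rho ->
    `|2 ^+ m * A (2^-1 ^+ m *: h) - l| <= D h / (1 - q) * q ^+ m.
  have hex : exists M : nat, enorm (2^-1 ^+ M *: h) < rho by have [M hM] := small h; exists M; exact: hM.
  (* The sequence starts at the first M for which 2^-M h lies in the ball; for h in the ball this is
     0, which yields the estimate at h itself. *)
  case: (ex_minnP hex) => M hM hmin.
  have mono j : enorm (2^-1 ^+ (M + j) *: h) < rho.
    rewrite exprD mulrC -scalerA enormZ ger0_norm ?exprn_ge0//; apply: le_lt_trans hM.
    by rewrite ler_piMl ?enorm_ge0// exprn_ile1// invf_le1// ler1n.
  pose u j := 2 ^+ (M + j) * A (2^-1 ^+ (M + j) *: h).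
  have [j|l hl] := @geometric_limit u (D h * q ^+ M) q q01 (mulr_ge0 (D0 h) (exprn_ge0 _ q0)); last first.
    exists l => m hm; have Mm : (M <= m)%N by exact: hmin.
    have qE : q ^+ m = q ^+ M * q ^+ (m - M) by rewrite -exprD subnKC.
    by have := hl (m - M)%N; rewrite /u subnKC// qE mulrA [D h * _ / _]mulrAC.
  rewrite /u addnS; have := mono j.+1; rewrite addnS; set m := (M + j)%N => hm.
  have E : 2^-1 ^+ m *: h = 2^-1 ^+ m.+1 *: h + 2^-1 ^+ m.+1 *: h.
    by rewrite -scalerDl exprS; congr (_ *: _); field.
  rewrite E; have := hAA _ _ hm hm; move: (A _) (A _) => b a hab.
  have -> : 2 ^+ m.+1 * b - 2 ^+ m * a = - (2 ^+ m * (a - b - b)) by rewrite exprS; ring.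
  rewrite normrN normrM ger0_norm ?exprn_ge0//; apply: le_trans (ler_wpM2l (exprn_ge0 _ (ler0n _ 2)) hab) _.
  rewrite enormZ ger0_norm ?exprn_ge0// qm ?enorm_ge0// -[leRHS]mulrA -exprD -/m /D !exprS.
  have -> : 2 ^+ m * (K2 * (2^-1 * 2^-1 ^+ m * enorm h) * (q * q ^+ m * enorm h `^ gam)) =
            (2^-1 * q) * (K2 * enorm h * enorm h `^ gam * q ^+ m).
    rewrite exprVn; have := exprn_gt0 m (ltr0n R 2); move: (2 ^+ m) => p p0; field.
    by rewrite gt_eqF.
  by rewrite ler_piMl// ?mulr_ge0 ?exprn_ge0 ?enorm_ge0 ?powR_ge0//; move: q0 q1; lra.
have [L hL] := boolp.choice hex.
have LD h k : L (h + k) = L h + L k.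
  apply/eqP; rewrite -subr_eq0 -normr_le0.
  have [M1 h1] := small h; have [M2 h2] := small k; have [M3 h3] := small (h + k).
  apply: (@le_geometric _ _ (D (h + k) / (1 - q) + D h / (1 - q) + D k / (1 - q) + K2 * enorm h * enorm k `^ gam) q (maxn M1 (maxn M2 M3)) q01).
    have q2 : 0 <= 1 - q by rewrite subr_ge0 ltW.
    by rewrite !addr_ge0 ?mulr_ge0 ?invr_ge0 ?enorm_ge0 ?powR_ge0.
  move=> m; rewrite !geq_max => /and3P[m1 m2 m3]; rewrite add0r !mulrDl.
  have H1 := hL _ _ (h1 _ m1); have H2 := hL _ _ (h2 _ m2); have H3 := hL _ _ (h3 _ m3).
  have := hAA _ _ (h1 _ m1) (h2 _ m2); rewrite -scalerDr [k + h]addrC !enormZ !(ger0_norm (exprn_ge0 m h01)) qm ?enorm_ge0// => H4.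
  have {H4} := ler_wpM2l (exprn_ge0 m (ler0n R 2)) H4.
  have -> : 2 ^+ m * (K2 * (2^-1 ^+ m * enorm h) * (q ^+ m * enorm k `^ gam)) = K2 * enorm h * enorm k `^ gam * q ^+ m.
    rewrite exprVn; have := exprn_gt0 m (ltr0n R 2); move: (2 ^+ m) => p p0; field.
    by rewrite gt_eqF.
  rewrite -[X in X * `|_|](ger0_norm (exprn_ge0 m (ler0n R 2))) -normrM => H4.
  move: H1 H2 H3 H4; set a := 2 ^+ m * A (_ *: h); set b := 2 ^+ m * A (_ *: k); set c := 2 ^+ m * A _.
  rewrite (_ : 2 ^+ m * _ = c - b - a); last by rewrite /a /b /c; ring.
  move=> H1 H2 H3 H4.
  rewrite (_ : L (h + k) - _ = - (c - L (h + k)) + (a - L h) + (b - L k) + (c - b - a)); last by ring.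
  apply: le_trans (ler_normD _ _) (lerD _ H4); apply: le_trans (ler_normD _ _) (lerD _ H2).
  by apply: le_trans (ler_normD _ _) (lerD _ H1); rewrite normrN.
have q2 : 0 <= 1 - q by rewrite subr_ge0 ltW.
have LK h : `|L h| <= K * enorm h.
  have [M1 h1] := small h.
  apply: (@le_geometric _ _ (D h / (1 - q)) q M1 q01); first by rewrite mulr_ge0 ?invr_ge0.
  move=> m m1; have H1 := hL _ _ (h1 _ m1); have := hA _ (h1 _ m1); rewrite enormZ (ger0_norm (exprn_ge0 m h01)) => H2.
  have := ler_wpM2l (exprn_ge0 m (ler0n R 2)) H2.
  have -> : 2 ^+ m * (K * (2^-1 ^+ m * enorm h)) = K * enorm h.
    rewrite exprVn; have := exprn_gt0 m (ltr0n R 2); move: (2 ^+ m) => p p0; field.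
    by rewrite gt_eqF.
  rewrite -[X in X * `|_|](ger0_norm (exprn_ge0 m (ler0n R 2))) -normrM.
  move: (2 ^+ m * _) H1 => a H1 H3; rewrite (_ : L h = a - (a - L h)); last by ring.
  by apply: le_trans (ler_normB _ _) (lerD H3 H1).
have [l hl] := additive_bounded_dot LD LK.
exists (K2 / (1 - q)); split; first by rewrite mulr_ge0 ?invr_ge0.
exists l; split; first by apply: enorm_le_dot => //; rewrite -hl.
move=> h hr; have := hL h 0%N; rewrite !expr0 scale1r mul1r mulr1 hl => /(_ hr) H.
by apply: le_trans H _; rewrite le_eqVlt; apply/orP; left; apply/eqP; rewrite /D; ring.
Qed.

Lemma differentiable_of_expansion w x l C rho gam : 0 < rho -> 0 <= C -> 0 < gam ->
  (forall h, enorm h < rho -> `|w (x + h) - w x - dot h l| <= C * (enorm h * enorm h `^ gam)) ->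
  differentiable w x /\ grad w x = l.
Proof.
move=> r0 C0 g0 hw.
have dlin : linear (dot ^~ l : T -> R).
  move=> a h k; rewrite /dot scaler_sumr -big_split; apply: eq_bigr => i _ /=.
  by rewrite !mxE mulrDl -mulrA.
pose dM := GRing.isLinear.Build _ _ _ _ _ dlin.
pose dL : {linear T -> R} := HB.pack (dot ^~ l : T -> R) dM.
have dc : continuous dL.
  have -> : (dL : T -> R) = \sum_i (fun h : T => h ord0 i * l ord0 i).
    by apply/funext => h; rewrite fct_sumE.
  move=> h; apply: differentiable_continuous; apply: differentiable_sum => i.
  apply: differentiableM; [exact: differentiable_coord|exact: differentiable_cst].
have dE : (w \o shift x : T -> R^o) = cst (w x : R^o) + (dL : T -> R^o) +o_ (0 : T) (@id T).
  apply/eqaddoP => _/posnumP[e]; have e0 : 0 < e%:num by [].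
  have nC : 0 < C * n%:R + 1 by rewrite ltr_wpDl// mulr_ge0.
  have t0 : 0 < e%:num / (C * n%:R + 1) by rewrite divr_gt0.
  apply/enorm_nbhs; exists (Num.min rho ((e%:num / (C * n%:R + 1)) `^ gam^-1)); first by rewrite lt_min r0 powR_gt0.
  move=> h; rewrite subr0 lt_min => /andP[hr hd].
  rewrite -[X in `|X|]/(w (h + x) - (w x + dot h l)) [h + x]addrC opprD addrA.
  apply: le_trans (hw h hr) _.
  have hg : enorm h `^ gam <= e%:num / (C * n%:R + 1).
    rewrite [leRHS](_ : _ = ((e%:num / (C * n%:R + 1)) `^ gam^-1) `^ gam).
      by apply: ler_powR2; [exact: ltW|exact: enorm_ge0|exact: ltW].
    by rewrite -powRrM mulVf ?gt_eqF// powRr1// ltW.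
  have h1 := enorm_le_norm h; have h0 := normr_ge0 h.
  apply: (@le_trans _ _ (C * (n%:R * `|h| * (e%:num / (C * n%:R + 1))))).
    by rewrite ler_wpM2l//; apply: ler_pM; rewrite ?enorm_ge0 ?powR_ge0.
  rewrite [leLHS](_ : _ = e%:num * `|h| * (C * n%:R / (C * n%:R + 1))); last by ring.
  by rewrite ler_piMr ?mulr_ge0// ler_pdivrMr// mul1r lerDl.
have d1 := diff_unique dc dE.
have df : differentiable w x by apply/diff_locallyP; rewrite d1.
split=> //; apply/rowP => i; rewrite mxE /partial deriveE// d1 /= /dot (bigD1 i)//= mxE !eqxx mul1r big1 ?addr0//.
by move=> j /negbTE ji; rewrite mxE eqxx ji mul0r.
Qed.

(** For fixed x the increment of w is an approximately additive function of h. The gradients at x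
    and y are compared on h = 2^-m l, where l is their difference; relative to |h| the expansion
    errors vanish as m grows. *)
Lemma regular_of_differences w (x0 : T) rho K K2 gam : 0 < rho -> 0 <= K -> 0 <= K2 -> 0 < gam ->
  (forall x h, enorm (x - x0) < rho -> enorm h < rho -> `|w (x + h) - w x| <= K * enorm h) ->
  (forall x h k, enorm (x - x0) < rho -> enorm h < rho -> enorm k < rho ->
    `|w (x + k + h) - w (x + k) - (w (x + h) - w x)| <= K2 * enorm h * enorm k `^ gam) ->
  (forall x, enorm (x - x0) < rho -> differentiable w x /\ enorm (grad w x) <= K) /\
  forall x y, enorm (x - x0) < rho / 2 -> enorm (y - x0) < rho / 2 ->
    enorm (grad w x - grad w y) <= K2 * enorm (x - y) `^ gam.
Proof.
move=> r0 K0 K20 g0 h1 h2.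
have ex x : enorm (x - x0) < rho -> exists C : R, [/\ 0 <= C, differentiable w x, enorm (grad w x) <= K &
    forall h, enorm h < rho -> `|w (x + h) - w x - dot h (grad w x)| <= C * (enorm h * enorm h `^ gam)].
  move=> xr; have [|h k hr kr|C [C0 [l [lK hl]]]] := @approximately_additive (fun h => w (x + h) - w x) _ _ _ _ r0 K0 K20 g0.
  - by move=> h hr; exact: h1.
  - rewrite (_ : _ - _ - _ = w (x + k + h) - w (x + k) - (w (x + h) - w x)); first exact: h2.
    by rewrite addrA; ring.
  by have [dw gl] := differentiable_of_expansion r0 C0 g0 hl; exists C; split; rewrite ?gl.
split=> [x xr|x y xr yr]; first by have [C [_ ? ? _]] := ex x xr.
have r2 : rho / 2 < rho by rewrite ltr_pdivrMr// mulrDr mulr1 ltrDl.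
have yr' := lt_trans yr r2; have [Cx [Cx0 _ _ hx]] := ex x (lt_trans xr r2); have [Cy [Cy0 _ _ hy]] := ex y yr'.
have kr : enorm (x - y) < rho.
  by apply: le_lt_trans (enorm_triangle x0 _ _) _; rewrite (enormB x0) [ltRHS]splitr ltrD.
set l := grad w x - grad w y; have P0 : 0 <= K2 * enorm (x - y) `^ gam by rewrite mulr_ge0 ?powR_ge0.
apply: enorm_le_dot => //; have q01 := half_powR g0; have [M hM] := dyadic_small l r0.
have h01 : 0 <= 2^-1 :> R by rewrite invr_ge0.
apply: (@le_geometric _ _ ((Cx + Cy) * (enorm l * enorm l `^ gam)) (2^-1 `^ gam) M q01).
  by rewrite !mulr_ge0 ?addr_ge0 ?enorm_ge0 ?powR_ge0.
move=> m Mm; have hr := hM m Mm; have H1 := hx _ hr; have H2 := hy _ hr; have := h2 _ _ _ yr' hr kr.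
rewrite subrKC => H3; move: H1 H2 H3; set h := _ *: l.
have -> : enorm h = 2^-1 ^+ m * enorm l by rewrite enormZ ger0_norm ?exprn_ge0.
rewrite powRM ?exprn_ge0 ?enorm_ge0// powR_exprn// => H1 H2 H3.
have m0 : 0 < 2^-1 ^+ m :> R by rewrite exprn_gt0 ?invr_gt0.
rewrite -(ler_pM2l m0) -[X in X * _](ger0_norm (ltW m0)) -normrM -dotZ -/h dotBr.
rewrite (_ : dot h _ - _ = (w (x + h) - w x - (w (y + h) - w y)) - (w (x + h) - w x - dot h (grad w x)) + (w (y + h) - w y - dot h (grad w y))); last by ring.
apply: le_trans (ler_normD _ _) _; apply: le_trans (lerD (ler_normB _ _) (lexx _)) _.
apply: le_trans (lerD (lerD H3 H1) H2) _; rewrite le_eqVlt; apply/orP; left; apply/eqP.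
by move: (2^-1 ^+ m) (2^-1 `^ gam ^+ m) (enorm l) (enorm l `^ gam) (enorm (x - y) `^ gam) => a b c d e; ring.
Qed.

End approximately_additive.

(** * Gluing of representatives, the excess, and the final estimate *)

Section local_regularity.
Context {R : realType} {n : nat}.
Local Notation T := 'rV[R]_n.
Local Notation leb := (@lebesgue_rV R n).
Implicit Types (u v w : T -> R) (x y h k z : T) (s r a b c e : R) (Phi : R -> R).

Lemma compact_bound (A : set T) (P : R -> T -> Prop) : compact A ->
  (forall K K' x, K <= K' -> P K x -> P K' x) ->
  (forall x, A x -> exists d K : R, 0 < d /\ forall y, enorm (y - x) < d -> P K y) ->
  exists K, forall x, A x -> P K x.
Proof.
move=> /compact_near_coveringP cA mono hA.
have [K [_ hK]] : \forall K \near +oo, A `<=` P K.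
  apply: cA => x Ax; have [d [K [d0 hK]]] := hA x Ax.
  exists ([set y : T | enorm (y - x) < d], [set K' : R | K < K']); first split.
  - by apply/enorm_nbhs; exists d.
  - by exists K; split=> //; exact: num_real.
  by move=> [y K'] /= [yd KK']; apply: (mono K); [exact: ltW|exact: hK].
by exists (K + 1); apply: hK; rewrite ltrDl.
Qed.

(** The glued function is the diagonal x |-> W x x. Continuous functions that agree almost
    everywhere near a point agree at it, so the diagonal coincides with every local representative.
    It equals u almost everywhere because balls with rational centre and radius 1/(k+1) reduce the
    claim to countably many null sets. *)
Lemma glue_representatives (Om : set T) u (W : T -> T -> R) (rd : T -> R) :
  (forall x, Om x -> [/\ 0 < rd x, {ae leb, forall y, enorm (y - x) < rd x -> u y = W x y} &
    forall y, enorm (y - x) < rd x -> Om y /\ {for y, continuous (W x)}]) ->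
  {ae leb, forall x, Om x -> u x = W x x} /\
  forall x w r, 0 < r -> {ae leb, forall y, enorm (y - x) < r -> u y = w y} ->
    (forall y, enorm (y - x) < r -> {for y, continuous w}) ->
    forall y, enorm (y - x) < r -> Om y -> W y y = w y.
Proof.
move=> hW.
have uniq x w r : 0 < r -> {ae leb, forall y, enorm (y - x) < r -> u y = w y} ->
    (forall y, enorm (y - x) < r -> {for y, continuous w}) ->
    forall y, enorm (y - x) < r -> Om y -> W y y = w y.
  move=> r0 uw cw y yx Oy; have [ry uW cW] := hW y Oy.
  apply: (@ae_continuous_eq _ _ y (Num.min (rd y) (r - enorm (y - x)))).
  - by rewrite lt_min ry subr_gt0.
  - apply: filterS2 uw uW => z h1 h2; rewrite lt_min => /andP[z1 z2].
    rewrite -h2// h1//; apply: le_lt_trans (enorm_triangle y _ _) _.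
    by rewrite -ltrBrDr.
  - by apply: (proj2 (cW y _)); rewrite subrr enorm0.
  - exact: cw.
split=> //.
have cnt : {ae leb, forall x, forall i : nat, if unpickle i is Some (q, k) then
    (exists2 z, Om z & forall y, enorm (y - map_mx ratr (q : 'rV[rat]_n)) < (k : nat).+1%:R^-1 -> enorm (y - z) < rd z) ->
    enorm (x - map_mx ratr q) < k.+1%:R^-1 -> Om x -> u x = W x x else True}.
  apply: ae_foralln => i; case: (unpickle i) => [[q k]|]; last exact: aeW.
  have [[z Oz hz]|nz] := pselect (exists2 z, Om z & forall y, enorm (y - map_mx ratr (q : 'rV[rat]_n)) < (k : nat).+1%:R^-1 -> enorm (y - z) < rd z); last first.
    by apply: aeW => x /nz.
  have [r0 uW cW] := hW z Oz; apply: (filterS _ uW) => x ux _ xq Ox.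
  rewrite ux ?hz//; apply/esym.
  exact: (uniq z (W z) (rd z) r0 uW (fun y hy => proj2 (cW y hy)) x (hz x xq) Ox).
apply: filterS cnt => x hx Ox; have [r0 _ _] := hW x Ox.
have := archi_boundP (divr_ge0 (ler0n R 2) (ltW r0)); set k := Num.bound _.
rewrite ltr_pdivrMr// => hk.
have k0 : 0 < k.+1%:R^-1 :> R by rewrite invr_gt0.
have [q hq] := ratV_dense x k0.
have := hx (pickle (q, k)); rewrite pickleK; apply=> //; exists x => // y yq.
apply: le_lt_trans (enorm_triangle (map_mx ratr q) _ _) _; rewrite (enormB _ x).
apply: lt_le_trans (ltrD yq hq) _; rewrite -mulr2n -[_ *+ 2]mulr_natl ler_pdivrMr// mulrC.
by apply: le_trans (ltW hk) _; rewrite ler_wpM2r ?(ltW r0)// ler_nat.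
Qed.

Variable Lambda s0 : R.
Hypothesis Lambda1 : 1 <= Lambda.
Hypothesis s01 : 0 < s0 < 1.
Hypothesis n_gt0 : (1 <= n)%N.

Let s0_gt0 : 0 < s0. Proof. by case/andP: s01. Qed.

(** [bootstrap] for (u (x0 + r x) - m) / e; the factors e / r and r^-gam come from undoing this
    scaling. *)
Lemma local_representative : exists gam rho K : R, [/\ 0 < gam, gam < 1, 0 < rho, 0 <= K &
  forall s Phi u (x0 : T) r m e, s0 <= s < 1 -> structure_assumption Lambda Phi -> 0 < r -> 0 < e ->
  wsol x0 r s Phi u -> I1 (fun x => \1[enorm x < 1] * `|u (x0 + r *: x) - m|) e ->
  I1 (fun x => `|u (x0 + r *: x) - m| * wt s x) e -> exists w,
  [/\ {ae leb, forall y, enorm (y - x0) < rho * r -> u y = w y},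
    (forall y h, enorm (y - x0) < rho * r -> enorm h < rho * r -> `|w (y + h) - w y| <= K * e / r * enorm h) &
    forall y h k, enorm (y - x0) < rho * r -> enorm h < rho * r -> enorm k < rho * r ->
      `|w (y + k + h) - w (y + k) - (w (y + h) - w y)| <= K * e / r / r `^ gam * enorm h * enorm k `^ gam]].
Proof.
have [gam [rho [K [g0 g1 r0 K0 hB]]]] := @bootstrap R n Lambda s0 Lambda1 s01 n_gt0.
exists gam, rho, K; split=> // s Phi u x0 r m e ss hP r_0 e0 hu h1 h2.
have [s0s s1] := andP ss; have s_in : 0 < s < 1 by rewrite (lt_le_trans s0_gt0 s0s).
have ei : 0 < e^-1 by rewrite invr_gt0.
have [mu _ _ _ _] := hu.
have [Phi' [hP' hw]] := wsol_affine m s_in r_0 (lt0r_neq0 ei) hP hu.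
have h1' := ile_scale (ltW ei) (ltac:(mauto) : mf1 (fun x : T => \1[enorm x < 1] * `|u (x0 + r *: x) - m|)) ltac:(move=> x; nneg) h1.
have h2' := ile_scale (ltW ei) (ltac:(mauto) : mf1 (fun x : T => `|u (x0 + r *: x) - m| * wt s x)) ltac:(move=> x; nneg) h2.
rewrite mulVf ?gt_eqF// in h1' h2'.
have [||w [w1 w2 w3]] := hB s (fun x => e^-1 * (u (x0 + r *: x) - m)) ss.
- exists Phi'; split=> //; apply: I1_eq h2' => x.
  by rewrite [RHS]mulrA normrM gtr0_norm.
- by apply: I1_eq h1' => x; rewrite normrM gtr0_norm// mulrCA.
have ri : 0 < r^-1 by rewrite invr_gt0.
have sc z : enorm z < rho * r -> enorm (r^-1 *: z) < rho.
  by move=> zr; rewrite enormZ gtr0_norm// mulrC ltr_pdivrMr.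
have ew (y z : T) : r^-1 *: (y + z - x0) = r^-1 *: (y - x0) + r^-1 *: z by rewrite -scalerDr addrAC.
exists (fun y => m + e * w (r^-1 *: (y - x0))); split.
- have : {ae leb, forall x, enorm (- (r^-1 *: x0) + r^-1 *: x) < rho -> u x = m + e * w (- (r^-1 *: x0) + r^-1 *: x)}.
    apply: (ae_affine (x0 := x0) r_0); apply: filterS w1 => x.
    rewrite scalerDr addKr scalerA mulVf ?gt_eqF// scale1r => hx /hx <-.
    by rewrite mulVKf ?gt_eqF// subrKC.
  apply: filterS => x; rewrite addrC -scalerBr => hx xr; apply: hx; exact: sc.
- move=> y h yr hr; rewrite ew opprD addrACA subrr add0r -mulrBr normrM (gtr0_norm e0).
  have := w2 _ _ (sc _ yr) (sc _ hr); rewrite [enorm (_ *: h)]enormZ (gtr0_norm ri) => /(ler_wpM2l (ltW e0)) H.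
  by apply: le_trans H _; rewrite le_eqVlt; apply/orP; left; apply/eqP; ring.
- move=> y h k yr hr kr; rewrite !ew.
  have := w3 _ _ _ (sc _ yr) (sc _ hr) (sc _ kr).
  rewrite [enorm (_ *: h)]enormZ [enorm (_ *: k)]enormZ (gtr0_norm ri) powRM ?(ltW ri) ?enorm_ge0// => /(ler_wpM2l (ltW e0)).
  have -> : r^-1 `^ gam = (r `^ gam)^-1 by rewrite -(powR_inv1 (ltW r_0)) -powRrM mulN1r powRN.
  rewrite -[X in X * `|_|](gtr0_norm e0) -normrM => H.
  rewrite (_ : _ - _ - _ = e * (w (r^-1 *: (y - x0) + r^-1 *: k + r^-1 *: h) - w (r^-1 *: (y - x0) + r^-1 *: k) -
     (w (r^-1 *: (y - x0) + r^-1 *: h) - w (r^-1 *: (y - x0))))); last by ring.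
  by apply: le_trans H _; rewrite le_eqVlt; apply/orP; left; apply/eqP; ring.
Qed.

End local_regularity.

Section excess.
Context {R : realType} {n : nat}.
Local Notation T := 'rV[R]_n.
Local Notation leb := (@lebesgue_rV R n).
Implicit Types (u v w : T -> R) (x y h k z : T) (s r a b c e : R).

Lemma adde_fin_split (p q e : R) (X Y : \bar R) : 0 < p -> 0 < q -> (0 <= X)%E -> (0 <= Y)%E ->
  (p%:E * X + q%:E * Y = e%:E)%E -> exists a b : R, [/\ X = a%:E, Y = b%:E, 0 <= a, 0 <= b & p * a + q * b = e].
Proof.
move=> p0 q0; case: X => [a| |]//; case: Y => [b| |]//; rewrite ?lee_fin => a0 b0.
- by case=> E; exists a, b.
- by rewrite gt0_muley ?lte_fin// addey.
- by rewrite gt0_muley ?lte_fin// addye.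
- by rewrite !gt0_muley ?lte_fin.
Qed.

Lemma I1_setint (D : set T) (d : T -> bool) (f : T -> R) a : (forall x, D x <-> d x) ->
  (\int[leb]_(x in D) (f x)%:E = a%:E)%E -> I1 (fun x => (d x)%:R * f x) a.
Proof.
move=> Dd; rewrite /I1 /ile => <-; rewrite [leRHS]integral_mkcond.
rewrite le_eqVlt; apply/orP; left; apply/eqP; apply: eq_integral => x _.
rewrite patchE; case: ifPn; first by rewrite inE => /Dd ->; rewrite mul1r.
by move=> /negP h; case: (boolP (d x)) => [/Dd dx|_]; [case: h; rewrite inE|rewrite mul0r].
Qed.

Lemma excess_bounds s u (x0 : T) r e : 0 < s < 1 -> 0 < r -> mf1 u ->
  excess s (fun x => u x / r) x0 r = e%:E -> exists m, forall x, enorm (x - x0) < r / 2 ->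
  let C := 2 ^+ n * (@unit_volume R n + 1) * (r * e) in
  I1 (fun z => \1[enorm z < 1] * `|u (x + (r / 2) *: z) - m|) C /\
  I1 (fun z => `|u (x + (r / 2) *: z) - m| * wt s z) C.
Proof.
move=> /andP[s_0 s1] r0 mu; rewrite /excess /excess_loc /tail leb_eball//=.
set mn := mean _ _; have V0 := @unit_volume_gt0 R n; set V := @unit_volume R n in V0 *.
have rn : 0 < r ^+ n by rewrite exprn_gt0.
have t0 : 0 < (1 - s) * r `^ (2 * s) by rewrite mulr_gt0 ?subr_gt0 ?powR_gt0.
have p0 : 0 < (r ^+ n * V)^-1 by rewrite invr_gt0 mulr_gt0.
move=> /(adde_fin_split p0 t0)[||a [b [Xa Yb a0 b0 abE]]].
- by apply: integral_ge0 => x _; rewrite lee_fin.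
- by apply: integral_ge0 => x _; rewrite lee_fin divr_ge0 ?powR_ge0.
pose q y := `|u y / r - mn|.
have mq : mf1 q by rewrite /q; mauto.
have q0 y : 0 <= q y by exact: normr_ge0.
have ha : I1 (fun y => \1[enorm (y - x0) < r] * q y) a by apply: I1_setint Xa => x.
have hb : I1 (fun y => (~~ (enorm (y - x0) < r))%:R * (q y / enorm (x0 - y) `^ (n%:R + 2 * s))) b.
  by apply: I1_setint Yb => x; split=> [/negP|/negP].
have Nq y : `|u y - r * mn| = r * q y.
  transitivity `|r * (u y / r - mn)|; last by rewrite normrM gtr0_norm.
  by rewrite mulrBr [r * (_ / _)]mulrC divfK// gt_eqF.
have eE : e = a / (r ^+ n * V) + (1 - s) * r `^ (2 * s) * b by rewrite -abE mulrC.
have r2 : 0 < r / 2 by rewrite divr_gt0.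
have rnE : (r / 2) ^- n = 2 ^+ n / r ^+ n by rewrite expr_div_n invf_div.
exists (r * mn) => x xr; have xy z : enorm (x + (r / 2) *: z - x0) <= enorm (x - x0) + r / 2 * enorm z.
  by rewrite addrAC; apply: le_trans (enormD _ _) _; rewrite enormZ gtr0_norm.
have ha' := I1_affine x r2 (ltac:(mauto) : mf1 (fun y => \1[enorm (y - x0) < r] * q y)) ltac:(move=> y; nneg) ha.
have hb' := I1_affine x r2 (ltac:(mauto) : mf1 (fun y => (~~ (enorm (y - x0) < r))%:R * (q y / enorm (x0 - y) `^ (n%:R + 2 * s)))) ltac:(move=> y; nneg) hb.
have al0 : 0 <= a / (r ^+ n * V) by rewrite mulr_ge0// ltW.
have be0 : 0 <= (1 - s) * r `^ (2 * s) * b by rewrite mulr_ge0// ltW.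
have aE : r * ((r / 2) ^- n * a) = 2 ^+ n * V * (r * (a / (r ^+ n * V))).
  by rewrite rnE; field; rewrite !gt_eqF.
have bE : r * ((1 - s) * r `^ (n%:R + 2 * s)) * ((r / 2) ^- n * b) = 2 ^+ n * (r * ((1 - s) * r `^ (2 * s) * b)).
  rewrite rnE powRDp// powR_mulrn ?(ltW r0)//; move: (r `^ _) => rs; field.
  by rewrite gt_eqF.
have X0 : 0 <= 2 ^+ n * (r * (a / (r ^+ n * V))) by rewrite mulr_ge0 ?exprn_ge0// mulr_ge0// ltW.
have Y0 : 0 <= 2 ^+ n * (r * ((1 - s) * r `^ (2 * s) * b)) by rewrite mulr_ge0 ?exprn_ge0// mulr_ge0// ltW.
have VY := mulr_ge0 (ltW V0) Y0.
have rE : 2 ^+ n * (V + 1) * (r * e) = V * (2 ^+ n * (r * (a / (r ^+ n * V)))) + 2 ^+ n * (r * (a / (r ^+ n * V))) +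
    (V * (2 ^+ n * (r * ((1 - s) * r `^ (2 * s) * b))) + 2 ^+ n * (r * ((1 - s) * r `^ (2 * s) * b))) by rewrite eE; ring.
have aE' : 2 ^+ n * V * (r * (a / (r ^+ n * V))) = V * (2 ^+ n * (r * (a / (r ^+ n * V)))) by ring.
split.
- have h : I1 (fun z => \1[enorm z < 1] * `|u (x + (r / 2) *: z) - r * mn|) (r * ((r / 2) ^- n * a)).
    apply: (ile_mono_scale _ _ _ _ _ ha'); [exact: ltW|mauto|by move=> z; nneg|by move=> z; nneg|move=> z].
    case: (ltP (enorm z) 1) => z1; last by rewrite mul0r !mulr_ge0 ?ler0n// ltW.
    rewrite Nq mul1r (_ : enorm _ < r) ?mul1r//; apply: le_lt_trans (xy z) _.
    by rewrite [ltRHS]splitr ltr_leD// ler_piMr ?(ltW r2)// ltW.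
  by apply: ile_le h; rewrite aE aE' rE; move: X0 Y0 VY; rewrite -addrA lerDl => *; rewrite !addr_ge0.
have h : I1 (fun z => `|u (x + (r / 2) *: z) - r * mn| * wt s z) (r * ((r / 2) ^- n * a) + r * ((1 - s) * r `^ (n%:R + 2 * s)) * ((r / 2) ^- n * b)).
  apply: (ile_mono_lin2 _ _ _ _ _ _ _ _ ha' hb'); [exact: ltW| |mauto|mauto|by move=> z; nneg|by move=> z; nneg|by move=> z; rewrite mulr_ge0 ?wt_ge0|move=> z].
    by rewrite mulr_ge0 ?(ltW r0)// mulr_ge0 ?powR_ge0// subr_ge0 ltW.
  rewrite Nq; set y := x + _; have N0 : 0 <= n%:R + 2 * s by rewrite addr_ge0// mulr_ge0// ltW.
  have z1 : 0 < 1 + enorm z by rewrite ltr_pwDl ?enorm_ge0.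
  case: (ltP (enorm (y - x0)) r) => yr /=.
    rewrite mul0r mulr0 addr0 mul1r -mulrA ler_pM2l//; apply: ler_piMr; first exact: q0.
    rewrite /wt /Jr -[leRHS]mulr1; apply: ler_pM; rewrite ?subr_ge0 ?(ltW s1) ?invr_ge0 ?powR_ge0 ?gerBl ?(ltW s_0)//.
    rewrite invf_le1 ?powR_gt0// -[leLHS](congr1 (fun f : R -> R => f (n%:R + 2 * s)) (powR1 R)).
    by apply: ler_powR2; rewrite ?lerDl ?enorm_ge0.
  rewrite mul0r mulr0 add0r mul1r; have d0 : 0 < enorm (x0 - y) by rewrite enormB; apply: lt_le_trans yr.
  have dp : 0 < enorm (x0 - y) `^ (n%:R + 2 * s) by rewrite powR_gt0.
  have zp : 0 < (1 + enorm z) `^ (n%:R + 2 * s) by rewrite powR_gt0.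
  have key : enorm (x0 - y) `^ (n%:R + 2 * s) <= r `^ (n%:R + 2 * s) * (1 + enorm z) `^ (n%:R + 2 * s).
    rewrite -powRM ?(ltW r0) ?(ltW z1)//; apply: ler_powR2 => //; first exact: ltW.
    rewrite enormB; apply: le_trans (xy z) _; rewrite mulrDr mulr1 lerD//.
      by apply: le_trans (ltW xr) _; rewrite ler_pdivrMr// ler_peMr ?(ltW r0)// ler1n.
    by rewrite ler_wpM2r ?enorm_ge0// ler_pdivrMr// ler_peMr ?(ltW r0)// ler1n.
  rewrite /wt /Jr [leRHS](_ : _ = r * q y * ((1 - s) * (r `^ (n%:R + 2 * s) / enorm (x0 - y) `^ (n%:R + 2 * s)))); last by ring.
  rewrite ler_wpM2l ?mulr_ge0 ?(ltW r0)// ler_wpM2l ?subr_ge0 ?(ltW s1)//.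
  by rewrite ler_pdivlMr// mulrC ler_pdivrMr.
apply: ile_le h; rewrite aE bE aE' rE; move: X0 Y0 VY.
set X := 2 ^+ n * _; set Y := 2 ^+ n * _; set V1 := V * X; set V2 := V * Y => X0 Y0 VY.
by rewrite -addrA lerD2l -[leLHS]add0r lerD// lerDr.
Qed.

End excess.

Section norms_of_gradients.
Context {R : realType} {n : nat}.
Local Notation T := 'rV[R]_n.
Local Notation leb := (@lebesgue_rV R n).
Implicit Types (g : T -> T) (x y : T) (A : set T) (K d gam : R).

Lemma holder_continuous_rV g x K d gam : 0 <= K -> 0 < gam -> 0 < d ->
  (forall y, enorm (y - x) < d -> enorm (g y - g x) <= K * enorm (y - x) `^ gam) -> {for x, continuous g}.
Proof.
move=> K0 g0 d0 hg A /nbhs_ballP[e /= e0 eA]; apply/enorm_nbhs.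
have h y : enorm (y - x) < d -> `|enorm (g y - g x) - enorm (g x - g x)| <= K * enorm (y - x) `^ gam.
  by move=> yd; rewrite subrr enorm0 subr0 ger0_norm ?enorm_ge0//; exact: hg.
have /continuous_enormP/(_ e e0)[r r0 hr] := holder_continuous_at K0 g0 d0 h.
exists r => // y yr; apply: eA; rewrite -ball_normE /ball_/= distrC; apply: le_lt_trans (norm_le_enorm _) _.
by have := hr y yr; rewrite subrr enorm0 subr0 ger0_norm ?enorm_ge0.
Qed.

Lemma Linfty_norm_le A g K : 0 <= K -> (forall x, A x -> enorm (g x) <= K) -> (Linfty_norm A g <= K%:E)%E.
Proof.
move=> K0 h; rewrite /Linfty_norm unlock; case: ifPn => _; last by rewrite lee_fin.
apply/ess_sup_inf.ess_supP; apply: aeW => x /=; rewrite patchE; case: ifPn => [|_]; last by rewrite abse0 lee_fin.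
by rewrite inE => Ax; rewrite gee0_abs ?lee_fin ?enorm_ge0// h.
Qed.

Lemma holder_seminorm_le gam A g K :
  (forall x y, A x -> A y -> enorm (g x - g y) <= K * enorm (x - y) `^ gam) ->
  (holder_seminorm gam A g <= K%:E)%E.
Proof.
move=> h; apply: ge_ereal_sup => _ [x [y [Ax Ay xy ->]]]; rewrite lee_fin ler_pdivrMr ?h//.
by rewrite powR_gt0// enorm_gt0 subr_eq0.
Qed.

End norms_of_gradients.

Section gradient_regularity.
Context {R : realType} {n : nat}.
Local Notation T := 'rV[R]_n.
Local Notation leb := (@lebesgue_rV R n).
Implicit Types (u v w : T -> R) (x y h k z : T) (s r a b c e : R) (Phi : R -> R).
Variable Lambda s0 : R.
Hypothesis Lambda1 : 1 <= Lambda.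
Hypothesis s01 : 0 < s0 < 1.
Hypothesis n_gt0 : (1 <= n)%N.

Let s0_gt0 : 0 < s0. Proof. by case/andP: s01. Qed.

(** The excess may vanish, while [local_representative] asks for a positive size: the size is
    enlarged by a multiple of d, and d is sent to 0. *)
Lemma le_limit (x a b X : R) : 0 <= b -> 0 <= X -> (forall d, 0 < d -> x <= (a + b * d) * X) -> x <= a * X.
Proof.
move=> b0 X0 h; apply/ler_addgt0Pr => e e0; have bX : 0 <= b * X by rewrite mulr_ge0.
have b1 : 0 < b * X + 1 by rewrite ltr_wpDl.
apply: le_trans (h _ (divr_gt0 e0 b1)) _; rewrite mulrDl lerD2l mulrAC mulrA ler_pdivrMr//.
by rewrite mulrC ler_pM2l// lerDl.
Qed.

(** Finiteness alone serves the qualitative part of the regularity statement, where some ball around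
    each point will do. *)
Lemma mass_on_balls s (x0 : T) r Phi u : 0 < s < 1 -> 0 < r -> wsol x0 r s Phi u -> exists e, [/\ 0 < e,
  I1 (fun x => \1[enorm x < 1] * `|u (x0 + r *: x) - 0|) e & I1 (fun x => `|u (x0 + r *: x) - 0| * wt s x) e].
Proof.
move=> ss r0 [mu _ [b hb] [c hc] _]; have [s_0 s1] := andP ss.
have h1 := tail_affine x0 ss r0 mu hc.
have h2 := I1_affine x0 r0 (ltac:(mauto) : mf1 (fun x => \1[enorm (x - x0) < r] * u x ^+ 2)) ltac:(move=> x; nneg) hb.
have h3 : I1 (fun x => \1[enorm x < 1] * `|u (x0 + r *: x) - 0|) (1 * (1 ^+ n * @unit_volume R n) + 1 * (r ^- n * b)).
  apply: (ile_mono_lin2 _ _ _ _ _ _ _ _ (I1_ball (0 : T) ltr01) h2); [by []|by []|mauto|mauto|by move=> x; nneg|by move=> x; nneg|by move=> x; nneg|move=> x].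
  rewrite (_ : (enorm (x0 + r *: x - x0) < r) = (enorm x < 1)); last first.
    by rewrite [_ - x0]addrC addKr enormZ (gtr0_norm r0) -[ltRHS]mulr1 ltr_pM2l.
  rewrite !subr0 !mul1r.
  case: (ltP (enorm x) 1) => x1; last by rewrite !mul0r addr0.
  rewrite (_ : \1[true] = 1 :> R)// !mul1r.
  by rewrite -[u _ ^+ 2]real_normK ?num_real//; have := sqr_ge0 (`|u (x0 + r *: x)| - 1); have := normr_ge0 (u (x0 + r *: x)); nra.
have b0 : 0 <= b by apply: ile_ge0 hb => x; nneg.
have p1 : 0 <= 1 * (1 ^+ n * @unit_volume R n) + 1 * (r ^- n * b).
  by have V0 := ltW (@unit_volume_gt0 R n); have r0' := ltW r0; nneg.
have p2 := ile_ge0 (fun x => mulr_ge0 (normr_ge0 _) (wt_ge0 _ s1)) h1.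
exists (1 * (1 ^+ n * @unit_volume R n) + 1 * (r ^- n * b) + (1 + enorm x0 + r) ^+ (n + 2) * (r ^- n * c) + 1); split.
- by rewrite ltr_wpDl// addr_ge0.
- by apply: ile_le h3; rewrite -addrA lerDl addr_ge0.
- by under eq_fun do rewrite subr0; apply: ile_le h1; rewrite [leRHS]addrAC lerDr addr_ge0.
Qed.

Lemma uniform_regularity : exists alpha c : R, [/\ 0 < alpha < 1, 0 < c &
  forall s, s0 <= s < 1 -> @gradient_regularity R n s Lambda alpha c].
Proof.
have [gam [rho [K [g0 g1 rho0 K0 hl]]]] := @local_representative R n Lambda s0 Lambda1 s01 n_gt0.
(* d0 <= 1 keeps the balls of radius d0 r inside the ball on which u solves the equation. *)
pose d0 := Num.min rho 1; have d00 : 0 < d0 by rewrite lt_min rho0 ltr01.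
have d01 : d0 <= 1 by rewrite ge_min lexx orbT.
have d0r : d0 <= rho by rewrite ge_min lexx.
pose C1 := 2 ^+ n * (@unit_volume R n + 1).
have C10 : 0 <= C1 by rewrite mulr_ge0 ?exprn_ge0// addr_ge0// ltW// unit_volume_gt0.
pose C2 := 2 `^ gam + 2 * (12 / d0) `^ gam.
have C20 : 0 <= C2 by rewrite addr_ge0 ?mulr_ge0 ?powR_ge0.
have K20 : 0 <= 2 * K by rewrite mulr_ge0.
have KC : 0 <= 2 * K * C1 by rewrite mulr_ge0.
have cc : 0 <= 2 * K * C1 * (1 + C2) by rewrite mulr_ge0// addr_ge0.
exists gam, (2 * K * C1 * (1 + C2) + 1); split; [by rewrite g0|by rewrite ltr_wpDl|].
move=> s ss Om Phi u [oOm _ _] hP hu; have [s0s s1] := andP ss.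
have s_in : 0 < s < 1 by rewrite (lt_le_trans s0_gt0 s0s).
have base x : Om x -> exists r e, [/\ 0 < r, 0 < e, wsol x r s Phi u, (forall y, enorm (y - x) < r -> Om y) &
    I1 (fun z => \1[enorm z < 1] * `|u (x + r *: z) - 0|) e /\ I1 (fun z => `|u (x + r *: z) - 0| * wt s z) e].
  move=> Ox; have /enorm_nbhs[r r0 hr] : nbhs x Om by exact: open_nbhs_nbhs.
  have r2 : 0 < r / 2 by rewrite divr_gt0.
  have r2r : r / 2 < r by rewrite ltr_pdivrMr// mulrDr mulr1 ltrDl.
  have hc : compactly_contained (eball x (r / 2)) Om.
    split; first by apply: (@compactly_contained_eball _ _ x (r / 2)) => y /ltW.
    by move=> y /closure_eball h; apply: hr; exact: le_lt_trans r2r.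
  have hw := wsol_of_weak_solution s_in r2 hP hu hc.
  have [e [e0 h1 h2]] := mass_on_balls s_in r2 hw.
  by exists (r / 2), e; split=> // y /lt_trans/(_ r2r); exact: hr.
have cw (w : T -> R) x d K1 : 0 < d -> 0 <= K1 -> (forall y h, enorm (y - x) < d -> enorm h < d -> `|w (y + h) - w y| <= K1 * enorm h) ->
    forall y, enorm (y - x) < d -> {for y, continuous w}.
  move=> dd K10 hw y yx; apply: (holder_continuous_at K10 ltr01 dd) => z zy.
  by rewrite powRr1 ?enorm_ge0//; have := hw y (z - y) yx zy; rewrite subrKC.
have exW x : exists p : R * (T -> R), Om x -> [/\ 0 < p.1, {ae leb, forall y, enorm (y - x) < p.1 -> u y = p.2 y} &
    forall y, enorm (y - x) < p.1 -> Om y /\ {for y, continuous p.2}].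
  have [Ox|nO] := pselect (Om x); last by exists (0, u) => /nO.
  have [r [e [r0 e0 hw hO [h1 h2]]]] := base x Ox.
  have [w [w1 w2 _]] := hl s Phi u x r 0 e ss hP r0 e0 hw h1 h2.
  have dr : d0 * r <= rho * r by rewrite ler_pM2r.
  exists (d0 * r, w) => _; split=> /=; first by rewrite mulr_gt0.
    by apply: filterS w1 => y hy yx; apply: hy; exact: lt_le_trans dr.
  move=> y yx; split; first by apply: hO; apply: lt_le_trans yx _; rewrite ler_piMl// ltW.
  by apply: (cw w x (rho * r) (K * e / r)) w2 _ (lt_le_trans yx dr); rewrite ?mulr_gt0// !mulr_ge0 ?invr_ge0// ltW.
have [p hp] := boolp.choice exW.
have [vae vW] := glue_representatives (W := fun x => (p x).2) (rd := fun x => (p x).1) hp.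
pose v x := (p x).2 x.
(* The radius d0 r / 3 keeps the points y + k + h in the ball of radius d0 r, where v = w;
   [regular_of_differences] halves it to d0 r / 6. *)
have vloc x r m e : 0 < r -> 0 < e -> wsol x r s Phi u -> (forall y, enorm (y - x) < r -> Om y) ->
    I1 (fun z => \1[enorm z < 1] * `|u (x + r *: z) - m|) e -> I1 (fun z => `|u (x + r *: z) - m| * wt s z) e ->
    (forall y, enorm (y - x) < d0 * r / 6 -> differentiable v y /\ enorm (grad v y) <= K * e / r) /\
    forall y z, enorm (y - x) < d0 * r / 6 -> enorm (z - x) < d0 * r / 6 ->
      enorm (grad v y - grad v z) <= K * e / r / r `^ gam * enorm (y - z) `^ gam.
  move=> r0 e0 hw hO h1 h2; have [w [w1 w2 w3]] := hl s Phi u x r m e ss hP r0 e0 hw h1 h2.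
  have dr : d0 * r <= rho * r by rewrite ler_pM2r.
  have dr0 : 0 < d0 * r by rewrite mulr_gt0.
  have k1 : 0 <= K * e / r by rewrite !mulr_ge0 ?invr_ge0// ltW.
  have k2 : 0 <= K * e / r / r `^ gam by rewrite mulr_ge0 ?invr_ge0 ?powR_ge0.
  have vw y : enorm (y - x) < d0 * r -> v y = w y.
    move=> yx; apply: (vW x w (d0 * r)) => //.
    - by apply: filterS w1 => z hz zx; apply: hz; exact: lt_le_trans dr.
    - by move=> z zx; apply: (cw w x (rho * r) (K * e / r)) w2 _ (lt_le_trans zx dr); rewrite ?mulr_gt0.
    - by apply: hO; apply: lt_le_trans yx _; rewrite ler_piMl// ltW.
  have in1 y : enorm (y - x) < d0 * r / 3 -> enorm (y - x) < d0 * r by move=> ?; qlra.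
  have in2 y h : enorm (y - x) < d0 * r / 3 -> enorm h < d0 * r / 3 -> enorm (y + h - x) < 2 * (d0 * r / 3).
    by move=> yx hx; rewrite addrAC; apply: le_lt_trans (enormD _ _) _; rewrite mulrDl mul1r ltrD.
  have in3 y h k : enorm (y - x) < d0 * r / 3 -> enorm h < d0 * r / 3 -> enorm k < d0 * r / 3 -> enorm (y + k + h - x) < d0 * r.
    move=> yx hx kx; rewrite addrAC; apply: le_lt_trans (enormD _ _) _; have := in2 _ _ yx kx; qlra.
  have lt3 (t : R) : t < d0 * r / 3 -> t < rho * r by move=> ?; qlra.
  have lt3' (t : R) : t < 2 * (d0 * r / 3) -> t < d0 * r by move=> ?; qlra.
  have r3 : 0 < d0 * r / 3 by rewrite divr_gt0.
  have [||d1 d2] := @regular_of_differences R n v x (d0 * r / 3) _ _ gam r3 k1 k2 g0.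
  - by move=> y h yx hx; rewrite (vw _ (lt3' _ (in2 _ _ yx hx))) (vw _ (in1 _ yx)); apply: w2; exact: lt3.
  - move=> y h k yx hx kx; rewrite (vw _ (in3 _ _ _ yx hx kx)) (vw _ (lt3' _ (in2 _ _ yx kx))) (vw _ (lt3' _ (in2 _ _ yx hx))) (vw _ (in1 _ yx)).
    by apply: w3; exact: lt3.
  have r6 : d0 * r / 3 / 2 = d0 * r / 6 by field.
  rewrite r6 in d2; split=> [y yx|]; last exact: d2.
  by apply: d1; apply: lt_le_trans yx _; move: r3; qlra.
have vx x : Om x -> exists d K1 K2 : R, [/\ 0 < d, 0 <= K2, (forall y, enorm (y - x) < d -> differentiable v y /\ enorm (grad v y) <= K1) &
    forall y z, enorm (y - x) < d -> enorm (z - x) < d -> enorm (grad v y - grad v z) <= K2 * enorm (y - z) `^ gam].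
  move=> Ox; have [r [e [r0 e0 hw hO [h1 h2]]]] := base x Ox.
  have [H1 H2] := vloc x r 0 e r0 e0 hw hO h1 h2.
  exists (d0 * r / 6), (K * e / r), (K * e / r / r `^ gam); split=> //; first by rewrite divr_gt0// mulr_gt0.
  by rewrite !mulr_ge0 ?invr_ge0 ?powR_ge0// ltW.
exists v; split; first exact: vae.
- split=> [x Ox|A oA [cA sA]].
    have [d [K1 [K2 [dd K2p H1 H2]]]] := vx x Ox.
    have xx : enorm (x - x) < d by rewrite subrr enorm0.
    split; first by have [] := H1 x xx.
    by apply: (holder_continuous_rV K2p g0 dd) => y yx; exact: H2.
  have [G hG] : exists G, forall x, closure A x -> enorm (grad v x) <= G.
    apply: (@compact_bound _ _ _ (fun G x => enorm (grad v x) <= G)) cA _ _ => [K1 K2 x KK hx|x cx].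
      exact: le_trans KK.
    have [d [K1 [K2 [dd _ H1 _]]]] := vx x (sA x cx).
    by exists d, K1; split=> // y yx; have [] := H1 y yx.
  (* Close points are compared by the local estimate, distant ones by the bound on the gradient over
     the closure. *)
  have [H hH] : exists H, forall x, closure A x -> forall z, A z -> enorm (grad v x - grad v z) <= H * enorm (x - z) `^ gam.
    apply: (@compact_bound _ _ _ (fun H x => forall z, A z -> enorm (grad v x - grad v z) <= H * enorm (x - z) `^ gam)) cA _ _ => [L1 L2 x LL hx z Az|x cx].
      by apply: le_trans (hx z Az) _; rewrite ler_wpM2r ?powR_ge0.
    have [d [K1 [K2 [dd K2p H1 H2]]]] := vx x (sA x cx).
    have d2 : 0 < d / 2 by rewrite divr_gt0.
    have p0 : 0 < (d / 2) `^ gam by rewrite powR_gt0.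
    have xx : enorm (x - x) < d by rewrite subrr enorm0.
    have KG : 0 <= (K1 + G) / (d / 2) `^ gam.
      rewrite divr_ge0 ?powR_ge0// addr_ge0//; last exact: le_trans (enorm_ge0 _) (hG x cx).
      by apply: le_trans (enorm_ge0 _) (proj2 (H1 x xx)).
    exists (d / 2), (K2 + (K1 + G) / (d / 2) `^ gam); split=> // y yx z Az.
    have yd : enorm (y - x) < d by move: yx; rewrite ltr_pdivlMr//; have := enorm_ge0 (y - x); qlra.
    have [zy|zy] := ltP (enorm (y - z)) (d / 2).
      have zd : enorm (z - x) < d.
        by apply: le_lt_trans (enorm_triangle y _ _) _; rewrite (enormB z) [ltRHS]splitr ltrD.
      by apply: le_trans (H2 _ _ yd zd) _; rewrite ler_wpM2r ?powR_ge0// lerDl.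
    apply: (@le_trans _ _ ((K1 + G) / (d / 2) `^ gam * enorm (y - z) `^ gam)); last by rewrite ler_wpM2r ?powR_ge0// lerDr.
    apply: (@le_trans _ _ (K1 + G)).
      apply: le_trans (enormD _ _) _; rewrite enormN lerD ?(proj2 (H1 y yd))// hG//.
      exact: subset_closure.
    rewrite -mulrA ler_peMr//; first by have := KG; rewrite pmulr_lge0// invr_gt0.
    rewrite mulrC ler_pdivlMr// mul1r; apply: ler_powR2; [exact: ltW|exact: ltW|by []].
  apply: le_lt_trans (ltry H); apply: holder_seminorm_le => x y Ax Ay; apply: hH => //.
  exact: subset_closure.
move=> x0 r Ox0 r0 hc.
have E0 : (0 <= excess s (fun x => u x / r)%R x0 r)%E.
  rewrite /excess /excess_loc /tail adde_ge0// mule_ge0 ?lee_fin ?invr_ge0 ?fine_ge0 ?mulr_ge0 ?powR_ge0 ?subr_ge0 ?(ltW s1)//.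
    by apply: integral_ge0 => x _; rewrite lee_fin.
  by apply: integral_ge0 => x _; rewrite lee_fin divr_ge0 ?powR_ge0.
have c0 : 0 < 2 * K * C1 * (1 + C2) + 1 by rewrite ltr_wpDl.
(* An infinite excess makes the claim trivial because the constant is positive, which is the reason
   for the summand 1 in it. *)
move: E0; case Ee : (excess _ _ _ _) => [e| |]; [|by move=> _; rewrite gt0_muley ?lte_fin// leey|by []].
rewrite lee_fin => e0; have hw := wsol_of_weak_solution s_in r0 hP hu hc.
have [mu _ _ _ _] := hw; have [m hm] := excess_bounds s_in r0 mu Ee.
have r2 : 0 < r / 2 by rewrite divr_gt0.
(* 2 K C1 e = K (C1 r e) / (r / 2): the gradient bound for data of size C1 r e on balls of radius r
   / 2. *)
pose G := 2 * K * C1 * e; have G0 : 0 <= G by rewrite mulr_ge0.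
have near x : enorm (x - x0) < r / 2 -> forall d, 0 < d -> enorm (grad v x) <= (G + 2 * K * d) * 1 /\
    forall y, enorm (y - x) < d0 * (r / 2) / 6 -> enorm (grad v x - grad v y) <= (G + 2 * K * d) * ((r / 2) `^ gam)^-1 * enorm (x - y) `^ gam.
  move=> xx0 d dd; have [h1 h2] := hm x xx0.
  have rd : 0 < r * d by rewrite mulr_gt0.
  have e1 : 0 < C1 * (r * e) + r * d by rewrite ltr_wpDl// mulr_ge0// mulr_ge0// ltW.
  have e2 : C1 * (r * e) <= C1 * (r * e) + r * d by rewrite lerDl ltW.
  have xr : enorm (x - x0) + r / 2 <= r by rewrite [leRHS]splitr lerD2r ltW.
  have hO y : enorm (y - x) < r / 2 -> Om y.
    move=> yx; apply: (proj2 hc); apply: subset_closure; apply: le_lt_trans (enorm_triangle x _ _) _.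
    by rewrite addrC; apply: lt_le_trans xr; rewrite ltrD2l.
  have [H1 H2] := vloc x (r / 2) m _ r2 e1 (wsol_mono s1 xr hw) hO (ile_le e2 h1) (ile_le e2 h2).
  have -> : G + 2 * K * d = K * (C1 * (r * e) + r * d) / (r / 2) by rewrite /G; field; rewrite gt_eqF.
  have xx : enorm (x - x) < d0 * (r / 2) / 6 by rewrite subrr enorm0 divr_gt0// mulr_gt0.
  by split=> [|y yx]; [rewrite mulr1; exact: (proj2 (H1 x xx))|exact: H2].
have sup x : enorm (x - x0) < r / 2 -> enorm (grad v x) <= G.
  move=> xx0; rewrite -[G]mulr1; apply: (le_limit K20 ler01) => d dd.
  exact: (proj1 (near x xx0 d dd)).
(* Points closer than d1 = d0 r / 12 are compared by the local estimate, the others by the supremum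
   bound; r / d1 = 12 / d0 explains [C2]. *)
pose d1 := d0 * (r / 2) / 6; have d10 : 0 < d1 by rewrite divr_gt0// mulr_gt0.
have hol x y : enorm (x - x0) < r / 2 -> enorm (y - x0) < r / 2 ->
    enorm (grad v x - grad v y) <= G * (((r / 2) `^ gam)^-1 + 2 * (d1 `^ gam)^-1) * enorm (x - y) `^ gam.
  move=> xx yx; have q1 : 0 <= ((r / 2) `^ gam)^-1 by rewrite invr_ge0 powR_ge0.
  have q2 : 0 <= (d1 `^ gam)^-1 by rewrite invr_ge0 powR_ge0.
  have [xy|xy] := ltP (enorm (y - x)) d1.
    apply: (@le_trans _ _ (G * (((r / 2) `^ gam)^-1 * enorm (x - y) `^ gam))).
      apply: (le_limit K20) => [|d dd]; first by rewrite mulr_ge0 ?powR_ge0.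
      by rewrite mulrA; exact: (proj2 (near x xx d dd)).
    by rewrite -mulrA ler_wpM2l// ler_wpM2r ?powR_ge0// lerDl mulr_ge0.
  apply: (@le_trans _ _ (G * 2)).
    by rewrite mulrDr mulr1; apply: le_trans (enormD _ _) _; rewrite enormN lerD// sup.
  rewrite -mulrA ler_wpM2l// mulrDl; apply: (@le_trans _ _ (2 * (d1 `^ gam)^-1 * enorm (x - y) `^ gam)); last first.
    by rewrite lerDr mulr_ge0 ?powR_ge0.
  rewrite -mulrA ler_peMr// mulrC ler_pdivlMr ?powR_gt0// mul1r enormB.
  by apply: ler_powR2; [exact: ltW|exact: ltW|].
have L1 := Linfty_norm_le G0 (A := eball x0 (r / 2)) (g := grad v) sup.
have L2 := holder_seminorm_le (A := eball x0 (r / 2)) (g := grad v) hol.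
apply: (@le_trans _ _ (G%:E + (r `^ gam)%:E * (G * (((r / 2) `^ gam)^-1 + 2 * (d1 `^ gam)^-1))%:E)%E).
  by apply: leeD => //; apply: lee_wpmul2l => //; rewrite lee_fin powR_ge0.
rewrite -EFinM -EFinD lee_fin.
have ratio (t : R) : 0 < t -> r `^ gam / t `^ gam = (r / t) `^ gam.
  move=> tp; have := @powRM R (r / t) t gam (divr_ge0 (ltW r0) (ltW tp)) (ltW tp).
  by rewrite (divfK (lt0r_neq0 tp)) => ->; rewrite mulfK// gt_eqF// powR_gt0.
have E1 : r `^ gam * ((r / 2) `^ gam)^-1 = 2 `^ gam.
  by rewrite (ratio _ r2); congr (_ `^ _); field; rewrite gt_eqF.
have E2 : r `^ gam * (d1 `^ gam)^-1 = (12 / d0) `^ gam.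
  by rewrite (ratio _ d10) /d1; congr (_ `^ _); field; rewrite !gt_eqF.
rewrite [X in _ + X <= _]mulrCA mulrDr E1 mulrCA E2 -/C2.
rewrite [leRHS](_ : _ = G + G * C2 + e); last by rewrite /G; ring.
by rewrite lerDl.
Qed.

End gradient_regularity.

Theorem theorem1p5 (R : realType) (n : nat) (Lambda : R)
    (hn : (2 <= n)%N) (hLambda : 1 <= Lambda) :
  (forall s : R, 0 < s < 1 ->
     exists alpha c : R, [/\ 0 < alpha < 1, 0 < c &
       @gradient_regularity R n s Lambda alpha c])
  /\
  (forall s0 : R, 0 < s0 < 1 ->
     exists alpha c : R, [/\ 0 < alpha < 1, 0 < c &
       forall s : R, s0 <= s < 1 ->
         @gradient_regularity R n s Lambda alpha c]).

Proof.
have n0 : (1 <= n)%N by apply: leq_trans hn.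
split=> [s s01|s0 s01]; last exact: uniform_regularity.
have [alpha [c [h1 h2 h3]]] := @uniform_regularity R n Lambda s hLambda s01 n0.
by exists alpha, c; split=> //; apply: h3; rewrite lexx; case/andP: s01.
Qed.
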